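(* Let $u_0\in L^1(\mathbb{R}^N)\cap L^\infty(\mathbb{R}^N)$ and let $f$ be measurable on $Q_T$ with $\int_0^T\big(\|f(\cdot,t)\|_{L^1(\mathbb{R}^N)}+\|f(\cdot,t)\|_{L^\infty(\mathbb{R}^N)}\big)dt<\infty$. Let (S) be a family of schemes indexed by $h>0$ with $\Delta t=o_h(1)$ (i.e. $\Delta t\to0$ as $h\to0^+$) which is consistent, admissible for every $h$, and satisfies the uniform Lévy condition (all as defined in the context). For every $h>0$ let $U_h^j$ be the a.e.-solution of (S) in $L^1(\mathbb{R}^N)\cap L^\infty(\mathbb{R}^N)$ and let $\widetilde{U}_h$ be its piecewise linear time interpolant. Then there exists a unique distributional solution $u\in L^1(Q_T)\cap L^\infty(Q_T)\cap C([0,T];L^1_{\mathrm{loc}}(\mathbb{R}^N))$ of the Cauchy problem (E), and $$\widetilde{U}_h\to u\quad\text{in}\quad C([0,T];L^1_{\mathrm{loc}}(\mathbb{R}^N))\quad\text{as}\quad h\to0^+.$$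
   Context: Let $N\in\mathbb{N}$, $T>0$, $Q_T=\mathbb{R}^N\times(0,T)$, $a\wedge b=\min\{a,b\}$. Convergence in $C([0,T];L^1_{\mathrm{loc}}(\mathbb{R}^N))$ means $\sup_{t\in[0,T]}\|\cdot\|_{L^1(K)}\to0$ for every compact $K\subset\mathbb{R}^N$. Limit operators: for $\sigma\in\mathbb{R}^{N\times P}$ and a nonnegative symmetric Radon measure $\mu$ on $\mathbb{R}^N\setminus\{0\}$ with $\int_{|z|\le1}|z|^2d\mu+\int_{|z|>1}d\mu<\infty$ (a Lévy measure), put $\mathfrak{L}^{\sigma,\mu}[\psi](x)=\mathrm{tr}(\sigma\sigma^TD^2\psi(x))+\int_{\mathbb{R}^N\setminus\{0\}}\big(\psi(x+z)-\psi(x)-z\cdot D\psi(x)\mathbf{1}_{|z|\le1}\big)d\mu(z)$. Cauchy problem (E): $\partial_tu-\mathfrak{L}^{\sigma,\mu}[\varphi(u)]=f$ in $Q_T$, $u(\cdot,0)=u_0$ on $\mathbb{R}^N$, with $\varphi:\mathbb{R}\to\mathbb{R}$ nondecreasing and continuous. A function $u\in L^1_{\mathrm{loc}}(Q_T)$ is a distributional solution of (E) if for all $\psi\in C_c^\infty(\mathbb{R}^N\times[0,T))$ one has $\varphi(u)\mathfrak{L}^{\sigma,\mu}[\psi]\in L^1(Q_T)$ and $\int_0^T\int_{\mathbb{R}^N}\big(u\partial_t\psi+\varphi(u)\mathfrak{L}^{\sigma,\mu}[\psi]+f\psi\big)dx\,dt+\int_{\mathbb{R}^N}u_0(x)\psi(x,0)dx=0$.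 Discrete operators: for a nonnegative symmetric Radon measure $\nu$ on $\mathbb{R}^N\setminus\{0\}$ of finite total mass $\nu(\mathbb{R}^N)$, $\mathcal{L}^\nu[\psi](x)=\int(\psi(x+z)-\psi(x))d\nu(z)$ (for a.e.-defined $\psi$, a Borel representative is used). Time grid (may depend on $h$): $0=t_0<\dots<t_J=T$, $\Delta t_j=t_j-t_{j-1}$, $\Delta t=\max_j\Delta t_j$, $F^j(x)=\frac1{\Delta t_j}\int_{t_{j-1}}^{t_j}f(x,t)dt$. Scheme (S): $U_h^0=u_0$ and, for $j=1,\dots,J$ and a.e. $x$, $$U_h^j(x)=U_h^{j-1}(x)+\Delta t_j\Big(\mathcal{L}_1^h[\varphi_1^h(U_h^j)](x)+\mathcal{L}_2^h[\varphi_2^h(U_h^{j-1})](x)+F^j(x)\Big),\qquad \mathcal{L}_i^h=\mathcal{L}^{\nu_i^h}.$$ Time interpolant: $\widetilde{U}_h(x,0)=U_h^0(x)$ and $\widetilde{U}_h(x,t)=U_h^{j-1}(x)+\frac{t-t_{j-1}}{t_j-t_{j-1}}(U_h^j(x)-U_h^{j-1}(x))$ for $t\in(t_{j-1},t_j]$. Admissible: $\nu_1^h,\nu_2^h$ are nonnegative symmetric finite Radon measures on $\mathbb{R}^N\setminus\{0\}$; $\varphi_1^h$ is nondecreasing and continuous; $\varphi_2^h$ is nondecreasing and locally Lipschitz; and $\Delta t\,L_{\varphi_2^h}\,\nu_2^h(\mathbb{R}^N)\le1$, where $L_{\varphi_2^h}$ is the Lipschitz constant of $\varphi_2^h$ on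 $[-M,M]$, $M=\|u_0\|_{L^\infty}+\int_0^T\|f(\cdot,\tau)\|_{L^\infty}d\tau$. Consistent: there are nondecreasing continuous $\varphi_1,\varphi_2:\mathbb{R}\to\mathbb{R}$ and operators $\mathfrak{L}_1=\mathfrak{L}^{\sigma_1,\mu_1}$, $\mathfrak{L}_2=\mathfrak{L}^{\sigma_2,\mu_2}$, where for $i=1,2$, $\sigma_i\in\mathbb{R}^{N\times P_i}$ for some $P_i\in\mathbb{N}$, $\mu_i$ is a nonnegative symmetric Radon measure on $\mathbb{R}^N\setminus\{0\}$ with $\int_{|z|\le1}|z|^2d\mu_i+\int_{|z|>1}d\mu_i<\infty$, and $\mathfrak{L}^{\sigma_i,\mu_i}[\psi](x)=\mathrm{tr}(\sigma_i\sigma_i^TD^2\psi(x))+\int_{\mathbb{R}^N\setminus\{0\}}\big(\psi(x+z)-\psi(x)-z\cdot D\psi(x)\mathbf{1}_{|z|\le1}\big)d\mu_i(z)$, such that (i) for all $\phi\in L^1(\mathbb{R}^N)\cap L^\infty(\mathbb{R}^N)$, $\mathfrak{L}_1[\varphi_1(\phi)]+\mathfrak{L}_2[\varphi_2(\phi)]=\mathfrak{L}^{\sigma,\mu}[\varphi(\phi)]$ in the sense of distributions, i.e. $\int\big(\varphi_1(\phi)\mathfrak{L}_1[\psi]+\varphi_2(\phi)\mathfrak{L}_2[\psi]-\varphi(\phi)\mathfrak{L}^{\sigma,\mu}[\psi]\big)dx=0$ for all $\psi\in C_c^\infty(\mathbb{R}^N)$; (ii) for some $k_1,k_2\ge0$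 and all $\psi\in C_c^\infty(\mathbb{R}^N)$, $\|\mathcal{L}_i^h[\psi]-\mathfrak{L}_i[\psi]\|_{L^1(\mathbb{R}^N)}\le\|\psi\|_{W^{k_i,1}(\mathbb{R}^N)}\,o_h(1)$, $i=1,2$, where $o_h(1)\to0$ as $h\to0^+$ independently of $\psi$; (iii) $\varphi_i^h\to\varphi_i$ locally uniformly as $h\to0^+$, $i=1,2$. Uniform Lévy condition: $\sup_{h<1,\,i=1,2}\int_{|z|>0}|z|^2\wedge1\,d\nu_i^h(z)<\infty$. *)

(* Defs.v *)
From HB Require Import structures.
From mathcomp Require Import all_boot all_order all_algebra.
From mathcomp Require Import all_classical all_reals all_analysis.
From mathcomp Require Import measurable_realfun.
Set Implicit Arguments.
Unset Strict Implicit.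
Unset Printing Implicit Defensive.
Import Order.TTheory GRing.Theory Num.Theory.
Import numFieldNormedType.Exports.
Local Open Scope classical_set_scope.
Local Open Scope ring_scope.

(* The measurable subsets of 'rV[R]_n are its Borel sets. *)
Fact rV_display : measure_display. Proof. exact: default_measure_display. Qed.

HB.instance Definition _ (R : realType) (n : nat) :=
  @isMeasurable.Build rV_display 'rV[R]_n (<<s @open 'rV[R]_n >>)
    (@sigma_algebra0 _ setT _) (@sigma_algebraC _ _) (@sigma_algebra_bigcup _ setT _).

Section rV_borel.
Context {R : realType}.

Lemma open_measurable_rV n (A : set 'rV[R]_n) : open A -> measurable A.
Proof. by move=> oA; exact: sub_sigma_algebra. Qed.

Lemma measurable_coord n (i : 'I_n) :
  measurable_fun setT (fun v : 'rV[R]_n => v ord0 i).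
Proof.
apply: (measurability _ (RGenOpens.measurableE R)) => _ [_ [a [b ->]] <-].
rewrite setTI; apply: open_measurable_rV.
apply: open_comp => [v _|]; first exact: coord_continuous.
exact: interval_open.
Qed.

Definition rat_box n (q : {ffun 'I_n -> rat * rat}) : set 'rV[R]_n :=
  [set v | forall i, ratr (q i).1 < v ord0 i < ratr (q i).2].

Lemma open_rat_box n (A : set 'rV[R]_n) : open A ->
  A = \bigcup_(q in [set q | rat_box q `<=` A]) rat_box q.
Proof.
move=> oA; apply/seteqP; split=> [v Av|v [q qA qv]]; last exact: qA.
have [P Pv PA] : nbhs v A by exact: open_nbhs_nbhs.
have H (i : 'I_n) : exists q : rat * rat, (ratr q.1 < v ord0 i < ratr q.2) /\
    (forall y : R, ratr q.1 < y < ratr q.2 -> P ord0 i y).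
  have /nbhs_ballP[e /= e0 eP] := Pv ord0 i.
  have lt1 : v ord0 i - e < v ord0 i by rewrite ltrBlDr ltrDl.
  have lt2 : v ord0 i < v ord0 i + e by rewrite ltrDl.
  have [p /[!inE] /andP[p1 p2]] := rat_in_itvoo lt1.
  have [r /[!inE] /andP[r1 r2]] := rat_in_itvoo lt2.
  rewrite !bnd_simp in p1 p2 r1 r2.
  exists (p, r); split=> /=; first by rewrite p2 r1.
  move=> y /andP[py yr]; apply: eP; rewrite /ball/= ltr_distlC.
  by rewrite (lt_trans p1 py) (lt_trans yr r2).
have [q qP] := choice H.
exists [ffun i => q i] => [w wq|i]; last by rewrite ffunE; have [] := qP i.
apply: PA => i j; rewrite (ord1 i).
by have [_] := qP j; apply; have := wq j; rewrite ffunE.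
Qed.

Lemma measurable_fun_rV d (T : measurableType d) n (f : T -> 'rV[R]_n) :
  (forall i, measurable_fun setT (fun x => f x ord0 i)) -> measurable_fun setT f.
Proof.
move=> mf.
apply: (@measurability _ _ _ _ setT f (@open 'rV[R]_n)) => // _ [A oA <-].
rewrite setTI (open_rat_box oA) preimage_bigcup.
rewrite bigcup_mkcond; apply: countable_bigcupT_measurable => [//|q].
case: ifPn => // _; rewrite (_ : f @^-1` rat_box q =
  \bigcap_(i : 'I_n) [set x | f x ord0 i \in `]ratr (q i).1, ratr (q i).2[]).
  apply: fin_bigcap_measurable => [|i _]; first exact: finite_finset.
  rewrite -[X in measurable X]setTI.
  exact: (mf i measurableT _ (measurable_itv `]ratr (q i).1, ratr (q i).2[)).
by apply/seteqP; split=> [x xq i _|x xq i] /=; [rewrite in_itv; exact: xq|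
  have := xq i I; rewrite /= in_itv].
Qed.

Definition cons_rV n (p : R * 'rV[R]_n) : 'rV[R]_n.+1 :=
  row_mx (p.1%:M : 'rV[R]_1) p.2.

Definition uncons_rV n (v : 'rV[R]_n.+1) : R * 'rV[R]_n :=
  (v ord0 ord0, \row_i v ord0 (lift ord0 i)).

Lemma cons_rVK n : cancel (@cons_rV n) (@uncons_rV n).
Proof.
move=> [a v]; rewrite /uncons_rV /cons_rV /=; congr (_, _).
  transitivity (row_mx (a%:M : 'rV[R]_1) v ord0 (lshift n ord0)).
    by congr (row_mx _ _ _ _); exact: val_inj.
  by rewrite row_mxEl mxE eqxx.
apply/rowP => i; rewrite mxE.
transitivity (row_mx (a%:M : 'rV[R]_1) v ord0 (rshift 1 i)).
  by congr (row_mx _ _ _ _); exact: val_inj.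
by rewrite row_mxEr.
Qed.

Lemma measurable_cons_rV n : measurable_fun setT (@cons_rV n).
Proof.
apply: measurable_fun_rV => i; have [j ->|j ->] := split_ordP (i : 'I_(1 + n)).
  rewrite (_ : (fun _ => _) = fst); first exact: measurable_fst.
  apply/funext => p; apply: etrans; first exact: row_mxEl.
  by rewrite mxE !ord1 eqxx.
rewrite (_ : (fun _ => _) = (fun v : 'rV[R]_n => v ord0 j) \o snd).
  exact: (measurableT_comp (measurable_coord _) measurable_snd).
by apply/funext => p; exact: row_mxEr.
Qed.

Lemma measurable_uncons_rV n : measurable_fun setT (@uncons_rV n).
Proof.
apply: measurable_fun_pair; first exact: measurable_coord.
apply: measurable_fun_rV => i; rewrite (_ : (fun _ => _) =
  fun v : 'rV[R]_n.+1 => v ord0 (lift ord0 i)); first exact: measurable_coord.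
by apply/funext => v; rewrite mxE.
Qed.

End rV_borel.

Lemma exists_sigma_finite_measure d (T : measurableType d) (R : realType)
    (mu : set T -> \bar R) : mu set0 = 0%E -> (forall A, 0%E <= mu A)%E ->
  semi_sigma_additive mu -> sigma_finite setT mu ->
  exists m : {sigma_finite_measure set T -> \bar R}, m = mu :> (set T -> \bar R).
Proof.
move=> mu0 mu_ge0 mu_sigma mu_sfin.
pose mu1 := isMeasure.Build _ _ _ mu mu0 mu_ge0 mu_sigma.
pose mu2 : {measure set _ -> \bar R} := HB.pack mu mu1.
pose mu3 := Measure_isSigmaFinite.Build _ _ _ mu2 mu_sfin.
pose mu4 : {sigma_finite_measure set _ -> \bar R} := HB.pack mu mu1 mu3.
by exists mu4.
Qed.

Section lebesgue_rV.
Context {R : realType}.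
Local Open Scope ereal_scope.

(* Lebesgue measure, by slicing along the first coordinate (Tonelli). *)
Fixpoint lebesgue_rV (n : nat) : set 'rV[R]_n -> \bar R :=
  match n with
  | 0%N => fun A => \d_(0%R : 'rV[R]_0) A
  | m.+1 => fun A => \int[@lebesgue_measure R]_a
      lebesgue_rV [set v : 'rV[R]_m | A (cons_rV (a, v))]
  end.

Let lebesgue_rV_subproof n :
  exists m : {sigma_finite_measure set 'rV[R]_n -> \bar R},
    lebesgue_rV (n := n) = m.
Proof.
elim: n => [|n [m mE]]; first by exists (\d_(0%R : 'rV[R]_0)).
pose mu := pushforward (@lebesgue_measure R \x m) (@cons_rV R n).
have mu0 : mu set0 = 0 by rewrite /mu /pushforward preimage_set0 measure0.
have mu_ge0 A : 0 <= mu A by exact: (measure_ge0 (@lebesgue_measure R \x m)).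
have mpre A : measurable A -> measurable (@cons_rV R n @^-1` A).
  by move=> mA; rewrite -[X in measurable X]setTI; exact: measurable_cons_rV.
have mu_sigma : semi_sigma_additive mu.
  move=> F mF tF mUF; rewrite /mu /pushforward preimage_bigcup.
  apply: measure_semi_sigma_additive => [i||]; first exact: mpre.
    apply/trivIsetP => i j _ _ ij; rewrite -preimage_setI.
    by move/trivIsetP : tF => /(_ _ _ _ _ ij) ->//; rewrite preimage_set0.
  by rewrite -preimage_bigcup; exact: mpre.
have mu_sfin : sigma_finite setT mu.
  have : sigma_finite setT (@lebesgue_measure R \x m).
    have /sigma_finiteP[F [TF ndF Foo]] := sigma_finiteT (@lebesgue_measure R).
    have /sigma_finiteP[G [TG ndG Goo]] := sigma_finiteT m.
    exists (fun k => F k `*` G k).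
      rewrite -setXTT TF TG predeqE => -[x y]; split.
        move=> [/= [i _ Fix] [k _ Gky]]; exists (maxn i k) => //; split.
        - by move: x Fix; exact/subsetPset/ndF/leq_maxl.
        - by move: y Gky; exact/subsetPset/ndG/leq_maxr.
      by move=> [i _ []/= ? ?]; split; exists i.
    move=> k; have [? ?] := Foo k; have [? ?] := Goo k.
    split; first exact: measurableX.
    by rewrite product_measure1E// lte_mul_pinfty// ge0_fin_numE.
  move=> [F TF Foo].
  exists (fun k => @uncons_rV R n @^-1` F k).
    by rewrite -preimage_bigcup -TF preimage_setT.
  move=> k; have [mFk Fkoo] := Foo k; split.
    by rewrite -[X in measurable X]setTI; exact: measurable_uncons_rV.
  rewrite /mu /pushforward -comp_preimage.
  by rewrite (_ : _ \o _ = id) //; apply/funext => p /=; rewrite cons_rVK.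
have [mu' mu'E] := exists_sigma_finite_measure mu0 mu_ge0 mu_sigma mu_sfin.
exists mu'; rewrite mu'E; apply/funext => A; rewrite /= /mu /pushforward /product_measure1.
apply: eq_integral => a _ /=; rewrite mE; congr (m _).
by apply/seteqP; split => v /=; rewrite /xsection/= inE.
Qed.

Let lebesgue_rV0 n : lebesgue_rV (set0 : set 'rV[R]_n) = 0.
Proof. by have [m ->] := lebesgue_rV_subproof n; exact: measure0. Qed.

Let lebesgue_rV_ge0 n (A : set 'rV[R]_n) : 0 <= lebesgue_rV A.
Proof. by have [m ->] := lebesgue_rV_subproof n; exact: measure_ge0. Qed.

Let lebesgue_rV_sigma_additive n : semi_sigma_additive (@lebesgue_rV n).
Proof.
by have [m ->] := lebesgue_rV_subproof n; exact: measure_semi_sigma_additive.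
Qed.

HB.instance Definition _ n := isMeasure.Build _ _ _ (@lebesgue_rV n)
  (lebesgue_rV0 n) (@lebesgue_rV_ge0 n) (@lebesgue_rV_sigma_additive n).

Let lebesgue_rV_sigma_finite n : sigma_finite setT (@lebesgue_rV n).
Proof. by have [m ->] := lebesgue_rV_subproof n; exact: sigma_finiteT. Qed.

HB.instance Definition _ n := Measure_isSigmaFinite.Build _ _ _
  (@lebesgue_rV n) (@lebesgue_rV_sigma_finite n).

End lebesgue_rV.

Lemma lebesgue_rV_box (R : realType) n (A : 'I_n -> set R) :
  (forall i, measurable (A i)) ->
  @lebesgue_rV R n [set v | forall i, A i (v ord0 i)] =
  (\prod_(i < n) @lebesgue_measure R (A i))%E.
Proof.
elim: n A => [A _|n IH A mA].
  by rewrite big_ord0 /= diracE mem_set//= => -[].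
rewrite big_ord_recl /=.
rewrite (_ : (fun a => _) = fun a => ((\1_(A ord0) a)%:E *
    (\prod_(i < n) @lebesgue_measure R (A (lift ord0 i))))%E).
  rewrite ge0_integralZr//=.
  - rewrite integral_indic//; [by rewrite setIT| exact: mA].
  - by apply/measurable_EFinP; apply: measurable_indic; exact: mA.
  - by apply: prode_ge0 => i _; exact: measure_ge0.
apply/funext => a.
have H : forall v : 'rV[R]_n, (forall i, A i (cons_rV (a, v) ord0 i)) <->
    A ord0 a /\ forall i, A (lift ord0 i) (v ord0 i).
  move=> v; have [E1 E2] := cons_rVK (a, v).
  split=> [h|[h0 h] i].
    split; first by rewrite -{1}E1; exact: h.
    by move=> i; rewrite -E2 mxE; exact: h.
  case: (unliftP ord0 i) => [j|] ->; last by rewrite -E1 in h0.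
  by have := h j; rewrite -{1}E2 mxE.
rewrite indicE; case: (boolP (a \in A ord0)) => aA.
  rewrite mul1e -IH//; congr (lebesgue_rV _); apply/seteqP; split => v /=.
    by move=> /H[].
  by move=> h; apply/H; split=> //; rewrite inE in aA.
rewrite mul0e (_ : mkset _ = set0) ?measure0//; apply/seteqP; split=> // v /= /H[].
by rewrite notin_setE in aA.
Qed.

Section smooth.
Context {R : realType}.

Definition iter_derive (V : normedModType R) (vs : seq V) (f : V -> R) : V -> R :=
  foldr (fun v g => 'D_v g) f vs.

(* C^oo: the directional derivatives of all orders exist and are continuous. *)
Definition smooth (V : normedModType R) (f : V -> R) :=
  forall vs : seq V, continuous (iter_derive vs f) /\
    forall x v, derivable (iter_derive vs f) x v.

Definition supp (V : normedModType R) (f : V -> R) := closure [set x | f x != 0].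

Definition Cc_smooth (V : normedModType R) (f : V -> R) :=
  smooth f /\ compact (supp f).

Definition unit_rV n (i : 'I_n) : 'rV[R]_n := delta_mx ord0 i.

Definition partial n (i : 'I_n) (f : 'rV[R]_n -> R) := 'D_(unit_rV i) f.

Definition grad n (f : 'rV[R]_n -> R) (x : 'rV[R]_n) : 'rV[R]_n :=
  \row_i partial i f x.

Definition hessian n (f : 'rV[R]_n -> R) (x : 'rV[R]_n) : 'M[R]_n :=
  \matrix_(i, j) partial i (partial j f) x.

Definition multi_derive n k (alpha : {ffun 'I_n -> 'I_k}) (f : 'rV[R]_n -> R) :=
  foldr (fun i => iter (alpha i) (partial i)) f (enum 'I_n).

(* The W^{k,1} norm: the sum of the L^1 norms of the derivatives D^alpha with
   |alpha| <= k. *)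
Definition sobolev1_norm n (k : nat) (f : 'rV[R]_n -> R) : \bar R :=
  (\sum_(alpha : {ffun 'I_n -> 'I_k.+1} | (\sum_i alpha i <= k)%N)
    'N[@lebesgue_rV R n]_1[EFin \o multi_derive alpha f])%E.

End smooth.

Definition L1_Loo d (T : measurableType d) (R : realType)
    (mu : {measure set T -> \bar R}) (f : T -> R) :=
  f \in Lfun mu 1 /\ f \in Lfun mu +oo%E.

Section levy.
Context {R : realType} {N : nat}.
Implicit Types mu nu : {measure set 'rV[R]_N -> \bar R}.

Definition dot (x y : 'rV[R]_N) : R := \sum_i x ord0 i * y ord0 i.

(* The norm of the library on row vectors is the maximum norm. *)
Definition enorm (x : 'rV[R]_N) : R := Num.sqrt (dot x x).

(* A measure on R^N without the origin is seen as a measure on R^N that does not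
   charge the origin. A Borel measure is Radon when it is finite on the compact
   sets; inner and outer regularity are then automatic, R^N minus the origin
   being locally compact and second countable. *)
Definition symmetric_radon mu :=
  [/\ mu [set 0] = 0%E,
      forall A : set 'rV[R]_N, measurable A -> mu [set z | A (- z)] = mu A &
      forall K : set 'rV[R]_N, compact K -> ~ K 0 -> (mu K < +oo)%E].

Definition levy_measure mu :=
  symmetric_radon mu /\
  (\int[mu]_(z in [set z : 'rV[R]_N | (z != 0)%R /\ (enorm z <= 1)%R]) ((enorm z) ^+ 2)%:E +
   \int[mu]_(z in [set z : 'rV[R]_N | (1 < enorm z)%R]) 1 < +oo)%E.

Definition levy_op P (sigma : 'M[R]_(N, P)) mu (psi : 'rV[R]_N -> R)
    (x : 'rV[R]_N) : R :=
  \tr (sigma *m sigma^T *m hessian psi x) +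
  \int[mu]_(z in [set~ 0])
    (psi (x + z) - psi x - dot z (grad psi x) * (enorm z <= 1)%R%:R).

Definition discrete_op nu (psi : 'rV[R]_N -> R) (x : 'rV[R]_N) : R :=
  \int[nu]_(z in [set~ 0]) (psi (x + z) - psi x).

End levy.

Section cauchy_problem.
Context {R : realType} {N : nat}.
Variable T : R.
Local Notation leb := (@lebesgue_rV R N).

Definition QT : set ('rV[R]_N * R) := [set: 'rV[R]_N] `*` `]0, T[.

Definition lebesgue_QT : {measure set ('rV[R]_N * measurableTypeR R) -> \bar R} :=
  (leb \x @lebesgue_measure R)%E.

Definition locally_L1_QT (u : 'rV[R]_N * R -> R) :=
  measurable_fun QT u /\
  forall K : set ('rV[R]_N * R), compact K -> K `<=` QT -> lebesgue_QT.-integrable K (EFin \o u).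

Definition L1_dist (K : set 'rV[R]_N) (v w : 'rV[R]_N -> R) : \bar R :=
  \int[leb]_(x in K) `|(v x - w x)%:E|%E.

(* u(., t), for t in [0, T], is a continuous path in L^1_loc(R^N). *)
Definition C_L1loc (u : 'rV[R]_N * R -> R) :=
  forall K : set 'rV[R]_N, compact K ->
    (forall t : R, 0 <= t <= T -> leb.-integrable K (fun x => (u (x, t))%:E)) /\
    (forall s : R, 0 <= s <= T ->
      L1_dist K (fun x => u (x, t)) (fun x => u (x, s))
        @[t --> within `[0, T] (nbhs s)] --> 0%E).

(* C_c^oo(R^N x [0, T)): restrictions of smooth functions on R^N x R that vanish
   for t near and above T; they need not vanish at t = 0. *)
Definition test_function (psi : 'rV[R]_N * R -> R) :=
  Cc_smooth psi /\ supp psi `<=` [set p | p.2 < T].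

Definition dt (psi : 'rV[R]_N * R -> R) := 'D_((0, 1) : 'rV[R]_N * R) psi.

Definition levy_op_x P (sigma : 'M[R]_(N, P))
    (mu : {measure set 'rV[R]_N -> \bar R}) (psi : 'rV[R]_N * R -> R)
    (p : 'rV[R]_N * R) : R :=
  levy_op sigma mu (fun x => psi (x, p.2)) p.1.

(* The integral over QT has to converge. When u and f are integrable on QT and
   psi, dt psi are bounded, this follows from the first clause. *)
Definition distributional_solution P (sigma : 'M[R]_(N, P))
    (mu : {measure set 'rV[R]_N -> \bar R}) (phi : R -> R)
    (f : 'rV[R]_N * R -> R) (u0 : 'rV[R]_N -> R) (u : 'rV[R]_N * R -> R) :=
  locally_L1_QT u /\
  forall psi, test_function psi ->
    let g p := phi (u p) * levy_op_x sigma mu psi p in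
    let G p := u p * dt psi p + g p + f p * psi p in
    [/\ lebesgue_QT.-integrable QT (EFin \o g),
        lebesgue_QT.-integrable QT (EFin \o G) &
        \int[lebesgue_QT]_(p in QT) G p + \int[leb]_x (u0 x * psi (x, 0)) = 0].

End cauchy_problem.

Definition nondecreasing_continuous (R : realType) (phi : R -> R) :=
  {homo phi : x y / x <= y} /\ continuous phi.

(* The least Lipschitz constant of phi on A: since 0 / 0 = 0, pairs (x, x)
   contribute 0. *)
Definition lipschitz_const (R : realType) (phi : R -> R) (A : set R) : \bar R :=
  ereal_sup [set (`|phi p.1 - phi p.2| / `|p.1 - p.2|)%:E | p in A `*` A].

Record scheme (R : realType) (N : nat) := Scheme {
  steps : nat;
  node : nat -> R;
  nu1 : {measure set 'rV[R]_N -> \bar R};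
  nu2 : {measure set 'rV[R]_N -> \bar R};
  phi1 : R -> R;
  phi2 : R -> R }.

Section scheme.
Context {R : realType} {N : nat}.
Implicit Type S : scheme R N.
Variable T : R.
Local Notation leb := (@lebesgue_rV R N).

Definition time_grid S :=
  [/\ node S 0%N = 0, node S (steps S) = T &
      forall j, (j < steps S)%N -> node S j < node S j.+1].

Definition step S (j : nat) : R := node S j - node S j.-1.

Definition max_step S : R := \big[Num.max/0]_(1 <= j < (steps S).+1) step S j.

Definition source_mean S (f : 'rV[R]_N * R -> R) (j : nat) (x : 'rV[R]_N) : R :=
  (step S j)^-1 *
  \int[@lebesgue_measure R]_(t in `]node S j.-1, node S j[) f (x, t).

(* L1_Loo makes each U j a Borel function, and discrete_op is applied to this
   representative; changing U j on a null set changes discrete_op on a null set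
   only, by invariance of leb under translations. *)
Definition scheme_solution S (u0 : 'rV[R]_N -> R) (f : 'rV[R]_N * R -> R)
    (U : nat -> 'rV[R]_N -> R) :=
  [/\ forall j, (j <= steps S)%N -> L1_Loo leb (U j),
      {ae leb, forall x, U 0%N x = u0 x} &
      forall j, (1 <= j <= steps S)%N ->
        {ae leb, forall x, U j x = U j.-1 x + step S j *
          (discrete_op (nu1 S) (phi1 S \o U j) x +
           discrete_op (nu2 S) (phi2 S \o U j.-1) x + source_mean S f j x)}].

Definition interpolant S (U : nat -> 'rV[R]_N -> R) (p : 'rV[R]_N * R) : R :=
  let: (x, t) := p in
  if t == 0 then U 0%N x else
  \sum_(1 <= j < (steps S).+1 | node S j.-1 < t <= node S j)
    (U j.-1 x + (t - node S j.-1) / (node S j - node S j.-1) *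
      (U j x - U j.-1 x)).

Definition data_bound (u0 : 'rV[R]_N -> R) (f : 'rV[R]_N * R -> R) : \bar R :=
  ('N[leb]_+oo[EFin \o u0] + \int[@lebesgue_measure R]_(t in `]0%R, T[)
    'N[leb]_+oo[EFin \o (fun x => f (x, t))])%E.

Definition admissible S (u0 : 'rV[R]_N -> R) (f : 'rV[R]_N * R -> R) :=
  [/\ symmetric_radon (nu1 S) /\ symmetric_radon (nu2 S),
      (nu1 S setT < +oo)%E /\ (nu2 S setT < +oo)%E,
      nondecreasing_continuous (phi1 S),
      {homo phi2 S : x y / x <= y} /\
      (forall x : R, exists2 A : set R, nbhs x A & [lipschitz phi2 S y | y in A]) &
      ((max_step S)%:E *
        lipschitz_const (phi2 S) [set r | (`|r|%:E <= data_bound u0 f)%E] *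
        nu2 S setT <= 1)%E].

Definition consistent_op (nu : R -> {measure set 'rV[R]_N -> \bar R})
    P (sigma : 'M[R]_(N, P)) (mu : {measure set 'rV[R]_N -> \bar R}) :=
  exists (k : nat) (omega : R -> R),
    omega h @[h --> 0^'+] --> 0 /\
    forall h, 0 < h -> forall psi : 'rV[R]_N -> R, Cc_smooth psi ->
      ('N[leb]_1[EFin \o (discrete_op (nu h) psi \- levy_op sigma mu psi)%R]
        <= sobolev1_norm k psi * (omega h)%:E)%E.

Definition consistent (S : R -> scheme R N) P (sigma : 'M[R]_(N, P))
    (mu : {measure set 'rV[R]_N -> \bar R}) (phi : R -> R) :=
  exists (f1 f2 : R -> R) (P1 P2 : nat)
    (sigma1 : 'M[R]_(N, P1)) (sigma2 : 'M[R]_(N, P2))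
    (mu1 mu2 : {measure set 'rV[R]_N -> \bar R}),
  [/\ nondecreasing_continuous f1 /\ nondecreasing_continuous f2,
      levy_measure mu1 /\ levy_measure mu2,
      forall v psi : 'rV[R]_N -> R, L1_Loo leb v -> Cc_smooth psi ->
        \int[leb]_x (f1 (v x) * levy_op sigma1 mu1 psi x +
          f2 (v x) * levy_op sigma2 mu2 psi x -
          phi (v x) * levy_op sigma mu psi x) = 0,
      consistent_op (fun h => nu1 (S h)) sigma1 mu1 /\
      consistent_op (fun h => nu2 (S h)) sigma2 mu2 &
      {family compact, phi1 (S h) @[h --> 0^'+] --> f1} /\
      {family compact, phi2 (S h) @[h --> 0^'+] --> f2}].

Definition levy_mass (nu : {measure set 'rV[R]_N -> \bar R}) : \bar R :=
  \int[nu]_(z in [set~ 0]) (Num.min ((enorm z) ^+ 2) 1)%:E.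

Definition uniform_levy (S : R -> scheme R N) :=
  (ereal_sup [set levy_mass (nu1 (S h)) | h in `]0%R, 1%R[] < +oo)%E /\
  (ereal_sup [set levy_mass (nu2 (S h)) | h in `]0%R, 1%R[] < +oo)%E.

Definition CL1loc_dist (K : set 'rV[R]_N) (u v : 'rV[R]_N * R -> R) : \bar R :=
  ereal_sup
    [set L1_dist K (fun x => u (x, t)) (fun x => v (x, t)) | t in `[0, T]].

End scheme.

(* Main.v *)
(* One step of the scheme is monotone under the CFL condition, hence an L^1-contraction which
   preserves the bound M. Comparing a solution with its translates gives equicontinuity in
   space, and testing the scheme against a smooth function gives equicontinuity in time of
   the local averages; so along an ultrafilter the interpolants are Cauchy in C([0,T]; L^1_loc),
   and by consistency every limit is a distributional solution.
   Uniqueness, after Oleinik and Brezis-Crandall: if w = u - v, z = phi(u) - phi(v) and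
   W(t) is the integral of z over [0,t], then w = L W. Being a limit of symmetric jump
   operators, the mollified L is symmetric and nonpositive, so that the integral of
   z * w = (dW/dt) * (L W) is nonpositive; as z * w >= 0, z and then w vanish. Uniqueness upgrades
   convergence of subsequences to convergence of the whole family. *)
Require Import Defs.
From HB Require Import structures.
From mathcomp Require Import all_boot all_order all_algebra.
From mathcomp Require Import all_classical all_reals all_analysis.
From mathcomp Require Import measurable_realfun ess_sup_inf ring lra.
Set Implicit Arguments.
Unset Strict Implicit.
Unset Printing Implicit Defensive.
Import Order.TTheory GRing.Theory Num.Theory.
Import numFieldNormedType.Exports.
Local Open Scope classical_set_scope.
Local Open Scope ring_scope.

(** The obstacle is that z = phi(u) - phi(v) is merely bounded: [phi] is just continuous, so all
    that integrability of u - v leaves for z is that the sets {|z| > xi} have finite measure.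
    Consistency, moreover, controls the discrete operators L_n only in L^1 and only on test
    functions. Mollification turns this L^1 error into a uniform one, but the pairing of a bounded W
    with an integrable L W is still not visibly a limit of nonpositive forms. It is compared with an
    energy built from the powers of the Markov operator I + L_n / (2 c), where c exceeds the mass of
    the jump measure; this is a truncated Neumann series for the inverse of -L_n. Taking about c K
    powers, with K fixed, keeps the errors under control even if c blows up with n. The jump
    operators that approximate the given Levy operator L come from the schemes themselves: inserting
    the functions a 1_A into the consistency identity expresses (phi(a) - phi(0)) L as a combination
    of the two limit operators with coefficients of the same sign as phi(a) - phi(0). If [phi] is
    constant, z vanishes and the zero operator serves. *)

Section toolkit.
Context d (X : measurableType d) (R : realType).
Variable mu : {measure set X -> \bar R}.
Implicit Types f g : X -> R.

(** * Integration of real-valued functions *)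

Definition Intg (mu : {measure set X -> \bar R}) (f : X -> R) :=
  mu.-integrable setT (EFin \o f).

Lemma Intg_meas f : Intg mu f -> measurable_fun setT f.
Proof. by move=> /integrableP[/measurable_EFinP]. Qed.

Lemma Intg_le f g : measurable_fun setT f -> Intg mu g ->
  (forall x, `|f x| <= g x) -> Intg mu f.
Proof.
move=> mf ig fg; apply: le_integrable ig => //; first exact/measurable_EFinP.
by move=> x _ /=; rewrite lee_fin (le_trans (fg x))// ler_norm.
Qed.

Lemma IntgD f g : Intg mu f -> Intg mu g -> Intg mu (fun x => f x + g x).
Proof. by move=> h1 h2; exact: (integrableD measurableT h1 h2). Qed.

Lemma IntgB f g : Intg mu f -> Intg mu g -> Intg mu (fun x => f x - g x).
Proof. by move=> h1 h2; exact: (integrableB measurableT h1 h2). Qed.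

Lemma IntgZ r f : Intg mu f -> Intg mu (fun x => r * f x).
Proof. by move=> h; exact: (integrableZl measurableT r h). Qed.

Lemma Intg_abs f : Intg mu f -> Intg mu (fun x => `|f x|).
Proof. by move=> h; exact: (integrable_abse h). Qed.

Lemma Intg0 : Intg mu (fun=> 0).
Proof. exact: integrable0. Qed.

Lemma Intg_sum (I : Type) (s : seq I) (P : pred I) (F : I -> X -> R) :
  (forall i, P i -> Intg mu (F i)) -> Intg mu (fun x => \sum_(i <- s | P i) F i x).
Proof.
move=> h; elim: s => [|i s IH].
  by under eq_fun do rewrite big_nil; exact: Intg0.
under eq_fun do rewrite big_cons; case: (boolP (P i)) => // Pi.
by apply: IntgD => //; exact: h.
Qed.

Lemma IntgM_bdd (b f : X -> R) (C : R) : measurable_fun setT b ->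
  (forall x, `|b x| <= C) -> Intg mu f -> Intg mu (fun x => b x * f x).
Proof.
move=> mb bC If; apply: (@Intg_le _ (fun x => C * `|f x|)).
- by apply: measurable_funM => //; exact: Intg_meas If.
- by apply: IntgZ; exact: Intg_abs.
- by move=> x; rewrite normrM ler_wpM2r.
Qed.

Lemma RintD f g : Intg mu f -> Intg mu g ->
  \int[mu]_x (f x + g x) = \int[mu]_x f x + \int[mu]_x g x.
Proof. exact: RintegralD. Qed.

Lemma RintB f g : Intg mu f -> Intg mu g ->
  \int[mu]_x (f x - g x) = \int[mu]_x f x - \int[mu]_x g x.
Proof. exact: RintegralB. Qed.

Lemma RintZ r f : Intg mu f -> \int[mu]_x (r * f x) = r * \int[mu]_x f x.
Proof. exact: RintegralZl. Qed.

Lemma Rint_zero : \int[mu]_x (0 : R) = 0.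
Proof. by rewrite /Rintegral integral0. Qed.

Lemma Rint_sum (I : Type) (s : seq I) (P : pred I) (F : I -> X -> R) :
  (forall i, P i -> Intg mu (F i)) ->
  \int[mu]_x (\sum_(i <- s | P i) F i x) = \sum_(i <- s | P i) \int[mu]_x F i x.
Proof.
move=> h; elim: s => [|i s IH].
  by rewrite big_nil; under eq_Rintegral do rewrite big_nil; exact: Rint_zero.
rewrite big_cons; under eq_Rintegral do rewrite big_cons; case: (boolP (P i)) => // Pi.
by rewrite RintD ?IH//; [exact: h|exact: Intg_sum].
Qed.

Lemma Rint_le f g : Intg mu f -> Intg mu g -> (forall x, f x <= g x) ->
  \int[mu]_x f x <= \int[mu]_x g x.
Proof. by move=> h1 h2 fg; apply: le_Rintegral. Qed.

Lemma Rint_ge0 f : (forall x, 0 <= f x) -> 0 <= \int[mu]_x f x.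
Proof. by move=> h; apply: Rintegral_ge0. Qed.

Lemma Rint_norm f : Intg mu f -> `|\int[mu]_x f x| <= \int[mu]_x `|f x|.
Proof. exact: le_normr_Rintegral. Qed.

Lemma Rint_dom f g : Intg mu f -> Intg mu g -> (forall x, `|f x| <= g x) -> `|\int[mu]_x f x| <= \int[mu]_x g x.
Proof. by move=> If Ig fg; apply: le_trans (Rint_norm If) (Rint_le (Intg_abs If) Ig fg). Qed.

Lemma Rint_EFin f : Intg mu f -> (\int[mu]_x f x)%:E = (\int[mu]_x (f x)%:E)%E.
Proof. by move=> h; rewrite /Rintegral fineK//; exact: integrable_fin_num. Qed.

Lemma Rint_ext f g : f =1 g -> \int[mu]_x f x = \int[mu]_x g x.
Proof. by move=> fg; apply: eq_Rintegral => x _; exact: fg. Qed.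

Lemma Rint_eq0 f : (forall x, f x = 0) -> \int[mu]_x f x = 0.
Proof. by move=> h; rewrite (Rint_ext (g := fun=> 0))// Rint_zero. Qed.

Lemma Rint_ae f g : measurable_fun setT f -> measurable_fun setT g ->
  {ae mu, forall x, f x = g x} -> \int[mu]_x f x = \int[mu]_x g x.
Proof.
move=> mf mg h; rewrite /Rintegral; congr fine; apply: ae_eq_integral => //.
- exact/measurable_EFinP.
- exact/measurable_EFinP.
- by apply: filterS h => x -> _.
Qed.

Lemma Intg_le_ae f g : measurable_fun setT f -> Intg mu g ->
  {ae mu, forall x, `|f x| <= g x} -> Intg mu f.
Proof.
move=> mf ig fg; have mg := Intg_meas ig.
have /integrableP[_ gy] := ig.
apply/integrableP; split; first exact/measurable_EFinP.
apply: le_lt_trans gy; apply: ae_ge0_le_integral => //.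
- by apply: measurableT_comp => //; exact/measurable_EFinP.
- by apply: measurableT_comp => //; exact/measurable_EFinP.
by apply: filterS fg => x h _ /=; rewrite lee_fin (le_trans h)// ler_norm.
Qed.

Lemma Intg_ae f g : measurable_fun setT g ->
  {ae mu, forall x, f x = g x} -> Intg mu f -> Intg mu g.
Proof.
move=> mg h /Intg_abs If; apply: (Intg_le_ae mg If).
by apply: filterS h => x ->.
Qed.

Lemma Rint_le_ae f g : Intg mu f -> Intg mu g ->
  {ae mu, forall x, f x <= g x} -> \int[mu]_x f x <= \int[mu]_x g x.
Proof.
(* [h] equals [g] almost everywhere and dominates [f] everywhere, which reduces the claim to the
   pointwise [Rint_le]. *)
move=> If Ig fg; pose h x := Num.max (f x) (g x).
have mh : measurable_fun setT h by apply: measurable_maxr; exact: Intg_meas.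
have e : {ae mu, forall x, g x = h x}.
  by apply: filterS fg => x fx; rewrite /h max_r.
rewrite (Rint_ae (Intg_meas Ig) mh e); apply: Rint_le => //.
  exact: Intg_ae Ig.
by move=> x; rewrite le_max lexx.
Qed.

Lemma Intg_ge0 f : measurable_fun setT f -> (forall x, 0 <= f x) ->
  (\int[mu]_x (f x)%:E < +oo)%E -> Intg mu f.
Proof.
move=> mf f0 fy; apply/integrableP; split; first exact/measurable_EFinP.
by under eq_integral => x _ do rewrite /= ger0_norm//.
Qed.

Lemma Intg_bdd f (A : set X) (C : R) : measurable A -> (mu A < +oo)%E ->
  measurable_fun setT f -> (forall x, `|f x| <= C) ->
  (forall x, ~ A x -> f x = 0) -> Intg mu f.
Proof.
move=> mA Ay mf fC f0; apply: (@Intg_le _ (fun x => C * \1_A x)) => //.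
  apply/IntgZ/Intg_ge0 => [|x|]; first exact: measurable_indic.
    by rewrite indicE.
  by rewrite integral_indic// setIT.
move=> x; rewrite indicE; have [xA|xA] := boolP (x \in A).
  by rewrite mulr1.
by rewrite f0 ?normr0 ?mulr0//; move/negP : xA => h Ax; apply: h; rewrite inE.
Qed.

Lemma Rint_indic (A : set X) : measurable A -> \int[mu]_x (\1_A x : R) = fine (mu A).
Proof. by move=> mA; rewrite /Rintegral integral_indic// setIT. Qed.

Lemma Intg_eq_measure (m : {measure set X -> \bar R}) f : m = mu :> (set X -> \bar R) -> Intg mu f -> Intg m f.
Proof.
move=> e /integrableP[mf If]; apply/integrableP; split => //.
by rewrite (eq_measure_integral mu) // => A mA _; exact: (congr1 (@^~ A) e).
Qed.

Lemma Rint_eq0_ae f : Intg mu f -> (forall x, 0 <= f x) -> \int[mu]_x f x = 0 ->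
  {ae mu, forall x, f x = 0}.
Proof.
move=> If f0 e.
have mf : measurable_fun setT (EFin \o f) by apply/measurable_EFinP; exact: Intg_meas If.
have : ae_eq mu setT (EFin \o f) (cst 0%E).
  apply/(ae_eq_integral_abs mu measurableT mf).
  under eq_integral => x _ do rewrite /= ger0_norm//.
  by rewrite -(Rint_EFin If) e.
by apply: filterS => x /(_ I) /= [].
Qed.

Lemma measurable_gt_abs f (r : R) : measurable_fun setT f -> measurable [set x | r < `|f x|].
Proof.
move=> mf; have mn : measurable_fun setT (fun x => `|f x|) by exact: measurableT_comp.
rewrite (_ : mkset _ = setT `&` (fun x => `|f x|) @^-1` `]r, +oo[%classic).
  exact: (mn measurableT _ (measurable_itv _)).
by apply/seteqP; split => x /=; rewrite in_itv/= andbT// => -[].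
Qed.

(** Chebyshev's inequality kept as bare finiteness: level sets of finite measure are what survives
    of integrability after composition with a continuous nonlinearity. *)
Lemma markov_fin f (e : R) : Intg mu f -> 0 < e -> (mu [set x | (e < `|f x|)%R] < +oo)%E.
Proof.
move=> If e0.
have mf := Intg_meas If.
have mA := measurable_gt_abs e mf.
have h : Intg mu (fun x => e^-1 * `|f x|) by apply: IntgZ; exact: Intg_abs.
have -> : mu [set x | (e < `|f x|)%R] = (\int[mu]_x (\1_[set x | e < `|f x|] x)%:E)%E.
  by rewrite integral_indic// setIT.
apply: (@le_lt_trans _ _ (\int[mu]_x (e^-1 * `|f x|)%:E)%E).
  apply: ge0_le_integral => //.
  - apply/measurable_EFinP; exact: measurable_indic.
  - exact/measurable_EFinP/(Intg_meas h).
  move=> x _; rewrite lee_fin indicE; case: (boolP (x \in _)) => [|_].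
    by rewrite inE/= => ex; rewrite ler_pdivlMl// mulr1 ltW.
  by rewrite mulr_ge0// invr_ge0 ltW.
by rewrite -(Rint_EFin h) ltry.
Qed.

Section preserving.
Variable h : X -> X.
Hypothesis mh : measurable_fun setT h.
Hypothesis pres : forall A, measurable A -> mu (h @^-1` A) = mu A.

(** Isolated for an arbitrary measure-preserving map because translations and reflections of space
    and shifts of time all go through it. *)
Lemma integral_preserving (F : X -> \bar R) : measurable_fun setT F -> (forall x, 0 <= F x)%E ->
  (\int[mu]_x F (h x) = \int[mu]_x F x)%E.
Proof.
move=> mF F0; have e := @ge0_integral_pushforward _ _ X X R h mh mu setT F measurableT mF (fun x _ => F0 x).
by apply: etrans (esym e) _; apply: eq_measure_integral => // A mA _; exact: pres.
Qed.

Lemma Intg_preserving f : Intg mu f -> Intg mu (fun x => f (h x)).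
Proof.
move=> If; have /integrableP[mf fin] := If; apply/integrableP; split.
  by apply/measurable_EFinP; exact: (measurableT_comp (Intg_meas If) mh).
by rewrite (integral_preserving (F := fun x => `|(EFin \o f) x|%E))//; exact: measurableT_comp.
Qed.

Lemma Rint_preserving f : measurable_fun setT f -> \int[mu]_x f (h x) = \int[mu]_x f x.
Proof.
move=> mf; have mf' : measurable_fun setT (EFin \o f) by exact/measurable_EFinP.
rewrite /Rintegral; congr fine; rewrite integralE [in RHS]integralE; congr (_ - _)%E.
  rewrite -[RHS](integral_preserving (measurable_funepos mf') (fun x => funepos_ge0 (EFin \o f) x)).
  by apply: eq_integral => x _; rewrite !funeposE.
rewrite -[RHS](integral_preserving (measurable_funeneg mf') (fun x => funeneg_ge0 (EFin \o f) x)).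
by apply: eq_integral => x _; rewrite !funenegE.
Qed.

Lemma ae_preserving (P : X -> Prop) : {ae mu, forall x, P x} -> {ae mu, forall x, P (h x)}.
Proof.
move=> [A [mA A0 PA]]; exists (h @^-1` A); split; [|by rewrite pres|by move=> x /= nP; apply: PA].
by rewrite -[X in measurable X]setTI; exact: mh.
Qed.

End preserving.

Lemma Intg_fine (F : X -> \bar R) : mu.-integrable setT F ->
  Intg mu (fun x => fine (F x)) /\ \int[mu]_x fine (F x) = fine (\int[mu]_x F x)%E.
Proof.
move=> IF; have mF := measurable_int _ IF.
have mf : measurable_fun setT (EFin \o (fun x => fine (F x))).
  by apply/measurable_EFinP; exact: (measurableT_comp (fine_measurable measurableT) mF).
have e : ae_eq mu setT F (EFin \o (fun x => fine (F x))).
  by apply: filterS (integrable_ae measurableT IF) => x h /h /fineK /= ->.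
split; first by apply: (le_integrable measurableT mf _ IF) => x _ /=; case: (F x) => [r||] //=; rewrite normr0 leey.
by rewrite /Rintegral; congr fine; apply: esym; exact: ae_eq_integral.
Qed.

Lemma DCT (f_ : nat -> X -> R) f g :
  (forall n, measurable_fun setT (f_ n)) -> measurable_fun setT f ->
  {ae mu, forall x, f_ ^~ x @ \oo --> f x} -> Intg mu g ->
  (forall n, {ae mu, forall x, `|f_ n x| <= g x}) ->
  [/\ Intg mu f, \int[mu]_x `|f_ n x - f x| @[n --> \oo] --> (0:R) &
     \int[mu]_x f_ n x @[n --> \oo] --> (\int[mu]_x f x : R)].
Proof.
move=> mf_ mf ff ig fg.
have fg' : {ae mu, forall x n, setT x -> (`|(EFin \o f_ n) x| <= (EFin \o g) x)%E}.
  have : {ae mu, forall x, forall n, `|f_ n x| <= g x}.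
    by apply: ae_foralln => n; exact: fg.
  by apply: filterS => x h n _; rewrite lee_fin.
have ff' : {ae mu, forall x, setT x -> (EFin \o f_ n) x @[n --> \oo] --> (EFin \o f) x}.
  by apply: filterS ff => x h _; apply/fine_cvgP; split; [exact: nearW|exact: h].
have [h1 h2 h3] := @dominated_convergence _ X R mu setT measurableT
  (fun n => EFin \o f_ n) (EFin \o f) (EFin \o g)
  (fun n => proj2 (measurable_EFinP _ _) (mf_ n)) (proj2 (measurable_EFinP _ _) mf) ff' ig fg'.
split => //.
  by have /fine_cvgP[] := h2.
move: h3; rewrite -(Rint_EFin h1) => /fine_cvgP[_].
exact.
Qed.

End toolkit.

(** * Bounded Borel functions and essential bounds *)

Section bounded.
Context d (X : measurableType d) {R : realType}.

(** The bound holds everywhere rather than almost everywhere, so that it passes to all translates,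
    slices and compositions without exceptional sets. *)
Definition bmeas (C : R) (g : X -> R) := measurable_fun setT g /\ forall x, `|g x| <= C.

Lemma bmeasD C1 C2 f g : bmeas C1 f -> bmeas C2 g -> bmeas (C1 + C2) (fun x => f x + g x).
Proof.
move=> [mf f1] [mg g1]; split; first exact: measurable_funD.
by move=> x; apply: le_trans (ler_normD _ _) _; exact: lerD.
Qed.

Lemma bmeasB C1 C2 f g : bmeas C1 f -> bmeas C2 g -> bmeas (C1 + C2) (fun x => f x - g x).
Proof.
move=> [mf f1] [mg g1]; split; first exact: measurable_funB.
by move=> x; apply: le_trans (ler_normB _ _) _; exact: lerD.
Qed.

Lemma bmeasM C1 C2 f g : bmeas C1 f -> bmeas C2 g -> bmeas (C1 * C2) (fun x => f x * g x).
Proof.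
move=> [mf f1] [mg g1]; split; first exact: measurable_funM.
by move=> x; rewrite normrM; exact: ler_pM.
Qed.

Lemma bmeasZ C r g : bmeas C g -> bmeas (`|r| * C) (fun x => r * g x).
Proof.
move=> [mg g1]; split; first exact: measurable_funM.
by move=> x; rewrite normrM ler_wpM2l.
Qed.

Lemma bmeas_abs C g : bmeas C g -> bmeas C (fun x => `|g x|).
Proof. by move=> [mg g1]; split => [|x]; [exact: measurableT_comp|rewrite normr_id]. Qed.

Lemma bmeas_cst (C : R) : bmeas `|C| (fun=> C).
Proof. by split. Qed.

Lemma bmeas_indic (A : set X) : measurable A -> bmeas 1 (\1_A : X -> R).
Proof.
move=> mA; split; first exact: measurable_indic.
by move=> x; rewrite indicE; case: (_ \in _); rewrite ?normr1 ?normr0.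
Qed.

Lemma bmeas_le C1 C2 g : C1 <= C2 -> bmeas C1 g -> bmeas C2 g.
Proof. by move=> C12 [mg g1]; split => // x; exact: le_trans C12. Qed.

Lemma bmeas_Intg (mu : {finite_measure set X -> \bar R}) C g : bmeas C g -> Intg mu g.
Proof.
move=> [mg gC]; apply: (@Intg_bdd _ _ _ mu g setT C) => //.
  by rewrite -ge0_fin_numE//; exact: fin_num_measure.
by move=> x /(_ I).
Qed.

Lemma bmeas_IntgM (mu : {measure set X -> \bar R}) C f g : bmeas C f -> Intg mu g ->
  Intg mu (fun x => f x * g x).
Proof. by move=> [mf fC] Ig; exact: IntgM_bdd mf fC Ig. Qed.

Lemma Rint_bmeasM_le (mu : {measure set X -> \bar R}) C f g : bmeas C f -> Intg mu g ->
  `|\int[mu]_x (f x * g x)| <= C * \int[mu]_x `|g x|.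
Proof.
move=> bf Ig; have Ia := Intg_abs Ig; rewrite -RintZ//.
by apply: (Rint_dom (bmeas_IntgM bf Ig) (IntgZ C Ia)) => x; rewrite normrM ler_wpM2r// bf.2.
Qed.

End bounded.

Section Linfty.
Context d (X : measurableType d) (R : realType).
Variable mu : {measure set X -> \bar R}.
Implicit Type f : X -> R.

Lemma Loo_ae f : {ae mu, forall x, (`|f x|%:E <= 'N[mu]_+oo[EFin \o f])%E}.
Proof.
have [h|h] := ltP 0%E (mu setT).
  by rewrite unlock /= h; exact: ess_sup_ge mu (abse \o (EFin \o f)).
(* Here the whole space is null, so any property holds almost everywhere. *)
exists setT; split => //.
by apply/eqP; rewrite eq_le h measure_ge0.
Qed.

Lemma Loo_le f (c : R) : 0 <= c -> {ae mu, forall x, `|f x| <= c} -> ('N[mu]_+oo[EFin \o f] <= c%:E)%E.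
Proof.
move=> c0 fc; rewrite unlock /=; case: ifPn => // h.
by apply/ess_supP; apply: filterS fc => x; rewrite /= lee_fin.
Qed.

Lemma L1_LooP f : L1_Loo mu f <-> Intg mu f /\ exists2 C : R, 0 <= C & {ae mu, forall x, `|f x| <= C}.
Proof.
split.
  move=> [/Lfun1_integrable h1]; rewrite inE => /andP[_]; rewrite inE /= /finite_norm => h2.
  split => //; exists (fine 'N[mu]_+oo[EFin \o f]); first by rewrite fine_ge0// Lnorm_ge0.
  apply: filterS (Loo_ae f) => x; rewrite -lee_fin fineK// ge0_fin_numE ?Lnorm_ge0//.
move=> [h1 [C C0 fC]]; split; first exact/Lfun1_integrable.
rewrite inE; apply/andP; split; first by rewrite inE /=; exact: Intg_meas h1.
by rewrite inE /= /finite_norm (le_lt_trans (Loo_le C0 fC))// ltry.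
Qed.

End Linfty.

(** Attaches the structure of a finite measure to the same set function: integrability of bounded
    functions and Fubini are then found without side conditions. *)
Lemma exists_finite_measure d (X : measurableType d) (R : realType) (nu : {measure set X -> \bar R}) :
  (nu setT < +oo)%E -> exists m : {finite_measure set X -> \bar R}, m = nu :> (set X -> \bar R).
Proof.
have H (mu : set X -> \bar R) : mu set0 = 0%E -> (forall A, 0%E <= mu A)%E ->
    semi_sigma_additive mu -> fin_num_fun mu ->
    exists m : {finite_measure set X -> \bar R}, m = mu :> (set X -> \bar R).
  move=> mu0 mu_ge0 mu_sigma mu_fin.
  pose mu1 := isMeasure.Build _ _ _ mu mu0 mu_ge0 mu_sigma.
  pose mu2 : {measure set _ -> \bar R} := HB.pack mu mu1.
  pose mu3 := Measure_isFinite.Build _ _ _ mu2 mu_fin.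
  pose mu4 : {finite_measure set _ -> \bar R} := HB.pack mu mu1 mu3.
  by exists mu4.
move=> fin; apply: H => //; first exact: measure_semi_sigma_additive.
move=> A mA; rewrite ge0_fin_numE//; apply: le_lt_trans fin.
by apply: le_measure; rewrite ?inE.
Qed.

(** * Directional derivatives of smooth functions *)

Section directional.
Context {R : realType} (E : normedModType R).
Implicit Types (f g : E -> R) (x v w : E).

Lemma is_dirP f x v (l : R) :
  is_derive x v f l <-> h^-1 * (f (h *: v + x) - f x) @[h --> (0 : R)^'] --> l.
Proof.
split=> [[h1 h2]|h]; last first.
  split; first by apply/cvg_ex; exists l.
  by apply/cvg_lim.
by move: h1 h2; rewrite /derivable /derive => /cvg_ex[m hm] <-; rewrite (cvg_lim _ hm).
Qed.

Lemma derivable_line f x v t : derivable f (t *: v + x) v ->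
  is_derive t 1 (fun s : R => f (s *: v + x)) ('D_v f (t *: v + x)).
Proof.
move=> d; have /is_dirP h : is_derive (t *: v + x) v f ('D_v f (t *: v + x)) by split.
split.
  apply/cvg_ex; exists ('D_v f (t *: v + x)); move: h; apply: cvg_trans; apply: near_eq_cvg.
  by near=> h; rewrite /= [h *: 1]mulr1 scalerDl addrA.
apply/cvg_lim => //; move: h; apply: cvg_trans; apply: near_eq_cvg.
by near=> h; rewrite /= [h *: 1]mulr1 scalerDl addrA.
Unshelve. all: by end_near. Qed.

Lemma continuous_line x v : continuous (fun s : R => s *: v + x).
Proof. by move=> s; apply: cvgD; [apply: cvgZ; [exact: cvg_id|exact: cvg_cst]|exact: cvg_cst]. Qed.

Lemma MVT_line f x v (s : R) : (forall y, derivable f y v) -> continuous f ->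
  exists2 c : R, `|c| <= `|s| & f (s *: v + x) - f x = s * 'D_v f (c *: v + x).
Proof.
move=> d cf; pose g (r : R) := f (r *: v + x).
have dg (r : R) : is_derive r 1 g ('D_v f (r *: v + x)) by exact: derivable_line.
have cg : continuous g by move=> r; exact: (continuous_comp (@continuous_line x v r) (cf _)).
have [s0|s0] := leP 0 s.
  have [c] := @MVT_segment R g (fun r => 'D_v f (r *: v + x)) 0 s s0 (fun r _ => dg r) (continuous_subspaceT cg).
  rewrite in_itv/= => /andP[c0 cs]; rewrite /g scale0r add0r subr0 mulrC => e.
  by exists c => //; rewrite !ger0_norm.
have [c] := @MVT_segment R g (fun r => 'D_v f (r *: v + x)) s 0 (ltW s0) (fun r _ => dg r) (continuous_subspaceT cg).
rewrite in_itv/= => /andP[c0 cs]; rewrite /g scale0r add0r sub0r => e.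
exists c; first by rewrite !ler0_norm ?lerN2// ltW.
by rewrite -opprB e mulrN opprK mulrC.
Qed.

(** No Frechet derivative is at hand. The increment along v + w is split into one along v and one
    along w from the displaced base point h v + x; the mean value theorem turns the latter into
    ['D_w f] at a point that tends to x, where continuity of ['D_w f] concludes. *)
Lemma derive_dirD f x v w : (forall y u, derivable f y u) -> continuous f ->
  continuous ('D_w f) -> 'D_(v + w) f x = 'D_v f x + 'D_w f x.
Proof.
move=> d cf cw.
have /is_dirP hv : is_derive x v f ('D_v f x) by split.
suff : is_derive x (v + w) f ('D_v f x + 'D_w f x) by case.
apply/is_dirP.
have -> : (fun h => h^-1 * (f (h *: (v + w) + x) - f x)) =
    (fun h => h^-1 * (f (h *: v + x) - f x) + h^-1 * (f (h *: w + (h *: v + x)) - f (h *: v + x))).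
  apply/funext => h; rewrite scalerDr (addrC (h *: v)) -addrA; ring.
apply: (cvgD hv); apply/cvgrPdist_lt => e e0.
have /cvgrPdist_lt/(_ e e0) := cw x => /nbhs_ballP[r /= r0 hr].
near=> h.
have [c ch ->] := @MVT_line f (h *: v + x) w h (fun y => d y w) cf.
have h0 : h != 0 by near: h; exact: nbhs_dnbhs_neq.
rewrite mulrA mulVf// mul1r; apply: hr; rewrite -ball_normE /=.
have -> : x - (c *: w + (h *: v + x)) = - (c *: w + h *: v).
  by rewrite addrA opprD addrCA subrr addr0.
rewrite normrN; apply: le_lt_trans (ler_normD _ _) _; rewrite !normrZ.
apply: (@le_lt_trans _ _ (`|h| * (`|w| + `|v|))).
  by rewrite mulrDr lerD2r ler_wpM2r.
have hn : `|h| < r / (`|w| + `|v| + 1).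
  near: h; apply: dnbhs0_lt; rewrite divr_gt0// ltr_wpDl// addr_ge0//.
have den : 0 < `|w| + `|v| + 1 by rewrite ltr_wpDl// addr_ge0.
rewrite ltr_pdivlMr// in hn; apply: le_lt_trans hn.
by rewrite ler_wpM2l// lerDl.
Unshelve. all: by end_near. Qed.

Lemma derive_dir0 f x : 'D_0 f x = 0.
Proof.
have : is_derive x 0 f 0.
  apply/is_dirP; apply: cvg_near_cst; near=> h.
  by rewrite scaler0 add0r subrr mulr0.
by case.
Unshelve. all: by end_near. Qed.

Lemma derive_dirZ f x v (c : R) : derivable f x v -> 'D_(c *: v) f x = c * 'D_v f x.
Proof.
move=> d; have [->|c0] := eqVneq c 0; first by rewrite scale0r derive_dir0 mul0r.
have /is_dirP hv : is_derive x v f ('D_v f x) by split.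
suff : is_derive x (c *: v) f (c * 'D_v f x) by case.
apply/is_dirP.
have -> : (fun h => h^-1 * (f (h *: (c *: v) + x) - f x)) =
    (fun h => c * ((fun h => h^-1 * (f (h *: v + x) - f x)) (h * c))).
  apply/funext => h; rewrite scalerA; have [->|h0] := eqVneq h 0; first by rewrite invr0 !mul0r invr0 mul0r mulr0.
  by rewrite invfM mulrA mulrCA divff// mulr1.
apply: cvgMl_tmp; apply: cvg_comp hv.
move=> P /nbhs_ballP[e /= e0 hP]; apply/nbhs_ballP; exists (e / `|c|).
  by rewrite /= divr_gt0// normr_gt0.
move=> y /=; rewrite -ball_normE /= sub0r normrN ltr_pdivlMr ?normr_gt0// => hy y0.
apply: hP; last by rewrite mulf_neq0.
by rewrite -ball_normE /= sub0r normrN normrM.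
Qed.

Lemma smooth_iter f vs : smooth f -> smooth (iter_derive vs f).
Proof.
move=> sf ws; have -> : iter_derive ws (iter_derive vs f) = iter_derive (ws ++ vs) f.
  by rewrite /iter_derive foldr_cat.
exact: sf.
Qed.

Lemma smooth_derive f v : smooth f -> smooth ('D_v f).
Proof. by move=> /(@smooth_iter f [:: v]). Qed.

Lemma smooth_continuous f : smooth f -> continuous f.
Proof. by move=> /(_ [::])[]. Qed.

Lemma smooth_derivable f x v : smooth f -> derivable f x v.
Proof. by move=> /(_ [::])[_]. Qed.

Lemma derive_vanish f (K : set E) v : closed K -> (forall x, ~ K x -> f x = 0) ->
  forall x, ~ K x -> 'D_v f x = 0.
Proof.
move=> cK fK x Kx; rewrite -(derive_cst (0 : R) x v).
apply: near_eq_derive; have oK : open (~` K) by exact: closed_openC.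
by apply: filterS (open_nbhs_nbhs (conj oK Kx)) => y; exact: fK.
Qed.

Lemma iter_vanish f (K : set E) vs : closed K -> (forall x, ~ K x -> f x = 0) ->
  forall x, ~ K x -> iter_derive vs f x = 0.
Proof. by move=> cK fK; elim: vs => [//|v vs IH] x Kx /=; exact: derive_vanish cK IH _ Kx. Qed.

Lemma supp_vanish f x : ~ supp f x -> f x = 0.
Proof.
move=> h; apply/eqP; apply: contrapT => /negP fx; apply: h.
by apply: subset_closure.
Qed.

Lemma compact_bdd f (K : set E) : continuous f -> compact K -> (forall x, ~ K x -> f x = 0) ->
  exists2 C : R, 0 <= C & forall x, `|f x| <= C.
Proof.
move=> cf cK fK.
have cfK : compact (f @` K) by apply: continuous_compact => //; exact: continuous_subspaceT.
have [M [Mr hM]] := compact_bounded cfK.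
exists (`|M| + 1); first by rewrite addr_ge0.
move=> x; have [Kx|Kx] := pselect (K x); last by rewrite fK// normr0 addr_ge0.
have Ml : M < `|M| + 1 by rewrite (le_lt_trans (ler_norm M)) ?ltrDl.
by apply: (hM _ Ml); exists x.
Qed.

Lemma Cc_bdd f vs : Cc_smooth f -> exists2 C : R, 0 <= C & forall x, `|iter_derive vs f x| <= C.
Proof.
move=> [sf cf]; apply: (compact_bdd (proj1 (sf vs)) cf).
apply: iter_vanish; first exact: closed_closure.
exact: supp_vanish.
Qed.

End directional.

(** * Product measures and dependence on parameters *)

Section fubini.
Context d1 (X : measurableType d1) d2 (Y : measurableType d2) (R : realType).
Variables (m1 : {sigma_finite_measure set X -> \bar R})
  (m2 : {sigma_finite_measure set Y -> \bar R}).
Implicit Type f : X * Y -> R.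

Lemma bmeas_pair1 C f x : bmeas C f -> bmeas C (fun y => f (x, y)).
Proof. by move=> [mf fC]; split => [|y]; [exact: (measurableT_comp mf (measurable_pair1 x))|exact: fC]. Qed.

Lemma bmeas_pair2 C f y : bmeas C f -> bmeas C (fun x => f (x, y)).
Proof. by move=> [mf fC]; split => [|x]; [exact: (measurableT_comp mf (measurable_pair2 y))|exact: fC]. Qed.

Lemma meas_fst (g : X -> R) : measurable_fun setT g -> measurable_fun setT (fun p : X * Y => g p.1).
Proof. by move=> mg; exact: (measurableT_comp mg measurable_fst). Qed.

Lemma meas_snd (g : Y -> R) : measurable_fun setT g -> measurable_fun setT (fun p : X * Y => g p.2).
Proof. by move=> mg; exact: (measurableT_comp mg measurable_snd). Qed.

Lemma Intg_prod f (h : X -> R) : measurable_fun setT f -> Intg m1 h ->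
  (forall x, Intg m2 (fun y => f (x, y))) ->
  (forall x, \int[m2]_y `|f (x, y)| <= h x) -> Intg (m1 \x m2)%E f.
Proof.
move=> mf Ih If fh; have mf' : measurable_fun setT (EFin \o f) by exact/measurable_EFinP.
apply/(integrable12ltyP m1 m2 mf').
apply: (@le_lt_trans _ _ (\int[m1]_x (h x)%:E)%E).
  apply: ge0_le_integral => //.
  - by move=> x _; apply: integral_ge0.
  - apply: (@measurable_fun_fubini_tonelli_F _ _ _ _ _ m2 (fun z => `|(EFin \o f) z|%E)) => //.
    exact: measurableT_comp.
  - exact/measurable_EFinP/(Intg_meas Ih).
  - move=> x _; have := Intg_abs (If x) => /Rint_EFin/= <-.
    by rewrite lee_fin.
by rewrite -(Rint_EFin Ih) ltry.
Qed.

Lemma Intg_prod2 f (h : Y -> R) : measurable_fun setT f -> Intg m2 h ->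
  (forall y, Intg m1 (fun x => f (x, y))) ->
  (forall y, \int[m1]_x `|f (x, y)| <= h y) -> Intg (m1 \x m2)%E f.
Proof.
move=> mf Ih If fh; have mf' : measurable_fun setT (EFin \o f) by exact/measurable_EFinP.
apply/(integrable21ltyP m1 m2 mf').
apply: (@le_lt_trans _ _ (\int[m2]_y (h y)%:E)%E).
  apply: ge0_le_integral => //.
  - by move=> y _; apply: integral_ge0.
  - apply: (@measurable_fun_fubini_tonelli_G _ _ _ _ _ m1 (fun z => `|(EFin \o f) z|%E)) => //.
    exact: measurableT_comp.
  - exact/measurable_EFinP/(Intg_meas Ih).
  - move=> y _; have := Intg_abs (If y) => /Rint_EFin/= <-.
    by rewrite lee_fin.
by rewrite -(Rint_EFin Ih) ltry.
Qed.

Lemma Fubini_ae1 f : Intg (m1 \x m2)%E f ->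
  {ae m1, forall x, Intg m2 (fun y => f (x, y))}.
Proof. by move=> /(@ae_integrable1 _ _ _ _ _ m1 m2). Qed.

Lemma Fubini_intg1 f : Intg (m1 \x m2)%E f ->
  Intg m1 (fun x => \int[m2]_y f (x, y)).
Proof. by move=> If; have [] := Intg_fine (@integrable_fubini_F _ _ _ _ _ m1 m2 _ If). Qed.

Lemma Fubini_Rint1 f : Intg (m1 \x m2)%E f ->
  \int[m1]_x \int[m2]_y f (x, y) = \int[(m1 \x m2)%E]_z f z.
Proof.
move=> If; have [_ ->] := Intg_fine (@integrable_fubini_F _ _ _ _ _ m1 m2 _ If).
by rewrite (@integral12_prod_meas1 _ _ _ _ _ m1 m2 _ If).
Qed.

Lemma Fubini_ae2 f : Intg (m1 \x m2)%E f ->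
  {ae m2, forall y, Intg m1 (fun x => f (x, y))}.
Proof. by move=> /(@ae_integrable2 _ _ _ _ _ m1 m2). Qed.

Let integrable_G f : Intg (m1 \x m2)%E f ->
  m2.-integrable setT (fubini_G m1 (EFin \o f)).
Proof.
move=> If; have mf := measurable_int _ If; apply/integrableP; split.
  exact: (@measurable_fubini_G _ _ _ _ _ m1 m2 _ If).
apply: le_lt_trans ((integrable21ltyP m1 m2 mf).1 If).
apply: ge0_le_integral => //.
- by apply: measurableT_comp => //; exact: (@measurable_fubini_G _ _ _ _ _ m1 m2 _ If).
- apply: (@measurable_fun_fubini_tonelli_G _ _ _ _ _ m1 (fun z => `|(EFin \o f) z|%E)) => //.
  exact: measurableT_comp.
- move=> y _; apply: le_abse_integral => //.
  exact: (measurableT_comp mf).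
Qed.

Lemma Fubini_intg2 f : Intg (m1 \x m2)%E f ->
  Intg m2 (fun y => \int[m1]_x f (x, y)).
Proof. by move=> /integrable_G/Intg_fine[]. Qed.

Lemma Fubini_Rint2 f : Intg (m1 \x m2)%E f ->
  \int[m2]_y \int[m1]_x f (x, y) = \int[(m1 \x m2)%E]_z f z.
Proof.
move=> If; have [_ ->] := Intg_fine (integrable_G If).
by rewrite (@integral21_prod_meas1 _ _ _ _ _ m1 m2 _ If).
Qed.

Lemma Fubini_swap f : Intg (m1 \x m2)%E f ->
  \int[m1]_x \int[m2]_y f (x, y) = \int[m2]_y \int[m1]_x f (x, y).
Proof. by move=> If; rewrite Fubini_Rint1// Fubini_Rint2. Qed.

(** For a >= 0 the norm of a slice exceeds a exactly when the corresponding section of {|f| > a} has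
    positive measure, and the measure of a section is measurable. *)
Lemma measurable_Loo_slice (f : X * Y -> R) : measurable_fun setT f ->
  measurable_fun setT (fun y => 'N[m1]_+oo[EFin \o (fun x => f (x, y))]%E).
Proof.
move=> mf; have [h|h] := ltP 0%E (m1 setT); last first.
  rewrite (_ : (fun _ => _) = cst 0%E); first exact: measurable_cst.
  by apply/funext => y; rewrite unlock /= ltNge h.
apply: (measurability _ (ErealGenOInfty.measurableE R)) => _ [_ [a ->] <-]; rewrite setTI.
have [a0|a0] := ltP a 0.
  rewrite (_ : _ @^-1` _ = setT); first exact: measurableT.
  apply/seteqP; split => // y _ /=; rewrite in_itv/= andbT.
  by apply: lt_le_trans (Lnorm_ge0 _ _ _); rewrite lte_fin.
pose A := [set p : X * Y | a < `|f p|].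
have mA : measurable A by exact: measurable_gt_abs.
rewrite (_ : _ @^-1` _ = setT `&` (m1 \o ysection A) @^-1` `]0%E, +oo[%classic).
  exact: (measurable_fun_ysection m1 mA measurableT (emeasurable_itv _)).
have E y : ('N[m1]_+oo[EFin \o (fun x => f (x, y))] <= a%:E)%E <-> m1 (ysection A y) = 0%E.
  rewrite -negligibleP; last exact: measurable_ysection.
  rewrite (_ : ysection A y = ~` [set x | `|f (x, y)| <= a]); last first.
    by apply/seteqP; split => x; rewrite /ysection/= inE /A/= ltNge => /negP.
  split=> [h1|]; last exact: Loo_le.
  by apply: filterS (Loo_ae m1 (fun x => f (x, y))) => x /le_trans/(_ h1).
apply/seteqP; split => y /=; rewrite !in_itv/= !andbT => H.
  by split => //; rewrite lt0e measure_ge0 andbT; apply/eqP => /E; rewrite leNgt H.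
by rewrite ltNge; apply/negP => /E e; case: H; rewrite e ltxx.
Qed.

(** The product measure is defined by slicing along the first factor; uniqueness of product measures
    allows slicing along the second. *)
Lemma ae_prod_swap (A : set (X * Y)) : measurable A ->
  {ae m2, forall y, m1 (ysection A y) = 0%E} -> (m1 \x m2)%E A = 0%E.
Proof.
move=> mA h.
transitivity ((m1 \x^ m2)%E A).
  by apply: product_measure_unique => // B C mB mC /=; rewrite product_measure2E.
rewrite /= /product_measure2; transitivity (\int[m2]_y cst 0%E y)%E; last by rewrite integral0.
apply: ae_eq_integral => //; first exact: measurable_fun_ysection.
by apply: filterS h => y.
Qed.

Let ae_eq0 d (Z : measurableType d) (m : {measure set Z -> \bar R}) (F : Z -> \bar R) : measurable_fun setT F ->
  (forall z, 0 <= F z)%E -> (\int[m]_z F z = 0)%E -> {ae m, forall z, F z = 0%E}.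
Proof.
move=> mF F0 iF; have : ae_eq m setT F (cst 0%E).
  apply/(ae_eq_integral_abs m measurableT mF); rewrite -[RHS]iF.
  by apply: eq_integral => z _; exact: gee0_abs.
by apply: filterS => z /(_ I).
Qed.

Lemma ae_prod1 (P : X * Y -> Prop) : {ae (m1 \x m2)%E, forall z, P z} ->
  {ae m1, forall x, {ae m2, forall y, P (x, y)}}.
Proof.
move=> [A [mA A0 PA]].
apply: filterS (ae_eq0 (measurable_fun_xsection m2 mA) (fun=> measure_ge0 m2 _) A0) => x e.
exists (xsection A x); split => //; first exact: measurable_xsection.
by move=> y /= nP; rewrite /xsection/= inE; exact: PA.
Qed.

Lemma ae_prod2 (P : X * Y -> Prop) : {ae (m1 \x m2)%E, forall z, P z} ->
  {ae m2, forall y, {ae m1, forall x, P (x, y)}}.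
Proof.
move=> [A [mA A0 PA]].
have A0' : (m1 \x^ m2)%E A = 0%E.
  rewrite -A0; apply: esym.
  by apply: product_measure_unique => // B C mB mC /=; rewrite product_measure2E.
apply: filterS (ae_eq0 (measurable_fun_ysection m1 mA) (fun=> measure_ge0 m1 _) A0') => y e.
exists (ysection A y); split => //; first exact: measurable_ysection.
by move=> x /= nP; rewrite /ysection/= inE; exact: PA.
Qed.

(** Parameter integrals are needed before their convergence is known. Positive and negative parts
    are measurable by Tonelli, and [fine] of the difference is Borel whether or not the integral
    converges. *)
Lemma measurable_Rint_param (f : X * Y -> R) : measurable_fun setT f ->
  measurable_fun setT (fun x => \int[m2]_y f (x, y)).
Proof.
move=> mf; have mf' : measurable_fun setT (EFin \o f) by exact/measurable_EFinP.
apply: (measurableT_comp (fine_measurable measurableT)).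
have -> : (fun x => \int[m2]_y (f (x, y))%:E)%E = (fun x =>
    \int[m2]_y (EFin \o f)^\+ (x, y) - \int[m2]_y (EFin \o f)^\- (x, y))%E.
  apply/funext => x; rewrite integralE; congr (_ - _)%E.
    by apply: eq_integral => y _; rewrite !funeposE.
  by apply: eq_integral => y _; rewrite !funenegE.
apply: emeasurable_funB.
  apply: (@measurable_fun_fubini_tonelli_F _ _ _ _ _ m2 (EFin \o f)^\+%E) => //.
  exact: measurable_funepos.
apply: (@measurable_fun_fubini_tonelli_F _ _ _ _ _ m2 (EFin \o f)^\-%E) => //.
exact: measurable_funeneg.
Qed.

End fubini.

(** * Borel structure and affine invariance of Lebesgue measure *)

Section real_line.
Context {R : realType}.
Local Notation lam := (@lebesgue_measure R).
Local Notation RT := (measurableTypeR R).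

Lemma continuous_measurable_rV n (f : 'rV[R]_n -> R) : continuous f -> measurable_fun setT f.
Proof.
move=> cf; apply: (measurability _ (RGenOpens.measurableE R)) => _ [_ [a [b ->]] <-].
rewrite setTI; apply: open_measurable_rV.
by apply: open_comp => [v _|]; [exact: cf|exact: interval_open].
Qed.

Lemma closed_measurable_rV n (K : set 'rV[R]_n) : closed K -> measurable K.
Proof.
move=> cK; rewrite -(setCK K); apply: measurableC; apply: open_measurable_rV.
exact: closed_openC.
Qed.

Lemma continuous_measurable_rV2 m n (f : 'rV[R]_m -> 'rV[R]_n) : continuous f ->
  measurable_fun setT f.
Proof.
move=> cf; apply: measurable_fun_rV => i; apply: continuous_measurable_rV => x.
exact: (continuous_comp (cf x) (@coord_continuous _ _ _ ord0 i (f x))).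
Qed.

Lemma cvg_rV (T : Type) (F : set_system T) (FF : Filter F) n (f : T -> 'rV[R]_n) (a : 'rV[R]_n) :
  (forall i, f t ord0 i @[t --> F] --> a ord0 i) -> f @ F --> a.
Proof.
move=> h A [P HP PA].
have : F [set t | forall i, P ord0 i (f t ord0 i)].
  by apply: filter_forall => i; exact: (h i _ (HP ord0 i)).
by apply: (@filterS _ F FF) => t ht; apply: PA => i j; rewrite (ord1 i); exact: ht.
Qed.

Lemma continuous_uncons1 n : continuous (fun v : 'rV[R]_n.+1 => (uncons_rV v).1).
Proof. by move=> v; exact: coord_continuous. Qed.

Lemma continuous_uncons2 n : continuous (fun v : 'rV[R]_n.+1 => (uncons_rV v).2).
Proof.
move=> v; apply: (@cvg_rV _ (nbhs v) _) => i; rewrite mxE.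
rewrite (_ : (fun _ => _) = (fun t : 'rV[R]_n.+1 => t ord0 (lift ord0 i))).
  exact: coord_continuous.
by apply/funext => t; rewrite mxE.
Qed.

(** The sigma-algebra on pairs is the product one, while continuity refers to the product topology.
    The identification with R^(n+1) through [cons_rV] reduces the claim to row vectors, whose
    measurable sets are the Borel sets. *)
Lemma continuous_measurable_prod n (f : 'rV[R]_n * R -> R) : continuous f ->
  measurable_fun [set: 'rV[R]_n * RT] f.
Proof.
move=> cf.
have cg : continuous (fun v : 'rV[R]_n.+1 => f ((uncons_rV v).2, (uncons_rV v).1)).
  move=> v; have h1 := @continuous_uncons1 n v; have h2 := @continuous_uncons2 n v.
  exact: (continuous_comp (cvg_pair h2 h1) (cf _)).
have mg := continuous_measurable_rV cg.
have ms : measurable_fun [set: 'rV[R]_n * RT] (fun p => (p.2, p.1)).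
  by apply: measurable_fun_pair; [exact: measurable_snd|exact: measurable_fst].
have := measurableT_comp mg (measurableT_comp (@measurable_cons_rV R n) ms).
by apply: eq_measurable_fun => -[x t] _; rewrite /comp cons_rVK.
Qed.

Lemma measurable_addrV n : measurable_fun [set: 'rV[R]_n * 'rV[R]_n] (fun p => p.1 + p.2).
Proof.
apply: measurable_fun_rV => i.
rewrite (_ : (fun _ => _) = fun p : 'rV[R]_n * 'rV[R]_n => p.1 ord0 i + p.2 ord0 i).
  apply: measurable_funD.
    exact: meas_fst (measurable_coord i).
  exact: meas_snd (measurable_coord i).
by apply/funext => p; rewrite mxE.
Qed.

Lemma measurable_subrV n : measurable_fun [set: 'rV[R]_n * 'rV[R]_n] (fun p => p.1 - p.2).
Proof.
apply: measurable_fun_rV => i.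
rewrite (_ : (fun _ => _) = fun p : 'rV[R]_n * 'rV[R]_n => p.1 ord0 i - p.2 ord0 i).
  apply: measurable_funB.
    exact: meas_fst (measurable_coord i).
  exact: meas_snd (measurable_coord i).
by apply/funext => p; rewrite !mxE.
Qed.

Lemma measurable_addrV_swap n : measurable_fun [set: 'rV[R]_n * 'rV[R]_n] (fun p => p.2 + p.1).
Proof. by have := @measurable_addrV n; apply: eq_measurable_fun => p _; exact: addrC. Qed.

Lemma measurable_subrV_swap n : measurable_fun [set: 'rV[R]_n * 'rV[R]_n] (fun p => p.2 - p.1).
Proof.
have m : measurable_fun [set: 'rV[R]_n * 'rV[R]_n] (fun p => (p.2, p.1)) by exact: measurable_fun_pair.
exact: (measurableT_comp (@measurable_subrV n) m).
Qed.

(** Translations ([b = false]) and point reflections ([b = true]) in one formula, so that invariance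
    is proved by a single induction. *)
Definition aff n (b : bool) (y v : 'rV[R]_n) := (-1) ^+ b *: v + y.

Lemma measurable_aff n b (y : 'rV[R]_n) : measurable_fun setT (aff b y).
Proof.
apply: measurable_fun_rV => i.
rewrite (_ : (fun _ => _) = fun p : 'rV[R]_n => (-1) ^+ b * p ord0 i + y ord0 i).
  by apply: measurable_funD => //; apply: measurable_funM => //; exact: measurable_coord.
by apply/funext => p; rewrite !mxE.
Qed.

Lemma lebesgue_measure_aff (b : bool) (y : R) (A : set R) : measurable A ->
  lebesgue_measure ((fun x : R => (-1) ^+ b * x + y) @^-1` A) = lebesgue_measure A.
Proof.
have trans (z : R) (B : set R) : measurable B ->
    lebesgue_measure ((fun x : R => x + z) @^-1` B) = lebesgue_measure B.
  move=> mB.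
  have mf : measurable_fun [set: RT] (fun x : RT => (x + z : RT)).
    exact: measurable_funD.
  pose m : {measure set RT -> \bar R} :=
    pushforward (@lebesgue_measure R) (fun x : RT => (x + z : RT)).
  apply: esym; apply: (@lebesgue_measure_unique R (m mf)) => // _ [[c e]] _ <-.
  rewrite /m /= /pushforward (_ : _ @^-1` _ = `]c - z, e - z]%classic); last first.
    by apply/seteqP; split => x /=; rewrite !in_itv/= ltrBlDr lerBrDr.
  by rewrite !lebesgue_measure_itv/= !lte_fin ltrD2r -!EFinB; case: ifP => // _; congr _%:E; ring.
case: b => mA; last first.
  by rewrite expr0; under eq_fun do rewrite mul1r; exact: trans.
rewrite (_ : _ @^-1` _ = (-%R : R -> R) @^-1` ((fun x => x + y) @^-1` A)); last first.
  by apply/seteqP; split => x /=; rewrite expr1 mulN1r.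
rewrite -[RHS](trans y) //; apply: lebesgue_measureN.
rewrite -[X in measurable X]setTI.
have mf : measurable_fun [set: R] (fun x : R => x + y) by exact: measurable_funD.
exact: mf.
Qed.

Lemma slice_aff n b (y : 'rV[R]_n.+1) a v :
  aff b y (cons_rV (a, v)) =
  cons_rV ((-1) ^+ b * a + (uncons_rV y).1, aff b (uncons_rV y).2 v).
Proof.
have unconsK (w : 'rV[R]_n.+1) : cons_rV (uncons_rV w) = w.
  apply/rowP => i; have [F1 F2] := cons_rVK (uncons_rV w).
  case: (unliftP ord0 i) => [j|] -> //.
  by move/rowP/(_ j) : F2; rewrite !mxE.
rewrite -[LHS]unconsK.
have [E1 E2] := cons_rVK (a, v).
have E2i i : cons_rV (a, v) ord0 (lift ord0 i) = v ord0 i.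
  by have := congr1 (fun w : 'rV_n => w ord0 i) E2; rewrite /= [X in X = _ -> _]mxE.
have affE m (z w : 'rV[R]_m) i : aff b z w ord0 i = (-1) ^+ b * w ord0 i + z ord0 i.
  by rewrite !mxE.
rewrite /uncons_rV; congr (cons_rV (_, _)) => /=; first by rewrite affE E1.
by apply/rowP => i; rewrite [LHS]mxE !affE E2i [X in _ = _ + X]mxE.
Qed.

Lemma measurable_slice n (A : set 'rV[R]_n.+1) : measurable A ->
  measurable_fun [set: RT]
    (fun a => lebesgue_rV [set v : 'rV[R]_n | A (cons_rV (a, v))]).
Proof.
move=> mA.
have mB : measurable (@cons_rV R n @^-1` A).
  by rewrite -[X in measurable X]setTI; exact: measurable_cons_rV.
have := @measurable_fun_xsection _ _ RT 'rV[R]_n R (@lebesgue_rV R n) _ mB.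
apply: eq_measurable_fun => a _ /=; congr (lebesgue_rV _).
by apply/seteqP; split => v; rewrite /xsection/= inE.
Qed.

(** Induction on the dimension: a slice of the preimage is the preimage of a slice under the map in
    one dimension less, and the slicing variable itself undergoes a one-dimensional affine map. *)
Lemma lebesgue_rV_aff n b (y : 'rV[R]_n) (A : set 'rV[R]_n) : measurable A ->
  lebesgue_rV (aff b y @^-1` A) = lebesgue_rV A.
Proof.
elim: n y A => [|n IH] y A mA.
  congr (lebesgue_rV _); apply/seteqP.
  have e v : aff b y v = v by apply/rowP => -[].
  by split => v /=; rewrite e.
pose h a := lebesgue_rV [set v : 'rV[R]_n | A (cons_rV (a, v))].
have mh : measurable_fun [set: RT] h by exact: measurable_slice.
have mB a : measurable [set v : 'rV[R]_n | A (cons_rV (a, v))].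
  have := measurableT_comp (@measurable_cons_rV R n) (measurable_pair1 a).
  by move=> /(_ measurableT _ mA); rewrite setTI.
pose g (a : R) : R := (-1) ^+ b * a + (uncons_rV y).1.
have mg : measurable_fun [set: RT] (g : _ -> RT).
  by apply: measurable_funD => //; exact: measurable_funM.
transitivity (\int[@lebesgue_measure R]_a h (g a))%E.
  apply: eq_integral => a _; rewrite /h -(IH (uncons_rV y).2)//.
  congr (lebesgue_rV _); apply/seteqP; split => v /=; rewrite slice_aff//.
transitivity (\int[@lebesgue_measure R]_a h a)%E => //.
have := @ge0_integral_pushforward _ _ RT RT R g mg
  (@lebesgue_measure R) setT h measurableT mh (fun a _ => measure_ge0 _ _).
rewrite preimage_setT => <-; apply: eq_measure_integral => //= C mC _.
by rewrite /pushforward; exact: lebesgue_measure_aff.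
Qed.

(** * Soft thresholding and finite level sets *)

Definition shrink (xi r : R) : R := Num.max 0 (r - xi) + Num.min 0 (r + xi).

Lemma shrinkE xi r : 0 <= xi -> shrink xi r =
  if xi < r then r - xi else if r < - xi then r + xi else 0.
Proof.
move=> xi0; rewrite /shrink; case: ltP => h.
  by rewrite max_r ?min_l ?addr0//; lra.
case: ltP => h2; first by rewrite max_l ?min_r ?add0r//; lra.
by rewrite max_l ?min_l ?addr0//; lra.
Qed.

Lemma shrink_norm xi r : 0 <= xi -> `|shrink xi r| = Num.max 0 (`|r| - xi).
Proof.
move=> xi0; rewrite shrinkE//; case: ltP => h.
  by rewrite !ger0_norm ?max_r//; lra.
case: ltP => h2; first by rewrite !ler0_norm ?max_r//; lra.
by rewrite normr0 max_l// subr_le0 ler_norml; lra.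
Qed.

Lemma shrink_le xi r : 0 <= xi -> `|shrink xi r| <= `|r|.
Proof. by move=> xi0; rewrite shrink_norm// ge_max normr_ge0/= lerBlDr lerDl. Qed.

Lemma measurable_shrink d (X : measurableType d) xi (f : X -> R) : measurable_fun setT f ->
  measurable_fun setT (fun x => shrink xi (f x)).
Proof.
move=> mf; apply: measurable_funD.
  by apply: measurable_maxr => //; exact: measurable_funB.
by apply: measurable_minr => //; exact: measurable_funD.
Qed.

(** Soft thresholding kills all values below xi, so finiteness of one level set makes the result
    integrable, and it moves values by at most xi. It is the integrable substitute for a function
    that is only bounded. *)
Lemma Intg_shrink d (X : measurableType d) (mu : {measure set X -> \bar R}) C xi (f : X -> R) : 0 <= xi -> bmeas C f ->
  (mu [set x | (xi < `|f x|)%R] < +oo)%E -> Intg mu (fun x => shrink xi (f x)).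
Proof.
move=> xi0 [mf fC] fin.
have mA := measurable_gt_abs xi mf.
apply: (Intg_bdd mA fin (measurable_shrink xi mf) (C := C)).
  by move=> x; exact: le_trans (shrink_le _ xi0) (fC x).
move=> x /negP; rewrite -leNgt => h; apply/eqP; rewrite -normr_eq0 shrink_norm//.
by rewrite max_l// subr_le0.
Qed.

(** Only [a] ranges over the compact interval; [b] may leave it. The near-covering form of
    compactness gives one radius valid for all [a]. *)
Lemma unif_cont_on (phi : R -> R) (M xi : R) : continuous phi -> 0 < xi ->
  exists2 d : R, 0 < d & forall a b, `|a| <= M -> `|b - a| < d -> `|phi b - phi a| < xi.
Proof.
move=> cphi xi0.
have cK : compact `[- M, M]%classic by exact: segment_compact.
have /compact_near_coveringP ncK := cK.
have : \forall d \near (0 : R)^'+, `[- M, M]%classic `<=`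
    [set a | forall b, `|b - a| < d -> `|phi b - phi a| < xi].
  apply: ncK => a _.
  have xi2 : 0 < xi / 2 by rewrite divr_gt0.
  have /cvgrPdist_lt/(_ _ xi2)/nbhs_ballP[e /= e0 he] := cphi a.
  have e2 : 0 < e / 2 by rewrite divr_gt0.
  exists (ball a (e / 2), [set d | 0 < d < e / 2]) => /=.
    split; first exact: nbhsx_ballx.
    by near=> d; apply/andP; split; near: d; [exact: nbhs_right_gt|exact: nbhs_right_lt].
  move=> [a' d] /= [aa' /andP[d0 de]] b bd.
  have h1 : `|phi a - phi a'| < xi / 2.
    by apply: he; apply: le_ball aa'; rewrite ler_pdivrMr// ler_pMr// ler1n.
  have h2 : `|phi a - phi b| < xi / 2.
    apply: he; rewrite /ball/=; have := aa'; rewrite /ball/= => aa2.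
    have -> : a - b = (a - a') + (a' - b) by ring.
    by apply: le_lt_trans (ler_normD _ _) _; rewrite [X in _ + X]distrC; lra.
  have -> : phi b - phi a' = (phi a - phi a') - (phi a - phi b) by ring.
  by apply: le_lt_trans (ler_normB _ _) _; lra.
move=> [e /= e0 he].
exists (e / 2); first by rewrite divr_gt0.
move=> a b aM; apply: (he (e / 2)) => /=.
- by rewrite sub0r normrN gtr0_norm ?divr_gt0// ltr_pdivrMr// ltr_pMr// ltr1n.
- by rewrite divr_gt0.
- by rewrite in_itv/= -ler_norml.
Unshelve. all: by end_near. Qed.

(** By uniform continuity, a difference of the values of [phi] above xi forces a difference of the
    arguments above some e / 2, and Chebyshev applies to the latter. Integrability itself would be
    lost under a [phi] that is not Lipschitz. *)
Lemma vanish_comp d (X : measurableType d) (mu : {measure set X -> \bar R}) M (phi : R -> R)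
    (U V : X -> R) : continuous phi ->
  bmeas M U -> bmeas M V -> Intg mu (fun x => U x - V x) ->
  forall xi, 0 < xi -> (mu [set x | (xi < `|phi (U x) - phi (V x)|)%R] < +oo)%E.
Proof.
move=> cphi [mU UM] [mV VM] I xi xi0.
have [e e0 he] := unif_cont_on M cphi xi0.
have e2 : 0 < e / 2 by rewrite divr_gt0.
have mphi : measurable_fun setT phi by exact: continuous_measurable_fun.
apply: le_lt_trans (markov_fin I e2); apply: le_measure; rewrite ?inE.
- by apply: measurable_gt_abs; apply: measurable_funB; exact: measurableT_comp.
- exact: measurable_gt_abs (Intg_meas I).
move=> x /= h; rewrite ltNge; apply/negP => h2.
have : `|U x - V x| < e by apply: le_lt_trans h2 _; rewrite ltr_pdivrMr// ltr_pMr// ltr1n.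
by move/(he _ _ (VM x)); rewrite ltNge ltW.
Qed.

(** * Primitives on the time axis *)

Section primitive.
Implicit Type phi : RT -> R.

(** Half-open intervals, so that the cells of a time grid partition ]0, T] exactly. *)
Definition itv_ind (a b : R) : RT -> R := \1_(`]a, b]%classic : set R).

Lemma itv_indE a b t : itv_ind a b t = (a < t <= b)%R%:R.
Proof. by rewrite /itv_ind indicE mem_setE in_itv. Qed.

Lemma measurable_itv_ind a b : measurable_fun setT (itv_ind a b).
Proof. by apply: measurable_indic; exact: measurable_itv. Qed.

Lemma bmeas_itv_ind a b : bmeas 1 (itv_ind a b).
Proof.
by split; [exact: measurable_itv_ind|move=> t; rewrite itv_indE; case: (_ && _); rewrite ?normr1 ?normr0].
Qed.

Lemma itv_ind_ge0 a b t : 0 <= itv_ind a b t.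
Proof. by rewrite itv_indE. Qed.

(** An integral over the whole line with an indicator as weight: linearity and Fubini then apply
    without restricted domains. *)
Definition prim phi (t : R) : R := \int[lam]_s (itv_ind 0 t s * phi s).

Lemma Intg_itv phi a b : Intg lam phi -> Intg lam (fun s => itv_ind a b s * phi s).
Proof. by apply: bmeas_IntgM; exact: bmeas_itv_ind. Qed.

Lemma prim0 phi : prim phi 0 = 0.
Proof.
rewrite /prim -[RHS](@Rint_zero _ _ R lam); apply: Rint_ext => s.
by rewrite itv_indE; case: ltP; case: leP => //=; rewrite ?mul0r// => h1 h2; lra.
Qed.

Lemma primB phi a b : Intg lam phi -> 0 <= a -> a <= b ->
  prim phi b - prim phi a = \int[lam]_s (itv_ind a b s * phi s).
Proof.
move=> I a0 ab; rewrite /prim -RintB; [|exact: Intg_itv..].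
apply: Rint_ext => s; rewrite -mulrBl; congr (_ * _); rewrite !itv_indE.
by case: (ltP 0 s) => h1; case: (leP s b) => h2; case: (leP s a) => h3; case: (ltP a s) => h4 //=; rewrite ?subr0 ?subrr//; lra.
Qed.

Lemma prim_nd phi a b : Intg lam phi -> (forall s, 0 <= phi s) -> 0 <= a -> a <= b -> prim phi a <= prim phi b.
Proof.
move=> I p0 a0 ab; rewrite -subr_ge0 primB//.
by apply: Rint_ge0 => s; rewrite mulr_ge0// itv_ind_ge0.
Qed.

Lemma prim_ge0 phi t : (forall s, 0 <= phi s) -> 0 <= prim phi t.
Proof. by move=> p0; apply: Rint_ge0 => s; rewrite mulr_ge0// itv_ind_ge0. Qed.

Lemma prim_le phi t : Intg lam phi -> (forall s, 0 <= phi s) -> prim phi t <= \int[lam]_s phi s.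
Proof.
move=> I p0; apply: Rint_le => //; first exact: Intg_itv.
move=> s; rewrite itv_indE; case: (_ && _); rewrite ?mul1r ?mul0r//.
Qed.

Lemma Rint_itv_open (g : RT -> R) (a b : R) : measurable_fun setT g ->
  \int[lam]_(t in `]a, b[) g t = \int[lam]_t (itv_ind a b t * g t).
Proof.
move=> mg; rewrite [LHS]Rintegral_mkcond; apply: Rint_ae.
- apply/(measurable_restrictT _ (measurable_itv _)); exact: measurable_funTS.
- by apply: measurable_funM => //; exact: measurable_itv_ind.
exists [set b]; split; [exact: measurable_set1|exact: lebesgue_measure_set1|].
move=> t /= h; apply: contrapT => tb; apply: h; rewrite patchE itv_indE mem_setE in_itv/=.
have -> : (t < b) = (t <= b) by rewrite lt_neqAle; case: eqP.
by case: (_ && _); rewrite ?mul1r ?mul0r.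
Qed.

End primitive.

Lemma Rint_itv_ind (a b : R) : a <= b -> \int[lam]_s itv_ind a b s = b - a.
Proof.
move=> ab; rewrite /itv_ind Rint_indic; last exact: measurable_itv.
transitivity (fine (lebesgue_measure (`]a, b]%classic : set R))) => //.
by rewrite lebesgue_measure_itv/= lte_fin; case: ltP => // h; have -> : a = b; [lra|rewrite subrr].
Qed.

Lemma Intg_itv_ind (a b : R) : Intg lam (itv_ind a b).
Proof.
apply: Intg_ge0; [exact: measurable_itv_ind|exact: itv_ind_ge0|].
rewrite /itv_ind integral_indic//.
rewrite setIT; apply: (@le_lt_trans _ _ (lebesgue_measure (`]a, b]%classic : set R))) => //.
by rewrite lebesgue_measure_itv/=; case: ifP => _; rewrite ltry.
Qed.

(** The excess of [phi] over a height n has integral below e / 2 for some n; the part below n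
    contributes at most n times the length of the interval. *)
Lemma abs_cont (phi : RT -> R) (e : R) : Intg lam phi -> (forall s, 0 <= phi s) -> 0 < e ->
  exists2 d : R, 0 < d & forall a b, a <= b -> b - a < d -> \int[lam]_s (itv_ind a b s * phi s) < e.
Proof.
move=> I p0 e0; have e2 : 0 < e / 2 by rewrite divr_gt0.
have mphi := Intg_meas I.
have [|//||//||_ _] := @DCT _ _ R lam (fun (n : nat) s => Num.max 0 (phi s - n%:R)) (fun=> 0) phi.
- by move=> n; apply: measurable_maxr => //; exact: measurable_funB.
- apply: aeW => s; apply: cvg_near_cst; exists (Num.bound (phi s)) => // n /= hn.
  rewrite max_l// subr_le0; apply: le_trans (ltW (archi_boundP (p0 s))) _.
  by rewrite ler_nat.
- move=> n; apply: aeW => s; rewrite ger0_norm ?le_max ?lexx//.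
  by rewrite ge_max p0/= gerBl.
rewrite Rint_zero => /cvgrPdist_lt/(_ _ e2)[n _ /(_ n (leqnn n))].
set q := fun s => Num.max 0 (phi s - n%:R) => hq.
have Iq : Intg lam (q : RT -> R).
  apply: (@Intg_le _ _ _ lam q phi) => //.
    by apply: measurable_maxr => //; exact: measurable_funB.
  move=> s; rewrite /q ger0_norm ?le_max ?lexx//; by rewrite ge_max p0/= gerBl.
rewrite sub0r normrN ger0_norm in hq; last by apply: Rint_ge0 => s; rewrite le_max lexx.
(* The denominator n + 1 covers the case n = 0. *)
exists (e / 2 / n.+1%:R); first by rewrite divr_gt0.
move=> a b ab hab.
apply: (@le_lt_trans _ _ (\int[lam]_s (n%:R * itv_ind a b s + q s))).
  apply: Rint_le; first exact: Intg_itv.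
    by apply: IntgD => //; apply: IntgZ; exact: Intg_itv_ind.
  move=> s; rewrite itv_indE /q; case: (_ && _); rewrite ?mul1r ?mulr1 ?mul0r ?mulr0 ?add0r.
    by rewrite -lerBlDl le_max lexx orbT.
  by rewrite le_max lexx.
rewrite RintD//; last by apply: IntgZ; exact: Intg_itv_ind.
rewrite RintZ; last exact: Intg_itv_ind.
rewrite Rint_itv_ind// (_ : e = e / 2 + e / 2); last by field.
apply: ler_ltD => //.
apply: (@le_trans _ _ (n.+1%:R * (b - a))); first by rewrite ler_wpM2r ?subr_ge0// ler_nat.
by rewrite -ler_pdivlMl// mulrC ltW.
Qed.

(** * Smooth functions and bumps *)

Lemma smooth_coind (E : normedModType R) (P : (E -> R) -> Prop) :
  (forall f, P f -> continuous f /\ forall x v, derivable f x v) ->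
  (forall f v, P f -> P ('D_v f)) -> forall f, P f -> smooth f.
Proof.
(* An invariant class of functions replaces the induction over lists of directions in each later
   proof of smoothness. *)
move=> h1 h2 f Pf vs; apply: (h1); elim: vs => [//|v vs IH] /=; exact: h2.
Qed.

Lemma smooth_line (F : nat -> R -> R) :
  (forall n (t : R), is_derive t 1 (F n) (F n.+1 t)) -> smooth (F 0%N : R^o -> R).
Proof.
(* A derivative in direction v multiplies by v, hence the scalar factor in the class. *)
move=> dF; pose P (f : R^o -> R) := exists n c, f = fun t => c * F n t.
apply: (@smooth_coind _ P); last by exists 0%N, 1; apply/funext => t; rewrite mul1r.
  move=> f [n [c ->]]; split.
    move=> t; apply: cvgMr; apply: differentiable_continuous; apply/derivable1_diffP.
    by have [] := dF n t.
  move=> t v; have := @derivableZ _ _ _ (F n) c t v; apply.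
  have -> : v = v *: (1 : R^o) by rewrite [v *: _]mulr1.
  apply: diff_derivable; apply/derivable1_diffP; by have [] := dF n t.
move=> f v [n [c ->]]; exists n.+1, (c * v); apply/funext => t.
have dn : derivable (F n : R^o -> R) t v.
  by apply: diff_derivable; apply/derivable1_diffP; by have [] := dF n t.
have -> : (fun t0 => c * F n t0) = c *: (F n : R^o -> R) by [].
rewrite deriveZ//.
have -> : 'D_v (F n : R^o -> R) t = v * F n.+1 t.
  have [d <-] := dF n t; rewrite -derive_dirZ//.
  by congr ('D_ _ _ _); rewrite [RHS]mulr1.
by rewrite [LHS]mulrA.
Qed.

Lemma smooth_comp_aff (E E' : normedModType R) (f : E' -> R) (l : E -> E') (l0 : E -> E') : smooth f ->
  continuous l -> (forall x v (s : R), l (s *: v + x) = s *: l0 v + l x) -> smooth (f \o l).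
Proof.
move=> sf cl hl.
have quot (g : E' -> R) x v : (fun h : R => h^-1 *: (((g \o l) \o shift x) (h *: v) - (g \o l) x)) =
    (fun h : R => h^-1 *: ((g \o shift (l x)) (h *: l0 v) - g (l x))).
  by apply/funext => h /=; rewrite hl.
have der (g : E' -> R) v : 'D_v (g \o l) = 'D_(l0 v) g \o l.
  by apply/funext => x; rewrite /derive quot.
have it vs : iter_derive vs (f \o l) = iter_derive (map l0 vs) f \o l.
  by elim: vs => [//|v vs IH] /=; rewrite -der -IH.
move=> vs; rewrite it; have [c d] := sf (map l0 vs); split.
  by move=> x; apply: continuous_comp; [exact: cl|exact: c].
by move=> x v; rewrite /derivable quot; exact: d.
Qed.

Lemma smoothM (E : normedModType R) (f g : E -> R) : smooth f -> smooth g ->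
  smooth (fun x => f x * g x).
Proof.
move=> sf sg.
(* Leibniz' rule leaves the class of products but not the class of finite sums of products. *)
pose P (h : E -> R) := exists s : seq ((E -> R) * (E -> R)),
  (forall p, List.In p s -> smooth p.1 /\ smooth p.2) /\ h = fun x => \sum_(p <- s) p.1 x * p.2 x.
have key (s : seq ((E -> R) * (E -> R))) : (forall p, List.In p s -> smooth p.1 /\ smooth p.2) ->
    continuous (fun x => \sum_(p <- s) p.1 x * p.2 x : R) /\
    forall v, exists s', (forall p, List.In p s' -> smooth p.1 /\ smooth p.2) /\
      forall x, is_derive x v (fun x => \sum_(p <- s) p.1 x * p.2 x) (\sum_(p <- s') p.1 x * p.2 x).
  elim: s => [|[a b] s IH] hs.
    split; first by under eq_fun do rewrite big_nil; move=> x; exact: cvg_cst.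
    move=> v; exists [::]; split => // x; rewrite big_nil.
    by under eq_fun do rewrite big_nil; exact: is_derive_cst.
  have [sa sb] := hs (a, b) (or_introl erefl); rewrite /= in sa sb.
  have [c d] := IH (fun p hp => hs p (or_intror hp)); split.
    under eq_fun do rewrite big_cons; move=> x; apply: cvgD; last exact: c.
    by apply: cvgM; [exact: smooth_continuous sa _|exact: smooth_continuous sb _].
  move=> v; have [s' [hs' ds']] := d v.
  exists [:: (a, 'D_v b), (b, 'D_v a) & s']; split.
    by move=> p /= [<-|[<-|]]; [exact: conj sa (smooth_derive _ sb)|exact: conj sb (smooth_derive _ sa)|exact: hs'].
  move=> x; under eq_fun do rewrite big_cons; rewrite !big_cons addrA /=.
  apply: is_deriveD; apply: is_deriveM; split => //; exact: smooth_derivable.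
have Pfg : P (fun x => f x * g x).
  exists [:: (f, g)]; split; first by move=> p [<-|[]]; exact: conj sf sg.
  by apply/funext => x; rewrite big_seq1.
apply: smooth_coind Pfg => [h [s [hs ->]]|h v [s [hs ->]]].
  have [c d] := key s hs; split => // x v; have [s' [_ /(_ x)]] := d v; by case.
have [_ /(_ v)[s' [hs' d']]] := key s hs; exists s'; split => //; apply/funext => x.
by have [] := d' x.
Qed.

Lemma smooth_cst (E : normedModType R) (c : R) : smooth (fun _ : E => c).
Proof.
pose P (h : E -> R) := exists c, h = fun=> c.
apply: (@smooth_coind _ P); last by exists c.
  by move=> f [a ->]; split=> [x|x v]; [exact: cvg_cst|exact: derivable_cst].
by move=> f v [a ->]; exists 0; apply/funext => x; exact: derive_cst.
Qed.

Lemma smooth_prod (E : normedModType R) (I : Type) (s : seq I) (F : I -> E -> R) :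
  (forall i, smooth (F i)) -> smooth (fun x => \prod_(i <- s) F i x).
Proof.
move=> sF; elim: s => [|i s IH].
  by under eq_fun do rewrite big_nil; exact: smooth_cst.
by under eq_fun do rewrite big_cons; exact: smoothM (sF i) IH.
Qed.

Lemma smoothZ (E : normedModType R) (c : R) (f : E -> R) : smooth f -> smooth (fun x => c * f x).
Proof. exact: smoothM (smooth_cst c). Qed.

(* The polynomial factor makes this family stable under differentiation. *)
Definition flat_exp (p : {poly R}) (x : R) : R :=
  if 0 < x then p.[x^-1] * expR (- x^-1) else 0.

(** With y = 1/x >= 1 the polynomial is at most A y^m, and the term of degree m + 2 in the series of
    exp gives exp(-y) <= (m+2)! / y^(m+2). The two surplus powers leave x^2, enough for a zero
    derivative at 0. *)
Lemma flat_exp_bnd (p : {poly R}) : exists2 C : R, 0 <= C & forall x, `|x| <= 1 -> `|flat_exp p x| <= C * x ^+ 2.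
Proof.
pose m := size p; pose A : R := \sum_(i < m) `|p`_i|.
have A0 : 0 <= A by apply: sumr_ge0.
exists (A * (m.+2)`!%:R); first by rewrite mulr_ge0.
move=> x x1; rewrite /flat_exp; case: ifPn => x0; last by rewrite normr0 mulr_ge0 ?sqr_ge0// mulr_ge0.
have y1 : 1 <= x^-1 by rewrite invf_ge1//; move: x1; rewrite gtr0_norm.
have y0 : 0 < x^-1 by rewrite invr_gt0.
set y := x^-1 in y1 y0 *.
have pb : `|p.[y]| <= A * y ^+ m.
  rewrite horner_coef; apply: le_trans (ler_norm_sum _ _ _) _; rewrite mulr_suml; apply: ler_sum => i _.
  rewrite normrM ler_wpM2l// normrX gtr0_norm//; apply: ler_weXn2l => //; exact: ltnW.
have eb : expR (- y) <= (m.+2)`!%:R / y ^+ m.+2.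
  rewrite expRN -lef_pV2 ?posrE ?invrK ?invr_gt0 ?expR_gt0//; last first.
    by rewrite divr_gt0 ?exprn_gt0// ltr0n fact_gt0.
  rewrite invf_div; apply: le_trans (expR_ge1Dxn m.+1 (ltW y0)).
    by rewrite lerDr.
rewrite normrM [`|expR _|]gtr0_norm ?expR_gt0//.
apply: (@le_trans _ _ (A * y ^+ m * ((m.+2)`!%:R / y ^+ m.+2))).
  by apply: ler_pM => //; exact: expR_ge0.
have -> : x ^+ 2 = (y ^+ 2)^-1 by rewrite /y exprVn invrK.
rewrite (_ : y ^+ m.+2 = y ^+ m * y ^+ 2); last by rewrite -exprD addn2.
have ym : y ^+ m != 0 by rewrite expf_neq0// gt_eqF.
have y2 : y ^+ 2 != 0 by rewrite expf_neq0// gt_eqF.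
rewrite le_eqVlt; apply/orP; left; apply/eqP.
by rewrite invfM !mulrA [A * _ * _]mulrAC mulfK.
Qed.

(** The chain rule in y = 1/x, where dy/dx = -y^2: p(y) exp(-y) differentiates to y^2 (p - p')(y)
    exp(-y). *)
Definition flat_next (p : {poly R}) : {poly R} := 'X^2 * (p - p^`()).

Lemma is_derive_flat (p : {poly R}) (x : R) : is_derive x 1 (flat_exp p) (flat_exp (flat_next p) x).
Proof.
have [x0|x0|->] := ltgtP x 0.
- apply: (@near_eq_is_derive _ _ _ (cst 0)).
    near=> y; rewrite /flat_exp ltNge (_ : y <= 0)//; near: y.
    by apply: filterS (lt_nbhsl x0) => z; exact: ltW.
  by rewrite /flat_exp ltNge (ltW x0)/=; exact: is_derive_cst.
- apply: (@near_eq_is_derive _ _ _ ((horner p \o (fun y => y^-1)) * (expR \o (fun y => - y^-1)))).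
    near=> y; rewrite /flat_exp (_ : 0 < y)//; near: y; exact: lt_nbhsr.
  have iv : is_derive x 1 (fun y : R => y^-1) (- x ^- 2).
    have xn : id x != 0 by rewrite /= gt_eqF.
    apply: (is_derive_eq (is_deriveV xn (is_derive_id _ _))).
    by rewrite [LHS]mulr1.
  have d1 : is_derive x 1 (horner p \o (fun y => y^-1)) (p^`().[x^-1] * (- x ^- 2)) by apply: is_derive1_comp.
  have nv : is_derive x 1 (fun y : R => - y^-1) (x ^- 2) by rewrite -[x ^- 2]opprK; apply: is_deriveN.
  have d2 : is_derive x 1 (expR \o (fun y : R => - y^-1)) (expR (- x^-1) * (x ^- 2)) by apply: is_derive1_comp.
  apply: (is_derive_eq (is_deriveM d1 d2)).
  rewrite /flat_exp x0 /flat_next !hornerE /= !exprVn [_ *: _]mulrC.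
  by rewrite -[X in _ + X = _]/(_ * _) /=; ring.
have [C C0 Cb] := flat_exp_bnd p.
rewrite [X in is_derive _ _ _ X]/flat_exp ltxx; apply/is_dirP.
have f0 : flat_exp p 0 = 0 by rewrite /flat_exp ltxx.
apply/cvgr0Pnorm_lt => e e0; near=> h.
have h1 : `|h| <= 1 by apply: ltW; near: h; apply: dnbhs0_lt.
have h0 : h != 0 by near: h; exact: nbhs_dnbhs_neq.
have he : `|h| < e / (C + 1) by near: h; apply: dnbhs0_lt; rewrite divr_gt0// ltr_wpDl.
rewrite addr0 [h *: 1]mulr1 f0 subr0 normrM normfV ltr_pdivrMl ?normr_gt0//.
apply: le_lt_trans (Cb _ h1) _; rewrite -real_normK ?num_real// expr2 mulrA mulrC ltr_pM2l ?normr_gt0//.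
apply: (@le_lt_trans _ _ ((C + 1) * `|h|)); first by rewrite ler_wpM2r// lerDl.
by rewrite -ltr_pdivlMl ?ltr_wpDl// mulrC.
Unshelve. all: by end_near. Qed.

Definition bump1 (t : R) : R := flat_exp 1 (1 - t) * flat_exp 1 (1 + t).

Lemma smooth_flat : smooth (flat_exp 1 : R^o -> R).
Proof.
apply: (@smooth_line (fun n => flat_exp (iter n flat_next 1))) => n t.
exact: is_derive_flat.
Qed.

Lemma smooth_bump1 : smooth (bump1 : R^o -> R).
Proof.
apply: smoothM.
  apply: (@smooth_comp_aff _ _ (flat_exp 1 : R^o -> R) (fun t : R^o => 1 - t : R^o) (fun t => - t)).
  - exact: smooth_flat.
  - by move=> t; apply: cvgB; [exact: cvg_cst|exact: cvg_id].
  - by move=> x v s; rewrite scalerN opprD addrCA addrA.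
apply: (@smooth_comp_aff _ _ (flat_exp 1 : R^o -> R) (fun t : R^o => 1 + t : R^o) (fun t => t)).
- exact: smooth_flat.
- by move=> t; apply: cvgD; [exact: cvg_cst|exact: cvg_id].
- by move=> x v s; rewrite addrCA.
Qed.

Lemma flat_exp1_ge0 x : 0 <= flat_exp 1 x.
Proof. by rewrite /flat_exp hornerC mul1r; case: ifP => // _; exact: expR_ge0. Qed.

Lemma flat_exp1_gt0 x : 0 < x -> 0 < flat_exp 1 x.
Proof. by move=> x0; rewrite /flat_exp x0 hornerC mul1r expR_gt0. Qed.

Lemma flat_exp1_out x : x <= 0 -> flat_exp 1 x = 0.
Proof. by move=> x0; rewrite /flat_exp ltNge x0. Qed.

Lemma bump1_ge0 t : 0 <= bump1 t.
Proof. by rewrite mulr_ge0// flat_exp1_ge0. Qed.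

Lemma bump1N t : bump1 (- t) = bump1 t.
Proof. by rewrite /bump1 opprK mulrC. Qed.

Lemma bump1_gt0 t : `|t| < 1 -> 0 < bump1 t.
Proof. by rewrite ltr_norml => /andP[a b]; rewrite mulr_gt0// flat_exp1_gt0//; lra. Qed.

Lemma bump1_out t : 1 <= `|t| -> bump1 t = 0.
Proof.
by rewrite ler_normr => /orP[h|h]; rewrite /bump1; [rewrite (flat_exp1_out (x := 1 - t)) ?mul0r//|
  rewrite (flat_exp1_out (x := 1 + t)) ?mulr0//]; lra.
Qed.

Lemma lam_itv (x y : bool) (a b : R) : a <= b -> lebesgue_measure [set` Interval (BSide x a) (BSide y b)] = (b - a)%:E.
Proof.
move=> ab; rewrite lebesgue_measure_itv/= lte_fin; case: ltP => // ba.
by have -> : a = b; [lra|rewrite subrr].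
Qed.

Lemma bump1_continuous : continuous (bump1 : R -> R).
Proof. exact: smooth_continuous (@smooth_bump1). Qed.

(** A smooth step, left unnormalised: it vanishes up to -1 and is constant from 1 on. The time
    cutoffs are made of it, with [bump1] as their explicit derivative. *)
Definition bump1_int (t : R) : R := \int[lam]_(s in `]-oo, t]) bump1 s.

Lemma bump1_Intg : Intg lam (bump1 : RT -> R).
Proof.
have mb : measurable_fun setT (bump1 : RT -> R).
  exact: continuous_measurable_fun bump1_continuous.
have bm : compact `[-1, 1 : R] by exact: segment_compact.
have out (x : R) : ~ `[-1, 1]%classic x -> bump1 x = 0.
  move=> h; apply: bump1_out; rewrite leNgt; apply/negP; rewrite ltr_norml => /andP[a b].
  by apply: h; rewrite /= in_itv/= !ltW.
have [C C0 hC] := @compact_bdd R R^o (bump1 : R^o -> R) `[-1, 1]%classic bump1_continuous bm out.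
apply: (@Intg_bdd _ _ _ lam _ `[-1, 1]%classic C) => //.
by rewrite [X in (X < _)%E]lam_itv ?ltry//; lra.
Qed.

Lemma is_derive_bump1_int (t : R) : is_derive t 1 bump1_int (bump1 t).
Proof.
have [||dd e] := @continuous_FTC1 R bump1 -oo%O t (t + 1) (ltr_pwDr ltr01 (lexx t))
  (@integrableS _ RT _ _ setT _ _ measurableT (measurable_itv _) (@subsetT _ _) bump1_Intg).
- by rewrite ltNye.
- exact: bump1_continuous.
by split; [exact: dd|rewrite -e derive1E].
Qed.

Lemma smooth_bump1_int : smooth (bump1_int : R^o -> R).
Proof.
apply: (@smooth_line (fun n => if n is m.+1 then iter_derive (nseq m (1 : R^o)) (bump1 : R^o -> R) else bump1_int)).
case=> [|n] t; first exact: is_derive_bump1_int.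
by split => //; have [_] := @smooth_bump1 (nseq n 1); exact.
Qed.

Lemma bump1_int_lo t : t <= -1 -> bump1_int t = 0.
Proof.
move=> t1; rewrite /bump1_int Rintegral_mkcond -[RHS](@Rint_zero _ _ R lam); apply: Rint_ext => s.
rewrite patchE; case: ifPn => //; rewrite inE /= in_itv/= => st; apply: bump1_out.
by rewrite ler_normr; apply/orP; right; lra.
Qed.

Lemma bump1_int_hi t : 1 <= t -> bump1_int t = bump1_int 1.
Proof.
move=> t1; rewrite /bump1_int Rintegral_mkcond [RHS]Rintegral_mkcond; apply: Rint_ext => s.
rewrite !patchE !mem_setE !in_itv/=; case: (leP s 1) => s1; first by rewrite (le_trans s1 t1).
by case: ifP => // _; apply: bump1_out; rewrite ler_normr; apply/orP; left; lra.
Qed.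

Lemma bump1_int1 : 0 < bump1_int 1.
Proof.
have -> : bump1_int 1 = \int[lam]_s bump1 s.
  rewrite /bump1_int Rintegral_mkcond; apply: Rint_ext => s; rewrite patchE mem_setE in_itv/=.
  by case: (leP s 1) => // s1; rewrite bump1_out// ler_normr; apply/orP; left; lra.
rewrite lt_def; apply/andP; split; last by apply: Rint_ge0; exact: bump1_ge0.
apply/eqP => e0; have := Rint_eq0_ae bump1_Intg (@bump1_ge0) e0.
move=> [A [mA A0 sub]].
have : (lam `](- 1%R)%R, 1%R[%classic <= lam A)%E.
  apply: le_measure; rewrite ?inE//.
  move=> x; rewrite /= in_itv/= => xq; apply: sub => /= x0; suff : 0 < bump1 x by rewrite x0 ltxx.
  by apply: bump1_gt0; rewrite ltr_norml.
by rewrite A0 [X in (X <= _)%E]lam_itv ?lee_fin; lra.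
Qed.

(** * Compactness along ultrafilters, shifts and difference quotients in time *)

Lemma ultra_lim (I : Type) (G : set_system I) (F : I -> R) (C : R) : UltraFilter G ->
  (\forall i \near G, `|F i| <= C) -> exists l : R, F i @[i --> G] --> l.
Proof.
move=> uG FC; have pG := @ultra_proper _ _ uG.
have /(_ (F @ G) _)[|l [_ cl]] := @segment_compact R (- C) C.
  by move: FC; apply: filterS => i; rewrite /= in_itv/= -ler_norml.
exists l => A Al; have [//|hc] := in_ultra_setVsetC (F @^-1` A) uG.
have [y [hy Ay]] := cl (~` A) A hc Al; by [].
Qed.

(** Arzela-Ascoli along an ultrafilter: at each point the values converge, equicontinuity spreads
    closeness to that limit over a neighbourhood, and compactness makes it uniform. Bounds and
    equicontinuity are required only eventually along the filter, which is how the schemes satisfy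
    them. *)
Lemma equicontinuous_cauchy (E : topologicalType) (I : Type) (G : set_system I) (K : set E) (F : I -> E -> R) (C e : R) :
  UltraFilter G -> compact K ->
  (forall p, K p -> \forall i \near G, `|F i p| <= C) ->
  (forall p, K p -> forall r, 0 < r -> exists2 O, nbhs p O &
     \forall i \near G, forall q, O q -> K q -> `|F i q - F i p| < r) -> 0 < e ->
  exists2 A, G A & forall i j, A i -> A j -> forall p, K p -> `|F i p - F j p| < e.
Proof.
move=> uG cK FC Fe e0; have pG := @ultra_proper _ _ uG.
have /compact_near_coveringP/(_ _ (filter_prod G G) (fun ij q => K q -> `|F ij.1 q - F ij.2 q| < e)) := cK.
case.
  move=> p Kp; have e4 : 0 < e / 4 by rewrite divr_gt0.
  have [l Fl] := ultra_lim uG (FC p Kp).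
  have [B Bp HB] := Fe p Kp _ e4.
  have /cvgrPdist_lt/(_ _ e4) nl := Fl.
  pose A := [set i | `|l - F i p| < e / 4 /\ forall q, B q -> K q -> `|F i q - F i p| < e / 4].
  have GA : G A by apply: filterI.
  exists (B, A `*` A); first by split => //; exists (A, A).
  move=> [q [i j]] /= [Bq [[a1 a2] [b1 b2]]] Kq.
  have h1 := a2 q Bq Kq; have h2 := b2 q Bq Kq.
  rewrite (_ : F i q - F j q = (F i q - F i p) - (l - F i p) + (l - F j p) - (F j q - F j p)); last by ring.
  apply: le_lt_trans (ler_normB _ _) _; apply: le_lt_trans (lerD (ler_normD _ _) (lexx _)) _.
  apply: le_lt_trans (lerD (lerD (ler_normB _ _) (lexx _)) (lexx _)) _; lra.
move=> [A B] /= [GA GB] AB; exists (A `&` B); first exact: filterI.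
by move=> i j [Ai _] [_ Bj] p Kp; exact: (AB (i, j) _ p Kp Kp).
Qed.

Lemma measurable_tshift (c : R) : measurable_fun setT (fun t : RT => (t + c : RT)).
Proof. exact: measurable_funD. Qed.

Lemma lam_tshift (c : R) (A : set RT) : measurable A ->
  lam ((fun t : RT => t + c) @^-1` A) = lam A.
Proof.
by move=> mA; rewrite -[RHS](lebesgue_measure_aff false c mA); congr (lam _); apply/funext => t /=; rewrite expr0 mul1r.
Qed.

Lemma ae_tshift (c : R) (P : RT -> Prop) : {ae lam, forall t, P t} -> {ae lam, forall t, P (t + c)}.
Proof. exact: ae_preserving (measurable_tshift c) (lam_tshift c) _. Qed.

Lemma Rint_tshift (c : R) (f : RT -> R) : measurable_fun setT f -> \int[lam]_t f (t + c) = \int[lam]_t f t.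
Proof. exact: Rint_preserving (measurable_tshift c) (lam_tshift c) _. Qed.

Lemma Intg_tshift (c : R) (f : RT -> R) : Intg lam f -> Intg lam (fun t => f (t + c)).
Proof. exact: Intg_preserving (measurable_tshift c) (lam_tshift c) _. Qed.

(** Over the whole line a function and its shift have the same integral. This stands in for
    differentiating an energy whose regularity in time is unknown. *)
Lemma telescoping_le0 (a q : RT -> R) tau : Intg lam a -> Intg lam q ->
  {ae lam, forall t, 2 * q t <= a t - a (t - tau)} -> \int[lam]_t q t <= 0.
Proof.
move=> Ia Iq h; have Is := Intg_tshift (- tau) Ia.
suff : 2 * \int[lam]_t q t <= 0 by rewrite pmulr_rle0.
rewrite -(RintZ _ Iq); apply: (@le_trans _ _ (\int[lam]_t (a t - a (t - tau)))).
  by apply: Rint_le_ae => //; [exact: IntgZ|exact: IntgB].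
by rewrite (RintB Ia Is) (Rint_tshift (- tau) (Intg_meas Ia)) subrr.
Qed.

(** Lebesgue's differentiation theorem along the steps -1/(n+1). Since [f] vanishes for s <= 0, its
    primitive from 0 coincides with the primitive from minus infinity to which the theorem
    applies. *)
Lemma left_quotients (f : RT -> R) : Intg lam f -> (forall s : R, s <= 0 -> f s = 0) ->
  {ae lam, forall t : RT, n.+1%:R * (\int[lam]_s (itv_ind 0 t s * f s) -
    \int[lam]_s (itv_ind 0 (t - n.+1%:R^-1) s * f s)) @[n --> \oo] --> f t}.
Proof.
move=> If f0; pose F (x : R) := \int[lam]_(t in `]-oo, x]) f t.
have FE x : \int[lam]_s (itv_ind 0 x s * f s) = F x.
  rewrite /F [RHS]Rintegral_mkcond; apply: Rint_ext => s; rewrite itv_indE patchE mem_setE in_itv/=.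
  by case: ltP => s0 /=; case: (s <= x); rewrite ?mul1r ?mul0r// f0.
have li : locally_integrable [set: R] f by apply: open_integrable_locally => //; exact: openT.
have := @FTC1Ny R f (fun y => @integrableS _ RT _ _ setT _ _ measurableT (measurable_itv _) (@subsetT _ _) If) li.
apply: filterS; first exact: (ae_filter_ringOfSetsType lam).
move=> t [dF eF]; rewrite -eF derive1E.
have c0 : (- (n.+1%:R : R)^-1) @[n --> \oo] --> (0 : R)^'.
  have c1 : (- (n.+1%:R : R)^-1) @[n --> \oo] --> (0 : R).
    apply/cvgr0Pnorm_lt => e e0; have := near_infty_natSinv_lt (PosNum e0); apply: filterS => n /=.
    by rewrite normrN ger0_norm.
  move=> A /= /c1 h.
  have h' : \forall n \near \oo, - (n.+1%:R : R)^-1 != 0 -> A (- (n.+1%:R : R)^-1) := h.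
  have : \forall n \near \oo, A (- (n.+1%:R : R)^-1).
    by apply: filterS h' => n; apply; rewrite oppr_eq0 invr_eq0 pnatr_eq0.
  exact.
have q := cvg_comp _ _ c0 dF; apply: cvg_trans q; apply: near_eq_cvg; apply: nearW => n /=.
rewrite !FE invrN invrK [LHS]mulNr -mulrN opprB; congr (_ * (_ - F _)).
by rewrite [_ *: 1]mulr1 addrC.
Qed.

End real_line.

Import HBSimple.

(** * Integrals on R^N: translations, reflections and boxes *)

Section euclidean.
Context {R : realType} {N : nat}.
Local Notation leb := (@lebesgue_rV R N).
Local Notation lam := (@lebesgue_measure R).
Local Notation V := 'rV[R]_N.
Local Notation RT := (measurableTypeR R).
Local Notation VT := (V * RT)%type.
Local Notation lebT := (leb \x lam)%E.
Local Notation fmeas := {finite_measure set V -> \bar R}.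
Local Notation cell S i := (itv_ind (node S i) (node S i.+1)).

Lemma integral_aff b (y : V) (F : V -> \bar R) : measurable_fun setT F ->
  (forall x, 0 <= F x)%E -> (\int[leb]_x F (aff b y x) = \int[leb]_x F x)%E.
Proof. exact: integral_preserving (measurable_aff b y) (lebesgue_rV_aff b y) _. Qed.

Lemma Intg_aff b (y : V) (f : V -> R) : Intg leb f -> Intg leb (fun x => f (aff b y x)).
Proof. exact: Intg_preserving (measurable_aff b y) (lebesgue_rV_aff b y) _. Qed.

Lemma Rint_aff b (y : V) (f : V -> R) : measurable_fun setT f ->
  \int[leb]_x f (aff b y x) = \int[leb]_x f x.
Proof. exact: Rint_preserving (measurable_aff b y) (lebesgue_rV_aff b y) _. Qed.

Lemma ae_aff b (y : V) (P : V -> Prop) : {ae leb, forall x, P x} ->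
  {ae leb, forall x, P (aff b y x)}.
Proof. exact: ae_preserving (measurable_aff b y) (lebesgue_rV_aff b y) _. Qed.

Lemma aff_addE (y x : V) : aff false y x = x + y.
Proof. by rewrite /aff expr0 scale1r. Qed.

Lemma aff_oppE (y x : V) : aff true y x = y - x.
Proof. by rewrite /aff expr1 scaleN1r addrC. Qed.

Lemma comp_shift (T : Type) (y : V) (f : V -> T) : (fun x : V => f (x + y)) = f \o aff false y.
Proof. by apply/funext => x; rewrite /= aff_addE. Qed.

Lemma comp_refl (T : Type) (y : V) (f : V -> T) : (fun x : V => f (y - x)) = f \o aff true y.
Proof. by apply/funext => x; rewrite /= aff_oppE. Qed.

Lemma measurable_shift (y : V) (f : V -> R) : measurable_fun setT f ->
  measurable_fun setT (fun x : V => f (x + y)).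
Proof. by move=> mf; rewrite comp_shift; exact: (measurableT_comp mf (measurable_aff _ _)). Qed.

Lemma measurable_refl (y : V) (f : V -> R) : measurable_fun setT f ->
  measurable_fun setT (fun x : V => f (y - x)).
Proof. by move=> mf; rewrite comp_refl; exact: (measurableT_comp mf (measurable_aff _ _)). Qed.

Lemma Intg_shift (y : V) (f : V -> R) : Intg leb f -> Intg leb (fun x : V => f (x + y)).
Proof. by rewrite comp_shift; exact: Intg_aff. Qed.

Lemma Intg_refl (y : V) (f : V -> R) : Intg leb f -> Intg leb (fun x : V => f (y - x)).
Proof. by rewrite comp_refl; exact: Intg_aff. Qed.

Lemma Rint_shift (y : V) (f : V -> R) : measurable_fun setT f ->
  \int[leb]_x f (x + y) = \int[leb]_x f x.
Proof. by rewrite comp_shift; exact: Rint_aff. Qed.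

Lemma Rint_refl (y : V) (f : V -> R) : measurable_fun setT f ->
  \int[leb]_x f (y - x) = \int[leb]_x f x.
Proof. by rewrite comp_refl; exact: Rint_aff. Qed.

Lemma ae_shift (y : V) (P : V -> Prop) : {ae leb, forall x, P x} ->
  {ae leb, forall x, P (x + y)}.
Proof. by move=> /(@ae_aff false y); apply: filterS => x; rewrite aff_addE. Qed.

Lemma lty_prode n (F : 'I_n -> \bar R) : (forall i, F i \is a fin_num) ->
  (\prod_(i < n) F i < +oo)%E.
Proof.
move=> h; have : (\prod_(i < n) F i)%E \is a fin_num.
  by apply: (big_ind (fun x : \bar R => x \is a fin_num)) => // x y; exact: fin_numM.
by move=> /fin_numPlt/andP[].
Qed.

(** Boxes instead of balls, because their Lebesgue measure is a product; those of integer size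
    exhaust the space and carry all localisations below. *)
Definition Qbox (M : R) : set V := [set v | forall i, `]- M, M[%classic (v ord0 i)].

Lemma Qbox_fin M : (leb (Qbox M) < +oo)%E.
Proof.
rewrite (@lebesgue_rV_box R N (fun=> `]- M, M[%classic)) => [|i]; last exact: measurable_itv.
by apply: lty_prode => i; rewrite /= lebesgue_measure_itv; case: ifP.
Qed.

Lemma open_Qbox M : open (Qbox M).
Proof.
rewrite openE => v h; exists (fun _ _ => `]- M, M[%classic) => [i j|w hw i]; last exact: hw.
by rewrite (ord1 i); apply: open_nbhs_nbhs; split; [exact: interval_open|exact: h].
Qed.

Lemma measurable_Qbox M : measurable (Qbox M).
Proof. by apply: open_measurable_rV; exact: open_Qbox. Qed.

Lemma Qbox_norm M (x : V) : 0 < M -> `|x| < M -> Qbox M x.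
Proof.
move=> M0 xM i /=; rewrite in_itv/= -ltr_norml; apply: le_lt_trans xM.
by rewrite [leRHS]mx_normrE; apply: (le_bigmax _ (fun ij => `|x ij.1 ij.2|) (ord0, i)).
Qed.

Lemma leb_bounded_fin (A : set V) : measurable A -> bounded_set A -> (leb A < +oo)%E.
Proof.
move=> mA [M [Mr MA]].
have := MA (`|M| + 1); rewrite (le_lt_trans (ler_norm M)) ?ltrDl// => /(_ isT) h.
apply: le_lt_trans (Qbox_fin (`|M| + 2)); apply: le_measure; rewrite ?inE//.
  exact: measurable_Qbox.
move=> x /h /= xM; apply: Qbox_norm; first by rewrite ltr_wpDl.
by apply: le_lt_trans xM _; rewrite ltrD2l ltr1n.
Qed.

Lemma compact_measurable_rV (K : set V) : compact K -> measurable K.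
Proof. by move=> cK; apply: closed_measurable_rV; apply: compact_closed. Qed.

Lemma compact_leb_fin (K : set V) : compact K -> (leb K < +oo)%E.
Proof.
move=> cK; apply: leb_bounded_fin; first exact: compact_measurable_rV.
exact: compact_bounded.
Qed.

Lemma indic_in (A : set V) x : A x -> (\1_A x : R) = 1.
Proof. by move=> Ax; rewrite indicE mem_set. Qed.

Lemma indic_out (A : set V) x : ~ A x -> (\1_A x : R) = 0.
Proof. by move=> Ax; rewrite indicE memNset. Qed.

(** * Continuity of translations in L^1 *)

Definition trans_cts (f : V -> R) := Intg leb f /\
  forall y_ : nat -> V, y_ n @[n --> \oo] --> (0 : V) ->
    \int[leb]_x `|f (x + y_ n) - f x| @[n --> \oo] --> (0 : R).

Lemma Intg_transB (f : V -> R) y : Intg leb f -> Intg leb (fun x => `|f (x + y) - f x|).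
Proof. by move=> If; apply/Intg_abs/IntgB => //; exact: Intg_shift. Qed.

Lemma trans_ctsD f g : trans_cts f -> trans_cts g -> trans_cts (fun x => f x + g x).
Proof.
move=> [If cf] [Ig cg]; split; first exact: IntgD.
move=> y_ y0; apply: (squeeze_cvgr (f := fun=> 0)
  (h := fun n => \int[leb]_x `|f (x + y_ n) - f x| + \int[leb]_x `|g (x + y_ n) - g x|)).
- near=> n; rewrite Rint_ge0 //=; rewrite -RintD; [|exact: Intg_transB..].
  apply: Rint_le; [exact: (Intg_transB _ (IntgD If Ig))|by apply: IntgD; exact: Intg_transB|].
  by move=> x; rewrite opprD addrACA; exact: ler_normD.
- exact: cvg_cst.
- by rewrite -[X in _ --> X](addr0 0); apply: cvgD; [exact: cf|exact: cg].
Unshelve. all: by end_near. Qed.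

Lemma trans_ctsZ (r : R) f : trans_cts f -> trans_cts (fun x => r * f x).
Proof.
move=> [If cf]; split; first exact: IntgZ.
move=> y_ y0; rewrite -(mulr0 `|r|).
under eq_fun => n.
  under eq_Rintegral => x _ do rewrite -mulrBr normrM.
  rewrite RintZ; last exact: Intg_transB.
  over.
by apply: cvgMl_tmp; exact: cf.
Qed.

Lemma trans_cts_approx f : Intg leb f ->
  (forall e, 0 < e -> exists2 g, trans_cts g & \int[leb]_x `|f x - g x| < e) -> trans_cts f.
Proof.
move=> If h; split => // y_ y0; apply/cvgrPdist_lt => e e0.
have [g [Ig cg] fg] := h (e / 3) (divr_gt0 e0 (ltr0n _ 3)).
have e3 : 0 < e / 3 by rewrite divr_gt0.
have /cvgrPdist_lt/(_ _ e3) := cg _ y0; apply: filterS => n.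
rewrite !sub0r !normrN !ger0_norm ?Rint_ge0// => gn.
have Ifg : Intg leb (fun x => `|f x - g x|) by apply/Intg_abs/IntgB.
have Ifg2 := Intg_shift (y_ n) Ifg.
have -> : e = e / 3 + (e / 3 + e / 3) by field.
apply: (@le_lt_trans _ _ (\int[leb]_x `|f (x + y_ n) - g (x + y_ n)| +
  (\int[leb]_x `|g (x + y_ n) - g x| + \int[leb]_x `|f x - g x|))).
  rewrite -RintD//; last exact: Intg_transB.
  rewrite -RintD//; last by apply: IntgD => //; exact: Intg_transB.
  apply: Rint_le; first exact: Intg_transB.
    by apply: IntgD => //; apply: IntgD => //; exact: Intg_transB.
  move=> x; rewrite [in leRHS](distrC (f x)).
  have -> : f (x + y_ n) - f x = (f (x + y_ n) - g (x + y_ n)) + ((g (x + y_ n) - g x) + (g x - f x)) by ring.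
  by apply: le_trans (ler_normD _ _) _; rewrite lerD2l; exact: ler_normD.
rewrite ltrD// ?ltrD//.
by rewrite (Rint_shift (y_ n) (Intg_meas Ifg)).
Qed.

(** The symmetric difference of O and its translate consists of two halves, the second being a
    translate of the first with -y in place of y. Each half is dominated by the indicator of O and
    tends to 0 pointwise because O is open. *)
Lemma trans_cts_open (O : set V) : open O -> (leb O < +oo)%E -> trans_cts \1_O.
Proof.
move=> oO Oy; have mO := open_measurable_rV oO.
have IO : Intg leb (\1_O : V -> R).
  apply: Intg_ge0 => [|x|]; first exact: measurable_indic.
    by rewrite indicE.
  by rewrite integral_indic// setIT.
split => // y_ y0.
pose d (y : V) (x : V) : R := \1_O x * (1 - \1_O (x + y)).
have dn (z_ : nat -> V) : z_ n @[n --> \oo] --> (0 : V) ->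
    \int[leb]_x d (z_ n) x @[n --> \oo] --> (0 : R).
  move=> z0; rewrite -[X in _ --> X](@Rint_zero _ _ R leb).
  have m1 : measurable_fun setT (\1_O : V -> R) by exact: measurable_indic.
  have [|//||//||_ _] := @DCT _ _ R leb (fun n => d (z_ n)) (fun=> 0) (\1_O : V -> R); last by [].
  - move=> n; apply: measurable_funM => //; apply: measurable_funB => //.
    exact: measurable_shift.
  - apply: aeW => x; rewrite /d indicE; have [xO|xO] := boolP (x \in O); last first.
      by under eq_fun do rewrite mul0r; exact: cvg_cst.
    apply: cvg_near_cst; rewrite inE in xO.
    have : x + z_ n @[n --> \oo] --> x.
      by rewrite -[X in _ --> X]addr0; apply: cvgD => //; exact: cvg_cst.
    move=> h; have hO : \forall n \near \oo, O (x + z_ n) := h _ (open_nbhs_nbhs (conj oO xO)).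
    apply: filterS hO => n /= On.
    by rewrite indicE mem_set// subrr mulr0.
  - move=> n; apply: aeW => x; rewrite /d !indicE.
    by case: (_ \in _) => /=; rewrite ?mul0r ?normr0// mul1r; case: (_ \in _); rewrite /= ?subrr ?subr0 ?normr0 ?normr1.
have Id y : Intg leb (d y).
  apply: (Intg_le _ IO).
    apply: measurable_funM; first exact: measurable_indic.
    by apply: measurable_funB => //; apply: measurable_shift; exact: measurable_indic.
  move=> x; rewrite /d !indicE.
  by case: (_ \in _) => /=; rewrite ?mul0r ?normr0// mul1r; case: (_ \in _); rewrite /= ?subrr ?subr0 ?normr0 ?normr1.
have E y : \int[leb]_x `|\1_O (x + y) - \1_O x : R| = \int[leb]_x d y x + \int[leb]_x d (- y) x.
  rewrite -[in RHS](Rint_shift y (Intg_meas (Id (- y)))) -RintD//; last exact: Intg_shift.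
  apply: Rint_ext => x; rewrite /d addrK !indicE.
  by case: (_ \in _); case: (_ \in _); rewrite /= ?(subrr, subr0, mul0r, mulr0, addr0, add0r, sub0r, normrN, normr1, normr0, mulr1).
have -> : (fun n => \int[leb]_x `|\1_O (x + y_ n) - \1_O x : R|) =
    (fun n => \int[leb]_x d (y_ n) x + \int[leb]_x d (- y_ n) x) by apply/funext => n; exact: E.
rewrite -[X in _ --> X](addr0 0); apply: cvgD; first exact: dn.
by apply: dn; rewrite -oppr0; apply: cvgN.
Qed.

Lemma indic_Intg (A : set V) : measurable A -> (leb A < +oo)%E -> Intg leb (\1_A : V -> R).
Proof.
move=> mA Ay; apply: Intg_ge0 => [|x|]; first exact: measurable_indic.
  by rewrite indicE.
by rewrite integral_indic// setIT.
Qed.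

Lemma trans_cts_seq (A : nat -> set V) (B C : set V) : measurable B -> measurable C -> (leb C < +oo)%E ->
  (forall n, measurable (A n)) -> (forall n, A n `<=` C) ->
  (forall x, \1_(A n) x @[n --> \oo] --> (\1_B x : R)) -> Intg leb (\1_B : V -> R) ->
  (forall n, trans_cts \1_(A n)) -> trans_cts (\1_B).
Proof.
move=> mB mC Cy mA AC AB IB cA; apply: trans_cts_approx => // e e0.
have [|||||_ h _] := @DCT _ _ R leb (fun n => \1_(A n)) (\1_B) (\1_C : V -> R).
- by move=> n; exact: measurable_indic.
- exact: measurable_indic.
- exact: aeW.
- exact: indic_Intg.
- move=> n; apply: aeW => x; rewrite !indicE; have [xA|xA] := boolP (x \in A n).
    by rewrite mem_set ?normr1//; apply: (AC n); rewrite inE in xA.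
  by rewrite normr0.
have [n _ /(_ n (leqnn n))] := (cvgrPdist_lt _ _).1 h _ e0.
rewrite sub0r normrN ger0_norm ?Rint_ge0// => hn; exists (\1_(A n)) => //.
by under eq_Rintegral do rewrite distrC.
Qed.

Lemma ndseq_indic_cvg (F : nat -> set V) : nondecreasing_seq F ->
  forall x, \1_(F n) x @[n --> \oo] --> (\1_(\bigcup_n F n) x : R).
Proof.
move=> ndF x; rewrite [in X in _ --> X]indicE.
have [|xF] := boolP (x \in _); last first.
  under eq_fun do rewrite indicE.
  apply: cvg_near_cst; apply: nearW => n; rewrite memNset//.
  by move=> Fx; move/negP : xF; apply; rewrite inE; exists n.
rewrite inE => -[m _ Fm]; apply: cvg_near_cst; exists m => // n /= mn.
by rewrite indicE mem_set//; exact: (subsetPset _ _ (ndF _ _ mn)).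
Qed.

Lemma trans_cts_Qbox M (A : set V) : measurable A -> trans_cts \1_(A `&` Qbox M).
Proof.
have fin B : measurable B -> (leb (B `&` Qbox M) < +oo)%E.
  move=> mB; apply: le_lt_trans (Qbox_fin M); apply: le_measure; rewrite ?inE.
  - by apply: measurableI => //; exact: measurable_Qbox.
  - exact: measurable_Qbox.
  - exact: subIsetr.
have mQ := @measurable_Qbox M.
(* Intersection with a fixed box keeps all measures finite, so proper differences and increasing
   unions, the operations of a lambda-system, preserve the property. *)
pose H : set (set V) := [set B | measurable B /\ trans_cts \1_(B `&` Qbox M)].
suff : <<s @open V >> `<=` H by move=> h mA; have [] := h _ mA.
apply: lambda_system_subset => //.
- by move=> B C; exact: openI.
- split => //.
  + split => //; rewrite setTI; apply: trans_cts_open; [exact: open_Qbox|exact: Qbox_fin].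
  + move=> B C CB [mB hB] [mC hC]; split; first exact: measurableD.
    have -> : \1_((B `\` C) `&` Qbox M) = (fun x => \1_(B `&` Qbox M) x + (-1) * \1_(C `&` Qbox M) x) :> (V -> R).
      apply/funext => x; have [Qx|Qx] := pselect (Qbox M x); last first.
        by rewrite !indic_out ?mulr0 ?addr0// => -[].
      have [Cx|Cx] := pselect (C x).
        have Bx := CB _ Cx; rewrite indic_out; last by case=> -[].
        by rewrite !indic_in ?mulN1r ?subrr//.
      rewrite (@indic_out (C `&` _)); last by case.
      rewrite mulr0 addr0; have [Bx|Bx] := pselect (B x); first by rewrite !indic_in.
      by rewrite !indic_out// => -[] // [].
    by apply: trans_ctsD => //; exact: trans_ctsZ.
  + move=> F ndF hF; have mF : measurable (\bigcup_n F n).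
      by apply: bigcupT_measurable => n; have [] := hF n.
    split => //; apply: (@trans_cts_seq (fun n => F n `&` Qbox M) _ (Qbox M)) => //.
    * exact: measurableI.
    * exact: Qbox_fin.
    * by move=> n; apply: measurableI => //; have [] := hF n.
    * move=> x; rewrite setI_bigcupl; apply: ndseq_indic_cvg => m n mn.
      by apply/subsetPset; apply: setSI; apply/subsetPset/ndF.
    * by apply: indic_Intg; [exact: measurableI|exact: fin].
    * by move=> n; have [] := hF n.
- move=> B oB; split; first exact: open_measurable_rV.
  apply: trans_cts_open; first by apply: openI => //; exact: open_Qbox.
  by apply: fin; exact: open_measurable_rV.
Qed.

Lemma Qbox_bigcup : \bigcup_n @Qbox n%:R = setT.
Proof.
apply/seteqP; split => // x _; exists (Num.bound `|x|).+1 => //.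
apply: Qbox_norm; first by rewrite ltr0n.
by apply: (lt_trans (archi_boundP (normr_ge0 _))); rewrite ltr_nat.
Qed.

Lemma nd_Qbox : nondecreasing_seq (fun n => @Qbox n%:R).
Proof.
move=> m n mn; apply/subsetPset => x h i /=; have := h i; rewrite /= !in_itv/=.
have mn' : m%:R <= n%:R :> R by rewrite ler_nat.
by move=> /andP[h1 h2]; apply/andP; split; lra.
Qed.

Lemma trans_cts_indic (A : set V) : measurable A -> (leb A < +oo)%E -> trans_cts \1_A.
Proof.
move=> mA Ay; apply: (@trans_cts_seq (fun n => A `&` Qbox n%:R) A A) => //.
- by move=> n; apply: measurableI => //; exact: measurable_Qbox.
- move=> x; rewrite -[in X in _ --> X](setIT A) -Qbox_bigcup setI_bigcupr.
  apply: ndseq_indic_cvg => m n mn.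
  by apply/subsetPset; apply: setIS; apply/subsetPset/nd_Qbox.
- exact: indic_Intg.
- by move=> n; exact: trans_cts_Qbox.
Qed.

Lemma trans_cts0 : trans_cts (fun=> 0).
Proof.
split=> [|y_ _]; first exact: Intg0.
under eq_fun do under eq_Rintegral do rewrite subrr normr0.
by rewrite Rint_zero; exact: cvg_cst.
Qed.

Lemma trans_cts_sum (I : Type) (s : seq I) (F : I -> V -> R) :
  (forall i, trans_cts (F i)) -> trans_cts (fun x => \sum_(i <- s) F i x).
Proof.
move=> h; elim: s => [|i s IH].
  by under eq_fun do rewrite big_nil; exact: trans_cts0.
by under eq_fun do rewrite big_cons; apply: trans_ctsD.
Qed.

(* Translations act continuously on L^1: clear for indicators of open sets of finite
   measure, hence for Borel sets by a pi-lambda argument, hence for limits of simple functions. *)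
Lemma Intg_trans_cts (f : V -> R) : Intg leb f -> trans_cts f.
Proof.
move=> If; apply: trans_cts_approx => // e e0.
have [g_ [Ig _ gf]] := approximation_sfun_integrable measurableT If.
have cg n : trans_cts (g_ n).
  have mg r : measurable (g_ n @^-1` [set r]).
    by rewrite -[X in measurable X]setTI; exact: measurable_funP.
  have -> : (g_ n : V -> R) = fun x => \sum_(r <- finmap.enum_fset (fset_set (range (g_ n)))) r * \1_(g_ n @^-1` [set r]) x.
    by apply/funext => x; rewrite {1}(fimfunE (g_ n) x) fsbig_finite.
  apply: trans_cts_sum => r; have [->|r0] := eqVneq r 0.
    by under eq_fun do rewrite mul0r; exact: trans_cts0.
  apply/trans_ctsZ/trans_cts_indic => //.
  have r20 : 0 < `|r| / 2 by rewrite divr_gt0// normr_gt0.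
  apply: le_lt_trans (markov_fin (Ig n) r20); apply: le_measure; rewrite ?inE//.
    exact: measurable_gt_abs (Intg_meas (Ig n)).
  move=> x /= ->; have := normr_gt0 r; rewrite r0 => ?.
  by rewrite ltr_pdivrMr// ltr_pMr// ltr1n.
move/fine_cvgP : gf => [_ /cvgrPdist_lt/(_ _ e0)[n _ /(_ n (leqnn n))]] => h.
exists (g_ n) => //; apply: le_lt_trans h.
rewrite sub0r normrN; apply: le_trans (ler_norm _).
by rewrite /Rintegral lexx.
Qed.

(** Dominated convergence speaks of sequences, the estimates need a radius. Without one, there is a
    counterexample of norm below 1/(n+1) for each n, and these form a sequence tending to 0. *)
Lemma near0_seq (P : V -> Prop) : (forall y : nat -> V, y n @[n --> \oo] --> (0 : V) -> exists n, P (y n)) ->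
  exists2 d : R, 0 < d & forall y, `|y| < d -> P y.
Proof.
move=> H; apply: contrapT => h.
have /choice[y hy] : forall n : nat, exists y, `|y| < n.+1%:R^-1 /\ ~ P y.
  move=> n; apply: contrapT => h2; apply: h; exists n.+1%:R^-1 => // y yn.
  by apply: contrapT => h3; apply: h2; exists y.
have [|n Pn] := H y; last exact: (hy n).2 Pn.
apply/cvgr0Pnorm_lt => r r0; near=> n.
apply: lt_trans (hy n).1 _; near: n; exact: near_infty_natSinv_lt (PosNum r0).
Unshelve. all: by end_near. Qed.

Lemma trans_cts_ball (f : V -> R) (e : R) : Intg leb f -> 0 < e ->
  exists2 d : R, 0 < d & forall y, `|y| < d -> \int[leb]_x `|f (x + y) - f x| < e.
Proof.
move=> /Intg_trans_cts[If cf] e0; apply: near0_seq => y_ /cf /cvgrPdist_lt/(_ _ e0)[n _ /(_ n (leqnn n))] h.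
by exists n; move: h; rewrite sub0r normrN ger0_norm ?Rint_ge0.
Qed.

(** * Averages against a finite measure *)

Section average.
Variable nu : fmeas.

Definition mass := fine (nu setT).

(** The jump operator is [avg] minus [mass] times the identity. The two terms are kept apart because
    the mass term alone enters the sign and CFL arguments, while the average is controlled by
    norms. *)
Definition avg (g : V -> R) (x : V) : R := \int[nu]_z g (x + z).

Lemma mass_ge0 : 0 <= mass.
Proof. by rewrite /mass fine_ge0. Qed.

Lemma shiftl_meas (g : V -> R) (x : V) : measurable_fun setT g ->
  measurable_fun setT (fun z : V => g (x + z)).
Proof. by under eq_fun do rewrite addrC; exact: measurable_shift. Qed.

Lemma shiftl_bmeas C (g : V -> R) (x : V) : bmeas C g -> bmeas C (fun z : V => g (x + z)).
Proof. by move=> [mg gC]; split => [|z]; [exact: shiftl_meas|exact: gC]. Qed.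

Lemma Intg_avg0 C (g : V -> R) (x : V) : bmeas C g -> Intg nu (fun z => g (x + z)).
Proof. by move=> bg; apply: bmeas_Intg; exact: shiftl_bmeas bg. Qed.

Lemma Rint_cst (r : R) : \int[nu]_z r = r * mass.
Proof. by rewrite Rintegral_cst. Qed.

Lemma avg_bdd C g x : bmeas C g -> `|avg g x| <= C * mass.
Proof.
move=> bg; apply: le_trans (Rint_norm (Intg_avg0 x bg)) _.
rewrite -Rint_cst; apply: Rint_le.
- exact/Intg_abs/(Intg_avg0 x bg).
- exact: bmeas_Intg (bmeas_cst _ C).
- by move=> z; have [_] := bg; apply.
Qed.

Lemma avgD C1 C2 f g x : bmeas C1 f -> bmeas C2 g ->
  avg (fun y => f y + g y) x = avg f x + avg g x.
Proof. by move=> h1 h2; rewrite /avg RintD//; [exact: Intg_avg0 h1|exact: Intg_avg0 h2]. Qed.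

Lemma avgB C1 C2 f g x : bmeas C1 f -> bmeas C2 g ->
  avg (fun y => f y - g y) x = avg f x - avg g x.
Proof. by move=> h1 h2; rewrite /avg RintB//; [exact: Intg_avg0 h1|exact: Intg_avg0 h2]. Qed.

Lemma avgZ C r g x : bmeas C g -> avg (fun y => r * g y) x = r * avg g x.
Proof. by move=> h1; rewrite /avg RintZ//; exact: Intg_avg0 h1. Qed.

Lemma avg_cst r x : avg (fun=> r) x = r * mass.
Proof. exact: Rint_cst. Qed.

Lemma avg_le C1 C2 f g x : bmeas C1 f -> bmeas C2 g -> (forall y, f y <= g y) -> avg f x <= avg g x.
Proof.
by move=> h1 h2 fg; apply: Rint_le => //; [exact: Intg_avg0 h1|exact: Intg_avg0 h2].
Qed.

Lemma avg_norm C g x : bmeas C g -> `|avg g x| <= avg (fun y => `|g y|) x.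
Proof. by move=> bg; apply: Rint_norm; exact: Intg_avg0 bg. Qed.

Lemma avg_meas C g : bmeas C g -> measurable_fun setT (avg g).
Proof.
move=> bg; have [mg gC] := bg.
(* A constant is added to make the integrand nonnegative, as Tonelli's measurability requires. *)
pose g1 x := g x + `|C|.
have bg1 : bmeas (C + `| `|C| |) g1 by apply: bmeasD => //; exact: bmeas_cst.
have -> : avg g = fun x => avg g1 x - `|C| * mass.
  apply/funext => x; rewrite (avgD x bg (bmeas_cst _ `|C|)) avg_cst; ring.
apply: measurable_funB => //.
have m2 : measurable_fun [set: V * V] (fun p => (g1 (p.1 + p.2))%:E).
  apply/measurable_EFinP.
  exact: (measurableT_comp bg1.1 (@measurable_addrV R N)).
have := @measurable_fun_fubini_tonelli_F _ _ V V R nu _ m2.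
have p0 : forall p : V * V, (0 <= (g1 (p.1 + p.2))%:E)%E.
  move=> p; rewrite lee_fin /g1; have := gC (p.1 + p.2); rewrite ler_norml => /andP[h _].
  by have := ler_norm C; lra.
move=> /(_ p0) h; exact: (measurableT_comp (fine_measurable measurableT) h).
Qed.

Lemma avg_bmeas C g : bmeas C g -> bmeas (C * mass) (avg g).
Proof. by move=> bg; split => [|x]; [exact: avg_meas bg|exact: avg_bdd]. Qed.

Lemma discrete_opE C g x : bmeas C g -> discrete_op nu g x = avg g x - mass * g x.
Proof.
move=> bg; rewrite /discrete_op [LHS]Rintegral_mkcond.
transitivity (\int[nu]_z (g (x + z) - g x)).
  apply: Rint_ext => z; rewrite patchE; case: ifPn => //.
  by rewrite notin_setE/= => /contrapT ->; rewrite addr0 subrr.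
rewrite RintB ?Rint_cst ?(mulrC (g x))//; first exact: Intg_avg0 bg.
exact: bmeas_Intg (bmeas_cst _ _).
Qed.

Lemma Intg_shiftM C1 C2 g h : bmeas C1 g -> Intg leb g -> bmeas C2 h ->
  Intg (nu \x leb)%E (fun p => g (p.2 + p.1) * h p.2).
Proof.
move=> bg Ig bh.
apply: (@Intg_prod _ _ _ _ _ nu leb _ (fun=> C2 * \int[leb]_x `|g x|)).
- apply: measurable_funM.
    exact: (measurableT_comp bg.1 (@measurable_addrV_swap R N)).
  exact: meas_snd bh.1.
- exact: bmeas_Intg (bmeas_cst _ _).
- move=> z /=; under eq_fun do rewrite mulrC.
  by apply: bmeas_IntgM bh _; exact: Intg_shift.
move=> z /=; rewrite -(Rint_shift z (Intg_meas (Intg_abs Ig))).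
have I1 := Intg_shift z Ig.
have I2 : Intg leb (fun x => h x * g (x + z)) by exact: bmeas_IntgM bh I1.
rewrite -RintZ; last exact: Intg_abs I1.
apply: Rint_le.
- by apply: Intg_abs; under eq_fun do rewrite mulrC.
- by apply: IntgZ; exact: Intg_abs.
- by move=> x; rewrite normrM mulrC ler_wpM2r//; exact: bh.2.
Qed.

Lemma avg_Intg C g : bmeas C g -> Intg leb g -> Intg leb (avg g).
Proof.
move=> bg Ig; have h := Intg_shiftM bg Ig (bmeas_cst _ 1).
have := Fubini_intg2 h; congr (Intg _ _).
by apply/funext => x /=; apply: Rint_ext => z; rewrite mulr1.
Qed.

Lemma avg_Rint C g : bmeas C g -> Intg leb g -> \int[leb]_x avg g x = mass * \int[leb]_x g x.
Proof.
move=> bg Ig; have h := Intg_shiftM bg Ig (bmeas_cst _ 1).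
have := Fubini_swap h => /= e.
transitivity (\int[leb]_y \int[nu]_x (g (y + x) * 1)).
  by apply: Rint_ext => x; apply: Rint_ext => z; rewrite mulr1.
rewrite -e (Rint_ext _ (g := fun=> \int[leb]_x g x)) ?Rint_cst 1?mulrC// => z.
transitivity (\int[leb]_y g (y + z)); first by apply: Rint_ext => y; rewrite mulr1.
exact: Rint_shift (Intg_meas Ig).
Qed.

Lemma avg_Rint_abs C g : bmeas C g -> Intg leb g ->
  \int[leb]_x `|avg g x| <= mass * \int[leb]_x `|g x|.
Proof.
move=> bg Ig; rewrite -(avg_Rint (bmeas_abs bg) (Intg_abs Ig)).
apply: Rint_le.
- exact/Intg_abs/(avg_Intg bg).
- exact: avg_Intg (bmeas_abs bg) (Intg_abs Ig).
- by move=> x; exact: avg_norm bg.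
Qed.

(** The average of the indicator of a null set integrates to the mass times 0, so for almost every x
    the translated null set is [nu]-null. Hence jump operators respect equality almost everywhere
    even when [nu] is singular. *)
Lemma ae_avg (P : V -> Prop) : {ae leb, forall x, P x} ->
  {ae leb, forall x, {ae nu, forall z, P (x + z)}}.
Proof.
move=> [A [mA A0 PA]].
have bA : bmeas 1 (\1_A : V -> R) by exact: bmeas_indic.
have IA : Intg leb (\1_A : V -> R) by apply: indic_Intg => //; rewrite A0.
have e : \int[leb]_x avg \1_A x = 0.
  rewrite (avg_Rint bA IA) Rint_indic//; apply: etrans (mulr0 mass); congr (_ * _).
  by move: A0 => /= ->.
have g0 x : 0 <= avg \1_A x by apply: Rint_ge0 => z; rewrite indicE.
have := Rint_eq0_ae (avg_Intg bA IA) g0 e; apply: filterS => x ex.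
have I1 := Intg_avg0 x bA.
have i0 z : (0 : R) <= \1_A (x + z) by rewrite indicE.
have := Rint_eq0_ae I1 i0 ex.
apply: filterS => z Az; apply: contrapT => nP.
by move: Az; rewrite indic_in; [move/eqP; rewrite oner_eq0|exact: PA].
Qed.

Lemma discrete_op_ae (f g : V -> R) : measurable_fun setT f -> measurable_fun setT g ->
  {ae leb, forall x, f x = g x} -> {ae leb, forall x, discrete_op nu f x = discrete_op nu g x}.
Proof.
move=> mf mg fg; have := ae_avg fg; apply: filterS2 fg => x fgx h.
rewrite /discrete_op fgx.
apply: etrans (Rintegral_mkcond _ _ _) _; apply: etrans _ (esym (Rintegral_mkcond _ _ _)).
have m1 : measurable [set~ (0 : V)].
  by apply: measurableC; apply: compact_measurable_rV; exact: compact_set1.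
apply: Rint_ae.
- apply/(measurable_restrictT _ m1)/(measurable_funTS).
  by apply: measurable_funB => //; exact: shiftl_meas.
- apply/(measurable_restrictT _ m1)/(measurable_funTS).
  by apply: measurable_funB => //; exact: shiftl_meas.
by apply: filterS h => z; rewrite !patchE => ->.
Qed.

Hypothesis nu_sym : forall A : set V, measurable A -> nu [set z | A (- z)] = nu A.

Lemma Rint_sym (F : V -> R) : measurable_fun setT F -> \int[nu]_z F (- z) = \int[nu]_z F z.
Proof.
move=> mF; have mN : measurable_fun setT (fun z : V => - z).
  by apply: continuous_measurable_rV2; exact: opp_continuous.
have mF' : measurable_fun setT (EFin \o F) by exact/measurable_EFinP.
have h (G : V -> \bar R) : measurable_fun setT G -> (forall x, 0 <= G x)%E ->
    (\int[nu]_z G (- z)%R = \int[nu]_z G z)%E.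
  move=> mG G0.
  have := @ge0_integral_pushforward _ _ V V R (fun z => - z) mN nu setT G measurableT mG (fun a _ => G0 a).
  rewrite preimage_setT => <-; apply: eq_measure_integral => //=.
  by move=> C mC _; rewrite /pushforward; exact: nu_sym.
rewrite /Rintegral; congr fine; rewrite integralE [in RHS]integralE; congr (_ - _)%E.
  rewrite -[RHS](h _ (measurable_funepos mF') (fun x => funepos_ge0 (EFin \o F) x)).
  by apply: eq_integral => x _; rewrite !funeposE.
rewrite -[RHS](h _ (measurable_funeneg mF') (fun x => funeneg_ge0 (EFin \o F) x)).
by apply: eq_integral => x _; rewrite !funenegE.
Qed.

Lemma avg_sym C1 C2 g h : bmeas C1 g -> Intg leb g -> bmeas C2 h ->
  \int[leb]_x (avg g x * h x) = \int[leb]_x (g x * avg h x).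
Proof.
move=> bg Ig bh.
have I1 := Intg_shiftM bg Ig bh.
transitivity (\int[leb]_x \int[nu]_z (g (x + z) * h x)).
  apply: Rint_ext => x; rewrite mulrC -RintZ; last exact: Intg_avg0 bg.
  by apply: Rint_ext => z; rewrite mulrC.
rewrite -(Fubini_swap I1) /=.
(* A translation in x transfers the shift to [h] with the opposite sign; the symmetry of [nu] then
   restores the sign. *)
transitivity (\int[nu]_z \int[leb]_x (g x * h (x - z))).
  apply: Rint_ext => z.
  have m : measurable_fun setT (fun x : V => g x * h (x - z)).
    by apply: measurable_funM; [exact: bg.1|exact: measurable_shift bh.1].
  rewrite -[RHS](Rint_shift z m); apply: Rint_ext => x.
  by rewrite addrK.
pose F z := \int[leb]_x (g x * h (x + z)).
have I3 : Intg (nu \x leb)%E (fun p => h (p.2 + p.1) * g p.2).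
  apply: (@Intg_prod _ _ _ _ _ nu leb _ (fun=> C2 * \int[leb]_x `|g x|)).
  - apply: measurable_funM.
      exact: (measurableT_comp bh.1 (@measurable_addrV_swap R N)).
    exact: meas_snd bg.1.
  - exact: bmeas_Intg (bmeas_cst _ _).
  - move=> z /=; apply: bmeas_IntgM Ig; split; first exact: measurable_shift bh.1.
    by move=> x; exact: bh.2.
  move=> z /=; rewrite -RintZ; last exact: Intg_abs.
  apply: Rint_le; last by move=> x; rewrite normrM ler_wpM2r//; exact: bh.2.
    apply: Intg_abs; apply: bmeas_IntgM Ig; split; first exact: measurable_shift bh.1.
    by move=> x; exact: bh.2.
  by apply: IntgZ; exact: Intg_abs.
have mF : measurable_fun setT F.
  have := Intg_meas (Fubini_intg1 I3); apply: eq_measurable_fun => z _ /=.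
  by apply: Rint_ext => x; rewrite mulrC.
have := Rint_sym mF; rewrite /F => ->.
transitivity (\int[nu]_z \int[leb]_x (h (x + z) * g x)).
  by apply: Rint_ext => z; apply: Rint_ext => x; rewrite mulrC.
rewrite (Fubini_swap I3) /=; apply: Rint_ext => x.
rewrite /avg -RintZ; last exact: Intg_avg0 bh.
by apply: Rint_ext => z; rewrite mulrC.
Qed.

End average.

(** * Contraction and maximum principle for one step *)

Lemma abs_shrinkE (xi r : R) : 0 <= xi -> `|r| <= `|shrink xi r| + xi.
Proof. by move=> xi0; rewrite shrink_norm// -lerBlDr le_max lexx orbT. Qed.

(* Only the part of Z above the level xi is integrable; below that level the nonlocal
   term costs at most xi times the mass, which disappears on bounded sets as xi -> 0. *)
Lemma implicit_contraction (nu : fmeas) (s C : R) (D Z r : V -> R) :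
  0 <= s -> bmeas C Z -> Intg leb D -> Intg leb r ->
  (forall xi, 0 < xi -> (leb [set x | (xi < `|Z x|)%R] < +oo)%E) ->
  (forall x, `|D x| + s * mass nu * `|Z x| = `|D x + s * mass nu * Z x|) ->
  {ae leb, forall x, D x = r x + s * (avg nu Z x - mass nu * Z x)} ->
  \int[leb]_x `|D x| <= \int[leb]_x `|r x|.
Proof.
move=> s0 bZ ID Ir vZ sgn eqD; set m := mass nu.
have m0 : 0 <= m by exact: mass_ge0.
have H n : \int[leb]_x (\1_(@Qbox n%:R) x * `|D x|) <= \int[leb]_x `|r x|.
  set Q := @Qbox n%:R.
  have IQ : Intg leb (\1_Q : V -> R).
    by apply: indic_Intg; [exact: measurable_Qbox|exact: Qbox_fin].
  have bQ : bmeas 1 (\1_Q : V -> R) by apply: bmeas_indic; exact: measurable_Qbox.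
  have IQD : Intg leb (fun x => \1_Q x * `|D x|) by apply: bmeas_IntgM bQ _; exact: Intg_abs.
  apply/ler_addgt0Pr => e e0.
  pose lQ := \int[leb]_x (\1_Q x : R).
  have lQ0 : 0 <= lQ by apply: Rint_ge0 => x; rewrite indicE.
  (* Chosen so that s * m * xi * lQ, the total cost of the truncation inside the box, is at most
     e. *)
  pose xi := e / (1 + s * m * lQ).
  have den0 : 0 < 1 + s * m * lQ by rewrite ltr_pwDl// !mulr_ge0.
  have xi0 : 0 < xi by rewrite divr_gt0.
  have xi0' := ltW xi0.
  have bq : bmeas C (fun x => `|shrink xi (Z x)|).
    apply: bmeas_abs; split; first exact: measurable_shrink bZ.1.
    by move=> x; apply: le_trans (shrink_le _ xi0') (bZ.2 x).
  have Iq : Intg leb (fun x => `|shrink xi (Z x)|).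
    by apply: Intg_abs; exact: Intg_shrink xi0' bZ (vZ _ xi0).
  set q := fun x => `|shrink xi (Z x)| in bq Iq.
  have Iavg := avg_Intg nu bq Iq.
  have avgZ x : avg nu (fun y => `|Z y|) x <= avg nu q x + m * xi.
    rewrite [m * xi]mulrC -(avg_cst nu xi x) -(avgD nu x bq (bmeas_cst _ xi)).
    apply: (avg_le nu x (bmeas_abs bZ) (bmeasD bq (bmeas_cst _ xi))) => y.
    exact: abs_shrinkE.
  have : \int[leb]_x (\1_Q x * `|D x| + s * m * q x) <=
      \int[leb]_x (`|r x| + (s * avg nu q x + s * m * xi * \1_Q x)).
    apply: Rint_le_ae.
    - by apply: IntgD => //; exact: IntgZ.
    - apply: IntgD; first exact: Intg_abs.
      by apply: IntgD; exact: IntgZ.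
    apply: filterS eqD => x eqx.
    have key : `|D x| + s * m * `|Z x| <= `|r x| + s * (avg nu q x + m * xi).
      rewrite sgn -/m; have -> : D x + s * m * Z x = r x + s * avg nu Z x.
        by rewrite eqx -/m; ring.
      apply: le_trans (ler_normD _ _) _; rewrite lerD2l normrM ger0_norm// ler_wpM2l//.
      by apply: le_trans (avg_norm nu x bZ) _.
    have q0 : 0 <= avg nu q x by apply: Rint_ge0 => z; rewrite normr_ge0.
    have smxi : 0 <= s * m * xi by exact: mulr_ge0 (mulr_ge0 s0 m0) xi0'.
    have D0 := normr_ge0 (D x); have r0 := normr_ge0 (r x).
    have saq : 0 <= s * avg nu q x by exact: mulr_ge0.
    have Dk : `|D x| <= `|r x| + (s * avg nu q x + s * m * xi).
      apply: le_trans (_ : `|D x| + s * m * `|Z x| <= _); first by rewrite lerDl !mulr_ge0.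
      by move: key; rewrite mulrDr mulrA.
    rewrite /q shrink_norm//; case: (leP (`|Z x|) xi) => hZ.
      rewrite max_l ?subr_le0// mulr0 addr0 -/q indicE.
      by case: (_ \in _); rewrite /= ?mul1r ?mul0r ?mulr1 ?mulr0 ?addr0//; lra.
    rewrite max_r; last by rewrite subr_ge0 ltW.
    rewrite -/q indicE.
    move: key; rewrite mulrDr (mulrA s m xi) (mulrBr (s * m)).
    by case: (_ \in _); rewrite /= ?mul1r ?mul0r ?mulr1 ?mulr0 ?addr0//; lra.
  rewrite RintD//; last exact: IntgZ.
  rewrite RintD; [|exact: Intg_abs|by apply: IntgD; exact: IntgZ].
  rewrite RintD; [|exact: IntgZ|exact: IntgZ].
  rewrite !RintZ// (avg_Rint nu bq Iq) -/m -/lQ mulrA => h.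
  have : s * m * xi * lQ <= e.
    rewrite /xi mulrC mulrA (mulrC lQ) mulrA ler_pdivrMr//.
    by rewrite mulrC ler_wpM2l// ?ltW//; lra.
  by move: h; lra.
have mD := Intg_meas ID.
have mQ n : measurable (@Qbox n%:R) by exact: measurable_Qbox.
have [|//||||_ _ cv] := @DCT _ _ R leb (fun n x => \1_(@Qbox n%:R) x * `|D x|) (fun x => `|D x|) (fun x => `|D x|).
- move=> n; apply: measurable_funM; first exact: measurable_indic.
  exact: measurableT_comp.
- exact: measurableT_comp.
- apply: aeW => x; rewrite -[X in _ --> X]mul1r; apply: cvgM; last exact: cvg_cst.
  have := @ndseq_indic_cvg _ (@nd_Qbox) x; by rewrite Qbox_bigcup indicE mem_set.
- exact: Intg_abs.
- move=> n; apply: aeW => x; rewrite normrM normr_id indicE.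
  by case: (_ \in _); rewrite /= ?normr1 ?normr0 ?mul1r ?mul0r.
by apply: (cvgr_to_le cv); apply: nearW.
Qed.

(** Under the CFL condition, subtracting s m W from D lowers its absolute value by exactly s m |W|,
    and adding back s times the average of W costs no more than that in L^1. *)
Lemma explicit_contraction (nu : fmeas) (s C : R) (D W : V -> R) :
  0 <= s -> bmeas C W -> Intg leb D ->
  (forall x, s * mass nu * `|W x| <= `|D x|) ->
  (forall x, `|D x| = `|D x - s * mass nu * W x| + s * mass nu * `|W x|) ->
  Intg leb (fun x => s * (avg nu W x - mass nu * W x)) /\
  \int[leb]_x `|D x + s * (avg nu W x - mass nu * W x)| <= \int[leb]_x `|D x|.
Proof.
move=> s0 bW ID hW sgn; set m := mass nu in hW sgn *.
have m0 : 0 <= m by exact: mass_ge0.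
(* If s m = 0, the CFL bound no longer makes W integrable, but then the whole increment vanishes. *)
have [sm|sm] := eqVneq (s * m) 0.
  have e x : s * (avg nu W x - m * W x) = 0.
    rewrite mulrBr mulrA sm mul0r subr0; apply/eqP; rewrite -normr_le0 normrM ger0_norm//.
    apply: le_trans (ler_wpM2l s0 (avg_bdd nu x bW)) _; rewrite -/m.
    by rewrite (mulrC C) mulrA sm mul0r.
  split; first by under eq_fun do rewrite e; exact: Intg0.
  by rewrite (Rint_ext leb (g := fun x => `|D x|))// => x; rewrite e addr0.
have sm0 : 0 < s * m by rewrite lt_def sm mulr_ge0.
have IW : Intg leb W.
  apply: (@Intg_le _ _ _ leb W (fun x => (s * m)^-1 * `|D x|) bW.1).
    by apply: IntgZ; exact: Intg_abs.
  by move=> x; rewrite ler_pdivlMl// hW.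
have Ia := avg_Intg nu bW IW.
have IL : Intg leb (fun x => s * (avg nu W x - m * W x)).
  by apply/IntgZ/IntgB => //; exact: IntgZ.
split => //.
have bW' := bmeas_abs bW; have IW' := Intg_abs IW.
have Ia' := avg_Intg nu bW' IW'.
apply: (@le_trans _ _ (\int[leb]_x (`|D x| - s * m * `|W x| + s * avg nu (fun y => `|W y|) x))).
  apply: Rint_le.
  - by apply/Intg_abs/IntgD.
  - apply: IntgD; last exact: IntgZ.
    by apply: IntgB; [exact: Intg_abs|exact: IntgZ].
  move=> x; have -> : D x + s * (avg nu W x - m * W x) = (D x - s * m * W x) + s * avg nu W x by ring.
  apply: le_trans (ler_normD _ _) _; apply: lerD; first by rewrite [in leRHS]sgn addrK.
  by rewrite normrM ger0_norm// ler_wpM2l//; exact: avg_norm bW.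
rewrite RintD; [|by apply: IntgB; [exact: Intg_abs|exact: IntgZ]|exact: IntgZ].
rewrite RintB; [|exact: Intg_abs|exact: IntgZ].
by rewrite !RintZ// (avg_Rint nu bW' IW') -/m mulrA subrK.
Qed.

Lemma mono_bmeas (phi : R -> R) C (U : V -> R) : {homo phi : x y / x <= y} ->
  bmeas C U -> bmeas (`|phi C| + `|phi (- C)|) (phi \o U).
Proof.
move=> hphi [mU UC]; split.
  by apply: measurableT_comp => //; exact: nondecreasing_measurable.
move=> x /=; have := UC x; rewrite !ler_norml => /andP[/hphi h1 /hphi h2].
have h3 := ler_norm (phi C); have h4 := ler_norm (- phi (- C)); rewrite normrN in h4.
have h5 := normr_ge0 (phi C); have h6 := normr_ge0 (phi (- C)).
by apply/andP; split; lra.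
Qed.

(** Let S be the essential supremum of U. Where U > S - e, the average of phi(U) is at most m phi(S)
    while phi(U) >= phi(S - e); if S - e exceeded k + s m (phi(S) - phi(S - e)), the set {U > S - e}
    would be null. Continuity of [phi] gives S <= k as e tends to 0. *)
Lemma implicit_max (nu : fmeas) (s C k : R) (phi : R -> R) (U r : V -> R) :
  0 <= s -> bmeas C U -> {homo phi : x y / x <= y} -> continuous phi ->
  {ae leb, forall x, r x <= k} ->
  {ae leb, forall x, U x = r x + s * (avg nu (phi \o U) x - mass nu * phi (U x))} ->
  {ae leb, forall x, U x <= k}.
Proof.
move=> s0 UC' hphi cphi rk eqU; have [mU UC] := UC'; set m := mass nu in eqU *.
have m0 : 0 <= m by exact: mass_ge0.
pose Sx := ess_sup leb (EFin \o U).
suff : (Sx <= k%:E)%E by move/ess_supP; apply: filterS => x; rewrite lee_fin.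
rewrite leNgt; apply/negP => kS.
have SC : (Sx <= C%:E)%E.
  by apply/ess_supP; apply: aeW => x /=; rewrite lee_fin (le_trans _ (UC x))// ler_norm.
have SE : Sx \is a fin_num.
  by rewrite fin_numE; apply/andP; split; apply/eqP => e; [rewrite e in kS|rewrite e in SC].
pose S := fine Sx; have SS : Sx = S%:E by rewrite fineK.
rewrite SS lte_fin in kS.
have US : {ae leb, forall x, U x <= S}.
  by have := ess_sup_ge leb (EFin \o U); apply: filterS => x; rewrite -/Sx SS lee_fin.
have bphiU := mono_bmeas hphi UC'.
have phiS : {ae leb, forall x, avg nu (phi \o U) x <= m * phi S}.
  have := ae_avg nu US; apply: filterS => x hx.
  rewrite mulrC -(Rint_cst nu); apply: Rint_le_ae.
  - exact: Intg_avg0 bphiU.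
  - exact: bmeas_Intg (bmeas_cst _ _).
  - by apply: filterS hx => z; exact: hphi.
have key e : 0 < e -> S - e <= k + s * (m * (phi S - phi (S - e))).
  move=> e0; apply: contrapT => /negP; rewrite -ltNge => h.
  have : (Sx <= (S - e)%:E)%E.
    apply/ess_supP; near=> x; rewrite /= lee_fin leNgt; apply/negP => hx.
    have e1 : U x = r x + s * (avg nu (phi \o U) x - m * phi (U x)) by near: x.
    have e2 : r x <= k by near: x.
    have e3 : avg nu (phi \o U) x <= m * phi S by near: x.
    have e4 : phi (S - e) <= phi (U x) by apply/hphi/ltW.
    have : U x <= k + s * (m * (phi S - phi (S - e))).
      rewrite e1; apply: lerD => //; apply: ler_wpM2l => //.
      by rewrite mulrBr; apply: lerB => //; exact: ler_wpM2l.
    by move=> /(lt_le_trans hx)/lt_le_trans/(_ (ltW h)); rewrite ltxx.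
  by rewrite SS lee_fin => hS; lra.
have : S <= k.
  have cv : k + s * (m * (phi S - phi (S - e))) + e @[e --> (0:R)^'+] --> k + s * (m * (phi S - phi (S - 0))) + 0.
    apply: cvg_at_right_filter; apply: cvgD; last exact: cvg_id.
    apply: cvgD; first exact: cvg_cst.
    apply: cvgMl_tmp; apply: cvgMl_tmp; apply: cvgB; first exact: cvg_cst.
    by apply: (@cvg_comp _ _ _ (fun e => S - e) phi) (cphi _); apply: cvgB; [exact: cvg_cst|exact: cvg_id].
  have : S <= k + s * (m * (phi S - phi (S - 0))) + 0.
    apply: (cvgr_to_ge cv); near=> e.
    by rewrite -lerBlDr; apply: key; near: e; exact: nbhs_right_gt.
  by rewrite subr0 subrr !mulr0 !addr0.
by rewrite leNgt kS.
Unshelve. all: by end_near. Qed.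

Lemma neg_homo (phi : R -> R) : {homo phi : x y / x <= y} ->
  {homo (fun r => - phi (- r)) : x y / x <= y}.
Proof. by move=> h x y xy; rewrite lerN2; apply: h; rewrite lerN2. Qed.

Lemma avgN (nu : fmeas) C g x : bmeas C g ->
  avg nu (fun y => - g y) x = - avg nu g x.
Proof.
move=> bg; rewrite -mulN1r -(avgZ nu (-1) x bg).
by congr avg; apply/funext => y; rewrite mulN1r.
Qed.

Lemma implicit_bound (nu : fmeas) (s C k : R) (phi : R -> R) (U r : V -> R) :
  0 <= s -> bmeas C U -> {homo phi : x y / x <= y} -> continuous phi ->
  {ae leb, forall x, `|r x| <= k} ->
  {ae leb, forall x, U x = r x + s * (avg nu (phi \o U) x - mass nu * phi (U x))} ->
  {ae leb, forall x, `|U x| <= k}.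
Proof.
move=> s0 bU hphi cphi rk eqU.
have h1 : {ae leb, forall x, U x <= k}.
  apply: (implicit_max s0 bU hphi cphi _ eqU).
  by apply: filterS rk => x; exact: le_trans (ler_norm _).
have bphiU := mono_bmeas hphi bU.
have h2 : {ae leb, forall x, - U x <= k}.
  apply: (@implicit_max nu s C k (fun t => - phi (- t)) (fun x => - U x) (fun x => - r x)) => //.
  - split; first by under eq_fun do rewrite -sub0r; apply: measurable_funB => //; exact: bU.1.
    by move=> x; rewrite normrN; exact: bU.2.
  - exact: neg_homo.
  - move=> x; apply: cvgN; apply: (@cvg_comp _ _ _ (fun t => - t) phi) (cphi _).
    exact: opp_continuous.
  - by apply: filterS rk => x; apply: le_trans; rewrite -normrN ler_norm.
  apply: filterS eqU => x ex; rewrite opprK {1}ex.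
  have -> : (fun t => - phi (- t)) \o (fun x => - U x) = (fun y => - (phi \o U) y).
    by apply/funext => y /=; rewrite opprK.
  by rewrite (avgN nu x bphiU); ring.
by apply: filterS2 h1 h2 => x a1 a2; rewrite ler_norml a1 andbT lerNl.
Qed.

(** By the CFL condition r - s m phi(r) is nondecreasing on [-k, k], so the explicit step is
    monotone there, and it fixes the constants k and -k. *)
Lemma explicit_bound (nu : fmeas) (s k : R) (phi : R -> R) (u : V -> R) x :
  0 <= s -> {homo phi : x y / x <= y} -> bmeas k u ->
  (forall a b, `|a| <= k -> `|b| <= k -> s * mass nu * `|phi a - phi b| <= `|a - b|) ->
  `|u x + s * (avg nu (phi \o u) x - mass nu * phi (u x))| <= k.
Proof.
move=> s0 hphi bu cfl; set m := mass nu in cfl *.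
have m0 : 0 <= m by exact: mass_ge0.
have k0 : 0 <= k by apply: le_trans (bu.2 x).
have uk := bu.2 x; move: (uk); rewrite ler_norml => /andP[u1 u2].
have bphiu := mono_bmeas hphi bu.
have a1 : avg nu (phi \o u) x <= m * phi k.
  rewrite mulrC -(avg_cst nu (phi k) x); apply: (avg_le nu x bphiu (bmeas_cst _ _)) => y /=.
  by apply: hphi; apply: le_trans (bu.2 y); exact: ler_norm.
have a2 : m * phi (- k) <= avg nu (phi \o u) x.
  rewrite mulrC -(avg_cst nu (phi (- k)) x); apply: (avg_le nu x (bmeas_cst _ _) bphiu) => y /=.
  by apply: hphi; have := bu.2 y; rewrite ler_norml => /andP[].
have kk : `|k| <= k by rewrite ger0_norm.
have kNk : `|- k| <= k by rewrite normrN ger0_norm.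
have c1 := cfl _ _ kk uk; have c2 := cfl _ _ uk kNk.
rewrite ger0_norm ?subr_ge0 ?hphi// ger0_norm ?subr_ge0// in c1.
rewrite ger0_norm ?subr_ge0 ?hphi// ger0_norm ?subr_ge0// in c2.
have b1 := ler_wpM2l s0 a1; have b2 := ler_wpM2l s0 a2.
rewrite mulrBr !mulrA in c1 c2 b1 b2 *.
rewrite ler_norml; rewrite !mulrBr in c1 c2; apply/andP; split; lra.
Qed.

Lemma mono_norm_addE (a b s : R) : 0 <= s -> (0 <= a -> 0 <= b) -> (a <= 0 -> b <= 0) ->
  `|a| + s * `|b| = `|a + s * b|.
Proof.
move=> s0 h1 h2; have [a0|a0] := leP 0 a.
  by have b0 := h1 a0; rewrite !ger0_norm ?addr_ge0 ?mulr_ge0.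
have b0 := h2 (ltW a0); rewrite !ler0_norm ?(ltW a0)//; first by ring.
by have := mulr_ge0_le0 s0 b0; lra.
Qed.

(** The difference of two solutions satisfies the implicit equation with a right-hand side [r] that
    collects the explicit part and the source. [explicit_contraction] bounds [r],
    [implicit_contraction] bounds the difference by [r], its level sets being finite by
    [vanish_comp]. *)
Lemma step_contraction (nu1 nu2 : fmeas) (s M : R) (phi1 phi2 : R -> R)
    (U W u w F G : V -> R) :
  0 <= s -> {homo phi1 : x y / x <= y} -> continuous phi1 -> {homo phi2 : x y / x <= y} ->
  (forall a b, `|a| <= M -> `|b| <= M -> s * mass nu2 * `|phi2 a - phi2 b| <= `|a - b|) ->
  bmeas M U -> bmeas M W -> bmeas M u -> bmeas M w ->
  Intg leb (fun x => U x - W x) -> Intg leb (fun x => u x - w x) ->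
  Intg leb (fun x => F x - G x) ->
  {ae leb, forall x, U x = u x + s * ((avg nu1 (phi1 \o U) x - mass nu1 * phi1 (U x)) +
     (avg nu2 (phi2 \o u) x - mass nu2 * phi2 (u x)) + F x)} ->
  {ae leb, forall x, W x = w x + s * ((avg nu1 (phi1 \o W) x - mass nu1 * phi1 (W x)) +
     (avg nu2 (phi2 \o w) x - mass nu2 * phi2 (w x)) + G x)} ->
  \int[leb]_x `|U x - W x| <= \int[leb]_x `|u x - w x| + s * \int[leb]_x `|F x - G x|.
Proof.
move=> s0 h1 c1 h2 cfl bU bW bu bw ID Id IFG eU eW.
have b1U := mono_bmeas h1 bU; have b1W := mono_bmeas h1 bW.
have b2u := mono_bmeas h2 bu; have b2w := mono_bmeas h2 bw.
have m10 := mass_ge0 nu1; have m20 := mass_ge0 nu2.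
pose Z x := phi1 (U x) - phi1 (W x); pose Y x := phi2 (u x) - phi2 (w x).
have bZ := bmeasB b1U b1W; have bY := bmeasB b2u b2w.
have mono (phi : R -> R) (a b r : R) : {homo phi : x y / x <= y} -> 0 <= r ->
    `|a - b| + r * `|phi a - phi b| = `|a - b + r * (phi a - phi b)|.
  move=> hp r0; apply: mono_norm_addE => //.
    by rewrite !subr_ge0; exact: hp.
  by rewrite !subr_le0; exact: hp.
have [IE hE] : Intg leb (fun x => s * (avg nu2 Y x - mass nu2 * Y x)) /\
    \int[leb]_x `|(u x - w x) + s * (avg nu2 Y x - mass nu2 * Y x)| <= \int[leb]_x `|u x - w x|.
  apply: (explicit_contraction s0 bY Id) => x.
    by apply: cfl; [exact: bu.2|exact: bw.2].
  have c := cfl _ _ (bu.2 x) (bw.2 x).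
  have r0 : 0 <= s * mass nu2 by rewrite mulr_ge0.
  rewrite /Y; have [uw|uw] := leP (w x) (u x).
    have p0 : 0 <= phi2 (u x) - phi2 (w x) by rewrite subr_ge0 h2.
    rewrite (ger0_norm p0) (@ger0_norm _ (u x - w x)) ?subr_ge0// in c *.
    by rewrite [X in _ = X + _]ger0_norm; [rewrite /=; ring|rewrite /=; lra].
  have p0 : phi2 (u x) - phi2 (w x) <= 0 by rewrite subr_le0 h2// ltW.
  have q0 : u x - w x <= 0 by rewrite subr_le0 ltW.
  rewrite (ler0_norm p0) (ler0_norm q0) in c *.
  by rewrite [X in _ = X + _]ler0_norm; [rewrite /=; ring|rewrite /=; lra].
pose r x := ((u x - w x) + s * (avg nu2 Y x - mass nu2 * Y x)) + s * (F x - G x).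
have Ir1 : Intg leb (fun x => (u x - w x) + s * (avg nu2 Y x - mass nu2 * Y x)) by exact: IntgD.
have Ir : Intg leb r by apply: IntgD => //; exact: IntgZ.
apply: (@le_trans _ _ (\int[leb]_x `|r x|)).
  apply: (@implicit_contraction nu1 _ _ _ Z r s0 bZ ID Ir).
  - by move=> xi xi0; exact: vanish_comp c1 bU bW ID _ xi0.
  - by move=> x; apply: mono => //; rewrite mulr_ge0.
  apply: filterS2 eU eW => x -> ->.
  have eZ : avg nu1 Z x = _ := avgB nu1 x b1U b1W.
  have eY : avg nu2 Y x = _ := avgB nu2 x b2u b2w.
  by rewrite /r eZ eY /Z /Y; ring.
rewrite -RintZ; last exact: Intg_abs.
apply: (@le_trans _ _ (\int[leb]_x `|(u x - w x) + s * (avg nu2 Y x - mass nu2 * Y x)| +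
   \int[leb]_x (s * `|F x - G x|))); last by rewrite lerD2r.
rewrite -RintD; [|exact: Intg_abs|by apply: IntgZ; exact: Intg_abs].
apply: Rint_le; first exact: Intg_abs.
  by apply: IntgD; [exact: Intg_abs|apply: IntgZ; exact: Intg_abs].
by move=> x; apply: le_trans (ler_normD _ _) _; rewrite lerD2l normrM ger0_norm.
Qed.

(** * The source term *)

Lemma measurable_QT (T : R) : measurable (@QT R N T : set VT).
Proof. by apply: measurableX => //; exact: measurable_itv. Qed.

(** [ninf] is a finite, everywhere defined substitute for the essential supremum of the source at
    time t. The source is extended by 0 so that all integrals in time run over the whole line. *)
Record source_data (T : R) (f : VT -> R) (ninf : R -> R) := SourceData {
  src_meas : measurable_fun [set: VT] f;
  src_Intg : Intg lebT f;
  src_bnd_meas : measurable_fun setT (ninf : RT -> R);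
  src_bnd_Intg : Intg lam (ninf : RT -> R);
  src_bnd_ge0 : forall t, 0 <= ninf t;
  src_bnd : {ae lebT, forall p : VT, `|f p| <= ninf p.2};
  src_out : forall p, ~ QT T p -> f p = 0 }.

Lemma exists_source (T : R) (f : V * R -> R) (u0 : V -> R) :
  measurable_fun (@QT R N T : set VT) f -> L1_Loo leb u0 ->
  (\int[lam]_(t in `]0%R, T[) ('N[leb]_1[EFin \o (fun x => f (x, t))] +
     'N[leb]_+oo[EFin \o (fun x => f (x, t))]) < +oo)%E ->
  exists (ninf : R -> R) (k0 : R), [/\ source_data T (f \_ (@QT R N T)) ninf, 0 <= k0,
    {ae leb, forall x, `|u0 x| <= k0} &
    data_bound T u0 f = (k0 + \int[lam]_t ninf t)%:E].
Proof.
move=> mf /L1_LooP[I0 [C0 C00 uC]] fin.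
set ft := f \_ _.
have mft : measurable_fun [set: VT] ft.
  by apply/(measurable_restrictT _ (measurable_QT T)).
have ftE t : t \in `]0, T[ -> (fun x => ft (x, t)) = (fun x => f (x, t)).
  by move=> tT; apply/funext => x; rewrite /ft patchE mem_set// /QT; split.
have ft0 t : t \notin `]0, T[ -> (fun x => ft (x, t)) = (fun=> 0).
  move=> tT; apply/funext => x; rewrite /ft patchE memNset// /QT => -[_ /=].
  by move/negP : tT.
pose n1 t := (\int[leb]_x `|(EFin \o ft) (x, t)|)%E.
pose noo t := 'N[leb]_+oo[EFin \o (fun x => ft (x, t))]%E.
have mn1 : measurable_fun [set: RT] n1.
  apply: (@measurable_fun_fubini_tonelli_G _ _ _ _ _ leb (fun z => `|(EFin \o ft) z|%E)) => //.
  by apply: measurableT_comp => //; exact/measurable_EFinP.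
have mnoo : measurable_fun [set: RT] noo.
  exact: (@measurable_Loo_slice _ V _ RT R leb ft mft).
have fin2 : (\int[lam]_t (n1 t + noo t) < +oo)%E.
  apply: le_lt_trans fin; rewrite [leRHS]integral_mkcond le_eqVlt; apply/orP; left; apply/eqP.
  apply: eq_integral => t _; rewrite patchE /n1 /noo; case: ifPn => tT.
    rewrite Lnorm1; rewrite inE /= in tT; rewrite (ftE t)//; congr (_ + _)%E.
    by apply: eq_integral => x _ /=; have /= -> := congr1 (fun g : V -> R => g x) (ftE t tT).
  have tT' : t \notin `]0, T[ by apply/negP => h; move/negP : tT; apply; rewrite inE.
  rewrite (ft0 t)//.
  have -> : (\int[leb]_x `|(EFin \o ft) (x, t)| = 0)%E.
    rewrite (eq_integral (cst 0%E)) ?integral0// => x _ /=.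
    by rewrite (congr1 (fun g => g x) (ft0 t tT')) normr0.
  by rewrite add0e Lnorm0.
have n1_ge0 t : (0 <= n1 t)%E by exact: integral_ge0.
have noo_ge0 t : (0 <= noo t)%E by exact: Lnorm_ge0.
have [fin_n1 fin_noo] : (\int[lam]_t n1 t < +oo)%E /\ (\int[lam]_t noo t < +oo)%E.
  move: fin2; rewrite ge0_integralD// => h; split; apply: le_lt_trans h.
    by rewrite leeDl// integral_ge0.
  by rewrite leeDr// integral_ge0.
have Inoo : lam.-integrable setT noo.
  by apply/integrableP; split => //; under eq_integral do rewrite gee0_abs//.
have noo_fin := integrable_ae measurableT Inoo.
pose ninf t := fine (noo t).
have mninf : measurable_fun setT (ninf : RT -> R).
  exact: (measurableT_comp (fine_measurable measurableT) mnoo).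
have ninf_ge0 t : 0 <= ninf t by rewrite fine_ge0.
have eint : (\int[lam]_t noo t = \int[lam]_t (ninf t)%:E)%E.
  apply: ae_eq_integral => //; first exact/measurable_EFinP.
  by apply: filterS noo_fin => t h _; rewrite /ninf fineK// h.
have Ininf : Intg lam (ninf : RT -> R).
  by apply: Intg_ge0 => //; rewrite -eint.
exists ninf, (fine 'N[leb]_+oo[EFin \o u0]).
have u0fin : 'N[leb]_+oo[EFin \o u0]%E \is a fin_num.
  by rewrite ge0_fin_numE ?Lnorm_ge0// (le_lt_trans (Loo_le C00 uC))// ltry.
split.
- split => //.
  + apply/(integrable21ltyP leb lam); first exact/measurable_EFinP.
    exact: fin_n1.
  + pose A := [set p : VT | `|ft p| <= ninf p.2].
    have mA : measurable (~` A).
      have mg := measurable_fun_ler (measurableT_comp (@normr_measurable R setT) mft) (meas_snd mninf).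
      by apply: measurableC; have := mg measurableT [set true] I; rewrite setTI.
    exists (~` A); split => //; apply: ae_prod_swap => //; apply: filterS noo_fin => t /(_ I) tfin.
    apply/negligibleP; first exact: measurable_ysection.
    rewrite (_ : ysection _ t = ~` [set x | `|ft (x, t)| <= ninf t]); last first.
      by apply/seteqP; split => x; rewrite /ysection/= inE.
    by apply: filterS (Loo_ae leb (fun x => ft (x, t))) => x; rewrite -lee_fin /ninf fineK.
  + by move=> p nQ; rewrite /ft patchE memNset.
- by rewrite fine_ge0// Lnorm_ge0.
- by apply: filterS (Loo_ae leb u0) => x; rewrite -lee_fin fineK.
rewrite /data_bound EFinD fineK// (Rint_EFin Ininf) -eint; congr (_ + _)%E.
rewrite integral_mkcond; apply: eq_integral => t _; rewrite patchE /noo; case: ifPn => tT.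
  by rewrite inE /= in tT; rewrite (ftE t).
have tT' : t \notin `]0, T[ by apply/negP => h; move/negP : tT; apply; rewrite inE.
by rewrite (ft0 t)// Lnorm0.
Qed.

Lemma Intg_prod_abs (h : VT -> R) : Intg lebT h ->
  Intg lam (fun t : RT => \int[leb]_x `|h (x, t)|).
Proof. by move=> I; exact: (Fubini_intg2 (Intg_abs I)). Qed.

(** Minkowski's inequality for integrals. The weight [b] will be the indicator of a time cell. *)
Lemma slice_int (h : VT -> R) (b : RT -> R) : Intg lebT h -> bmeas 1 b ->
  (forall t, 0 <= b t) ->
  Intg leb (fun x => \int[lam]_t (b t * h (x, t))) /\
  \int[leb]_x `|\int[lam]_t (b t * h (x, t))| <= \int[lam]_t (b t * \int[leb]_x `|h (x, t)|).
Proof.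
move=> I bb b0.
have bb2 : bmeas 1 (fun p : VT => b p.2).
  by split => [|p]; [exact: meas_snd bb.1|exact: bb.2].
have I2 : Intg lebT (fun p : VT => b p.2 * h p) by exact: bmeas_IntgM bb2 I.
have I2' := Fubini_intg1 I2.
split => //.
have I3 := Fubini_intg1 (Intg_abs I2).
apply: (@le_trans _ _ (\int[leb]_x \int[lam]_t `|b t * h (x, t)|)).
  apply: Rint_le_ae => //; first exact: Intg_abs.
  by apply: filterS (Fubini_ae1 I2) => x hx; exact: Rint_norm.
rewrite (Fubini_swap (Intg_abs I2)) /=.
have I4 := Fubini_intg2 (Intg_abs I2).
apply: Rint_le_ae => //.
  by apply: bmeas_IntgM bb _; exact: Intg_prod_abs.
apply: filterS (Fubini_ae2 I) => t It.
rewrite -RintZ; last exact: Intg_abs.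
apply: Rint_le.
- by apply: Intg_abs; apply: IntgZ.
- by apply: IntgZ; exact: Intg_abs.
- by move=> x; rewrite normrM ger0_norm.
Qed.

Lemma slice_bnd (h : VT -> R) (n b : RT -> R) : Intg lebT h -> bmeas 1 b ->
  (forall t, 0 <= b t) -> Intg lam n ->
  {ae lebT, forall p : VT, `|h p| <= n p.2} ->
  {ae leb, forall x, `|\int[lam]_t (b t * h (x, t))| <= \int[lam]_t (b t * n t)}.
Proof.
move=> I bb b0 In hn.
have := ae_prod1 hn; apply: filterS2 (Fubini_ae1 I) => x Ix hx.
have Ib : Intg lam (fun t => b t * h (x, t)) by exact: bmeas_IntgM bb Ix.
apply: le_trans (Rint_norm Ib) _; apply: Rint_le_ae.
- exact: Intg_abs.
- exact: bmeas_IntgM bb In.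
by apply: filterS hx => t /= ht; rewrite normrM ger0_norm// ler_wpM2l.
Qed.

Lemma Intg_transT (h : VT -> R) (y : V) : Intg lebT h ->
  Intg lebT (fun p : VT => h (p.1 + y, p.2)).
Proof.
move=> I; have mh := Intg_meas I.
have mt : measurable_fun [set: VT] (fun p : VT => ((p.1 + y, p.2) : VT)).
  apply: measurable_fun_pair; last exact: measurable_snd.
  have m : measurable_fun setT (fun x : V => x + y) by have := measurable_aff false y; apply: eq_measurable_fun => x _; rewrite aff_addE.
  exact: (measurableT_comp m measurable_fst).
have mg : measurable_fun [set: VT] (fun p : VT => h (p.1 + y, p.2)) by exact: (measurableT_comp mh mt).
apply/(integrable12ltyP leb lam); first exact/measurable_EFinP.
have := (integrable12ltyP leb lam (proj2 (measurable_EFinP _ _) mh)).1 I.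
pose G x := (\int[lam]_y0 `|(EFin \o h) (x, y0)|)%E => fin.
have mG : measurable_fun setT G.
  apply: (@measurable_fun_fubini_tonelli_F _ _ _ _ _ lam (fun z => `|(EFin \o h) z|%E)) => //.
  by apply: measurableT_comp => //; exact/measurable_EFinP.
have := @integral_aff false y G mG (fun x => integral_ge0 _ (fun _ _ => abse_ge0 _)).
by under eq_integral do rewrite aff_addE; rewrite /G /= => ->.
Qed.

(** * Solutions of a single scheme *)

Section solutions.
Variable T : R.

Definition sym (nu : fmeas) :=
  forall A : set V, measurable A -> nu [set z | A (- z)] = nu A.

Definition fmean (S : scheme R N) (f : VT -> R) (j : nat) (x : V) : R :=
  \int[lam]_t (itv_ind (node S j.-1) (node S j) t * f (x, t)).

Definition step_eq (S : scheme R N) (f : VT -> R) (m1 m2 : fmeas)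
    (W : nat -> V -> R) (j : nat) :=
  {ae leb, forall x, W j x = W j.-1 x + step S j *
    ((avg m1 (phi1 S \o W j) x - mass m1 * phi1 S (W j x)) +
     (avg m2 (phi2 S \o W j.-1) x - mass m2 * phi2 S (W j.-1 x)) +
     (step S j)^-1 * fmean S f j x)}.

(** The given solution is known up to null sets and its operators involve plain measures. Here the
    measures carry their finite structure and [W] is a representative bounded by M everywhere, as
    the contraction lemmas demand. *)
Record good_scheme (S : scheme R N) (M : R) (u0 : V -> R) (f : VT -> R)
    (m1 m2 : fmeas) (W : nat -> V -> R) : Prop := GoodScheme {
  gs_grid : time_grid T S;
  gs_sym1 : sym m1;
  gs_sym2 : sym m2;
  gs_op1 : forall g, discrete_op (nu1 S) g = discrete_op m1 g;
  gs_op2 : forall g, discrete_op (nu2 S) g = discrete_op m2 g;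
  gs_phi1 : nondecreasing_continuous (phi1 S);
  gs_phi2 : {homo phi2 S : x y / x <= y};
  gs_cfl : forall j, (1 <= j <= steps S)%N -> forall a b, `|a| <= M -> `|b| <= M ->
    step S j * mass m2 * `|phi2 S a - phi2 S b| <= `|a - b|;
  gs_bnd : forall j, (j <= steps S)%N -> bmeas M (W j);
  gs_Intg : forall j, (j <= steps S)%N -> Intg leb (W j);
  gs_init : {ae leb, forall x, W 0%N x = u0 x};
  gs_step : forall j, (1 <= j <= steps S)%N -> step_eq S f m1 m2 W j }.

Lemma grid_mono (S : scheme R N) i j : time_grid T S -> (i <= j)%N -> (j <= steps S)%N ->
  node S i <= node S j.
Proof.
move=> [_ _ h]; elim: j => [|j IH]; first by rewrite leqn0 => /eqP ->.
rewrite leq_eqVlt => /predU1P[->//|ij jS].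
by apply: le_trans (IH ij (ltnW jS)) _; apply/ltW/h.
Qed.

Lemma grid_ge0 (S : scheme R N) j : time_grid T S -> (j <= steps S)%N -> 0 <= node S j.
Proof. by move=> g jS; have [<- _ _] := g; exact: grid_mono. Qed.

Lemma grid_leT (S : scheme R N) j : time_grid T S -> (j <= steps S)%N -> node S j <= T.
Proof. by move=> g jS; have [_ <- _] := g; exact: grid_mono. Qed.

Lemma step_gt0 (S : scheme R N) j : time_grid T S -> (1 <= j <= steps S)%N -> 0 < step S j.
Proof.
by case: j => // j [_ _ h] /andP[_ jS]; rewrite /step subr_gt0; exact: h.
Qed.

Lemma step_le_max (S : scheme R N) j : (1 <= j <= steps S)%N -> step S j <= max_step S.
Proof.
move=> /andP[j1 jS]; rewrite /max_step; apply: le_bigmax_seq => //.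
by rewrite mem_index_iota j1 ltnS.
Qed.

Lemma source_meanE (S : scheme R N) (f : V * R -> R) j x (g : VT -> R) : time_grid T S ->
  g = f \_ (QT T) -> measurable_fun [set: VT] g ->
  (1 <= j <= steps S)%N ->
  source_mean S f j x = (step S j)^-1 * fmean S g j x.
Proof.
move=> tg gE mg jS; rewrite /source_mean; congr (_ * _).
have mgx : measurable_fun [set: RT] (fun t => g (x, t)).
  exact: (measurableT_comp mg (measurable_pair1 x)).
rewrite /fmean -Rint_itv_open//; apply: eq_Rintegral => t; rewrite inE/= in_itv/= => /andP[t1 t2].
have [/andP[j1 jJ]] := (jS, jS) => _.
rewrite gE patchE mem_set//; split => //=; rewrite in_itv/=; apply/andP; split.
  apply: le_lt_trans t1; apply: grid_ge0 => //; exact: leq_trans (leq_pred _) jJ.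
by apply: lt_le_trans t2 _; exact: grid_leT.
Qed.

Definition clip (M r : R) : R := Num.max (- M) (Num.min M r).

Lemma clip_id M r : `|r| <= M -> clip M r = r.
Proof. by rewrite ler_norml => /andP[h1 h2]; rewrite /clip min_r// max_r. Qed.

Lemma clip_bmeas d (X : measurableType d) M (g : X -> R) : 0 <= M -> measurable_fun setT g -> bmeas M (fun x => clip M (g x)).
Proof.
move=> M0 mg; split.
  by apply: measurable_maxr => //; exact: measurable_minr.
by move=> x; rewrite ler_norml /clip le_max lexx/= ge_max ge_min lexx; rewrite andbT; lra.
Qed.

Lemma clip_le M r : 0 <= M -> `|clip M r| <= `|r|.
Proof.
move=> M0; rewrite /clip; case: (leP M r) => h.
  by rewrite max_r; [rewrite !ger0_norm//; lra|lra].
by case: (leP (- M) r) => h2 //; rewrite !ler0_norm; lra.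
Qed.

Lemma step_eq_transfer (S : scheme R N) (f : V * R -> R) (g : VT -> R) (m1 m2 : fmeas)
    (U W : nat -> V -> R) j C C' : time_grid T S -> g = f \_ (QT T) -> measurable_fun [set: VT] g ->
  (1 <= j <= steps S)%N ->
  (forall g, discrete_op (nu1 S) g = discrete_op m1 g) ->
  (forall g, discrete_op (nu2 S) g = discrete_op m2 g) ->
  {homo phi1 S : x y / x <= y} -> {homo phi2 S : x y / x <= y} ->
  measurable_fun setT (U j) -> measurable_fun setT (U j.-1) ->
  bmeas C (W j) -> bmeas C' (W j.-1) ->
  {ae leb, forall x, W j x = U j x} -> {ae leb, forall x, W j.-1 x = U j.-1 x} ->
  {ae leb, forall x, U j x = U j.-1 x + step S j *
     (discrete_op (nu1 S) (phi1 S \o U j) x +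
      discrete_op (nu2 S) (phi2 S \o U j.-1) x + source_mean S f j x)} ->
  step_eq S g m1 m2 W j.
Proof.
move=> tg gE mg jS op1 op2 h1 h2 mU mU' bW bW' e e' eqU.
have b1 := mono_bmeas h1 bW; have b2 := mono_bmeas h2 bW'.
have m1' : measurable_fun setT (phi1 S \o U j).
  by apply: measurableT_comp mU; exact: nondecreasing_measurable.
have m2' : measurable_fun setT (phi2 S \o U j.-1).
  by apply: measurableT_comp mU'; exact: nondecreasing_measurable.
have a1 : {ae leb, forall x, discrete_op m1 (phi1 S \o W j) x = discrete_op m1 (phi1 S \o U j) x}.
  by apply: discrete_op_ae => //; [exact: b1.1|apply: filterS e => x /= ->].
have a2 : {ae leb, forall x, discrete_op m2 (phi2 S \o W j.-1) x = discrete_op m2 (phi2 S \o U j.-1) x}.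
  by apply: discrete_op_ae => //; [exact: b2.1|apply: filterS e' => x /= ->].
rewrite /step_eq; near=> x.
have -> : W j x = U j x by near: x.
have -> : W j.-1 x = U j.-1 x by near: x.
have E : U j x = U j.-1 x + step S j *
     (discrete_op (nu1 S) (phi1 S \o U j) x +
      discrete_op (nu2 S) (phi2 S \o U j.-1) x + source_mean S f j x) by near: x.
have A1 : discrete_op m1 (phi1 S \o W j) x = discrete_op m1 (phi1 S \o U j) x by near: x.
have A2 : discrete_op m2 (phi2 S \o W j.-1) x = discrete_op m2 (phi2 S \o U j.-1) x by near: x.
have B1 : W j x = U j x by near: x.
have B2 : W j.-1 x = U j.-1 x by near: x.
rewrite {1}E op1 op2 -A1 -A2 (discrete_opE m1 x b1) (discrete_opE m2 x b2) /= B1 B2.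
by rewrite (source_meanE x tg gE mg jS).
Unshelve. all: by end_near. Qed.

Lemma cfl_admissible (S : scheme R N) (u0 : V -> R) (f : V * R -> R) M (m2 : fmeas) :
  time_grid T S -> data_bound T u0 f = M%:E -> m2 = nu2 S :> (set V -> \bar R) ->
  ((max_step S)%:E * lipschitz_const (phi2 S) [set r | (`|r|%:E <= data_bound T u0 f)%E] *
        nu2 S setT <= 1)%E ->
  forall j, (1 <= j <= steps S)%N -> forall a b, `|a| <= M -> `|b| <= M ->
    step S j * mass m2 * `|phi2 S a - phi2 S b| <= `|a - b|.
Proof.
move=> tg eM em cfl j jS a b aM bM.
have [->|ab] := eqVneq a b; first by rewrite !subrr normr0 mulr0.
have ab0 : 0 < `|a - b| by rewrite normr_gt0 subr_eq0.
set q := `|phi2 S a - phi2 S b| / `|a - b|.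
have q0 : 0 <= q by rewrite divr_ge0.
have ql : (q%:E <= lipschitz_const (phi2 S) [set r | (`|r|%:E <= data_bound T u0 f)%E])%E.
  by apply: ereal_sup_ubound; exists (a, b) => //=; split; rewrite /= eM lee_fin.
have st0 := ltW (step_gt0 tg jS).
have stm := step_le_max jS.
have m0 : (nu2 S setT = (mass m2)%:E).
  by rewrite /mass em fineK// -em; exact: fin_num_measure.
have : ((max_step S)%:E * q%:E * (mass m2)%:E <= 1)%E.
  apply: le_trans cfl; rewrite m0; apply: lee_wpmul2r; first by rewrite lee_fin mass_ge0.
  by apply: lee_wpmul2l => //; rewrite lee_fin (le_trans st0).
rewrite -!EFinM lee_fin => h.
have : step S j * mass m2 * q <= 1.
  apply: le_trans h; rewrite -mulrA (mulrC (mass m2)) mulrA.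
  by apply: ler_wpM2r; [exact: mass_ge0|exact: ler_wpM2r].
by rewrite /q mulrA ler_pdivrMr// mul1r.
Qed.

Lemma node_prev_le (S : scheme R N) j : (1 <= j <= steps S)%N -> (j.-1 <= steps S)%N.
Proof. by move=> /andP[_ h]; exact: leq_trans (leq_pred _) h. Qed.

Lemma fmean_bnd (S : scheme R N) (g : VT -> R) ninf j : time_grid T S -> source_data T g ninf ->
  (1 <= j <= steps S)%N ->
  {ae leb, forall x, `|fmean S g j x| <= prim ninf (node S j) - prim ninf (node S j.-1)}.
Proof.
move=> tg sd jS; have jp := node_prev_le jS.
rewrite (primB (src_bnd_Intg sd)); last 2 first.
- exact: grid_ge0.
- by apply: grid_mono => //; [exact: leq_pred|case/andP: jS].
exact: (slice_bnd (src_Intg sd) (bmeas_itv_ind _ _) (itv_ind_ge0 _ _) (src_bnd_Intg sd) (src_bnd sd)).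
Qed.

Lemma bmeas0 : bmeas 0 (fun _ : V => (0 : R)).
Proof. by split => // x; rewrite normr0. Qed.

(** The CFL condition concerns only [-M, M], so the bound must precede every contraction. It is
    proved along the steps with the running bound k0 + [prim ninf] at the current node, which never
    exceeds M. Each new value is known at first only to have some essential bound C; it is clipped
    there, and [implicit_bound] improves C to the running bound. *)
Lemma exists_good_scheme (S : scheme R N) (u0 : V -> R) (f : V * R -> R) (U : nat -> V -> R) ninf k0 :
  time_grid T S -> admissible T S u0 f -> scheme_solution S u0 f U ->
  source_data T (f \_ (QT T)) ninf -> 0 <= k0 -> {ae leb, forall x, `|u0 x| <= k0} ->
  data_bound T u0 f = (k0 + \int[lam]_t ninf t)%:E ->
  exists (m1 m2 : fmeas) (W : nat -> V -> R),
    good_scheme S (k0 + \int[lam]_t ninf t) u0 (f \_ (QT T)) m1 m2 W /\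
    forall j, (j <= steps S)%N -> {ae leb, forall x, W j x = U j x}.
Proof.
move=> tg [[sr1 sr2] [fin1 fin2] p1 [h2 lip2] cfl] [LU U0 eqU] sd k00 u0k eM.
set M := k0 + _ in eM *; set g := f \_ _ in sd *.
have [m1 em1] := exists_finite_measure fin1; have [m2 em2] := exists_finite_measure fin2.
have op (nu : {measure set V -> \bar R}) (m : fmeas) :
    m = nu :> (set V -> \bar R) -> forall h, discrete_op nu h = discrete_op m h.
  move=> e h; apply/funext => x; rewrite /discrete_op /Rintegral; congr fine.
  apply: eq_measure_integral => // A mA _.
  exact: (esym (congr1 (fun k : set V -> \bar R => k A) e)).
have op1 := op _ _ em1; have op2 := op _ _ em2.
have sy (nu : {measure set V -> \bar R}) (m : fmeas) :
    m = nu :> (set V -> \bar R) -> symmetric_radon nu -> sym m.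
  by move=> e [_ h _] A mA; rewrite !e h.
have [h1 c1] := p1.
have mg := src_meas sd.
have In := src_bnd_Intg sd; have n0 := src_bnd_ge0 sd.
have CF := cfl_admissible tg eM em2 cfl.
pose Mj j := k0 + prim ninf (node S j).
have Mj0 j : 0 <= Mj j by rewrite addr_ge0// prim_ge0.
have MjM j : Mj j <= M by rewrite lerD2l; exact: prim_le.
have UP j : (j <= steps S)%N -> {ae leb, forall x, `|U j x| <= Mj j}.
  elim: j => [_|j IH jS].
    apply: filterS2 U0 u0k => x -> ; rewrite /Mj.
    by have [-> _ _] := tg; rewrite prim0 addr0.
  have jS' : (1 <= j.+1 <= steps S)%N by [].
  have IHj := IH (ltnW jS).
  have mUj : measurable_fun setT (U j) by have /L1_LooP[/Intg_meas] := LU j (ltnW jS).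
  have /L1_LooP[/Intg_meas mUj1 [C C0 UC]] := LU j.+1 jS.
  pose u x := clip (Mj j) (U j x); pose U' x := clip C (U j.+1 x).
  have bu : bmeas (Mj j) u by exact: clip_bmeas.
  have bU' : bmeas C U' by exact: clip_bmeas.
  have eu : {ae leb, forall x, u x = U j x} by apply: filterS IHj => x; exact: clip_id.
  have eU' : {ae leb, forall x, U' x = U j.+1 x} by apply: filterS UC => x; exact: clip_id.
  pose W k := if k == j.+1 then U' else u.
  have W1 : W j.+1 = U' by rewrite /W eqxx.
  have W0 : W j = u by rewrite /W ltn_eqF.
  have st : step_eq S g m1 m2 W j.+1.
    apply: (@step_eq_transfer S f g m1 m2 U W j.+1 C (Mj j)) => //=; rewrite ?W1 ?W0//.
    exact: eqU.
  have st0 := ltW (step_gt0 tg jS').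
  rewrite /step_eq /= W1 W0 in st.
  pose r x := u x + step S j.+1 * (avg m2 (phi2 S \o u) x - mass m2 * phi2 S (u x)) + fmean S g j.+1 x.
  have stn0 : step S j.+1 != 0 by rewrite gt_eqF// step_gt0.
  have : {ae leb, forall x, `|U' x| <= Mj j.+1}.
    apply: (@implicit_bound m1 _ C _ (phi1 S) U' r st0 bU' h1 c1).
      apply: filterS (fmean_bnd tg sd jS') => x fx.
      have -> : Mj j.+1 = Mj j + (prim ninf (node S j.+1) - prim ninf (node S j)).
        by rewrite /Mj; ring.
      rewrite /r; apply: le_trans (ler_normD _ _) _; apply: lerD => //.
      apply: explicit_bound => // a b aM bM; apply: CF => //; exact: le_trans (MjM j).
    apply: filterS st => x; rewrite /r => {1}->.
    rewrite !mulrDr mulrA divff// mul1r; ring.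
  by apply: filterS2 eU' => x ->.
pose W j x := clip M (U j x).
have M0 : 0 <= M by apply: le_trans (MjM 0%N).
have mU j : (j <= steps S)%N -> measurable_fun setT (U j).
  by move=> jS; have /L1_LooP[/Intg_meas] := LU j jS.
have bW j : (j <= steps S)%N -> bmeas M (W j).
  by move=> jS; apply: clip_bmeas => //; exact: mU.
have eW j : (j <= steps S)%N -> {ae leb, forall x, W j x = U j x}.
  by move=> jS; apply: filterS (UP j jS) => x ux; rewrite /W clip_id// (le_trans ux).
exists m1, m2, W; split => //; split => //.
- exact: sy em1 sr1.
- exact: sy em2 sr2.
- move=> j jS; have /L1_LooP[IU _] := LU j jS.
  apply: (@Intg_le _ _ _ leb _ (fun x => `|U j x|) (bW j jS).1); first exact: Intg_abs.
  by move=> x; exact: clip_le.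
- by apply: filterS2 (eW 0%N isT) U0 => x -> ->.
move=> j jS; have jp := node_prev_le jS; have jJ : (j <= steps S)%N by case/andP: jS.
apply: (@step_eq_transfer S f g m1 m2 U W j M M) => //; [exact: mU|exact: mU|exact: bW|exact: bW|exact: eW|exact: eW|].
exact: eqU.
Qed.

(** Initial values and sources may both differ. Comparison with the zero solution yields the L^1
    bound, comparison with a translate the modulus of continuity in space. *)
Lemma contraction_all (S : scheme R N) M (m1 m2 : fmeas)
    (g g' : VT -> R) (W W' : nat -> V -> R) : time_grid T S ->
  nondecreasing_continuous (phi1 S) -> {homo phi2 S : x y / x <= y} ->
  (forall j, (1 <= j <= steps S)%N -> forall a b, `|a| <= M -> `|b| <= M ->
    step S j * mass m2 * `|phi2 S a - phi2 S b| <= `|a - b|) ->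
  Intg lebT g -> Intg lebT g' ->
  (forall j, (j <= steps S)%N -> bmeas M (W j) /\ Intg leb (W j)) ->
  (forall j, (j <= steps S)%N -> bmeas M (W' j) /\ Intg leb (W' j)) ->
  (forall j, (1 <= j <= steps S)%N -> step_eq S g m1 m2 W j) ->
  (forall j, (1 <= j <= steps S)%N -> step_eq S g' m1 m2 W' j) ->
  forall j, (j <= steps S)%N -> \int[leb]_x `|W j x - W' j x| <=
    \int[leb]_x `|W 0%N x - W' 0%N x| + \int[lam]_t \int[leb]_x `|g (x, t) - g' (x, t)|.
Proof.
move=> tg [h1 c1] h2 cfl Ig Ig' bW bW' st st'.
have Id := IntgB Ig Ig'.
pose n1 t := \int[leb]_x `|g (x, t) - g' (x, t)|.
have In1 : Intg lam (n1 : RT -> R) by exact: Intg_prod_abs Id.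
have n10 t : 0 <= n1 t by apply: Rint_ge0.
have key j : (j <= steps S)%N -> \int[leb]_x `|W j x - W' j x| <=
    \int[leb]_x `|W 0%N x - W' 0%N x| + prim n1 (node S j).
  elim: j => [_|j IH jS].
    by have [-> _ _] := tg; rewrite prim0 addr0.
  have jS' : (1 <= j.+1 <= steps S)%N by [].
  have [b1 I1] := bW _ jS; have [b1' I1'] := bW' _ jS.
  have [b0 I0] := bW _ (ltnW jS); have [b0' I0'] := bW' _ (ltnW jS).
  have s0 := step_gt0 tg jS'.
  have [If hf] := slice_int Id (bmeas_itv_ind (node S j) (node S j.+1)) (itv_ind_ge0 _ _).
  have [Ifg _] := slice_int Ig (bmeas_itv_ind (node S j) (node S j.+1)) (itv_ind_ge0 _ _).
  have [Ifg' _] := slice_int Ig' (bmeas_itv_ind (node S j) (node S j.+1)) (itv_ind_ge0 _ _).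
  have IF : Intg leb (fun x => (step S j.+1)^-1 * fmean S g j.+1 x - (step S j.+1)^-1 * fmean S g' j.+1 x).
    by apply: IntgB; exact: IntgZ.
  have := step_contraction (ltW s0) h1 c1 h2 (cfl _ jS') b1 b1' b0 b0' (IntgB I1 I1') (IntgB I0 I0') IF (st _ jS') (st' _ jS').
  move=> /le_trans; apply; apply: le_trans (lerD (IH (ltnW jS)) (lexx _)) _.
  rewrite -addrA lerD2l -lerBrDl (primB In1); last 2 first.
  - exact: grid_ge0 tg (ltnW jS).
  - exact: grid_mono.
  apply: le_trans hf; rewrite -RintZ; last exact: Intg_abs.
  apply: Rint_le_ae.
  - by apply: IntgZ; exact: Intg_abs.
  - exact: Intg_abs.
  apply: filterS2 (Fubini_ae1 Ig) (Fubini_ae1 Ig') => x Igx Igx'.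
  rewrite -mulrBr normrM (gtr0_norm (_ : 0 < (step S j.+1)^-1)) ?invr_gt0// mulrA divff ?gt_eqF// mul1r.
  rewrite /fmean /= -RintB; [|exact: Intg_itv..].
  by under [X in _ <= `|X|]eq_Rintegral do rewrite mulrBr.
move=> j jS; apply: le_trans (key j jS) _; rewrite lerD2l; exact: prim_le.
Qed.

Lemma good_L1 (S : scheme R N) M u0 g (m1 m2 : fmeas) W : 0 <= M ->
  Intg leb u0 -> Intg lebT g ->
  good_scheme S M u0 g m1 m2 W -> forall j, (j <= steps S)%N ->
  \int[leb]_x `|W j x| <= \int[leb]_x `|u0 x| + \int[lam]_t \int[leb]_x `|g (x, t)|.
Proof.
move=> M0 Iu0 Ig G j jS.
have b0 j' : (j' <= steps S)%N -> bmeas M (fun _ : V => (0 : R)) /\ Intg leb (fun _ : V => (0 : R)).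
  by move=> _; split; [exact: bmeas_le M0 bmeas0|exact: Intg0].
have := @contraction_all S M m1 m2 g (fun=> 0) W (fun _ _ => 0) (gs_grid G) (gs_phi1 G) (gs_phi2 G)
  (gs_cfl G) Ig (Intg0 _) (fun j jS => conj (gs_bnd G jS) (gs_Intg G jS)) b0 (gs_step G).
(* Zero solves the scheme with zero data even if the nonlinearities do not vanish at 0, because jump
   operators annihilate constants. *)
have st0 j' : (1 <= j' <= steps S)%N -> step_eq S (fun=> 0) m1 m2 (fun _ _ => 0) j'.
  move=> _; apply: aeW => x.
  have c (phi : R -> R) (m : fmeas) : avg m (phi \o (fun=> 0)) x = phi 0 * mass m by exact: avg_cst.
  rewrite !c /fmean.
  have -> : \int[lam]_t (itv_ind (node S j'.-1) (node S j') t * 0) = 0.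
    by rewrite -[RHS](@Rint_zero _ _ R lam); apply: Rint_ext => t; rewrite mulr0.
  ring.
move=> /(_ st0 j jS); under eq_Rintegral do rewrite subr0.
move=> /le_trans; apply; rewrite le_eqVlt; apply/orP; left; apply/eqP; congr (_ + _).
  apply: Rint_ae.
  - apply: measurableT_comp => //; apply: measurable_funB => //; exact: Intg_meas (gs_Intg G (leq0n _)).
  - by apply: measurableT_comp => //; exact: Intg_meas Iu0.
  - by apply: filterS (gs_init G) => x ->; rewrite subr0.
by apply: Rint_ext => t; apply: Rint_ext => x; rewrite subr0.
Qed.

Lemma good_trans (S : scheme R N) M u0 g (m1 m2 : fmeas) W (y : V) :
  Intg leb u0 -> Intg lebT g ->
  good_scheme S M u0 g m1 m2 W -> forall j, (j <= steps S)%N ->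
  \int[leb]_x `|W j (x + y) - W j x| <= \int[leb]_x `|u0 (x + y) - u0 x| +
    \int[lam]_t \int[leb]_x `|g (x + y, t) - g (x, t)|.
Proof.
move=> Iu0 Ig G j jS.
pose gy (p : VT) := g (p.1 + y, p.2).
pose Wy j (x : V) := W j (x + y).
have bWy j' : (j' <= steps S)%N -> bmeas M (Wy j') /\ Intg leb (Wy j').
  move=> j'S; have [mW WM] := gs_bnd G j'S; split.
    by split => [|x]; [exact: measurable_shift|exact: WM].
  exact: Intg_shift (gs_Intg G j'S).
have sty j' : (1 <= j' <= steps S)%N -> step_eq S gy m1 m2 Wy j'.
  move=> j'S; have := ae_shift y (gs_step G j'S); apply: filterS => x.
  have c (phi : R -> R) (m : fmeas) k :
      avg m (phi \o Wy k) x = avg m (phi \o W k) (x + y).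
    by apply: Rint_ext => z /=; rewrite /Wy addrAC.
  by rewrite !c.
have := @contraction_all S M m1 m2 gy g Wy W (gs_grid G) (gs_phi1 G) (gs_phi2 G)
  (gs_cfl G) (Intg_transT y Ig) Ig bWy (fun j jS => conj (gs_bnd G jS) (gs_Intg G jS)) sty (gs_step G) j jS.
move=> /le_trans; apply; rewrite le_eqVlt; apply/orP; left; apply/eqP; congr (_ + _).
have mW0 : measurable_fun setT (W 0%N) by exact: Intg_meas (gs_Intg G (leq0n _)).
have mu0 := Intg_meas Iu0.
apply: Rint_ae.
- by apply: measurableT_comp => //; apply: measurable_funB => //; exact: measurable_shift.
- by apply: measurableT_comp => //; apply: measurable_funB => //; exact: measurable_shift.
- by apply: filterS2 (gs_init G) (ae_shift y (gs_init G)) => x; rewrite /Wy => -> ->.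
Qed.

End solutions.

(** * Piecewise linear interpolation in time *)

Section interp.
Variables (T : R) (S : scheme R N).
Hypothesis T0 : 0 < T.
Hypothesis tg : time_grid T S.

Definition ramp (a b t : R) : R := Num.max 0 (Num.min 1 ((t - a) / (b - a))).

(** A sum of ramps times increments instead of a case distinction on cells: it is visibly linear in
    the nodal values, and differences between two times can be estimated term by term. *)
Definition interp (v : nat -> R) (t : R) : R :=
  v 0%N + \sum_(1 <= j < (steps S).+1) ramp (node S j.-1) (node S j) t * (v j - v j.-1).

Lemma ramp1 a b t : a < b -> b <= t -> ramp a b t = 1.
Proof.
move=> ab bt; rewrite /ramp min_l ?max_r//.
by rewrite ler_pdivlMr ?subr_gt0// mul1r lerD2r.
Qed.

Lemma ramp0 a b t : a < b -> t <= a -> ramp a b t = 0.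
Proof.
move=> ab bt; rewrite /ramp max_l// ge_min; apply/orP; right.
by rewrite ler_pdivrMr ?subr_gt0// mul0r subr_le0.
Qed.

Lemma rampE a b t : a < b -> a <= t <= b -> ramp a b t = (t - a) / (b - a).
Proof.
move=> ab /andP[at' tb]; rewrite /ramp min_r ?max_r//.
  by rewrite divr_ge0 ?subr_ge0 ?(ltW ab).
by rewrite ler_pdivrMr ?subr_gt0// mul1r lerD2r.
Qed.

Lemma ramp_bnd a b t : 0 <= ramp a b t <= 1.
Proof. by rewrite /ramp le_max lexx/= ge_max ler01/= ge_min lexx. Qed.

Lemma ramp_nd a b s t : a < b -> s <= t -> ramp a b s <= ramp a b t.
Proof.
move=> ab st; rewrite /ramp ge_max le_max lexx/= le_max; apply/orP; right.
rewrite le_min ge_min lexx/= ge_min; apply/orP; right.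
by rewrite ler_wpM2r ?invr_ge0 ?subr_ge0 ?(ltW ab)// lerD2r.
Qed.

Lemma node_lt j : (1 <= j <= steps S)%N -> node S j.-1 < node S j.
Proof. by move=> h; rewrite -subr_gt0; exact: step_gt0 tg h. Qed.

Lemma interp_piece (v : nat -> R) k t : (1 <= k <= steps S)%N -> node S k.-1 <= t <= node S k ->
  interp v t = v k.-1 + (t - node S k.-1) / (node S k - node S k.-1) * (v k - v k.-1).
Proof.
case: k => // k /andP[_ kJ] /= /andP[t1 t2]; rewrite /interp.
have kJ' : (1 <= k.+1 <= steps S)%N by [].
rewrite (@big_cat_nat _ _ _ k.+1)//=; last by rewrite ltnS ltnW.
rewrite [X in _ + (_ + X)]big_ltn//=.
have -> : \sum_(1 <= j < k.+1) ramp (node S j.-1) (node S j) t * (v j - v j.-1) = v k - v 0%N.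
  have -> : \sum_(1 <= j < k.+1) ramp (node S j.-1) (node S j) t * (v j - v j.-1) = \sum_(1 <= j < k.+1) (v j - v j.-1).
    apply: eq_big_nat => j /andP[j1 jk]; rewrite ramp1 ?mul1r//.
      by apply: node_lt; rewrite j1/= (leq_trans _ (ltnW kJ)).
    by apply: le_trans t1; apply: grid_mono tg _ _ => //; exact: ltnW.
  by rewrite big_add1 /= telescope_sumr.
rewrite rampE ?t1 ?t2//; last exact: node_lt kJ'.
rewrite big_nat big1 ?addr0; first by ring.
move=> j /andP[j1 jk]; rewrite ramp0 ?mul0r//.
  by apply: node_lt; rewrite (leq_trans _ j1).
apply: le_trans t2 _; apply: grid_mono tg _ _; first by rewrite -ltnS prednK// (leq_trans _ j1).
by apply: leq_trans (leq_pred _) _.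
Qed.

Lemma find_piece t : 0 < t <= T -> exists k, (1 <= k <= steps S)%N /\ node S k.-1 < t <= node S k.
Proof.
move=> /andP[t0 tT]; have [n0 nT _] := tg.
have ex : exists k, t <= node S k by exists (steps S); rewrite nT.
have kP := ex_minnP ex; case: kP => k tk kmin.
have k0 : (0 < k)%N by case: k tk kmin => // ; rewrite n0 leNgt t0.
exists k; rewrite k0/= tk andbT; split; first by apply: kmin; rewrite nT.
by rewrite ltNge; apply/negP => /kmin; rewrite -ltnS prednK// ltnn.
Qed.

Lemma steps_gt0 : (0 < steps S)%N.
Proof.
have [n0 nT _] := tg; rewrite lt0n; apply/eqP => e.
by move: T0; rewrite -nT e n0 ltxx.
Qed.

Lemma interp0 (v : nat -> R) : interp v 0 = v 0%N.
Proof.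
have [n0 _ _] := tg.
rewrite (@interp_piece v 1) ?steps_gt0//= n0 ?subrr ?mul0r ?addr0//.
by rewrite lexx/= (grid_ge0 tg)// steps_gt0.
Qed.

Lemma piece_uniq j k t : (1 <= j <= steps S)%N -> (1 <= k <= steps S)%N ->
  node S j.-1 < t <= node S j -> node S k.-1 < t <= node S k -> j = k.
Proof.
have lt i i' : (1 <= i')%N -> (i < i')%N -> (i' <= steps S)%N -> node S i'.-1 < t -> t <= node S i -> False.
  move=> i1 ii iS a b; have : node S i <= node S i'.-1.
    by apply: grid_mono tg _ _; [rewrite -ltnS prednK|exact: leq_trans (leq_pred _) iS].
  by move=> /(le_trans b)/(lt_le_trans a); rewrite ltxx.
move=> /andP[j1 jS] /andP[k1 kS] /andP[a1 a2] /andP[b1 b2]; apply/eqP/negPn/negP.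
by rewrite neq_ltn => /orP[h|h]; [exact: lt h kS b1 a2|exact: lt h jS a1 b2].
Qed.

Lemma interpolantE (U : nat -> V -> R) x t : 0 <= t <= T ->
  interpolant S U (x, t) = interp (fun j => U j x) t.
Proof.
move=> /andP[t0 tT]; rewrite /interpolant; case: eqP => [->|/eqP tn0]; first by rewrite interp0.
have tp : 0 < t by rewrite lt_def tn0.
have [|k [kJ kt]] := @find_piece t; first by rewrite tp.
rewrite (interp_piece _ kJ); last by case/andP: kt => /ltW -> ->.
rewrite big_mkcond (bigD1_seq k) ?iota_uniq//=; last by rewrite mem_index_iota; case/andP: kJ => -> /=; rewrite ltnS.
rewrite kt [X in _ + X]big1_seq ?addr0// => j /andP[jk]; rewrite mem_index_iota => /andP[j1 jJ].
case: ifP => // jt; case/eqP: jk; apply: piece_uniq jt kt => //; by rewrite j1.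
Qed.

Lemma interp_conv t : 0 <= t <= T -> exists k th, [/\ (1 <= k <= steps S)%N, 0 <= th <= 1,
  node S k.-1 <= t <= node S k & forall v, interp v t = (1 - th) * v k.-1 + th * v k].
Proof.
move=> /andP[t0 tT].
have [k [kJ /andP[k1 k2]]] : exists k, (1 <= k <= steps S)%N /\ node S k.-1 <= t <= node S k.
  move: t0; rewrite le_eqVlt => /predU1P[<-|t0].
    exists 1%N; rewrite steps_gt0; split => //=; have [-> _ _] := tg.
    by rewrite lexx (grid_ge0 tg)// steps_gt0.
  have [|k [kJ /andP[k1 k2]]] := @find_piece t; first by rewrite t0.
  by exists k; split => //; rewrite (ltW k1).
have nl := node_lt kJ.
exists k, ((t - node S k.-1) / (node S k - node S k.-1)); split => //.
- by rewrite -(rampE nl) ?k1// ramp_bnd.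
- by rewrite k1.
- by move=> v; rewrite (interp_piece v kJ) ?k1//; ring.
Qed.

(** Ramps are nondecreasing, so bounds on single steps add up to a bound between arbitrary times
    without locating these in the grid. *)
Lemma interp_mono_diff (v b : nat -> R) s t : s <= t ->
  (forall j, (1 <= j <= steps S)%N -> `|v j - v j.-1| <= b j - b j.-1) ->
  `|interp v t - interp v s| <= interp b t - interp b s.
Proof.
move=> st h.
have E w : interp w t - interp w s = \sum_(1 <= j < (steps S).+1)
    (ramp (node S j.-1) (node S j) t - ramp (node S j.-1) (node S j) s) * (w j - w j.-1).
  rewrite /interp opprD addrACA subrr add0r -sumrB.
  by apply: eq_bigr => j _; rewrite mulrBl.
rewrite !E; apply: le_trans (ler_norm_sum _ _ _) _.
rewrite big_nat [leRHS]big_nat; apply: ler_sum => j jJ.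
have jJ' : (1 <= j <= steps S)%N by [].
have r0 : 0 <= ramp (node S j.-1) (node S j) t - ramp (node S j.-1) (node S j) s.
  by rewrite subr_ge0; apply: ramp_nd => //; exact: node_lt.
by rewrite normrM ger0_norm//; apply: ler_wpM2l => //; exact: h.
Qed.

(** Lets the increments of the interpolated bound, which depend on the grid, be replaced by those of
    one fixed function of time. *)
Lemma interp_near (b : R -> R) (om d : R) t : 0 <= t <= T -> max_step S < d ->
  {in `[0, T] &, {homo b : x y / x <= y}} ->
  (forall x y, 0 <= x -> x <= y -> y <= T -> y - x < d -> b y - b x < om) ->
  `|interp (fun j => b (node S j)) t - b t| < om.
Proof.
move=> tT md hb ho; have [k [th [kJ th01 kt E]]] := interp_conv tT.
rewrite E; have [k1 kS] := andP kJ; have [t1 t2] := andP kt; have [th0 th1] := andP th01.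
have n0 : 0 <= node S k.-1 by apply: grid_ge0 tg _; exact: leq_trans (leq_pred _) kS.
have nT : node S k <= T by exact: grid_leT.
have i1 : node S k.-1 \in `[0, T].
  by rewrite in_itv/= n0/= (le_trans _ nT)// (le_trans t1).
have i2 : node S k \in `[0, T] by rewrite in_itv/= nT andbT (le_trans n0)// (le_trans t1).
have b1 := hb _ _ i1 tT t1; have b2 := hb _ _ tT i2 t2.
have := ho _ _ n0 (le_trans t1 t2) nT (le_lt_trans (step_le_max kJ) md) => h.
by rewrite ltr_norml; apply/andP; split; nra.
Qed.

Lemma interp_le (v : nat -> R) C t : 0 <= t <= T -> (forall j, (j <= steps S)%N -> `|v j| <= C) ->
  `|interp v t| <= C.
Proof.
move=> tT h; have [k [th [kJ /andP[th0 th1] _ ->]]] := interp_conv tT.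
have h1 := h k.-1 (node_prev_le kJ); have h2 := h k (proj2 (andP kJ)).
move: h1 h2; rewrite !ler_norml => /andP[a1 a2] /andP[a3 a4]; apply/andP; split; nra.
Qed.

Definition pw (v : nat -> R) (t : R) : R :=
  \sum_(1 <= j < (steps S).+1) itv_ind (node S j.-1) (node S j) t * v j.

Lemma pwE v k t : (1 <= k <= steps S)%N -> node S k.-1 < t <= node S k -> pw v t = v k.
Proof.
move=> kJ kt; rewrite /pw (bigD1_seq k) ?iota_uniq//=; last by rewrite mem_index_iota; case/andP: kJ => -> /=; rewrite ltnS.
rewrite itv_indE kt mul1r [X in _ + X]big1_seq ?addr0// => j /andP[jk]; rewrite mem_index_iota => /andP[j1 jJ].
rewrite itv_indE; case: (boolP (_ && _)) => [jt|]; last by rewrite mul0r.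
by case/eqP: jk; apply: piece_uniq jt kt => //; rewrite j1.
Qed.

End interp.

Lemma ramp_lip (a b s t : R) : a < b -> `|ramp a b t - ramp a b s| <= `|t - s| / (b - a).
Proof.
move=> ab; have b0 : 0 < (b - a)^-1 by rewrite invr_gt0 subr_gt0.
have -> : `|t - s| / (b - a) = `|(t - a) / (b - a) - (s - a) / (b - a)|.
  by rewrite -mulrBl normrM (gtr0_norm b0) (_ : t - a - (s - a) = t - s)//; ring.
rewrite /ramp; set x := (t - a) / _; set y := (s - a) / _.
have h1 := ler_norm (x - y); have h2 := ler_norm (y - x); rewrite distrC in h2.
rewrite ler_norml; have [hx|hx] := leP 1 x; have [hy|hy] := leP 1 y.
- by rewrite /Num.max; case: ltP => _; rewrite subrr oppr_le0 normr_ge0.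
- by rewrite (@max_r _ _ 0 1)//; have [y0|y0] := leP 0 y; apply/andP; split; lra.
- by rewrite (@max_r _ _ 0 1)//; have [x0|x0] := leP 0 x; apply/andP; split; lra.
- by have [x0|x0] := leP 0 x; have [y0|y0] := leP 0 y; apply/andP; split; lra.
Qed.

(** * A second-order Taylor bound *)

Section gradient.
Implicit Types (f : V -> R).

Lemma derive_dir_sum (E : normedModType R) (g : E -> R) (I : Type) (s : seq I) (F : I -> E) x : smooth g ->
  'D_(\sum_(i <- s) F i) g x = \sum_(i <- s) 'D_(F i) g x.
Proof.
move=> sg; elim: s => [|i s IH]; first by rewrite !big_nil derive_dir0.
rewrite !big_cons derive_dirD ?IH//.
- by move=> y u; exact: smooth_derivable.
- exact: smooth_continuous.
- by apply/smooth_continuous/smooth_derive.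
Qed.

Lemma derive_coord f x z : smooth f -> 'D_z f x = dot z (grad f x).
Proof.
move=> sf; have {1}-> : z = \sum_i z ord0 i *: unit_rV i.
  by rewrite {1}(row_sum_delta z).
rewrite derive_dir_sum//; apply: eq_bigr => i _.
by rewrite derive_dirZ ?mxE//; exact: smooth_derivable.
Qed.

Lemma dotE (x y : V) : dot x y = \sum_i x ord0 i * y ord0 i. Proof. by []. Qed.

Lemma dot_ge0 (z : V) : 0 <= dot z z.
Proof. by apply: sumr_ge0 => i _; rewrite -expr2 sqr_ge0. Qed.

Lemma enorm_sq (z : V) : enorm z ^+ 2 = dot z z.
Proof. by rewrite /enorm sqr_sqrtr// dot_ge0. Qed.

Lemma enorm_ge0 (z : V) : 0 <= enorm z.
Proof. exact: sqrtr_ge0. Qed.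

Lemma coord_enorm (z : V) i : `|z ord0 i| <= enorm z.
Proof.
rewrite -(@ler_pXn2r _ 2)// ?nnegrE ?enorm_ge0//.
rewrite enorm_sq real_normK ?num_real// dotE (bigD1 i)//= expr2 lerDl.
by apply: sumr_ge0 => j _; rewrite -expr2 sqr_ge0.
Qed.

Lemma dot_bnd (z w : V) C : 0 <= C -> (forall i, `|w ord0 i| <= C) -> `|dot z w| <= N%:R * C * enorm z.
Proof.
move=> C0 h; rewrite dotE; apply: le_trans (ler_norm_sum _ _ _) _.
apply: (@le_trans _ _ (\sum_(i < N) (C * enorm z))).
  by apply: ler_sum => i _; rewrite normrM mulrC; apply: ler_pM => //; exact: coord_enorm.
by rewrite sumr_const card_ord -[leLHS]mulr_natl mulrA.
Qed.

(** The mean value theorem is applied twice along the segment; each application brings a factor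
    [enorm z], and each sum over coordinates a factor N. *)
Lemma taylor2 f (C : R) (x z : V) : smooth f -> 0 <= C ->
  (forall i j y, `|partial i (partial j f) y| <= C) ->
  `|f (x + z) - f x - dot z (grad f x)| <= N%:R * (N%:R * C) * enorm z ^+ 2.
Proof.
move=> sf C0 hC.
have [c] := @MVT_line _ _ f x z 1 (fun y : V => @smooth_derivable _ _ _ y z sf) (smooth_continuous sf).
rewrite normr1 scale1r (addrC z x) mul1r => c1 ->.
have sz := smooth_derive z sf.
rewrite -derive_coord//.
have [d dc ->] := @MVT_line _ _ ('D_z f) x z c (fun y : V => @smooth_derivable _ _ _ y z sz) (smooth_continuous sz).
rewrite normrM; apply: le_trans (ler_piMl _ c1) _ => //.
rewrite derive_coord// expr2 mulrA.
set y := d *: z + x.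
have D0 : 0 <= N%:R * C * enorm z by rewrite !mulr_ge0// enorm_ge0.
apply: le_trans (dot_bnd z D0 _) _; last first.
  by rewrite !mulrA.
move=> i; rewrite mxE /partial.
have -> : 'D_z f = (fun y => \sum_j z ord0 j *: partial j f y).
  by apply/funext => w; rewrite derive_coord//; apply: eq_bigr => j _; rewrite mxE.
have -> : 'D_(unit_rV i) (fun y => \sum_j z ord0 j *: partial j f y) y =
    dot z (\row_j partial i (partial j f) y).
  have dj j : derivable (partial j f) y (unit_rV i).
    by apply: smooth_derivable; exact: smooth_derive.
  have -> : (fun y => \sum_j z ord0 j *: partial j f y) = \sum_j (z ord0 j \*: partial j f).
    by apply/funext => w; rewrite fct_sumE.
  rewrite derive_sum; last by move=> j; exact: derivableZ.
  by apply: eq_bigr => j _; rewrite deriveZ// mxE.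
by apply: dot_bnd => // j; rewrite mxE; exact: hC.
Qed.

End gradient.

(** * Test functions with time as a parameter *)

Section c2_families.
Implicit Types (psi : V * R -> R).

Lemma slice_quot psi (v : V) (t : R) (x : V) :
  (fun h : R => h^-1 *: (((fun y => psi (y, t)) \o shift x) (h *: v) - psi (x, t))) =
  (fun h : R => h^-1 *: ((psi \o shift (x, t)) (h *: ((v, 0) : V * R)) - psi (x, t))).
Proof.
apply/funext => h /=; congr (_ *: (psi _ - _)).
by apply: (congr1 (pair _)); rewrite /= scaler0 add0r.
Qed.

Lemma slice_derive psi (v : V) (t : R) (x : V) : 'D_v (fun y => psi (y, t)) x = 'D_((v, 0) : V * R) psi (x, t).
Proof.
by rewrite /derive (slice_quot psi v t x).
Qed.

Lemma slice_derivable psi v t x : derivable psi (x, t) ((v, 0) : V * R) ->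
  derivable (fun y => psi (y, t)) x v.
Proof. by rewrite /derivable (slice_quot psi v t x). Qed.

Lemma slice_iter psi vs t x :
  iter_derive vs (fun y => psi (y, t)) x = iter_derive [seq ((v, 0) : V * R) | v <- vs] psi (x, t).
Proof.
elim: vs x => [//|v vs IH] x /=; rewrite -slice_derive.
by congr ('D_v _ x); apply/funext => y; exact: IH.
Qed.

Lemma continuous_slice psi t : continuous psi -> continuous (fun x => psi (x, t)).
Proof.
move=> cp x.
exact: (continuous_comp (cvg_pair (cvg_id (F := nbhs x)) (cvg_cst (F := nbhs x) t)) (cp (x, t))).
Qed.

Lemma smooth_slice psi t : smooth psi -> smooth (fun x => psi (x, t)).
Proof.
move=> sp vs; have [c d] := sp [seq ((v, 0) : V * R) | v <- vs].
have -> : iter_derive vs (fun y => psi (y, t)) = fun y => iter_derive [seq ((v, 0) : V * R) | v <- vs] psi (y, t).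
  by apply/funext => x; exact: slice_iter.
by split; [exact: continuous_slice|move=> x v; exact: slice_derivable].
Qed.

Lemma Cc_slice_compact psi : Cc_smooth psi -> compact (fst @` supp psi).
Proof.
move=> [_ cs]; apply: continuous_compact => //; apply: continuous_subspaceT => p.
exact: cvg_fst.
Qed.

Lemma Cc_slice_vanish psi x t : ~ (fst @` supp psi) x -> psi (x, t) = 0.
Proof. by move=> h; apply: supp_vanish => h2; apply: h; exists (x, t). Qed.

Lemma Cc_slice psi t : Cc_smooth psi -> Cc_smooth (fun x => psi (x, t)).
Proof.
move=> cp; split; first exact: smooth_slice cp.1.
have cK := Cc_slice_compact cp.
apply: (subclosed_compact _ cK); first exact: closed_closure.
rewrite (closure_id (fst @` supp psi)).1; last exact: compact_closed.
by apply: closure_subset => x /= h; apply: contrapT => h2; move/eqP: h; apply; exact: Cc_slice_vanish.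
Qed.

Record C2fam (psi : V * R -> R) (K : set V) (C : R) := C2Fam {
  c2_smooth : forall t, smooth (fun x => psi (x, t));
  c2_meas : measurable_fun [set: VT] psi;
  c2_grad : forall i, measurable_fun [set: VT] (fun p : VT => partial i (fun x => psi (x, p.2)) p.1);
  c2_hess : forall i j, measurable_fun [set: VT] (fun p : VT => partial i (partial j (fun x => psi (x, p.2))) p.1);
  c2_ge0 : 0 <= C;
  c2_bnd : forall p, `|psi p| <= C;
  c2_hbnd : forall i j t x, `|partial i (partial j (fun x => psi (x, t))) x| <= C;
  c2_compact : compact K;
  c2_vanish : forall x t, ~ K x -> psi (x, t) = 0 }.

Lemma finite_bound (I : finType) (F : I -> R -> Prop) :
  (forall i C D, C <= D -> F i C -> F i D) -> (forall i, exists2 C, 0 <= C & F i C) ->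
  exists2 C, 0 <= C & forall i, F i C.
Proof.
move=> mono h; have /choice[c hc] : forall i, exists C, 0 <= C /\ F i C.
  by move=> i; have [C C0 FC] := h i; exists C.
exists (\sum_i c i); first by apply: sumr_ge0 => i _; have [] := hc i.
move=> i; apply: mono (hc i).2; rewrite (bigD1 i)//= lerDl.
by apply: sumr_ge0 => j _; have [] := hc j.
Qed.

Lemma C2fam_Cc psi : Cc_smooth psi -> exists C, C2fam psi (fst @` supp psi) C.
Proof.
move=> cp; have sp := cp.1.
have hE i j x t : partial i (partial j (fun x => psi (x, t))) x =
    iter_derive [:: ((unit_rV i, 0) : V * R); ((unit_rV j, 0) : V * R)] psi (x, t).
  exact: (slice_iter psi [:: unit_rV i; unit_rV j]).
have [C1 C10 hC1] := Cc_bdd [::] cp.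
have [C2 C20 hC2] := @finite_bound ('I_N * 'I_N)%type
  (fun ij C => forall p, `|iter_derive [:: ((unit_rV ij.1, 0) : V * R); ((unit_rV ij.2, 0) : V * R)] psi p| <= C)
  (fun ij C D CD h p => le_trans (h p) CD) (fun ij => Cc_bdd _ cp).
exists (C1 + C2); split.
- by move=> t; exact: smooth_slice.
- by apply: continuous_measurable_prod; exact: smooth_continuous.
- move=> i; have := continuous_measurable_prod (smooth_continuous (smooth_derive ((unit_rV i, 0) : V * R) sp)).
  by apply: eq_measurable_fun => -[x t] _ /=; rewrite /partial slice_derive.
- move=> i j; have := continuous_measurable_prod (proj1 (sp [:: ((unit_rV i, 0) : V * R); ((unit_rV j, 0) : V * R)])).
  by apply: eq_measurable_fun => -[x t] _ /=; rewrite hE.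
- by rewrite addr_ge0.
- by move=> p; apply: le_trans (hC1 p) _; rewrite lerDl.
- by move=> i j t x; rewrite hE; apply: le_trans (hC2 (i, j) _) _; rewrite lerDr.
- exact: Cc_slice_compact.
- by move=> x t; exact: Cc_slice_vanish.
Qed.

Lemma C2fam_cst (eta : V -> R) : Cc_smooth eta -> exists C, C2fam (fun p => eta p.1) (supp eta) C.
Proof.
move=> ce; have se := ce.1.
have [C1 C10 hC1] := Cc_bdd [::] ce.
have [C2 C20 hC2] := @finite_bound ('I_N * 'I_N)%type
  (fun ij C => forall p, `|iter_derive [:: unit_rV ij.1; unit_rV ij.2] eta p| <= C)
  (fun ij C D CD h p => le_trans (h p) CD) (fun ij => Cc_bdd _ ce).
have mc (g : V -> R) : continuous g -> measurable_fun [set: VT] (fun p : VT => g p.1).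
  by move=> cg; exact: meas_fst (continuous_measurable_rV cg).
exists (C1 + C2); split => //=.
- by apply: mc; exact: smooth_continuous.
- by move=> i; apply: (mc ('D_(unit_rV i) eta)); apply: smooth_continuous; exact: smooth_derive.
- by move=> i j; apply: (mc (iter_derive [:: unit_rV i; unit_rV j] eta)); have [] := se [:: unit_rV i; unit_rV j].
- by rewrite addr_ge0.
- by move=> p; apply: le_trans (hC1 p.1) _; rewrite lerDl.
- by move=> i j t x; apply: le_trans (hC2 (i, j) _) _; rewrite lerDr.
- exact: ce.2.
- by move=> x t; exact: supp_vanish.
Qed.

End c2_families.

(** * Levy operators on test functions *)

Definition kap (z : V) : R := Num.min (enorm z ^+ 2) 1.

Lemma measurable_enorm2 : measurable_fun setT (fun z : V => enorm z ^+ 2).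
Proof.
have -> : (fun z : V => enorm z ^+ 2) = (fun z => \sum_(i < N) z ord0 i * z ord0 i).
  by apply/funext => z; rewrite enorm_sq.
by apply: measurable_sum => i; apply: measurable_funM; exact: measurable_coord.
Qed.

Lemma measurable_kap : measurable_fun setT kap.
Proof. by apply: measurable_minr => //; exact: measurable_enorm2. Qed.

Lemma enorm_le1 (z : V) : (enorm z <= 1) = (enorm z ^+ 2 <= 1).
Proof. by rewrite -[in RHS](expr1n _ 2) ler_pXn2r// nnegrE ?enorm_ge0. Qed.

Lemma enorm_eq0 (z : V) : (enorm z == 0) = (z == 0).
Proof.
apply/eqP/eqP => [h|->]; last first.
  by rewrite /enorm dotE big1 ?sqrtr0// => i _; rewrite mxE mulr0.
apply/rowP => i; rewrite mxE; apply/eqP; rewrite -normr_le0 -h; exact: coord_enorm.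
Qed.

Lemma kap_ge0 z : 0 <= kap z.
Proof. by rewrite /kap le_min sqr_ge0 ler01. Qed.

(** Fubini needs sigma-finiteness. The sets {kap > 1/(n+1)} have finite measure by Chebyshev and
    exhaust everything but the origin, which carries no mass. *)
Lemma exists_levy_measure (mu : {measure set V -> \bar R}) : levy_measure mu ->
  exists m : {sigma_finite_measure set V -> \bar R},
    [/\ m = mu :> (set V -> \bar R), Intg m kap & m [set 0] = 0%E].
Proof.
move=> [[mu0 _ _]].
set A := [set z : V | (z != 0)%R /\ (enorm z <= 1)%R].
set B := [set z : V | (1 < enorm z)%R] => fin.
have m0 : measurable [set (0 : V)] by apply: compact_measurable_rV; exact: compact_set1.
have mgt (r : R) : measurable [set z : V | r < enorm z ^+ 2].
  have := measurable_gt_abs r measurable_enorm2; congr measurable.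
  by apply/seteqP; split => z /=; rewrite ger0_norm// sqr_ge0.
have mB : measurable B.
  have := mgt 1; congr measurable.
  by rewrite /B; apply/seteqP; split => z /=; rewrite !ltNge enorm_le1.
have mA : measurable A.
  rewrite (_ : A = ~` B `\` [set 0]); first by apply: measurableD => //; exact: measurableC.
  apply/seteqP; split => z /= [z0 z1].
    by split; [rewrite /B /= ltNge z1|exact/eqP].
  by split; [exact/eqP|rewrite leNgt; exact/negP].
have i0A : (0 <= \int[mu]_(z in A) ((enorm z) ^+ 2)%:E)%E by apply: integral_ge0 => z _; rewrite lee_fin sqr_ge0.
have finA : (\int[mu]_(z in A) ((enorm z) ^+ 2)%:E < +oo)%E.
  by apply: le_lt_trans fin; rewrite leeDl//; exact: integral_ge0.
have finB : (mu B < +oo)%E.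
  by apply: le_lt_trans fin; apply: le_trans (leeDr _ i0A); rewrite integral_cst// mul1e.
have Ik : Intg mu kap.
  apply: Intg_ge0; [exact: measurable_kap|exact: kap_ge0|].
  have iA : measurable_fun setT (\1_A : V -> R) by exact: measurable_indic.
  have iB : measurable_fun setT (\1_B : V -> R) by exact: measurable_indic.
  have m2 := measurable_enorm2.
  apply: (@le_lt_trans _ _ (\int[mu]_z ((enorm z ^+ 2 * \1_A z)%:E + (\1_B z)%:E))%E).
    apply: ge0_le_integral => //=.
    - by move=> z _; rewrite lee_fin kap_ge0.
    - by apply/measurable_EFinP; exact: measurable_kap.
    - apply/measurable_EFinP; apply: measurable_funD => //; exact: measurable_funM.
    move=> z _; rewrite -EFinD lee_fin /kap.
    have [->|z0] := eqVneq z 0.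
      by rewrite (eqP (_ : enorm (0 : V) == 0)) ?enorm_eq0// expr0n /= min_l// mul0r add0r indicE.
    have [z1|z1] := leP (enorm z) 1.
      by rewrite indic_in ?mulr1 ?ge_min ?lerDl ?indicE ?ler0n//; split.
    rewrite (@indic_in B)//; rewrite ge_min; apply/orP; right.
    by rewrite lerDr mulr_ge0// ?sqr_ge0// indicE.
  rewrite ge0_integralD//=.
  - rewrite lte_add_pinfty//; last by rewrite integral_indic// setIT.
    move: finA; rewrite integral_mkcond; congr (_ < _)%E; apply: eq_integral => z _.
    by rewrite patchE indicE; case: ifP => _; rewrite ?mulr1 ?mulr0.
  - by move=> z _; rewrite lee_fin mulr_ge0// ?sqr_ge0// indicE.
  - by apply/measurable_EFinP; exact: measurable_funM.
  - by apply/measurable_EFinP.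
pose F n : set V := [set z : V | n.+1%:R^-1 < `|kap z|] `|` [set 0].
have sfin : sigma_finite setT mu.
  exists F => [|n].
    apply/seteqP; split => // z _; have [->|z0] := eqVneq z 0; first by exists 0%N => //; right.
    have k0 : 0 < kap z by rewrite lt_min ltr01 exprn_gt0// lt_def enorm_eq0 z0 enorm_ge0.
    exists (Num.bound (kap z)^-1) => //; left => /=; rewrite (gtr0_norm k0) invf_plt ?posrE//.
    by apply: lt_trans (archi_boundP _) _; rewrite ?invr_ge0 ?(ltW k0)// ltr_nat.
  have mg := measurable_gt_abs n.+1%:R^-1 measurable_kap.
  split; first exact: measurableU.
  apply: le_lt_trans (measureU2 _ _ _) _ => //; rewrite [X in (_ + X)%E]mu0 adde0.
  exact: markov_fin.
have [m em] := exists_sigma_finite_measure (measure0 mu) (measure_ge0 mu) (@measure_semi_sigma_additive _ _ _ mu) sfin.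
by exists m; split; rewrite ?em//; exact: Intg_eq_measure em Ik.
Qed.

Lemma measurable_shift2 (psi : VT -> R) : measurable_fun [set: VT] psi ->
  measurable_fun [set: VT * V] (fun q : VT * V => psi (q.1.1 + q.2, q.1.2)).
Proof.
move=> mp.
have m1 : measurable_fun [set: VT * V] (fun q : VT * V => (q.1.1, q.2)).
  apply: measurable_fun_pair; last exact: measurable_snd.
  exact: (measurableT_comp measurable_fst measurable_fst).
have m2 : measurable_fun [set: VT * V] (fun q : VT * V => q.1.1 + q.2).
  exact: (measurableT_comp (@measurable_addrV R N) m1).
have m3 : measurable_fun [set: VT * V] (fun q : VT * V => q.1.2).
  exact: (measurableT_comp measurable_snd measurable_fst).
exact: (measurableT_comp mp (measurable_fun_pair m2 m3)).
Qed.

Definition levy_int (psi : V * R -> R) (x : V) (t : R) (z : V) : R :=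
  psi (x + z, t) - psi (x, t) - dot z (grad (fun y => psi (y, t)) x) * (enorm z <= 1)%R%:R.

Lemma levy_op_xE P (sigma : 'M[R]_(N, P)) (mu : {measure set V -> \bar R})
    (m : {sigma_finite_measure set V -> \bar R}) psi p : m = mu :> (set V -> \bar R) -> m [set 0] = 0%E ->
  levy_op_x sigma mu psi p =
    (\sum_i \sum_j (sigma *m sigma^T) i j * partial j (partial i (fun x => psi (x, p.2))) p.1) +
    \int[m]_z levy_int psi p.1 p.2 z.
Proof.
move=> em m0; rewrite /levy_op_x /levy_op; congr (_ + _).
  rewrite /mxtrace; apply: eq_bigr => i _; rewrite mxE; apply: eq_bigr => j _.
  by rewrite [X in _ * X]mxE.
rewrite [RHS]/Rintegral (eq_measure_integral mu); last first.
  by move=> C mC _; exact: (congr1 (fun k : set V -> \bar R => k C) em).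
rewrite -/(Rintegral mu setT (levy_int psi p.1 p.2)) [LHS]Rintegral_mkcond.
apply: Rint_ext => z; rewrite patchE; case: ifPn => //.
rewrite notin_setE/= => /contrapT ->.
rewrite /levy_int addr0 subrr sub0r dotE big1 ?mul0r ?oppr0// => i _.
by rewrite mxE mul0r.
Qed.

Lemma levy_dom P (sigma : 'M[R]_(N, P)) (mu : {measure set V -> \bar R}) psi K C :
  levy_measure mu -> C2fam psi K C ->
  measurable_fun [set: VT] (levy_op_x sigma mu psi) /\
  exists2 H : V -> R, Intg leb H & forall x t, `|levy_op_x sigma mu psi (x, t)| <= H x.
Proof.
move=> /exists_levy_measure[m [em Ik m0]] c2.
have mnu q := levy_op_xE sigma psi q em m0.
have C0 := c2_ge0 c2.
have mker : measurable_fun [set: VT * V] (fun q : VT * V => levy_int psi q.1.1 q.1.2 q.2).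
  apply: measurable_funB; first apply: measurable_funB.
  - exact: measurable_shift2 (c2_meas c2).
  - have := measurableT_comp (c2_meas c2) (@measurable_fst _ _ VT V).
    by apply: eq_measurable_fun => -[[x t] z].
  apply: measurable_funM.
    apply: measurable_sum => i; apply: measurable_funM.
      exact: meas_snd (measurable_coord i).
    have := measurableT_comp (c2_grad c2 i) (@measurable_fst _ _ VT V).
    by apply: eq_measurable_fun => q _ /=; rewrite mxE.
  have -> : (fun q : VT * V => (enorm q.2 <= 1)%R%:R) = (fun z : V => \1_[set z : V | enorm z ^+ 2 <= 1] z : R) \o snd.
    apply/funext => q /=; rewrite enorm_le1; case: (boolP (_ <= 1)) => h; first by rewrite indic_in.
    by rewrite (@indic_out [set z : V | enorm z ^+ 2 <= 1]) //=; exact/negP.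
  apply: (meas_snd _); apply: measurable_indic.
  have := measurableC (measurable_gt_abs 1 measurable_enorm2); congr measurable.
  by apply/seteqP; split => x /=; rewrite ger0_norm ?sqr_ge0// leNgt => /negP.
split.
  rewrite (_ : levy_op_x sigma mu psi = fun p : VT =>
    (\sum_i \sum_j (sigma *m sigma^T) i j * partial j (partial i (fun x => psi (x, p.2))) p.1) +
    \int[m]_z levy_int psi p.1 p.2 z); last by apply/funext => p; exact: mnu.
  apply: measurable_funD.
    apply: measurable_sum => i; apply: measurable_sum => j; apply: measurable_funM => //.
    exact: c2_hess c2 j i.
  exact: (@measurable_Rint_param _ VT _ V R m _ mker).
have cK := c2_compact c2.
have [M [Mr hM]] := compact_bounded cK.
pose Q := @Qbox (`|M| + 3).
have KQ x y : K x -> `|y - x| <= 1 -> Q y.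
  move=> Kx yx; apply: Qbox_norm; first by rewrite ltr_wpDl.
  have Ml : M < `|M| + 1 by rewrite (le_lt_trans (ler_norm M)) ?ltrDl.
  have := hM _ Ml x Kx => /= xM.
  have -> : y = (y - x) + x by rewrite subrK.
  by apply: le_lt_trans (ler_normD _ _) _; lra.
have iQ : Intg leb (\1_Q : V -> R) by apply: indic_Intg; [exact: measurable_Qbox|exact: Qbox_fin].
have bQ : bmeas 1 (\1_Q : V -> R) by apply: bmeas_indic; exact: measurable_Qbox.
have KQ0 x : K x -> \1_Q x = 1 :> R.
  by move=> Kx; rewrite indic_in//; apply: (KQ x) => //; rewrite subrr normr0.
pose D := C + N%:R * (N%:R * C).
have D0 : 0 <= D by rewrite addr_ge0// !mulr_ge0.
have CD : C <= D by rewrite lerDl !mulr_ge0.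
have ND : N%:R * (N%:R * C) <= D by rewrite lerDr.
have nv x t : \1_Q x = 0 :> R -> psi (x, t) = 0.
  move=> q0; apply: (c2_vanish c2) => Kx; move: q0; rewrite KQ0// => /eqP; by rewrite oner_eq0.
have pb x t : `|psi (x, t)| <= D * \1_Q x.
  rewrite indicE; case: (boolP (x \in Q)) => h /=; first by rewrite mulr1 (le_trans (c2_bnd c2 _)).
  by rewrite nv ?normr0 ?mulr0// indicE (negbTE h).
(* For |z| <= 1 Taylor's formula gives the factor [kap z], and the integrand vanishes unless x or x
   + z lies in K. For larger z the gradient term is absent and the two values are bounded
   separately. The translate of the box has the same measure as the box, so the bound is integrable
   in (z, x). *)
have kb x t z : `|levy_int psi x t z| <= D * kap z * (\1_Q x + \1_Q (x + z)).
  rewrite /levy_int; have [z1|z1] := leP (enorm z) 1.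
    have kz : kap z = enorm z ^+ 2 by rewrite /kap min_l// -enorm_le1.
    rewrite mulr1 kz; have [Kxz|nK] := pselect (K x \/ K (x + z)).
      have q1 : 1 <= \1_Q x + \1_Q (x + z) :> R.
        case: Kxz => h; rewrite (KQ0 _ h) ?lerDl ?lerDr indicE ler0n//.
      apply: le_trans (taylor2 x z (c2_smooth c2 t) C0 (fun i j y => c2_hbnd c2 i j t y)) _.
      rewrite -[leLHS]mulr1; apply: ler_pM => //.
        by rewrite !mulr_ge0// enorm_ge0.
      by rewrite ler_wpM2r// sqr_ge0.
    have g0 : dot z (grad (fun y => psi (y, t)) x) = 0.
      rewrite dotE big1// => i _; rewrite mxE /partial.
      rewrite (@derive_vanish R _ (fun y => psi (y, t)) K) ?mulr0//.
      - exact: compact_closed.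
      - by move=> y; exact: (c2_vanish c2).
      - by move=> h; apply: nK; left.
    rewrite g0 subr0 !(c2_vanish c2) ?subrr ?normr0; last 2 first.
    - by move=> h; apply: nK; right.
    - by move=> h; apply: nK; left.
    apply: mulr_ge0; first by apply: mulr_ge0 => //; exact: sqr_ge0.
    by apply: addr_ge0; rewrite indicE ler0n.
  have kz : kap z = 1 by rewrite /kap min_r// ltW// ltNge -enorm_le1 -ltNge.
  rewrite mulr0 subr0 kz mulr1 mulrDr.
  by apply: le_trans (ler_normB _ _) _; rewrite addrC; apply: lerD.
pose G x := \int[m]_z (D * kap z * (\1_Q x + \1_Q (x + z))).
have bQxz x : bmeas 2 (fun z : V => \1_Q x + \1_Q (x + z) : R).
  rewrite -(_ : 1 + 1 = 2 :> R) //; apply: bmeasD; first by split => // z; have := bQ.2 x.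
  exact: shiftl_bmeas.
have IDk : Intg m (fun z => D * kap z) by exact: IntgZ.
have Igx x : Intg m (fun z => D * kap z * (\1_Q x + \1_Q (x + z))).
  by under eq_fun do rewrite mulrC; exact: bmeas_IntgM (bQxz x) IDk.
have kap0 z : 0 <= D * kap z by rewrite mulr_ge0// kap_ge0.
have i0 (y : V) : 0 <= \1_Q y :> R by rewrite indicE.
have IG : Intg leb G.
  have mF : measurable_fun [set: V * V] (fun p : V * V => D * kap p.1 * (\1_Q p.2 + \1_Q (p.2 + p.1)) : R).
    apply: measurable_funM.
      by apply: measurable_funM => //; exact: meas_fst measurable_kap.
    apply: measurable_funD; first exact: meas_snd bQ.1.
    exact: (measurableT_comp bQ.1 (@measurable_addrV_swap R N)).
  have Is z : Intg leb (fun x => \1_Q x + \1_Q (x + z) : R) by apply: IntgD => //; exact: Intg_shift.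
  have : Intg (m \x leb)%E (fun p : V * V => D * kap p.1 * (\1_Q p.2 + \1_Q (p.2 + p.1)) : R).
    apply: (@Intg_prod _ _ _ _ _ m leb _ (fun z => (D * kap z) * (2 * \int[leb]_x \1_Q x))) => //.
    - by under eq_fun do rewrite mulrC; apply: IntgZ.
    - by move=> z /=; apply: IntgZ.
    move=> z /=; rewrite (Rint_ext _ (g := fun x => D * kap z * (\1_Q x + \1_Q (x + z)))); last first.
      by move=> x; rewrite ger0_norm// mulr_ge0// addr_ge0.
    rewrite RintZ// RintD//; last exact: Intg_shift.
    by rewrite (Rint_shift z bQ.1) -mulr2n mulr_natl.
  exact: Fubini_intg2.
pose A := \sum_i \sum_j `|(sigma *m sigma^T) i j| * D.
have A0 : 0 <= A by apply: sumr_ge0 => i _; apply: sumr_ge0 => j _; rewrite mulr_ge0.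
exists (fun x => A * \1_Q x + G x); first by apply: IntgD => //; exact: IntgZ.
move=> x t; rewrite mnu /=; apply: le_trans (ler_normD _ _) _; apply: lerD.
  have [Kx|Kx] := pselect (K x).
    rewrite KQ0// mulr1; apply: le_trans (ler_norm_sum _ _ _) _; apply: ler_sum => i _.
    apply: le_trans (ler_norm_sum _ _ _) _; apply: ler_sum => j _.
    by rewrite normrM ler_wpM2l//; apply: le_trans (c2_hbnd c2 _ _ _ _) CD.
  rewrite big1 ?normr0 ?mulr_ge0// => i _; rewrite big1// => j _.
  have cK' : closed K by exact: compact_closed.
  have h1 y : ~ K y -> partial i (fun y => psi (y, t)) y = 0.
    by apply: derive_vanish => // y' ; exact: (c2_vanish c2).
  by rewrite /partial (@derive_vanish R _ _ K) ?mulr0.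
have Il : Intg m (levy_int psi x t).
  apply: (Intg_le _ (Igx x) (kb x t)).
  exact: (measurableT_comp mker (measurable_pair1 ((x, t) : VT))).
exact: Rint_dom.
Qed.

(** * Mollifiers *)

Lemma rV_coord_le (x : V) i : `|x ord0 i| <= `|x|.
Proof. by rewrite [leRHS]mx_normrE; apply: (le_bigmax _ (fun ij => `|x ij.1 ij.2|) (ord0, i)). Qed.

Lemma rV_norm_le (x : V) (d : R) : 0 <= d -> (forall i, `|x ord0 i| <= d) -> `|x| <= d.
Proof.
move=> d0 h; rewrite [leLHS]mx_normrE; apply: bigmax_le => // -[i j] _ /=.
by rewrite (ord1 i).
Qed.

Definition bump (d : R) (x : V) : R := \prod_(i < N) bump1 (d^-1 * x ord0 i).

Lemma smooth_bump d : smooth (bump d).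
Proof.
rewrite /bump; apply: smooth_prod => i.
apply: (@smooth_comp_aff _ _ _ (bump1 : R^o -> R) (fun x : V => d^-1 * x ord0 i : R^o) (fun v => d^-1 * v ord0 i)).
- exact: smooth_bump1.
- have cc : continuous (fun x : V => d^-1 * x ord0 i : R).
    move=> x; have h : (fun y : V => y ord0 i) @ x --> x ord0 i by exact: coord_continuous.
    exact: (@cvgMr R _ _ _ (fun y : V => y ord0 i) d^-1 _ h).
  exact: cc.
- by move=> x v s; rewrite !mxE mulrDr mulrCA.
Qed.

Lemma bump_ge0 d x : 0 <= bump d x.
Proof. by apply: prodr_ge0 => i _; exact: bump1_ge0. Qed.

Lemma bumpN d x : bump d (- x) = bump d x.
Proof. by apply: eq_bigr => i _; rewrite mxE mulrN bump1N. Qed.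

Lemma bump_gt0 d x : 0 < d -> `|x| < d -> 0 < bump d x.
Proof.
move=> d0 xd; apply: prodr_gt0 => i _; apply: bump1_gt0.
rewrite normrM gtr0_norm ?invr_gt0// mulrC ltr_pdivrMr// mul1r.
apply: le_lt_trans xd; exact: rV_coord_le.
Qed.

Lemma bump_out d x : 0 < d -> d < `|x| -> bump d x = 0.
Proof.
move=> d0 dx; have [i xi] : exists i, d <= `|x ord0 i|.
  apply: contrapT => /forallNP h; move: dx; apply/negP; rewrite -leNgt.
  apply: rV_norm_le => [|i]; first exact: ltW.
  by apply/ltW; rewrite ltNge; exact/negP/h.
rewrite /bump (bigD1 i)//= bump1_out ?mul0r//.
by rewrite normrM gtr0_norm ?invr_gt0// mulrC ler_pdivlMr// mul1r.
Qed.

Lemma closed_ball_rV_compact d : compact [set x : V | `|x| <= d].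
Proof.
apply: bounded_closed_compact.
  exists d; split; first exact: num_real.
  by move=> M dM x /= xd; rewrite (le_trans xd)// ltW.
rewrite (_ : mkset _ = (fun x : V => `|x|) @^-1` [set r | r <= d])//.
apply: preimage_closed; last exact: closed_le.
by move=> x _; exact: norm_continuous.
Qed.

Lemma Cc_bump d : 0 < d -> Cc_smooth (bump d).
Proof.
move=> d0; split; first exact: smooth_bump.
have cl : closed [set x : V | `|x| <= d] by apply: compact_closed => //; exact: closed_ball_rV_compact.
apply: (subclosed_compact _ (@closed_ball_rV_compact d)); first exact: closed_closure.
rewrite /supp [X in _ `<=` X](closure_id _).1//; apply: closureS => x /=.
by apply: contraNT; rewrite -ltNge => h; rewrite bump_out.
Qed.

Lemma Cc_meas (eta : V -> R) : Cc_smooth eta -> exists2 C, 0 <= C & bmeas C eta.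
Proof.
move=> ce; have [C C0 hC] := Cc_bdd [::] ce; exists C => //; split => //.
by apply: continuous_measurable_rV; apply: smooth_continuous; case: ce.
Qed.

Lemma Cc_Intg (eta : V -> R) : Cc_smooth eta -> Intg leb eta.
Proof.
move=> ce; have [C C0 [me hC]] := Cc_meas ce.
apply: (@Intg_bdd _ _ _ leb _ (supp eta) C) => //.
- by apply: compact_measurable_rV; case: ce.
- by apply: compact_leb_fin; case: ce.
- exact: supp_vanish.
Qed.

Lemma bump_int_gt0 d : 0 < d -> 0 < \int[leb]_x bump d x.
Proof.
move=> d0; rewrite lt_def; apply/andP; split; last by apply: Rint_ge0; exact: bump_ge0.
apply/eqP => e0; have := Rint_eq0_ae (Cc_Intg (Cc_bump d0)) (@bump_ge0 d) e0.
move=> [A [mA A0 sub]].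
have : (leb (@Qbox (d / 2)) <= leb A)%E.
  apply: le_measure; rewrite ?inE//; first exact: measurable_Qbox.
  move=> x xq; apply: sub => /= x0; suff : 0 < bump d x by rewrite x0 ltxx.
  apply: bump_gt0 => //; apply: (@le_lt_trans _ _ (d / 2)); last by lra.
  apply: rV_norm_le => [|j]; first by lra.
  by have := xq j; rewrite /= in_itv/= => /andP[a b]; rewrite ler_norml; apply/andP; split; lra.
rewrite A0 (lebesgue_rV_box (A := fun _ => `](- (d / 2)), (d / 2)[%classic)); last by move=> i; exact: measurable_itv.
apply/negP; rewrite -ltNge; elim/big_ind: _ => [|x y|i _]; [exact: lte01|exact: mule_gt0|].
by rewrite lebesgue_measure_itv/= lte_fin; case: ifP; rewrite ?lte_fin; lra.
Qed.

Definition moll (d : R) (x : V) : R := (\int[leb]_y bump d y)^-1 * bump d x.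

Lemma CcZ (c : R) (eta : V -> R) : Cc_smooth eta -> Cc_smooth (fun x => c * eta x).
Proof.
move=> [se ce]; split; first exact: smoothZ.
apply: (subclosed_compact _ ce); first exact: closed_closure.
apply: closureS => x /=; apply: contra_neq => ->; exact: mulr0.
Qed.

Lemma Cc_moll d : 0 < d -> Cc_smooth (moll d).
Proof. by move=> d0; apply: CcZ; exact: Cc_bump. Qed.

Lemma moll_ge0 d x : 0 <= moll d x.
Proof. by rewrite mulr_ge0 ?bump_ge0// invr_ge0; apply: Rint_ge0; exact: bump_ge0. Qed.

Lemma mollN d x : moll d (- x) = moll d x.
Proof. by rewrite /moll bumpN. Qed.

Lemma moll_out d x : 0 < d -> d < `|x| -> moll d x = 0.
Proof. by move=> d0 dx; rewrite /moll bump_out// mulr0. Qed.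

Lemma moll_int d : 0 < d -> \int[leb]_x moll d x = 1.
Proof.
move=> d0; rewrite RintZ; last exact: Cc_Intg (Cc_bump d0).
by rewrite mulVf// gt_eqF// bump_int_gt0.
Qed.

Lemma Cc_refl (eta : V -> R) (y : V) : Cc_smooth eta -> Cc_smooth (fun x => eta (y - x)).
Proof.
move=> [se ce].
have cr : continuous (fun x : V => y - x).
  by move=> x; apply: (@cvgB _ _ _ (nbhs x) _ (fun=> y) id); [exact: cvg_cst|exact: cvg_id].
split.
  apply: (@smooth_comp_aff _ _ _ eta (fun x => y - x) (fun v => - v)) => //.
  by move=> x v s; rewrite scalerN opprD addrCA.
have cK : compact ((fun x => y - x) @` supp eta).
  by apply: continuous_compact => //; exact: continuous_subspaceT.
apply: (subclosed_compact _ cK); first exact: closed_closure.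
rewrite /supp [X in _ `<=` X](closure_id _).1; last exact: compact_closed.
apply: closureS => x /= ex; exists (y - x); last by rewrite subKr.
exact: subset_closure.
Qed.

Lemma multi_deriveE k (alpha : {ffun 'I_N -> 'I_k}) (f : V -> R) :
  multi_derive alpha f =
  iter_derive (flatten [seq nseq (alpha i) (unit_rV i) | i <- enum 'I_N]) f.
Proof.
rewrite /multi_derive; elim: (enum 'I_N) => [//|i s IH] /=.
by rewrite IH /iter_derive foldr_cat; elim: (nat_of_ord (alpha i)) => [//|n IHn] /=; rewrite IHn.
Qed.

(** The consistency error carries a Sobolev norm of the test function; a single bound for the whole
    family makes that error uniform in its index, the time. *)
Lemma sobolev_family (I : Type) (F : I -> V -> R) (K : set V) : compact K ->
  (forall i, smooth (F i)) -> (forall i x, ~ K x -> F i x = 0) ->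
  (forall vs, exists2 C, 0 <= C & forall i x, `|iter_derive vs (F i) x| <= C) ->
  forall k, exists2 B, 0 <= B & forall i, (sobolev1_norm k (F i) <= B%:E)%E.
Proof.
move=> cK sF vF bF k.
have [B B0 hB] : exists2 B : R, 0 <= B & forall (alpha : {ffun 'I_N -> 'I_k.+1}) i,
    ('N[leb]_1[EFin \o multi_derive alpha (F i)] <= B%:E)%E.
  apply: (@finite_bound _ (fun alpha C => forall i, ('N[leb]_1[EFin \o multi_derive alpha (F i)] <= C%:E)%E)).
    by move=> alpha C D CD h i; apply: le_trans (h i) _; rewrite lee_fin.
  move=> alpha; set vs := flatten [seq nseq (alpha i) (unit_rV i : V) | i <- enum 'I_N].
  have [C C0 hC] := bF vs.
  have mK : measurable K by exact: compact_measurable_rV.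
  have iK : Intg leb (\1_K : V -> R) by apply: indic_Intg => //; exact: compact_leb_fin.
  exists (C * \int[leb]_x \1_K x); first by rewrite mulr_ge0//; apply: Rint_ge0 => x; rewrite indicE.
  move=> i; rewrite multi_deriveE -/vs Lnorm1.
  have bd x : `|iter_derive vs (F i) x| <= C * \1_K x.
    rewrite indicE; case: (boolP (x \in K)) => h; first by rewrite mulr1.
    rewrite (iter_vanish vs (compact_closed _ cK) (vF i)) ?normr0 ?mulr_ge0//.
    by move: h; rewrite notin_setE.
  have cI : Intg leb (iter_derive vs (F i)).
    apply: Intg_le bd; last exact: IntgZ.
    by apply: continuous_measurable_rV; case: (sF i vs).
  have -> : (\int[leb]_x `|(EFin \o iter_derive vs (F i)) x|)%E = (\int[leb]_x `|iter_derive vs (F i) x|)%:E.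
    by rewrite Rint_EFin//; exact: Intg_abs.
  rewrite lee_fin -RintZ//; apply: Rint_le => //; first exact: Intg_abs.
  exact: IntgZ.
exists (\sum_(alpha : {ffun 'I_N -> 'I_k.+1} | (\sum_i alpha i <= k)%N) B); first exact: sumr_ge0.
by move=> i; rewrite /sobolev1_norm -sumEFin; apply: lee_sum => alpha _.
Qed.

Lemma sobolev_ge0 k (f : V -> R) : (0 <= sobolev1_norm k f)%E.
Proof. by apply: sume_ge0 => alpha _; exact: Lnorm_ge0. Qed.

Record testfam (psi : V * R -> R) (K : set V) (C : R) : Prop := TestFam {
  tf_C2 : C2fam psi K C;
  tf_Cc : forall t, Cc_smooth (fun x => psi (x, t));
  tf_sob : forall k, exists2 B, 0 <= B & forall t, (sobolev1_norm k (fun x => psi (x, t)) <= B%:E)%E }.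

Lemma testfam_Cc psi : Cc_smooth psi -> exists C, testfam psi (fst @` supp psi) C.
Proof.
move=> cp; have [C hC] := C2fam_Cc cp; exists C; split => //; first by move=> t; exact: Cc_slice.
apply: (@sobolev_family R (fun t x => psi (x, t)) (fst @` supp psi)).
- exact: Cc_slice_compact.
- by move=> t; apply: smooth_slice; case: cp.
- by move=> t x; exact: Cc_slice_vanish.
- move=> vs; have [D D0 hD] := Cc_bdd [seq ((v, 0) : V * R) | v <- vs] cp.
  by exists D => // t x; rewrite slice_iter.
Qed.

Lemma testfam_cst (eta : V -> R) : Cc_smooth eta -> exists C, testfam (fun p => eta p.1) (supp eta) C.
Proof.
move=> ce; have [C hC] := C2fam_cst ce; exists C; split => //.
apply: (@sobolev_family R (fun t x => eta x) (supp eta)).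
- by case: ce.
- by move=> t; case: ce.
- by move=> t x; exact: supp_vanish.
- by move=> vs; have [D D0 hD] := Cc_bdd vs ce; exists D.
Qed.

Definition dop (m : fmeas) (eta : V -> R) (x : V) : R :=
  avg m eta x - mass m * eta x.

Lemma dop_bmeas m C eta : bmeas C eta -> exists2 D, 0 <= D & bmeas D (dop m eta).
Proof.
move=> be; exists (`|C * mass m + `|mass m| * C|) => //.
apply: bmeas_le (ler_norm _) _; apply: bmeasB; [exact: avg_bmeas|exact: bmeasZ].
Qed.

Lemma dop_Intg m C eta : bmeas C eta -> Intg leb eta -> Intg leb (dop m eta).
Proof. by move=> be ie; apply: IntgB; [exact: avg_Intg be ie|exact: IntgZ]. Qed.

Lemma dop_sym m C1 C2 g eta : sym m -> bmeas C1 g -> bmeas C2 eta -> Intg leb eta ->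
  \int[leb]_x (dop m g x * eta x) = \int[leb]_x (g x * dop m eta x).
Proof.
move=> sm bg be ie.
have ag := avg_bmeas m bg; have ae := avg_Intg m be ie.
have i1 : Intg leb (fun x => avg m g x * eta x) by exact: bmeas_IntgM ag ie.
have i2 : Intg leb (fun x => g x * eta x) by exact: bmeas_IntgM bg ie.
have i3 : Intg leb (fun x => g x * avg m eta x) by exact: bmeas_IntgM bg ae.
rewrite (Rint_ext _ (g := fun x => avg m g x * eta x - mass m * (g x * eta x))); last first.
  by move=> x; rewrite /dop mulrBl mulrA.
rewrite [RHS](Rint_ext _ (g := fun x => g x * avg m eta x - mass m * (g x * eta x))); last first.
  by move=> x; rewrite /dop mulrBr mulrCA.
rewrite !RintB//; try exact: IntgZ.
congr (_ - _); rewrite (Rint_ext _ (g := fun x => eta x * avg m g x)); last by move=> x; exact: mulrC.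
rewrite -(avg_sym sm be ie bg); apply: Rint_ext => x; exact: mulrC.
Qed.

Lemma consistent_rate (nu : R -> {measure set V -> \bar R}) P (sigma : 'M[R]_(N, P)) mu psi K C :
  levy_measure mu -> consistent_op nu sigma mu -> testfam psi K C ->
  exists om : R -> R, om h @[h --> 0^'+] --> 0 /\ forall h, 0 < h ->
    forall m : fmeas, (forall g, discrete_op (nu h) g = discrete_op m g) ->
    forall t, \int[leb]_x `|dop m (fun x => psi (x, t)) x - levy_op_x sigma mu psi (x, t)| <= om h.
Proof.
(* The absolute value of omega is used because the rate may be negative, which would forbid
   enlarging the Sobolev norm to B. *)
move=> lmu [k [omega [omega0 H]]] tf; have [B B0 hB] := tf_sob tf k.
exists (fun h => B * `|omega h|); split.
  apply/cvgr0Pnorm_lt => e e0; move/cvgr0Pnorm_lt : omega0 => /(_ (e / (B + 1))).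
  have B1 : 0 < B + 1 by rewrite ltr_wpDl.
  rewrite divr_gt0// => /(_ isT); apply: filterS => h.
  rewrite normrM normr_id ger0_norm// ltr_pdivlMr// mulrC; apply: le_lt_trans.
  by rewrite ler_wpM2r// lerDl.
move=> h h0 m hm t; set eta := fun x => psi (x, t).
have ce : Cc_smooth eta := tf_Cc tf t.
have [Ce Ce0 be] := Cc_meas ce; have ie := Cc_Intg ce.
have [ml [G IG hG]] := levy_dom sigma lmu (tf_C2 tf).
have il : Intg leb (levy_op sigma mu eta).
  apply: Intg_le IG _; last by move=> x; exact: hG.
  exact: (measurableT_comp ml (measurable_pair2 t)).
have id : Intg leb (fun x => dop m eta x - levy_op sigma mu eta x).
  by apply: IntgB => //; exact: dop_Intg be ie.
have := H h h0 eta ce; rewrite Lnorm1.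
have -> : (\int[leb]_x `|(EFin \o (discrete_op (nu h) eta \- levy_op sigma mu eta)%R) x|)%E =
    (\int[leb]_x `|dop m eta x - levy_op sigma mu eta x|)%:E.
  rewrite Rint_EFin; last exact: Intg_abs.
  by apply: eq_integral => x _ /=; rewrite hm (discrete_opE _ _ be).
move=> /le_trans hh; rewrite -lee_fin; apply: hh.
apply: (@le_trans _ _ (sobolev1_norm k eta * `|omega h|%:E)%E).
  by apply: lee_wpmul2l; [exact: sobolev_ge0|rewrite lee_fin ler_norm].
by rewrite EFinM; apply: lee_wpmul2r => //; exact: hB.
Qed.

(** * Mollification of functions *)

Definition mconv (f : V -> R) (d : R) (y : V) : R := \int[leb]_x (f x * moll d (y - x)).

Lemma mconvE f d y : measurable_fun setT f -> 0 < d ->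
  mconv f d y = \int[leb]_z (f (y - z) * moll d z).
Proof.
move=> mf d0; have [C _ bm] := Cc_meas (Cc_moll d0).
rewrite /mconv -(Rint_refl y (f := fun x => f x * moll d (y - x))).
  by apply: Rint_ext => x; rewrite subKr.
by apply: measurable_funM => //; apply: measurable_refl; exact: bm.1.
Qed.

Lemma mconv_Intg_prod f d : Intg leb f -> 0 < d ->
  Intg (leb \x leb)%E (fun p : V * V => f (p.2 - p.1) * moll d p.1).
Proof.
move=> If d0; have [C C0 bm] := Cc_meas (Cc_moll d0).
have im := Cc_Intg (Cc_moll d0).
apply: (@Intg_prod _ _ _ _ _ leb leb _ (fun z => (\int[leb]_x `|f x|) * moll d z)).
- apply: measurable_funM; last exact: meas_fst bm.1.
  apply: (measurableT_comp (Intg_meas If)).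
  exact: (@measurable_subrV_swap R N).
- exact: IntgZ.
- move=> z /=; under eq_fun do rewrite mulrC; apply: IntgZ.
  exact: (Intg_shift (- z) If).
- move=> z /=; rewrite (Rint_ext _ (g := fun y : V => moll d z * `|f (y - z)|)); last first.
    by move=> y; rewrite normrM mulrC (ger0_norm (moll_ge0 _ _)).
  rewrite RintZ; last by apply: Intg_abs; exact: (Intg_shift (- z) If).
  rewrite (Rint_shift (- z) (f := fun x => `|f x|)) 1?mulrC//.
  exact: Intg_meas (Intg_abs If).
Qed.

(** The mollified function is an average of translates of f by vectors of norm at most d, so the L^1
    modulus of translations bounds the distance. *)
Lemma mconv_dist f d e : Intg leb f -> 0 < d ->
  (forall z, `|z| <= d -> \int[leb]_x `|f (x + z) - f x| <= e) ->
  Intg leb (mconv f d) /\ \int[leb]_y `|mconv f d y - f y| <= e.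
Proof.
move=> If d0 fe; have [C C0 bm] := Cc_meas (Cc_moll d0).
have im := Cc_Intg (Cc_moll d0).
have mf := Intg_meas If.
have i1 := mconv_Intg_prod If d0.
have Ic : Intg leb (mconv f d).
  have := Fubini_intg2 i1; congr (Intg leb _); apply/funext => y; rewrite mconvE//.
split => //.
have i2 : Intg (leb \x leb)%E (fun p : V * V => f p.2 * moll d p.1).
  apply: (@Intg_prod _ _ _ _ _ leb leb _ (fun z => (\int[leb]_x `|f x|) * moll d z)).
  - apply: measurable_funM; [exact: meas_snd mf|exact: meas_fst bm.1].
  - exact: IntgZ.
  - by move=> z /=; under eq_fun do rewrite mulrC; exact: IntgZ.
  - move=> z /=; rewrite (Rint_ext _ (g := fun y : V => moll d z * `|f y|)); last first.
      by move=> y; rewrite normrM mulrC (ger0_norm (moll_ge0 _ _)).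
    by rewrite RintZ 1?mulrC//; exact: Intg_abs.
have i3 : Intg (leb \x leb)%E (fun p : V * V => `|f (p.2 - p.1) - f p.2| * moll d p.1).
  have := Intg_abs (IntgB i1 i2); congr (Intg _ _); apply/funext => p /=.
  by rewrite -mulrBl normrM (ger0_norm (moll_ge0 _ _)).
apply: (@le_trans _ _ (\int[leb]_y \int[leb]_z (`|f (y - z) - f y| * moll d z))).
  apply: Rint_le_ae; [by apply: Intg_abs; exact: IntgB|exact: (Fubini_intg2 i3)|].
  have := Fubini_ae2 i3; have := Fubini_ae2 i1; apply: filterS2 => y h1 h3.
  rewrite mconvE// -[X in _ - X]mulr1 -(@moll_int d d0) -RintZ// -RintB//; last exact: IntgZ.
  apply: le_trans (Rint_norm _) _; first by apply: IntgB => //; exact: IntgZ.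
  rewrite le_eqVlt; apply/orP; left; apply/eqP; apply: Rint_ext => z.
  by rewrite -mulrBl normrM (ger0_norm (moll_ge0 _ _)).
rewrite -(Fubini_swap i3) -[e]mulr1 -(@moll_int d d0) -RintZ//.
apply: Rint_le; [exact: (Fubini_intg1 i3)|exact: IntgZ|move=> z /=].
rewrite (Rint_ext _ (g := fun y : V => moll d z * `|f (y - z) - f y|)); last by move=> y; exact: mulrC.
rewrite RintZ; last by apply: Intg_abs; apply: IntgB => //; exact: (Intg_shift (- z) If).
rewrite mulrC; have [zd|zd] := leP `|z| d; last by rewrite moll_out// !mulr0.
by apply: ler_wpM2r; [exact: moll_ge0|apply: fe; rewrite normrN].
Qed.

Lemma mconv_le f d y M : bmeas M f -> 0 < d -> `|mconv f d y| <= M.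
Proof.
move=> bf d0; have cm := Cc_refl y (Cc_moll d0).
have im := Cc_Intg cm.
rewrite -[leRHS]mulr1 -(@moll_int d d0) -(Rint_refl y (Intg_meas (Cc_Intg (Cc_moll d0)))) -RintZ//.
apply: (Rint_dom (bmeas_IntgM bf im)) => [|x]; first exact: IntgZ.
by rewrite normrM (ger0_norm (moll_ge0 _ _)) ler_wpM2r ?moll_ge0// bf.2.
Qed.

(** The modulus depends on f only through M. All interpolants, mollified at one scale, are therefore
    equicontinuous in space together. *)
Lemma mconv_lip f d y y' M : bmeas M f -> 0 < d ->
  `|mconv f d y - mconv f d y'| <= M * \int[leb]_x `|moll d (x + (y - y')) - moll d x|.
Proof.
move=> bf d0; have im w := Cc_Intg (Cc_refl w (Cc_moll d0)).
have mm := Cc_Intg (Cc_moll d0).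
have i w : Intg leb (fun x => f x * moll d (w - x)) by exact: bmeas_IntgM bf (im w).
rewrite /mconv -RintB//; apply: le_trans (Rint_norm _) _; first exact: IntgB.
have iA : Intg leb (fun x => `|moll d (x + (y - y')) - moll d x|).
  by apply: Intg_abs; apply: IntgB => //; exact: (Intg_shift (y - y') mm).
have iR := Intg_refl y' iA.
rewrite -(Rint_refl y' (Intg_meas iA)) -RintZ; last exact: iR.
apply: Rint_le; [by apply: Intg_abs; exact: IntgB|by apply: IntgZ; exact: iR|move=> x].
rewrite -mulrBr normrM (_ : y' - x + (y - y') = y - x); last by rewrite addrC addrA subrK.
by rewrite ler_wpM2r// bf.2.
Qed.

Lemma mconv_cvg (f : V -> R) : Intg leb f ->
  \int[leb]_y `|mconv f n.+1%:R^-1 y - f y| @[n --> \oo] --> (0 : R).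
Proof.
move=> If; apply/cvgr0Pnorm_le => e e0; have [d d0 hd] := trans_cts_ball If e0.
apply: filterS (near_infty_natSinv_lt (PosNum d0)) => n /= nd.
have n0 : 0 < (n.+1%:R : R)^-1 by rewrite invr_gt0.
have [|_ h] := @mconv_dist f _ e If n0.
  by move=> z zn; apply: ltW; apply: hd; exact: le_lt_trans zn nd.
by rewrite ger0_norm// Rint_ge0.
Qed.

Lemma mconv_adj C (f h : V -> R) d : bmeas C f -> Intg leb h -> 0 < d ->
  \int[leb]_y (mconv f d y * h y) = \int[leb]_x (f x * mconv h d x).
Proof.
move=> bf Ih d0; have I0 := mconv_Intg_prod Ih d0.
have Cr (y : V) : Cc_smooth (fun x : V => moll d (y - x) : R) by exact: Cc_refl (Cc_moll d0).
have [Cm _ bm] := Cc_meas (Cc_moll d0); have Im := Cc_Intg (Cc_moll d0).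
have I : Intg (leb \x leb)%E (fun p : V * V => f p.2 * (moll d (p.1 - p.2) * h p.1)).
  apply: (@Intg_prod _ _ _ _ _ leb leb _ (fun y => C * `|h y|)).
  - apply: measurable_funM; first exact: meas_snd bf.1.
    apply: measurable_funM; first exact: (measurableT_comp bm.1 (@measurable_subrV R N)).
    exact: meas_fst (Intg_meas Ih).
  - by apply: IntgZ; exact: Intg_abs.
  - move=> y; apply: bmeas_IntgM bf _; have := IntgZ (h y) (Intg_refl y Im).
    by congr (Intg _ _); apply/funext => x; exact: mulrC.
  - move=> y /=; have Ir := Cc_Intg (Cr y); have Jr := IntgZ (h y) Ir.
    have If : Intg leb (fun x => f x * (moll d (y - x) * h y)).
      by apply: bmeas_IntgM bf _; move: Jr; congr (Intg _ _); apply/funext => x; exact: mulrC.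
    rewrite -[leRHS]mulr1 -(@moll_int d d0) -(Rint_refl y (Intg_meas Im)) -RintZ; last exact: Ir.
    apply: Rint_le => [||x]; [exact: Intg_abs|exact: IntgZ Ir|].
    rewrite normrM normrM (ger0_norm (moll_ge0 _ _)) (mulrC (moll _ _)) mulrA.
    by rewrite ler_wpM2r ?moll_ge0// ler_wpM2r// bf.2.
transitivity (\int[leb]_y \int[leb]_x (f x * (moll d (y - x) * h y))).
  apply: Rint_ext => y; have J := bmeas_IntgM bf (Cc_Intg (Cr y)).
  by rewrite mulrC -(RintZ _ J); apply: Rint_ext => x; ring.
rewrite (Fubini_swap I) /=; apply: Rint_ext => x.
have Jr : Intg leb (fun y => h y * moll d (x - y)).
  under eq_fun do rewrite mulrC; apply: bmeas_IntgM _ Ih; split; last by move=> y; exact: bm.2.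
  exact: measurable_refl bm.1.
rewrite /mconv -(RintZ _ Jr); apply: Rint_ext => y.
by rewrite -(mollN d (y - x)) opprB (mulrC (moll _ _)).
Qed.

(** * Almost everywhere limits of fast Cauchy sequences *)

Definition rate (n : nat) : R := 1 / (2 ^ n.+1)%:R.

Lemma nbhs_rV_dist (y0 : V) d : 0 < d -> nbhs y0 [set y | `|y - y0| < d].
Proof.
by move=> d0; apply/nbhs_ballP; exists d => //= y; rewrite -ball_normE /= distrC.
Qed.

Lemma rate_gt0 n : 0 < rate n.
Proof. by rewrite divr_gt0// ltr0n expn_gt0. Qed.

Definition Qdist (k : nat) (v w : V -> R) : R := \int[leb]_x (\1_(Qbox k%:R) x * `|v x - w x|).

Lemma measurable_indic_Qbox k : measurable_fun setT (\1_(Qbox k%:R) : V -> R).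
Proof. by apply: measurable_indic; exact: measurable_Qbox. Qed.

Lemma Intg_Qbox k : Intg leb (\1_(Qbox k%:R) : V -> R).
Proof. by apply: indic_Intg; [exact: measurable_Qbox|exact: Qbox_fin]. Qed.

Lemma Intg_Qdist k v w M : bmeas M v -> bmeas M w -> Intg leb (fun x => \1_(Qbox k%:R) x * `|v x - w x|).
Proof.
move=> bv bw; under eq_fun do rewrite mulrC.
exact: bmeas_IntgM (bmeas_abs (bmeasB bv bw)) (Intg_Qbox k).
Qed.

(** The rates 1/2^(n+1) sum to at most 1, so the increments have an integrable sum on the box,
    finite almost everywhere, and the series converges absolutely. The sum starts at index k since
    the box of size k is controlled only from there on. *)
Lemma seq_ae_cvg (v : nat -> V -> R) M k :
  (forall n, bmeas M (v n)) -> (forall n, (k <= n)%N -> Qdist k (v n.+1) (v n) <= rate n) ->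
  {ae leb, forall x, Qbox k%:R x -> cvgn (fun n => v n x)}.
Proof.
move=> bv hv.
pose d n (x : V) : R := \1_(Qbox k%:R) x * `|v (n + k).+1 x - v (n + k)%N x|.
have d0 n x : 0 <= d n x by rewrite mulr_ge0// indicE.
have Id n : Intg leb (d n) by exact: Intg_Qdist (bv _) (bv _).
have mds : measurable_fun setT (fun x => (\sum_(0 <= n <oo) (d n x)%:E)%E).
  apply: ge0_emeasurable_sum => n; first by move=> x _ _; rewrite lee_fin.
  by move=> _; apply/measurable_EFinP; exact: Intg_meas.
have fin : (\int[leb]_x (\sum_(0 <= n <oo) (d n x)%:E) < +oo)%E.
  rewrite integral_nneseries//; last 2 first.
  - by move=> n; apply/measurable_EFinP; exact: Intg_meas.
  - by move=> n x _; rewrite lee_fin.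
  apply: (@le_lt_trans _ _ 1%:E); last exact: ltry.
  apply: le_trans (@epsilon_trick0 R 1 xpredT ler01).
  apply: lee_nneseries => [n _ _|n _]; first by apply: integral_ge0 => x _; rewrite lee_fin.
  rewrite -Rint_EFin// lee_fin; apply: le_trans (hv (n + k)%N (leq_addl _ _)) _.
  rewrite /rate ler_pM2l// lef_pV2 ?posrE ?ltr0n ?expn_gt0// ler_nat leq_exp2l//.
  by rewrite ltnS leq_addr.
have /integrable_ae : leb.-integrable setT (fun x => (\sum_(0 <= n <oo) (d n x)%:E)%E).
  apply/integrableP; split => //; apply: le_lt_trans fin; apply: ge0_le_integral => //.
  - exact: measurableT_comp.
  - move=> x _; rewrite gee0_abs//; apply: nneseries_ge0 => n _ _; by rewrite lee_fin.
move=> /(_ measurableT); apply: filterS => x /(_ I) fx Qx.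
have e n : v (n + k)%N x = v k x + series (telescope (fun n => v (n + k)%N x)) n.
  by have := eq_sum_telescope (fun n => v (n + k)%N x) n.
suff /cvg_ex[l sl] : cvgn (series (telescope (fun n => v (n + k)%N x))).
  apply/cvg_ex; exists (v k x + l); rewrite -(cvg_shiftn k) /=.
  by under eq_fun do rewrite e; apply: cvgD => //; exact: cvg_cst.
apply: normed_cvg; apply: nondecreasing_is_cvgn.
  by apply: nondecreasing_series => n _ _ /=.
exists (fine (\sum_(0 <= n <oo) (d n x)%:E)) => _ [n _ <-].
rewrite -lee_fin fineK//; apply: le_trans (nneseries_lim_ge n _); last by move=> j _ _; rewrite lee_fin.
rewrite sumEFin lee_fin /series /=; apply: ler_sum => j _.
by rewrite /d indic_in// mul1r.
Qed.

(** The exceptional null set depends on t. The limit superior selects the limit at all points at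
    once and is jointly Borel in (x, t), so a single function serves for every time; clipping makes
    its bound hold everywhere. *)
Lemma seq_limit (w : nat -> VT -> R) M : 0 <= M -> (forall n, bmeas M (w n)) ->
  (forall t k n m, (k <= n)%N -> (n <= m)%N ->
     Qdist k (fun x => w n (x, t)) (fun x => w m (x, t)) <= rate n) ->
  exists2 u : VT -> R, bmeas M u & forall t k n, (k <= n)%N ->
     Qdist k (fun x => w n (x, t)) (fun x => u (x, t)) <= rate n.
Proof.
move=> M0 bw hw.
pose u p := clip M (limn_sup (w ^~ p)).
have bu : bmeas M u.
  split.
    apply: measurable_maxr => //; apply: measurable_minr => //.
    apply: measurable_fun_limn_sup => [p _|p _|n]; last exact: (bw n).1.
      by exists M => _ [n _ <-]; have := (bw n).2 p; rewrite ler_norml => /andP[].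
    by exists (- M) => _ [n _ <-]; have := (bw n).2 p; rewrite ler_norml => /andP[].
  by move=> p; rewrite ler_norml /u /clip le_max lexx/= ge_max ge_min lexx; rewrite andbT; lra.
have lim p l : w n p @[n --> \oo] --> l -> u p = l.
  move=> wl; rewrite /u (cvg_limn_inf_sup wl).2 clip_id//.
  have wn : `|w n p| @[n --> \oo] --> `|l| by exact: cvg_norm.
  rewrite -(cvg_lim _ wn)//.
  apply: limr_le; first by apply/cvg_ex; exists `|l|.
  by apply: nearW => n; exact: (bw n).2.
exists u => // t k n kn.
have slice v : bmeas M v -> bmeas M (fun x : V => v (x, t) : R).
  by move=> [mv bv]; split; [exact: (measurableT_comp mv (measurable_pair2 t))|move=> x].
have bwt j := slice _ (bw j); have but := slice _ bu.
have ac : {ae leb, forall x, Qbox k%:R x -> cvgn (fun n => w n (x, t))}.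
  apply: (@seq_ae_cvg (fun n x => w n (x, t)) M) => // j kj.
  rewrite /Qdist; under eq_fun do rewrite distrC; exact: (hw t k j j.+1).
have [|||||_ _ cv] := @DCT _ _ _ leb (fun m x => \1_(Qbox k%:R) x * `|w n (x, t) - w m (x, t)|)
   (fun x => \1_(Qbox k%:R) x * `|w n (x, t) - u (x, t)|) (fun x => (M + M) * \1_(Qbox k%:R) x).
- by move=> m; exact: Intg_meas (Intg_Qdist k (bwt n) (bwt m)).
- exact: Intg_meas (Intg_Qdist k (bwt n) but).
- move: ac; apply: filterS => x hx; have [Qx|Qx] := pselect (Qbox k%:R x); last first.
    rewrite indic_out// mul0r; under eq_fun do rewrite mul0r; exact: cvg_cst.
  have := hx Qx => /cvg_ex[l wl]; rewrite (lim _ _ wl) indic_in// mul1r.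
  under eq_fun do rewrite mul1r; apply: cvg_norm; apply: cvgB => //; exact: cvg_cst.
- by apply: IntgZ; exact: Intg_Qbox.
- move=> m; apply: aeW => x; rewrite normrM normr_id mulrC ger0_norm ?indicE//.
  by rewrite ler_wpM2r//; apply: le_trans (ler_normB _ _) _; apply: lerD; [exact: (bwt n).2|exact: (bwt m).2].
rewrite /Qdist -(cvg_lim _ cv)//; apply: limr_le; first by apply/cvg_ex; eexists; exact: cv.
exists n => // m /= nm; exact: (hw t k n m).
Qed.

(** * Families of schemes and their limit operators *)

Record limit_op := LimitOp {
  lo_P : nat; lo_sigma : 'M[R]_(N, lo_P); lo_mu : {measure set V -> \bar R}; lo_f : R -> R }.

Definition lo_op (L : limit_op) := levy_op_x (lo_sigma L) (lo_mu L).

Record scheme_family (T M : R) (u0 : V -> R) (g : VT -> R) (ninf : R -> R) (S : R -> scheme R N)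
  (m1 m2 : R -> fmeas) (W : R -> nat -> V -> R) (L1 L2 : limit_op) : Prop := Family {
  fam_T : 0 < T;
  fam_M : 0 <= M;
  fam_u0 : Intg leb u0;
  fam_src : source_data T g ninf;
  fam_good : forall h, 0 < h -> good_scheme T (S h) M u0 g (m1 h) (m2 h) (W h);
  fam_step : max_step (S h) @[h --> 0^'+] --> 0;
  fam_f1 : nondecreasing_continuous (lo_f L1);
  fam_f2 : nondecreasing_continuous (lo_f L2);
  fam_mu1 : levy_measure (lo_mu L1);
  fam_mu2 : levy_measure (lo_mu L2);
  fam_op1 : consistent_op (fun h => nu1 (S h)) (lo_sigma L1) (lo_mu L1);
  fam_op2 : consistent_op (fun h => nu2 (S h)) (lo_sigma L2) (lo_mu L2);
  fam_phi1 : {family compact, phi1 (S h) @[h --> 0^'+] --> lo_f L1};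
  fam_phi2 : {family compact, phi2 (S h) @[h --> 0^'+] --> lo_f L2} }.

Lemma compact_cvg_near (F : R -> R -> R) (f : R -> R) M e :
  {family compact, F h @[h --> 0^'+] --> f} -> 0 < e ->
  \forall h \near 0^'+, forall r, `|r| <= M -> `|F h r - f r| < e.
Proof.
move=> /fam_cvgP /(_ `[- M, M]%classic (@segment_compact R _ _)) H e0.
have /H : nbhs (f : {uniform` `[- M, M]%classic -> R}) [set h | forall r, `[- M, M]%classic r -> ball (f r) e (h r)].
  apply/uniform_nbhs; exists [set xy | ball xy.1 e xy.2]; split => //.
  exact: (entourage_ball _ (PosNum e0)).
rewrite /=; apply: filterS => h hh r rM.
by have := hh r; rewrite /= in_itv/= -ler_norml rM => /(_ isT); rewrite /ball /= distrC.
Qed.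

Lemma mono_bnd M (f : R -> R) r : {homo f : x y / x <= y} -> `|r| <= M -> `|f r| <= `|f M| + `|f (- M)|.
Proof.
move=> hf; rewrite ler_norml => /andP[a b]; have := hf _ _ a; have := hf _ _ b => h1 h2.
rewrite ler_norml; apply/andP; split.
  by apply: le_trans _ h2; rewrite lerNl; apply: le_trans (ler_norm _) _; rewrite normrN lerDr.
by apply: (le_trans h1); apply: le_trans (ler_norm _) _; rewrite lerDl.
Qed.

Lemma compact_Qbox (K : set V) : compact K -> exists k : nat, K `<=` Qbox k%:R.
Proof.
move=> /compact_bounded[B [_ hB]]; pose k := Num.bound (`|B| + 1); exists k => x Kx.
have Bk : `|B| + 1 < k%:R by apply: archi_boundP; rewrite addr_ge0.
apply: Qbox_norm; first by apply: le_lt_trans Bk; rewrite addr_ge0.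
apply: le_lt_trans Bk; have h : B < `|B| + 1 by rewrite (le_lt_trans (ler_norm B)) ?ltrDl.
exact: (hB _ h x Kx).
Qed.

Lemma lo_slice psi (L : limit_op) K C : levy_measure (lo_mu L) -> testfam psi K C ->
  measurable_fun [set: VT] (lo_op L psi) /\ exists2 H : V -> R, Intg leb H &
    (forall x t, `|lo_op L psi (x, t)| <= H x) /\ forall t, Intg leb (fun x => lo_op L psi (x, t)).
Proof.
move=> lm tf; have [ml [H IH hH]] := levy_dom (lo_sigma L) lm (tf_C2 tf).
split => //; exists H => //; split => // t; apply: Intg_le IH (hH ^~ t).
exact: (measurableT_comp ml (measurable_pair2 (t : RT))).
Qed.

Lemma measurable_itv_snd (a b : R) : measurable_fun [set: VT] (fun p : VT => itv_ind a b p.2).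
Proof. exact: meas_snd (measurable_itv_ind a b). Qed.

(** A majorant independent of time is integrable over a strip of finite height. This gives
    integrability in space-time without assuming u integrable there. *)
Lemma Intg_strip (q : VT -> R) (H : V -> R) a b : measurable_fun setT q -> Intg leb H ->
  (forall x t, `|q (x, t)| <= H x) -> Intg lebT (fun p : VT => itv_ind a b p.2 * q p).
Proof.
move=> mq IH qH.
have mp : measurable_fun [set: VT] (fun p : VT => itv_ind a b p.2 * q p).
  by apply: measurable_funM => //; exact: measurable_itv_snd.
have ii := Intg_itv_ind a b.
have bd x t : `|itv_ind a b t * q (x, t)| <= H x * itv_ind a b t.
  by rewrite normrM (ger0_norm (itv_ind_ge0 _ _ _)) mulrC ler_wpM2r ?itv_ind_ge0.
have Ix x : Intg lam (fun t => itv_ind a b t * q (x, t)).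
  apply: (Intg_le (g := fun t => H x * itv_ind a b t)) => [||t]; [|exact: IntgZ|exact: bd].
  exact: (measurableT_comp mp (measurable_pair1 x)).
apply: (@Intg_prod _ _ _ _ _ leb lam _ (fun x => (\int[lam]_t itv_ind a b t) * H x)) => //.
  exact: IntgZ.
move=> x; rewrite mulrC -RintZ//; apply: Rint_le => [||t]; [exact: Intg_abs|exact: IntgZ|exact: bd].
Qed.

(** * Integration by parts in time *)

Lemma slice_dt (psi : V * R -> R) (x : V) : smooth psi -> forall t : R,
  is_derive t 1 (fun s => psi (x, s)) (dt psi (x, t)).
Proof.
move=> sp t.
have e : (fun h : R => h^-1 *: (((fun s => psi (x, s)) \o shift t) (h *: (1 : R^o)) - psi (x, t))) =
    (fun h : R => h^-1 *: ((psi \o shift (x, t)) (h *: ((0, 1) : V * R)) - psi (x, t))).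
  apply/funext => h /=; congr (_ *: (psi _ - _)); congr (_, _) => /=.
  by rewrite scaler0 add0r.
have d : derivable psi (x, t) ((0, 1) : V * R) by exact: smooth_derivable.
by split; rewrite /derivable /dt /derive e.
Qed.

Lemma slice_dt_continuous (psi : V * R -> R) (x : V) : smooth psi -> continuous (fun t : R => dt psi (x, t)).
Proof.
move=> sp; have cd : continuous (dt psi) by apply: smooth_continuous; exact: smooth_derive.
move=> t; apply: (@continuous_comp _ _ _ (fun t : R => (x, t)) (dt psi)); last exact: cd.
by apply: (@cvg_pair _ _ _ _ (nbhs x) (nbhs t) _ _ _ (fun=> x) id); [exact: cvg_cst|exact: cvg_id].
Qed.

Lemma FTC_line (h h' : R -> R) (a b : R) : (forall t : R, is_derive t 1 h (h' t)) -> continuous h' -> a <= b ->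
  \int[lam]_t (itv_ind a b t * h' t) = h b - h a.
Proof.
move=> dh ch; rewrite le_eqVlt => /orP[/eqP<-|ab].
  rewrite subrr (Rint_eq0 _)// => t.
  by rewrite itv_indE; case: ltP => //= h1; rewrite ?mul0r// leNgt h1 mul0r.
have chh : continuous h.
  by move=> t; apply: differentiable_continuous; apply/derivable1_diffP; have [] := dh t.
have mh : measurable_fun [set: RT] h' by exact: continuous_measurable_fun.
rewrite -Rint_itv_open// /Rintegral -(@integral_itv_bndoo R a b _ true false); last first.
  by apply/measurable_EFinP; exact: measurable_funTS.
rewrite (@continuous_FTC2 R h' h a b ab (continuous_subspaceT ch))//.
  split; [by move=> t _; have [] := dh t|exact: cvg_at_right_filter (chh a)|exact: cvg_at_left_filter (chh b)].
by move=> t _; rewrite derive1E; have [] := dh t.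
Qed.

Lemma ramp_int (a b t : R) : a < b -> ramp a b t = (b - a)^-1 * \int[lam]_s (itv_ind a b s * (s <= t)%R%:R).
Proof.
move=> ab; have b0 : b - a != 0 by rewrite subr_eq0 gt_eqF.
have [ta|ta] := leP t a.
  rewrite ramp0// (Rint_eq0 _) ?mulr0// => s.
  rewrite itv_indE; case: ltP => //= s1; rewrite ?mul0r// [s <= t]leNgt (le_lt_trans ta s1) mulr0//.
have [bt|tb] := leP b t.
  rewrite ramp1// (Rint_ext _ (g := itv_ind a b)) ?Rint_itv_ind ?(ltW ab) ?mulVf// => s.
  rewrite itv_indE; case: (leP s b) => sb; last by rewrite andbF mul0r.
  by rewrite (le_trans sb bt) mulr1.
rewrite rampE ?(ltW ta) ?(ltW tb)// (Rint_ext _ (g := itv_ind a t)) ?Rint_itv_ind ?(ltW ta)// 1?mulrC// => s.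
rewrite !itv_indE; case: (leP s t) => st; last by rewrite andbF mulr0.
by rewrite (le_trans st (ltW tb)) mulr1.
Qed.

Lemma ae_neq (s : R) : {ae lam, forall t : RT, t != s :> R}.
Proof.
exists [set s]; split => //; first exact: lebesgue_measure_set1.
by move=> t /= /negP; rewrite negbK => /eqP.
Qed.

(** A ramp is the normalised primitive of the indicator of its cell. Exchanging the integrals and
    using h(T) = 0 turns h' into minus the mean of h over the cell, without ever differentiating the
    ramp at its corners. *)
Lemma ramp_parts (h h' : R -> R) (T a b C : R) : (forall t : R, is_derive t 1 h (h' t)) -> continuous h' ->
  (forall t, `|h' t| <= C) -> h T = 0 -> 0 <= a -> a < b -> b <= T ->
  \int[lam]_t (itv_ind 0 T t * (ramp a b t * h' t)) = - ((b - a)^-1 * \int[lam]_s (itv_ind a b s * h s)).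
Proof.
move=> dh ch hC hT a0 ab bT.
have mh' : measurable_fun [set: RT] h' by exact: continuous_measurable_fun.
pose F (p : RT * RT) : R := itv_ind 0 T p.1 * (itv_ind a b p.2 * ((p.2 <= p.1)%R%:R * h' p.1)).
have m12 : measurable_fun [set: RT * RT] (fun p => (p.2 <= p.1)%R%:R : R).
  have mb := @measurable_fun_ler _ _ R setT _ _ (@measurable_snd _ _ RT RT) (@measurable_fst _ _ RT RT).
  rewrite (_ : (fun p => _) = fun p : RT * RT => if (p.2 <= p.1)%R then 1 else 0 : R); last first.
    by apply/funext => p; case: ifP.
  exact: measurable_fun_ifT.
have mF : measurable_fun setT F.
  apply: measurable_funM; first exact: meas_fst (measurable_itv_ind 0 T).
  apply: measurable_funM; first exact: meas_snd (measurable_itv_ind a b).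
  by apply: measurable_funM => //; exact: meas_fst mh'.
have bF t s : `|F (t, s)| <= C * itv_ind 0 T t * itv_ind a b s.
  rewrite /F /= !normrM !(ger0_norm (itv_ind_ge0 _ _ _)).
  rewrite (_ : C * _ * _ = itv_ind 0 T t * (itv_ind a b s * C)); last by ring.
  do 2 (apply: ler_wpM2l; first exact: itv_ind_ge0).
  have C0 : 0 <= C := le_trans (normr_ge0 _) (hC 0).
  by case: (s <= t); rewrite ?normr1 ?normr0 ?mul1r ?mul0r.
have IF : Intg (lam \x lam)%E F.
  have ii := Intg_itv_ind a b.
  have It t : Intg lam (fun s => F (t, s)).
    apply: (Intg_le (g := fun s => C * itv_ind 0 T t * itv_ind a b s)) => [||s]; [|exact: IntgZ|exact: bF].
    exact: (measurableT_comp mF (measurable_pair1 t)).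
  apply: (@Intg_prod _ _ _ _ _ lam lam _ (fun t => (C * \int[lam]_s itv_ind a b s) * itv_ind 0 T t)) => //.
    by apply: IntgZ; exact: Intg_itv_ind.
  move=> t; rewrite mulrAC -RintZ//; apply: Rint_le => [||s]; [exact: Intg_abs|exact: IntgZ|exact: bF].
have e1 : \int[lam]_t (itv_ind 0 T t * (ramp a b t * h' t)) = (b - a)^-1 * \int[lam]_t \int[lam]_s F (t, s).
  rewrite -RintZ; last exact: Fubini_intg1 IF.
  apply: Rint_ext => t; rewrite ramp_int//.
  rewrite (Rint_ext _ (f := fun s => F (t, s)) (g := fun s => (itv_ind 0 T t * h' t) * (itv_ind a b s * (s <= t)%R%:R))); last first.
    by move=> s; rewrite /F /=; ring.
  rewrite RintZ; first by ring.
  apply: (Intg_le (g := itv_ind a b)) => [||s]; [|exact: Intg_itv_ind|].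
    apply: measurable_funM; first exact: measurable_itv_ind.
    exact: (measurableT_comp m12 (measurable_pair1 t)).
  by rewrite normrM (ger0_norm (itv_ind_ge0 _ _ _)); case: (s <= t); rewrite ?normr1 ?normr0 ?mulr1 ?mulr0 ?itv_ind_ge0.
rewrite e1 (Fubini_swap IF) -mulrN; congr (_ * _).
rewrite (Rint_ext _ (f := fun s => itv_ind a b s * h s) (g := fun s => -1 * \int[lam]_t F (t, s))).
  by rewrite RintZ ?mulN1r ?opprK//; exact: Fubini_intg2 IF.
move=> s; rewrite itv_indE; case: (boolP (a < s <= b)) => [/andP[sa sb]|sab]; last first.
  rewrite mul0r (Rint_eq0 _) ?mulr0// => t.
  by rewrite /F /= [itv_ind a b s]itv_indE (negbTE sab) mul0r mulr0.
have sT := le_trans sb bT; have s0 : 0 <= s := le_trans a0 (ltW sa).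
rewrite mul1r -[h s]opprK -[- h s]add0r -hT -(FTC_line dh ch sT) mulN1r; congr (- _).
apply: Rint_ae; [by apply: measurable_funM => //; exact: measurable_itv_ind
                |exact: (measurableT_comp mF (measurable_pair2 s))|].
have := ae_neq s; apply: filterS => t ts.
rewrite /F /= !itv_indE sa sb /= mul1r (le_eqVlt s t) eq_sym (negbTE ts) /=.
case: (ltP s t) => st /=; last by rewrite mul0r mulr0.
by rewrite (le_lt_trans s0 st) mul1r.
Qed.

Lemma Intg_itv_bdd (q : RT -> R) a b C : bmeas C q -> Intg lam (fun t => itv_ind a b t * q t).
Proof. by move=> bq; under eq_fun do rewrite mulrC; exact: bmeas_IntgM bq (Intg_itv_ind a b). Qed.

Lemma swap_strip (psi : VT -> R) (G H : V -> R) a b C : bmeas C psi -> measurable_fun setT G -> Intg leb H ->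
  (forall x t, `|G x * psi (x, t)| <= H x) ->
  [/\ Intg lam (fun t => itv_ind a b t * \int[leb]_x (G x * psi (x, t))),
      Intg leb (fun x => G x * \int[lam]_t (itv_ind a b t * psi (x, t))) &
      \int[leb]_x (G x * \int[lam]_t (itv_ind a b t * psi (x, t))) =
      \int[lam]_t (itv_ind a b t * \int[leb]_x (G x * psi (x, t)))].
Proof.
move=> bp mG IH GH.
have mq : measurable_fun [set: VT] (fun p : VT => G p.1 * psi p).
  by apply: measurable_funM; [exact: meas_fst mG|exact: bp.1].
have I := @Intg_strip (fun p : VT => G p.1 * psi p) H a b mq IH GH.
have e1 x : \int[lam]_t (itv_ind a b t * (G x * psi (x, t))) = G x * \int[lam]_t (itv_ind a b t * psi (x, t)).
  rewrite -RintZ; first by apply: Rint_ext => t; rewrite mulrCA.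
  apply: (@Intg_itv_bdd (fun t => psi (x, t)) a b C); split; last by move=> t; exact: bp.2.
  exact: (measurableT_comp bp.1 (measurable_pair1 x)).
have e2 t : \int[leb]_x (itv_ind a b t * (G x * psi (x, t))) = itv_ind a b t * \int[leb]_x (G x * psi (x, t)).
  rewrite RintZ//; apply: Intg_le IH (GH ^~ t).
  exact: (measurableT_comp mq (measurable_pair2 t)).
split.
- by have := Fubini_intg2 I; rewrite /=; under eq_fun do rewrite e2.
- by have := Fubini_intg1 I; rewrite /=; under eq_fun do rewrite e1.
- have := Fubini_swap I; rewrite /= => h.
  transitivity (\int[leb]_x \int[lam]_t (itv_ind a b t * (G x * psi (x, t)))).
    by apply: Rint_ext => x; rewrite e1.
  by rewrite h; apply: Rint_ext => t; rewrite e2.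
Qed.

(** * Limits of nonlinear pairings *)

Definition tail (k : nat) (q : V -> R) (x : V) : R :=
  `|q x| * (1 - \1_(Qbox k%:R) x * (`|q x| <= k%:R)%R%:R).

Lemma tail_ge0 k q x : 0 <= tail k q x.
Proof.
rewrite mulr_ge0// subr_ge0 indicE.
by case: (x \in _); case: (`|q x| <= k%:R); rewrite ?mulr1 ?mulr0 ?mul0r ?ler01 ?lexx.
Qed.

Lemma tail_le k q x : tail k q x <= `|q x|.
Proof.
rewrite /tail -[leRHS]mulr1 ler_wpM2l// gerBl mulr_ge0// indicE//.
Qed.

Lemma measurable_tail k q : measurable_fun setT q -> measurable_fun setT (tail k q).
Proof.
move=> mq; have ma : measurable_fun setT (fun x => `|q x|) by exact: measurableT_comp.
apply: measurable_funM => //; apply: measurable_funB => //; apply: measurable_funM.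
  exact: measurable_indic_Qbox.
rewrite (_ : (fun x => _) = fun x => if `|q x| <= k%:R then 1 else 0 : R); last first.
  by apply/funext => x; case: ifP.
by apply: measurable_fun_ifT => //; exact: measurable_fun_ler.
Qed.

Lemma tail_small q e : Intg leb q -> 0 < e -> exists k, \int[leb]_x tail k q x < e.
Proof.
move=> Iq e0; have mq := Intg_meas Iq.
have [|||||_ _] := @DCT _ _ _ leb (tail^~ q) (fun=> 0) (fun x => `|q x|).
- by move=> k; exact: measurable_tail.
- exact: measurable_cst.
- apply: aeW => x; apply: cvg_near_cst.
  have : (\bigcup_n @Qbox n%:R) x by rewrite Qbox_bigcup.
  move=> [k1 _ Qx]; exists (maxn k1 (Num.bound `|q x|)) => // k /= hk.
  have k1k : (k1 <= k)%N by apply: leq_trans hk; exact: leq_maxl.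
  have bk : (Num.bound `|q x| <= k)%N by apply: leq_trans hk; exact: leq_maxr.
  have Qk : Qbox k%:R x by move: x Qx {hk bk}; apply/subsetPset; exact: nd_Qbox.
  rewrite /tail indic_in// mul1r (_ : (`|q x| <= k%:R) = true) ?subrr ?mulr0//.
  by apply: le_trans (ltW (archi_boundP (normr_ge0 _))) _; rewrite ler_nat.
- exact: Intg_abs.
- by move=> k; apply: aeW => x; rewrite ger0_norm ?tail_ge0// tail_le.
rewrite Rint_zero => /cvgrPdist_lt/(_ _ e0)[k _ /(_ k (leqnn k))].
by rewrite sub0r normrN => h; exists k; apply: le_lt_trans h; exact: ler_norm.
Qed.

(** Since v_n converges only locally, q is split into its part inside a box and below height k, and
    its [tail]. Five contributions of e / 5 arise: the L^1 error of q_n; the uniform error of phi_n;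
    the tail; the modulus of continuity of phi where |v_n - v| < d; and elsewhere the constant 2 A,
    which is at most (2 A / d) |v_n - v| and hence controlled by [Qdist]. *)
Lemma comp_cvg (M A : R) (phi_n : nat -> R -> R) (phi : R -> R) (v_n : nat -> V -> R) (v : V -> R)
    (q_n : nat -> V -> R) (q : V -> R) (D : nat -> R) : continuous phi ->
  (forall e, 0 < e -> \forall n \near \oo, forall r, `|r| <= M -> `|phi_n n r - phi r| < e) ->
  (forall n, bmeas (D n) (phi_n n \o v_n n)) -> bmeas A (phi \o v) ->
  (forall r, `|r| <= M -> `|phi r| <= A) ->
  (forall n, bmeas M (v_n n)) -> bmeas M v ->
  (forall k, Qdist k (v_n n) v @[n --> \oo] --> (0 : R)) ->
  (forall n, Intg leb (q_n n)) -> Intg leb q ->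
  \int[leb]_x `|q_n n x - q x| @[n --> \oo] --> (0 : R) ->
  \int[leb]_x (phi_n n (v_n n x) * q_n n x) @[n --> \oo] --> \int[leb]_x (phi (v x) * q x).
Proof.
move=> cphi cphin bpn bp pA bvn bv Qv Iqn Iq qn.
pose B := \int[leb]_x `|q x|; have B0 : 0 <= B by exact: Rint_ge0.
have A0 : 0 <= A by apply: le_trans (bp.2 0).
have A2 : 0 < A + 1 by rewrite ltr_wpDl.
have B1 : 0 < B + 1 by rewrite ltr_wpDl.
have iq n : Intg leb (fun x => phi_n n (v_n n x) * q_n n x) by exact: bmeas_IntgM (bpn n) (Iqn n).
have iq0 : Intg leb (fun x => phi (v x) * q x) by exact: bmeas_IntgM bp Iq.
apply/cvgrPdist_le => e e0.
have e5 : 0 < e / 5 by rewrite divr_gt0.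
have eA : 0 < e / 5 / (A + 1) by rewrite divr_gt0.
have eB : 0 < e / 5 / (B + 1) by rewrite divr_gt0.
have eA2 : 0 < e / 5 / (2 * (A + 1)) by rewrite divr_gt0// mulr_gt0.
have [d d0 hd] := unif_cont_on M cphi eB.
have [k hk] := tail_small Iq eA2.
pose c := k%:R * (2 * A / d); have c0 : 0 <= c by rewrite /c !mulr_ge0// invr_ge0 ltW.
have c1 : 0 < c + 1 by rewrite ltr_wpDl.
have ec : 0 < e / 5 / (c + 1) by rewrite divr_gt0.
have mtk := measurable_tail k (Intg_meas Iq).
have Itk : Intg leb (tail k q).
  apply: Intg_le (Intg_abs Iq) _ => // x; by rewrite ger0_norm ?tail_ge0 ?tail_le.
near=> n.
have p1 : forall r, `|r| <= M -> `|phi_n n r - phi r| < Num.min 1 (e / 5 / (B + 1)).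
  near: n; apply: cphin; by rewrite lt_min ltr01.
have q1 : \int[leb]_x `|q_n n x - q x| < e / 5 / (A + 1).
  by apply: le_lt_trans (ler_norm _) _; near: n; move/cvgr0Pnorm_lt : qn; exact.
have v1 : Qdist k (v_n n) v < e / 5 / (c + 1).
  by apply: le_lt_trans (ler_norm _) _; near: n; move/cvgr0Pnorm_lt : (Qv k); exact.
have Iqd : Intg leb (fun x => `|q_n n x - q x|) by apply: Intg_abs; exact: IntgB.
have IQd := Intg_Qdist k (bvn n) bv.
have Iaq := Intg_abs Iq.
rewrite -RintB//; apply: (@le_trans _ _ (\int[leb]_x ((A + 1) * `|q_n n x - q x| + (e / 5 / (B + 1)) * `|q x| +
   (2 * (A + 1) * tail k q x + (e / 5 / (B + 1)) * `|q x| + c * (\1_(Qbox k%:R) x * `|v_n n x - v x|))))).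
  apply: (Rint_dom (IntgB iq0 (iq n))) => [|x]; first by do ![apply: IntgD|apply: IntgZ].
  have vx := (bv.2 x); have vnx := (bvn n).2 x.
  have := p1 _ vnx; rewrite lt_min => /andP[pa pb].
  have b1 : `|phi_n n (v_n n x)| <= A + 1.
    rewrite -(subrK (phi (v_n n x)) (phi_n n (v_n n x))) addrC; apply: le_trans (ler_normD _ _) _.
    by apply: lerD; [exact: pA|exact: ltW].
  have b3 : `|phi (v_n n x) - phi (v x)| * `|q x| <= 2 * (A + 1) * tail k q x + (e / 5 / (B + 1)) * `|q x|
      + c * (\1_(Qbox k%:R) x * `|v_n n x - v x|).
    have b2A : `|phi (v_n n x) - phi (v x)| <= 2 * (A + 1).
      by apply: le_trans (ler_normB _ _) _; have := pA _ vx; have := pA _ vnx; lra.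
    have t0 := tail_ge0 k q x.
    have [Qx|Qx] := pselect (Qbox k%:R x); last first.
      rewrite indic_out// mul0r mulr0 addr0 /tail indic_out// mul0r subr0 mulr1.
      by apply: (@le_trans _ _ (2 * (A + 1) * `|q x|)); [rewrite ler_wpM2r|rewrite lerDl mulr_ge0// ltW].
    rewrite indic_in// mul1r; have [qk|qk] := leP `|q x| k%:R; last first.
      have -> : tail k q x = `|q x| by rewrite /tail indic_in// mul1r leNgt qk subr0 mulr1.
      rewrite -addrA; apply: (@le_trans _ _ (2 * (A + 1) * `|q x|)); first by rewrite ler_wpM2r.
      rewrite lerDl; apply: addr_ge0; last exact: mulr_ge0.
      by apply: mulr_ge0 => //; exact: ltW.
    have t2 : 0 <= 2 * (A + 1) * tail k q x by rewrite mulr_ge0// mulr_ge0// ltW.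
    have [dx|dx] := ltP `|v_n n x - v x| d.
      have := hd _ _ vx dx => /ltW h3; have := ler_wpM2r (normr_ge0 (q x)) h3.
      have : 0 <= c * `|v_n n x - v x| by rewrite mulr_ge0.
      lra.
    have h4 : `|phi (v_n n x) - phi (v x)| <= (2 * A / d) * `|v_n n x - v x|.
      apply: (@le_trans _ _ (2 * A)).
        by apply: le_trans (ler_normB _ _) _; have := pA _ vx; have := pA _ vnx; lra.
      by rewrite mulrAC ler_pdivlMr// ler_wpM2l// mulr_ge0.
    have h5 : `|phi (v_n n x) - phi (v x)| * `|q x| <= c * `|v_n n x - v x|.
      rewrite /c -mulrA mulrC; apply: ler_pM => //.
    have : 0 <= e / 5 / (B + 1) * `|q x| by rewrite mulr_ge0// ltW.
    lra.
  rewrite distrC (_ : _ - _ = phi_n n (v_n n x) * (q_n n x - q x) + (phi_n n (v_n n x) - phi (v_n n x)) * q x +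
     (phi (v_n n x) - phi (v x)) * q x); last by ring.
  apply: le_trans (ler_normD _ _) _; apply: lerD; last by rewrite normrM.
  apply: le_trans (ler_normD _ _) _; rewrite !normrM; apply: lerD; first by rewrite ler_wpM2r.
  by rewrite ler_wpM2r// ltW.
have i3 : Intg leb (fun x => 2 * (A + 1) * tail k q x + e / 5 / (B + 1) * `|q x|) by apply: IntgD; exact: IntgZ.
have i4 : Intg leb (fun x => c * (\1_(Qbox k%:R) x * `|v_n n x - v x|)) by exact: IntgZ.
have i1 : Intg leb (fun x => (A + 1) * `|q_n n x - q x| + e / 5 / (B + 1) * `|q x|) by apply: IntgD; exact: IntgZ.
rewrite RintD//; last exact: IntgD.
rewrite !RintD//; try exact: IntgZ.
rewrite !RintZ// -/B -/(Qdist k (v_n n) v).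
have g1 : (A + 1) * \int[leb]_x `|q_n n x - q x| <= e / 5 by rewrite mulrC -ler_pdivlMr// ltW.
have g2 : e / 5 / (B + 1) * B <= e / 5.
  by rewrite mulrAC ler_pdivrMr// ler_wpM2l ?(ltW e5)// lerDl.
have g3 : 2 * (A + 1) * \int[leb]_x tail k q x <= e / 5.
  by rewrite mulrC -ler_pdivlMr ?mulr_gt0// ltW.
have g4 : c * Qdist k (v_n n) v <= e / 5.
  have Q0 : 0 <= Qdist k (v_n n) v by apply: Rint_ge0 => x; rewrite mulr_ge0// indicE.
  apply: (@le_trans _ _ ((c + 1) * Qdist k (v_n n) v)); first by rewrite ler_wpM2r// lerDl.
  by rewrite mulrC -ler_pdivlMr// ltW.
lra.
Unshelve. all: by end_near. Qed.

Lemma Qdist_triangle k M (u v w : V -> R) : bmeas M u -> bmeas M v -> bmeas M w ->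
  Qdist k u w <= Qdist k u v + Qdist k v w.
Proof.
move=> bu bv bw; rewrite /Qdist -RintD; [|exact: Intg_Qdist bu bv|exact: Intg_Qdist bv bw].
apply: Rint_le => [||x]; first exact: Intg_Qdist bu bw.
  by apply: IntgD; [exact: Intg_Qdist bu bv|exact: Intg_Qdist bv bw].
rewrite -mulrDr ler_wpM2l ?indicE//.
have -> : u x - w x = (u x - v x) + (v x - w x) by ring.
exact: ler_normD.
Qed.

Lemma Qdist_ge0 k (u v : V -> R) : 0 <= Qdist k u v.
Proof. by apply: Rint_ge0 => x; rewrite mulr_ge0// indicE. Qed.

Lemma Qdist_sym k (u v : V -> R) : Qdist k u v = Qdist k v u.
Proof. by apply: Rint_ext => x; rewrite distrC. Qed.

Lemma Intg_exhaust (f : V -> R) C M : bmeas M f ->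
  (forall k, \int[leb]_x (\1_(Qbox k%:R) x * `|f x|) <= C) ->
  Intg leb f /\ \int[leb]_x `|f x| <= C.
Proof.
move=> bf fC.
have ba := bmeas_abs bf.
have Ik k : Intg leb (fun x => \1_(Qbox k%:R) x * `|f x|).
  by under eq_fun do rewrite mulrC; exact: bmeas_IntgM ba (Intg_Qbox k).
pose F k x : \bar R := (\1_(Qbox k%:R) x * `|f x|)%:E.
have lim x : limn (F ^~ x) = `|f x|%:E.
  apply: cvg_lim => //; apply: cvg_near_cst.
  have : (\bigcup_n @Qbox n%:R) x by rewrite Qbox_bigcup.
  move=> [k1 _ Qx]; exists k1 => // k /= hk; rewrite /F indic_in ?mul1r//.
  by move: x Qx; apply/subsetPset; exact: nd_Qbox.
have nd1 n m (x : V) : (n <= m)%N -> (\1_(Qbox n%:R) x : R) <= \1_(Qbox m%:R) x.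
  move=> nm; have [Qx|Qx] := pselect (Qbox n%:R x); last by rewrite (indic_out Qx) indicE.
  rewrite !indic_in//; move: x Qx; apply/subsetPset; exact: nd_Qbox.
have le : (\int[leb]_x `|f x|%:E <= C%:E)%E.
  rewrite (eq_integral (fun x => limn (F ^~ x))); last by move=> x _; rewrite lim.
  rewrite monotone_convergence//.
  - apply: lime_le.
      apply: ereal_nondecreasing_is_cvgn => n m nm; apply: ge0_le_integral => //.
      + by move=> x _; rewrite lee_fin mulr_ge0// indicE.
      + by apply/measurable_EFinP; exact: Intg_meas (Ik n).
      + by apply/measurable_EFinP; exact: Intg_meas (Ik m).
      + move=> x _; rewrite lee_fin ler_wpM2r//.
        exact: nd1.
    by apply: nearW => n; rewrite -Rint_EFin// lee_fin.
  - by move=> n; apply/measurable_EFinP; exact: Intg_meas (Ik n).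
  - by move=> n x _; rewrite lee_fin mulr_ge0// indicE.
  - move=> x _ n m nm; rewrite lee_fin ler_wpM2r//.
    exact: nd1.
have Ia : Intg leb (fun x => `|f x|).
  by apply: Intg_ge0 => //; [exact: ba.1|apply: le_lt_trans le _; exact: ltry].
split; first by apply: (Intg_le bf.1 Ia) => x.
by rewrite -lee_fin Rint_EFin.
Qed.

Lemma ae_time_neq (T : R) : {ae lebT, forall p : VT, p.2 <> T}.
Proof.
exists (setT `*` [set T]); split.
- by apply: measurableX => //; exact: measurable_set1.
- have mT : measurable ([set T] : set RT) by exact: measurable_set1.
  rewrite (product_measure1E _ _ measurableT mT).
  by rewrite [X in (_ * X)%E](lebesgue_measure_set1 T) mule0.
- by move=> p /= /contrapT.
Qed.

(** Compactness refers to the product topology, measurability to the product sigma-algebra; the two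
    meet on R^(N+1). *)
Lemma compact_measurable_prod (K : set (V * R)) : compact K -> measurable (K : set VT).
Proof.
move=> cK; have clK : closed K by exact: compact_closed.
pose F (v : 'rV[R]_N.+1) : V * R := ((uncons_rV v).2, (uncons_rV v).1).
have cF : continuous F.
  move=> v; have h1 := @continuous_uncons1 R N v; have h2 := @continuous_uncons2 R N v.
  exact: (cvg_pair h2 h1).
have mK : measurable (F @^-1` K).
  by apply: closed_measurable_rV; apply: preimage_closed => // v _; exact: cF.
have ms : measurable_fun [set: VT] (fun p => (p.2, p.1)).
  by apply: measurable_fun_pair; [exact: measurable_snd|exact: measurable_fst].
have := measurableT_comp (@measurable_cons_rV R N) ms measurableT mK.
rewrite setTI; congr measurable; apply/seteqP; split => -[x t]; by rewrite /= /F cons_rVK.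
Qed.

Lemma QT_restrictE T (q : VT -> R) (x : V) (t : R) : (q \_ (QT T)) (x, t) = if 0 < t < T then q (x, t) else 0.
Proof.
rewrite patchE; case: ifPn; rewrite /QT ?inE ?notin_setE /=.
  by move=> [_]; rewrite in_itv/= => ->.
by move=> h; case: ifPn => // h'; exfalso; apply: h; split => //; rewrite in_itv.
Qed.

(** Restriction to [QT], an open time interval, and the half-open indicator used for the grids
    differ only at time T, a null set. *)
Lemma QT_integral T (q q' : VT -> R) : (forall p, QT T p -> q p = q' p) -> measurable_fun setT q' ->
  Intg lebT (fun p : VT => itv_ind 0 T p.2 * q' p) ->
  (lebesgue_QT (N := N)).-integrable (QT T) (EFin \o q) /\
  \int[lebesgue_QT (N := N)]_(p in QT T) q p = \int[lebT]_p (itv_ind 0 T p.2 * q' p).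
Proof.
move=> qq mq I.
have e : q \_ (QT T) = q' \_ (QT T).
  apply/funext => p; rewrite !patchE; case: ifPn => //; rewrite inE; exact: qq.
have mr : measurable_fun [set: VT] (q' \_ (QT T)).
  by apply/(measurable_restrictT _ (measurable_QT T)); exact: measurable_funTS.
have ae : {ae lebT, forall p : VT, itv_ind 0 T p.2 * q' p = (q' \_ (QT T)) p}.
  have := ae_time_neq T; apply: filterS => -[x t] /= /eqP tT; rewrite QT_restrictE itv_indE.
  by rewrite [t <= T]le_eqVlt (negbTE tT) /=; case: ifP; rewrite ?mul1r ?mul0r.
split.
  apply/(integrable_mkcond _ (measurable_QT T)); rewrite restrict_EFin e.
  exact: Intg_ae mr ae I.
rewrite Rintegral_mkcond e; apply: Rint_ae => //; first exact: Intg_meas I.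
by move: ae; apply: filterS => p ->.
Qed.

(** * Weak form of one scheme *)

Section one_scheme.
Variables (T M : R) (S : scheme R N) (u0 : V -> R) (g : VT -> R) (ninf : R -> R).
Variables (m1 m2 : fmeas) (W : nat -> V -> R).
Hypothesis gs : good_scheme T S M u0 g m1 m2 W.
Hypothesis src : source_data T g ninf.

Lemma fmean_Intg j : Intg leb (fmean S g j).
Proof. by have [] := slice_int (src_Intg src) (bmeas_itv_ind (node S j.-1) (node S j)) (itv_ind_ge0 _ _). Qed.

Lemma weak_step j C eta : (1 <= j <= steps S)%N -> bmeas C eta -> Intg leb eta ->
  \int[leb]_x ((W j x - W j.-1 x) * eta x) =
  step S j * (\int[leb]_x (phi1 S (W j x) * dop m1 eta x) + \int[leb]_x (phi2 S (W j.-1 x) * dop m2 eta x)) +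
  \int[leb]_x (fmean S g j x * eta x).
Proof.
move=> hj be ie; have jS : (j <= steps S)%N by case/andP: hj.
have s0 : step S j != 0 by rewrite gt_eqF// (step_gt0 (gs_grid gs)).
have bW := gs_bnd gs jS; have bw := gs_bnd gs (node_prev_le hj).
have [mp1 _] := gs_phi1 gs.
have b1 := mono_bmeas mp1 bW; have b2 := mono_bmeas (gs_phi2 gs) bw.
have [D1 _ d1] := dop_bmeas m1 b1; have [D2 _ d2] := dop_bmeas m2 b2.
have i1 : Intg leb (fun x => dop m1 (phi1 S \o W j) x * eta x) by exact: bmeas_IntgM d1 ie.
have i2 : Intg leb (fun x => dop m2 (phi2 S \o W j.-1) x * eta x) by exact: bmeas_IntgM d2 ie.
have i3 : Intg leb (fun x => fmean S g j x * eta x).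
  by under eq_fun do rewrite mulrC; exact: bmeas_IntgM be (fmean_Intg j).
have i12 : Intg leb (fun x => dop m1 (phi1 S \o W j) x * eta x + dop m2 (phi2 S \o W j.-1) x * eta x) by exact: IntgD.
rewrite (Rint_ae (g := fun x => step S j * (dop m1 (phi1 S \o W j) x * eta x + dop m2 (phi2 S \o W j.-1) x * eta x)
   + fmean S g j x * eta x)).
- rewrite RintD//; last exact: IntgZ.
  rewrite RintZ// RintD//; congr (_ * (_ + _) + _).
    exact: (dop_sym (gs_sym1 gs) b1 be ie).
  exact: (dop_sym (gs_sym2 gs) b2 be ie).
- by apply: measurable_funM; [apply: measurable_funB; [exact: bW.1|exact: bw.1]|exact: be.1].
- exact: Intg_meas (IntgD (IntgZ (step S j) i12) i3).
- have := gs_step gs hj; apply: filterS => x ->.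
  rewrite /dop [in RHS]/= addrAC subrr add0r; field; exact: s0.
Qed.

(** The bound is the increment over one step of a nondecreasing function of time whose coefficients
    do not involve the grid; this is what will give equicontinuity in time. *)
Lemma weak_step_bnd j C eta A B1 B2 : (1 <= j <= steps S)%N -> bmeas C eta -> Intg leb eta ->
  0 <= A -> (forall r, `|r| <= M -> `|phi1 S r| <= A) -> (forall r, `|r| <= M -> `|phi2 S r| <= A) ->
  \int[leb]_x `|dop m1 eta x| <= B1 -> \int[leb]_x `|dop m2 eta x| <= B2 ->
  `|\int[leb]_x ((W j x - W j.-1 x) * eta x)| <=
    step S j * (A * B1 + A * B2) + (prim ninf (node S j) - prim ninf (node S j.-1)) * \int[leb]_x `|eta x|.
Proof.
move=> hj be ie A0 hp1 hp2 hB1 hB2; have jS : (j <= steps S)%N by case/andP: hj.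
rewrite (weak_step hj be ie).
have bW := gs_bnd gs jS; have bw := gs_bnd gs (node_prev_le hj).
have [mp1 _] := gs_phi1 gs.
have b1 := mono_bmeas mp1 bW; have b2 := mono_bmeas (gs_phi2 gs) bw.
have dI m : Intg leb (dop m eta) := dop_Intg m be ie.
apply: le_trans (ler_normD _ _) _; apply: lerD.
  rewrite normrM gtr0_norm ?(step_gt0 (gs_grid gs))// ler_pM2l ?(step_gt0 (gs_grid gs))//.
  apply: le_trans (ler_normD _ _) _; apply: lerD.
    apply: le_trans (ler_wpM2l A0 hB1); apply: Rint_bmeasM_le (dI m1).
    by split => [|x]; [exact: b1.1|apply: hp1; exact: bW.2].
  apply: le_trans (ler_wpM2l A0 hB2); apply: Rint_bmeasM_le (dI m2).
  by split => [|x]; [exact: b2.1|apply: hp2; exact: bw.2].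
have i3 : Intg leb (fun x => fmean S g j x * eta x).
  by under eq_fun do rewrite mulrC; exact: bmeas_IntgM be (fmean_Intg j).
apply: le_trans (Rint_norm i3) _; rewrite -RintZ; last exact: Intg_abs.
apply: Rint_le_ae; [exact: Intg_abs|by apply: IntgZ; exact: Intg_abs|].
have := fmean_bnd (gs_grid gs) src hj; apply: filterS => x hx.
by rewrite normrM ler_wpM2r.
Qed.

Section weak_form.
Hypothesis T0 : 0 < T.
Hypothesis M0 : 0 <= M.
Hypothesis Iu : Intg leb u0.
Variable psi : V * R -> R.
Hypothesis tpsi : test_function T psi.

Lemma test_bdd : exists C, [/\ 0 <= C, bmeas C (psi : VT -> R), bmeas C (dt psi : VT -> R) &
  forall x t, ~ (fst @` supp psi) x -> psi (x, t) = 0 /\ dt psi (x, t) = 0].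
Proof.
have [[sp cp] _] := tpsi; have cc : Cc_smooth psi by split.
have [C1 C10 h1] := Cc_bdd [::] cc.
have [C2 C20 h2] := Cc_bdd [:: (0, 1) : V * R] cc.
have cm q : continuous q -> measurable_fun setT (q : VT -> R) by exact: continuous_measurable_prod.
exists (C1 + C2); split; first exact: addr_ge0.
- split; first by apply: cm; exact: smooth_continuous.
  by move=> p; apply: le_trans (h1 p) _; rewrite lerDl.
- split; first by apply: cm; apply: smooth_continuous; exact: smooth_derive.
  by move=> p; apply: le_trans (h2 p) _; rewrite lerDr.
- move=> x t nx; split; first exact: Cc_slice_vanish.
  apply: (@derive_vanish _ _ psi (supp psi)); first exact: closed_closure.
    by move=> y; exact: supp_vanish.
  by move=> h; apply: nx; exists (x, t).
Qed.

Lemma test_end x t : T <= t -> psi (x, t) = 0.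
Proof.
move=> Tt; apply: supp_vanish => h; have [_ /(_ _ h)] := tpsi.
by rewrite /= ltNge Tt.
Qed.

(** The interpolant is affine on each cell, so pairing it with [dt psi] is an exact summation by
    parts against these means. The choice leaves no error in the time derivative. *)
Definition cell_mean (j : nat) (x : V) : R :=
  (step S j)^-1 * \int[lam]_t (itv_ind (node S j.-1) (node S j) t * psi (x, t)).

Definition flux (j : nat) (t : R) : R :=
  \int[leb]_x (phi1 S (W j x) * dop m1 (fun y => psi (y, t)) x) +
  \int[leb]_x (phi2 S (W j.-1 x) * dop m2 (fun y => psi (y, t)) x).

Lemma test_cutoff : exists H : V -> R, [/\ Intg leb H, bmeas 1 H, (forall x, 0 <= H x) &
  forall x t, (psi (x, t) = psi (x, t) * H x) /\ (dt psi (x, t) = dt psi (x, t) * H x)].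
Proof.
have [C [_ _ _ van]] := test_bdd; have [cc _] := tpsi.
have cK := Cc_slice_compact cc.
have mK : measurable (fst @` supp psi) by exact: compact_measurable_rV.
exists (\1_(fst @` supp psi)); split.
- by apply: indic_Intg => //; exact: compact_leb_fin.
- exact: bmeas_indic.
- by move=> x; rewrite indicE.
move=> x t; rewrite indicE; case: (boolP (x \in _)) => h; first by rewrite !mulr1.
by rewrite notin_setE in h; have [-> ->] := van x t h; rewrite !mul0r.
Qed.

Lemma node_step j : (1 <= j <= steps S)%N -> node S j.-1 < node S j.
Proof. by move=> hj; have := step_gt0 (gs_grid gs) hj; rewrite /step subr_gt0. Qed.

Lemma weak_x x : \int[lam]_t (itv_ind 0 T t * (interp S (fun j => W j x) t * dt psi (x, t))) =
  - (W 0%N x * psi (x, 0)) - \sum_(i < steps S) (W i.+1 x - W i x) * cell_mean i.+1 x.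
Proof.
have [C [C0 bp bd _]] := test_bdd; have [[sp cp] _] := tpsi.
have mtx : measurable_fun [set: RT] (fun t => dt psi (x, t)).
  exact: (measurableT_comp bd.1 (measurable_pair1 x)).
have bx : bmeas C (fun t : RT => dt psi (x, t)) by split => // t; exact: bd.2.
have cx := slice_dt_continuous (x:=x) sp.
have dx := slice_dt x sp.
pose F (i : 'I_(steps S)) t := (W i.+1 x - W i x) * (itv_ind 0 T t * (ramp (node S i) (node S i.+1) t * dt psi (x, t))).
have Ir (i : 'I_(steps S)) : Intg lam (fun t => itv_ind 0 T t * (ramp (node S i) (node S i.+1) t * dt psi (x, t))).
  apply: (@Intg_itv_bdd _ _ _ C); split.
    apply: measurable_funM => //; apply: measurable_maxr => //; apply: measurable_minr => //.
    by apply: measurable_funM => //; exact: measurable_funB.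
  move=> t; rewrite normrM; have /andP[r0 r1] := ramp_bnd (node S i) (node S i.+1) t.
  rewrite ger0_norm// -[leRHS]mul1r; apply: ler_pM => //; exact: bx.2.
have IF i : Intg lam (F i) by apply: IntgZ; exact: Ir.
have I0 : Intg lam (fun t => W 0%N x * (itv_ind 0 T t * dt psi (x, t))) by apply: IntgZ; exact: Intg_itv_bdd bx.
rewrite (Rint_ext _ (g := fun t => W 0%N x * (itv_ind 0 T t * dt psi (x, t)) + \sum_(i < steps S) F i t)); last first.
  move=> t; rewrite /interp big_add1 big_mkord mulrDl mulrDr mulrCA; congr (_ + _).
  by rewrite mulr_suml mulr_sumr; apply: eq_bigr => i _; rewrite /F /=; ring.
rewrite RintD//; last exact: Intg_sum.
rewrite RintZ; last exact: Intg_itv_bdd bx.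
rewrite (FTC_line dx cx (ltW T0)) test_end// sub0r mulrN Rint_sum//; congr (_ + _).
rewrite -sumrN; apply: eq_bigr => i _.
have hj : (1 <= i.+1 <= steps S)%N by rewrite /= ltn_ord.
have nj := node_step hj; rewrite /= in nj.
rewrite RintZ; last exact: Ir.
rewrite (ramp_parts dx cx (C := C))//.
- by rewrite mulrN.
- by move=> t; exact: bd.2.
- exact: test_end.
- apply: (grid_ge0 (gs_grid gs)); exact: ltnW.
- exact: (grid_leT (gs_grid gs)).
Qed.

Lemma weak_cell i : (i < steps S)%N ->
  [/\ Intg lam (fun t => cell S i t * flux i.+1 t),
     Intg leb (fun x => (W i.+1 x - W i x) * cell_mean i.+1 x),
     Intg leb (fun x => fmean S g i.+1 x * cell_mean i.+1 x) &
  \int[leb]_x ((W i.+1 x - W i x) * cell_mean i.+1 x) =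
  \int[lam]_t (cell S i t * flux i.+1 t) +
  \int[leb]_x (fmean S g i.+1 x * cell_mean i.+1 x)].
Proof.
move=> iS; have hj : (1 <= i.+1 <= steps S)%N by [].
have [C [C0 bp _ _]] := test_bdd; have [H [IH bH H0 hH]] := test_cutoff; have [cc _] := tpsi.
have s0 := step_gt0 (gs_grid gs) hj; have sn : step S i.+1 != 0 by rewrite gt_eqF.
have bW := gs_bnd gs iS; have bw := gs_bnd gs (ltnW iS).
have bD := bmeasB bW bw.
have If := fmean_Intg i.+1.
have [||| J1 J2 J3] := @swap_strip psi (fun x => W i.+1 x - W i x) (fun x => (M + M) * C * H x) (node S i) (node S i.+1) C bp.
- exact: bD.1.
- exact: IntgZ.
- move=> x t; rewrite (hH x t).1 mulrA normrM (ger0_norm (H0 x)) ler_wpM2r// normrM.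
  by apply: ler_pM => //; [exact: bD.2|exact: bp.2].
have [||| F1 F2 F3] := @swap_strip psi (fmean S g i.+1) (fun x => C * `|fmean S g i.+1 x|) (node S i) (node S i.+1) C bp.
- exact: Intg_meas If.
- by apply: IntgZ; exact: Intg_abs.
- by move=> x t; rewrite normrM mulrC ler_wpM2r// bp.2.
have ie t := Cc_Intg (Cc_slice t cc).
have be t : bmeas C (fun x => psi (x, t)).
  exact: (bmeas_pair2 (t : RT) bp).
have ws t := weak_step hj (be t) (ie t).
have efl t : cell S i t * flux i.+1 t =
   (step S i.+1)^-1 * (cell S i t * \int[leb]_x ((W i.+1 x - W i x) * psi (x, t)) -
     cell S i t * \int[leb]_x (fmean S g i.+1 x * psi (x, t))).
  by rewrite (ws t) /flux; field.
have cm (G : V -> R) : (fun x => G x * cell_mean i.+1 x) =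
    (fun x => (step S i.+1)^-1 * (G x * \int[lam]_t (cell S i t * psi (x, t)))).
  by apply/funext => x; rewrite /cell_mean mulrCA.
split.
- by under eq_fun do rewrite efl; apply: IntgZ; exact: IntgB.
- by rewrite cm; exact: IntgZ.
- by rewrite cm; exact: IntgZ.
rewrite !cm !RintZ// J3 F3 (Rint_ext _ efl) RintZ; last exact: IntgB.
by rewrite RintB// mulrBr subrK.
Qed.

Lemma weak_form : \int[leb]_x \int[lam]_t (itv_ind 0 T t * (interp S (fun j => W j x) t * dt psi (x, t))) =
  - (\int[leb]_x (u0 x * psi (x, 0))) -
  (\sum_(i < steps S) \int[lam]_t (cell S i t * flux i.+1 t)) -
  (\sum_(i < steps S) \int[leb]_x (fmean S g i.+1 x * cell_mean i.+1 x)).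
Proof.
have [cc _] := tpsi; have ie := Cc_Intg (Cc_slice 0 cc).
have b0 := gs_bnd gs (leq0n (steps S)).
have I0 : Intg leb (fun x => W 0%N x * psi (x, 0)) by exact: bmeas_IntgM b0 ie.
rewrite (Rint_ext _ weak_x) RintB; last 2 first.
- by under eq_fun do rewrite -mulN1r; exact: IntgZ.
- by apply: Intg_sum => i _; have [] := weak_cell (ltn_ord i).
rewrite Rint_sum; last by move=> i _; have [] := weak_cell (ltn_ord i).
have -> : \sum_(i < steps S) \int[leb]_x ((W i.+1 x - W i x) * cell_mean i.+1 x) =
    \sum_(i < steps S) \int[lam]_t (cell S i t * flux i.+1 t) +
    \sum_(i < steps S) \int[leb]_x (fmean S g i.+1 x * cell_mean i.+1 x).
  by rewrite -big_split; apply: eq_bigr => i _; have [] := weak_cell (ltn_ord i).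
rewrite opprD addrA; congr (_ - _ - _).
rewrite (Rint_ext _ (g := fun x => -1 * (W 0%N x * psi (x, 0)))); last by move=> x; rewrite mulN1r.
rewrite RintZ// mulN1r; congr (- _).
apply: Rint_ae.
- exact: Intg_meas I0.
- by apply: measurable_funM; [exact: Intg_meas Iu|exact: Intg_meas ie].
- by have := gs_init gs; apply: filterS => x ->.
Qed.

End weak_form.

End one_scheme.

(** * Powers of a lazy Markov operator *)

Section markov.
Variable nu : fmeas.
Hypothesis snu : sym nu.

Let c := mass nu + 1.
Let c1 : 1 <= c. Proof. by rewrite lerDr mass_ge0. Qed.
Let c0 : 0 < c. Proof. exact: lt_le_trans ltr01 c1. Qed.
Let i2 : 0 < (2 * c)^-1. Proof. by rewrite invr_gt0 mulr_gt0. Qed.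

(* The identity plus half of a jump operator is nonnegative in L^2. *)
Definition lazy (h : V -> R) (x : V) : R := h x + (2 * c)^-1 * dop nu h x.

Lemma lazyE h x : lazy h x = (1 - (2 * c)^-1 * mass nu) * h x + (2 * c)^-1 * avg nu h x.
Proof. by rewrite /lazy /dop; ring. Qed.

Lemma lazy_coef : 2^-1 <= 1 - (2 * c)^-1 * mass nu.
Proof.
have m0 := mass_ge0 nu; rewrite lerBrDr -lerBrDl mulrC ler_pdivrMr ?mulr_gt0//.
by rewrite /c; lra.
Qed.

Let k0 : 0 <= 1 - (2 * c)^-1 * mass nu. Proof. by apply: le_trans lazy_coef; rewrite invr_ge0. Qed.

Lemma lazy_bmeas C h : bmeas C h -> bmeas C (lazy h).
Proof.
move=> bh; split.
  apply: measurable_funD; first exact: bh.1.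
  by apply: measurable_funM => //; have [D _ []] := dop_bmeas nu bh.
move=> x; rewrite lazyE; apply: le_trans (ler_normD _ _) _; rewrite !normrM (ger0_norm k0) (gtr0_norm i2).
have h1 := ler_wpM2l k0 (bh.2 x); have h2 := ler_wpM2l (ltW i2) (avg_bdd nu x bh).
apply: le_trans (lerD h1 h2) _; rewrite le_eqVlt; apply/orP; left; apply/eqP; ring.
Qed.

Lemma lazy_Intg C h : bmeas C h -> Intg leb h -> Intg leb (lazy h) /\ \int[leb]_x `|lazy h x| <= \int[leb]_x `|h x|.
Proof.
move=> bh Ih; have Ia := avg_Intg nu bh Ih.
have I : Intg leb (lazy h) by apply: IntgD => //; apply: IntgZ; exact: dop_Intg bh Ih.
split => //.
have J1 := IntgZ (1 - (2 * c)^-1 * mass nu) (Intg_abs Ih).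
have J2 := IntgZ (2 * c)^-1 (Intg_abs Ia).
apply: (@le_trans _ _ (\int[leb]_x ((1 - (2 * c)^-1 * mass nu) * `|h x| + (2 * c)^-1 * `|avg nu h x|))).
  apply: Rint_le => [||x]; [exact: Intg_abs|exact: IntgD|].
  by rewrite lazyE; apply: le_trans (ler_normD _ _) _; rewrite !normrM (ger0_norm k0) (gtr0_norm i2).
rewrite RintD// !RintZ; try exact: Intg_abs.
have h2 := ler_wpM2l (ltW i2) (avg_Rint_abs nu bh Ih).
apply: le_trans (lerD (lexx _) h2) _; rewrite le_eqVlt; apply/orP; left; apply/eqP; ring.
Qed.

Lemma lazyD C1 C2 h1 h2 : bmeas C1 h1 -> bmeas C2 h2 -> lazy (fun x => h1 x + h2 x) = (fun x => lazy h1 x + lazy h2 x).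
Proof. by move=> b1 b2; apply/funext => x; rewrite !lazyE (avgD _ _ b1 b2); ring. Qed.

Lemma lazyZ C r h : bmeas C h -> lazy (fun x => r * h x) = (fun x => r * lazy h x).
Proof. by move=> bh; apply/funext => x; rewrite !lazyE (avgZ _ _ _ bh); ring. Qed.

Lemma lazy_sym C1 C2 g h : bmeas C1 g -> Intg leb g -> bmeas C2 h ->
  \int[leb]_x (lazy h x * g x) = \int[leb]_x (h x * lazy g x).
Proof.
move=> bg Ig bh; have [D _ bd] := dop_bmeas nu bh; have Id := dop_Intg nu bg Ig.
have J0 : Intg leb (fun x => h x * g x) by exact: bmeas_IntgM bh Ig.
have J1 : Intg leb (fun x => dop nu h x * g x) by exact: bmeas_IntgM bd Ig.
have J2 : Intg leb (fun x => h x * dop nu g x) by exact: bmeas_IntgM bh Id.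
rewrite (Rint_ext _ (g := fun x => h x * g x + (2 * c)^-1 * (dop nu h x * g x))); last by move=> x; rewrite /lazy; ring.
rewrite [RHS](Rint_ext _ (g := fun x => h x * g x + (2 * c)^-1 * (h x * dop nu g x))); last by move=> x; rewrite /lazy; ring.
by rewrite !RintD ?RintZ//; try exact: IntgZ; rewrite (dop_sym snu bh bg Ig).
Qed.

(** As h(x) h(y) >= -(h(x)^2 + h(y)^2) / 2, the average paired with h is at least minus the mass
    times the square integral of h. Its weight (2 c)^-1 is small enough for the identity part, whose
    coefficient is at least 1/2, to compensate. *)
Lemma lazy_pos C h : bmeas C h -> Intg leb h -> 0 <= \int[leb]_x (lazy h x * h x).
Proof.
move=> bh Ih; have b2 := bmeasM bh bh.
have I2 : Intg leb (fun x => h x * h x) by exact: bmeas_IntgM bh Ih.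
have Ia := avg_Intg nu b2 I2.
have m0 := mass_ge0 nu.
have key x : - (2^-1 * (avg nu (fun y => h y * h y) x + mass nu * (h x * h x))) <= avg nu h x * h x.
  have b3 : bmeas (C * C + `|h x| * `|h x|) (fun y => h y * h y + h x * h x) by apply: bmeasD b2 _; split => // y; rewrite normrM.
  have b4 := bmeasZ (- 2^-1) b3; have b5 := bmeasZ (h x) bh.
  have le y : - 2^-1 * (h y * h y + h x * h x) <= h x * h y.
    by have := sqr_ge0 (h x + h y); rewrite sqrrD; nra.
  have := avg_le nu x b4 b5 le; rewrite (avgZ _ _ _ b3) (avgZ _ _ _ bh).
  rewrite (avgD _ _ b2 (C2 := `|h x| * `|h x|)); last by split => // y; rewrite normrM.
  by rewrite avg_cst; lra.
have J1 := IntgZ (mass nu) I2; have J2 := IntgZ (- ((2 * c)^-1 * 2^-1)) (IntgD Ia J1).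
have J3 := IntgZ (1 - (2 * c)^-1 * mass nu) I2.
have I := IntgD J3 J2.
apply: (@le_trans _ _ (\int[leb]_x ((1 - (2 * c)^-1 * mass nu) * (h x * h x) +
    - ((2 * c)^-1 * 2^-1) * (avg nu (fun y => h y * h y) x + mass nu * (h x * h x))))); last first.
  apply: Rint_le => // [|x]; first exact: bmeas_IntgM (lazy_bmeas bh) Ih.
  have := ler_wpM2l (ltW i2) (key x); rewrite lazyE; set q := avg nu (fun y => _) x; set p := (2 * c)^-1; lra.
rewrite RintD// !RintZ//; last exact: IntgD.
rewrite RintD// RintZ// (avg_Rint nu b2 I2).
set q := \int[leb]_x (h x * h x); have q0 : 0 <= q by apply: Rint_ge0 => x; rewrite -expr2 sqr_ge0.
have := lazy_coef; set p := (2 * c)^-1 => hp.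
have -> : (1 - p * mass nu) * q + - (p / 2) * (mass nu * q + mass nu * q) = (1 - 2 * (p * mass nu)) * q by field.
rewrite mulr_ge0//; lra.
Qed.

Definition lazyn (j : nat) (h : V -> R) := iter j lazy h.

Lemma lazyn_bmeas C j h : bmeas C h -> bmeas C (lazyn j h).
Proof. by move=> bh; elim: j => //= j; exact: lazy_bmeas. Qed.

Lemma lazyn_Intg C j h : bmeas C h -> Intg leb h ->
  Intg leb (lazyn j h) /\ \int[leb]_x `|lazyn j h x| <= \int[leb]_x `|h x|.
Proof.
move=> bh Ih; elim: j => [//|j [I IH]] /=.
have [I' h'] := lazy_Intg (lazyn_bmeas j bh) I; split => //; exact: le_trans h' IH.
Qed.

Lemma lazynD C1 C2 j h1 h2 : bmeas C1 h1 -> bmeas C2 h2 ->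
  lazyn j (fun x => h1 x + h2 x) = (fun x => lazyn j h1 x + lazyn j h2 x).
Proof.
move=> b1 b2; elim: j => [//|j IH] /=.
by rewrite -/(lazyn j _) IH (lazyD (lazyn_bmeas j b1) (lazyn_bmeas j b2)).
Qed.

Lemma lazynZ C j r h : bmeas C h -> lazyn j (fun x => r * h x) = (fun x => r * lazyn j h x).
Proof.
move=> bh; elim: j => [//|j IH] /=.
by rewrite -/(lazyn j _) IH (lazyZ _ (lazyn_bmeas j bh)).
Qed.

Lemma lazyn_sym C1 C2 j g h : bmeas C1 g -> Intg leb g -> bmeas C2 h ->
  \int[leb]_x (lazyn j h x * g x) = \int[leb]_x (h x * lazyn j g x).
Proof.
move=> bg Ig bh; elim: j g bg Ig => [//|j IH] g bg Ig.
rewrite [lazyn j.+1 h]/= (lazy_sym bg Ig (lazyn_bmeas j bh)).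
have [Il _] := lazy_Intg bg Ig.
by rewrite (IH _ (lazy_bmeas bg) Il) /lazyn -iterSr.
Qed.

(** Symmetry moves half of the factors to the other side: an even power leaves a square, an odd one
    a case of [lazy_pos]. *)
Lemma lazyn_pos C j h : bmeas C h -> Intg leb h -> 0 <= \int[leb]_x (lazyn j h x * h x).
Proof.
move=> bh Ih; set i := j./2.
have [Ii _] := lazyn_Intg i bh Ih; have bi := lazyn_bmeas i bh.
rewrite -(odd_double_half j) -addnn -/i addnA /lazyn iterD -/(lazyn i h) -/(lazyn (odd j + i) (lazyn i h)).
rewrite addnC /lazyn iterD -/(lazyn (odd j) _) -/(lazyn i _).
have bo := lazyn_bmeas (odd j) bi.
rewrite (lazyn_sym i bh Ih bo); case: (odd j) => /=; first exact: lazy_pos bi Ii.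
by apply: Rint_ge0 => x; rewrite -expr2 sqr_ge0.
Qed.

Lemma lazyn_tele C j h x : bmeas C h ->
  lazyn j h x - h x = (2 * c)^-1 * \sum_(i < j) lazyn i (dop nu h) x.
Proof.
move=> bh; have [D _ bd] := dop_bmeas nu bh.
elim: j => [|j IH]; first by rewrite big_ord0 mulr0 subrr.
rewrite big_ord_recr /= mulrDr -IH.
have -> : lazy (lazyn j h) = lazyn j (fun y => h y + (2 * c)^-1 * dop nu h y) by rewrite /lazyn -iterS iterSr.
rewrite (lazynD _ bh (bmeasZ (2 * c)^-1 bd)) (lazynZ _ _ bd); ring.
Qed.

Section core.
Variables (B G err xi : R) (Phi1 Phi2 g1 g2 : V -> R) (C1 C2 : R) (k : nat).
Hypothesis b1 : bmeas B Phi1.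
Hypothesis b2 : bmeas B Phi2.
Hypothesis bg1 : bmeas C1 g1.
Hypothesis bg2 : bmeas C2 g2.
Hypothesis I2 : Intg leb g2.
Hypothesis G2 : \int[leb]_x `|g2 x| <= G.
Hypothesis e1 : forall x, `|dop nu Phi1 x - g1 x| <= err.
Hypothesis e2 : forall x, `|dop nu Phi2 x - g2 x| <= err.
Hypothesis xi0 : 0 <= xi.
Hypothesis mxi : (leb [set x | (xi < `|Phi1 x|)%R] < +oo)%E.
Hypothesis k_gt0 : (0 < k)%N.

(** With P = [lazy] one has I - P = -(2 c)^-1 [dop nu], so (2 c)^-1 times the sum of the P^j is a
    truncated Neumann series for the inverse of -[dop nu]. For h1 = [dop nu] Phi1 the energy is thus
    formally minus the pairing of Phi1 with h2. The order of truncation is averaged over m < k,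
    which smooths the remainder. *)
Definition energy (h1 h2 : V -> R) : R := (2 * c * k%:R)^-1 * \sum_(m < k) \sum_(j < m) \int[leb]_x (lazyn j h1 x * h2 x).

(** Telescoping writes Phi1 as P^m Phi1 minus a truncated series in [dop nu Phi1]. Once P^m is moved
    to g2 and m is averaged, the remainder is the pairing of Phi1 with q, the mean of the P^m g2. As
    g2 is close to [dop nu Phi2], q telescopes too: it is uniformly at most 4 c B / k + err, and its
    L^1 norm is at most G. The first bound is used where |Phi1| > xi, the second elsewhere; the last
    term comes from replacing [dop nu Phi1] by g1. *)
Lemma energy_core : `|\int[leb]_x (Phi1 x * g2 x) + energy g1 g2| <=
  B * (4 * c * B / k%:R + err) * fine (leb [set x | (xi < `|Phi1 x|)%R]) + xi * G + k%:R / (2 * c) * (err * G).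
Proof.
have kR : 0 < k%:R :> R by rewrite ltr0n.
have kn : k%:R != 0 :> R by rewrite gt_eqF.
have B0 : 0 <= B by apply: le_trans (b1.2 0).
have err0 : 0 <= err by apply: le_trans (e1 0).
have G0 : 0 <= G by apply: le_trans G2; exact: Rint_ge0.
have [D1 _ bd1] := dop_bmeas nu b1; have [D2 _ bd2] := dop_bmeas nu b2.
have be1 : bmeas err (fun x => dop nu Phi1 x - g1 x) by split => //; apply: measurable_funB; [exact: bd1.1|exact: bg1.1].
have be2 : bmeas err (fun x => dop nu Phi2 x - g2 x) by split => //; apply: measurable_funB; [exact: bd2.1|exact: bg2.1].
have Ib h C : bmeas C h -> Intg leb (fun x => h x * g2 x) by move=> bh; exact: bmeas_IntgM bh I2.
pose E j := \int[leb]_x (lazyn j (fun x => dop nu Phi1 x - g1 x) x * g2 x).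
have hE j : `|E j| <= err * G.
  exact: le_trans (Rint_bmeasM_le (lazyn_bmeas j be1) I2) (ler_wpM2l err0 G2).
have step m : \int[leb]_x (Phi1 x * g2 x) = \int[leb]_x (Phi1 x * lazyn m g2 x) -
    (2 * c)^-1 * \sum_(j < m) (\int[leb]_x (lazyn j g1 x * g2 x) + E j).
  rewrite -(lazyn_sym m bg2 I2 b1).
  have -> : \sum_(j < m) (\int[leb]_x (lazyn j g1 x * g2 x) + E j) = \int[leb]_x ((\sum_(j < m) lazyn j (dop nu Phi1) x) * g2 x).
    transitivity (\sum_(j < m) \int[leb]_x (lazyn j (dop nu Phi1) x * g2 x)).
      apply: eq_bigr => j _; rewrite -RintD; [|exact: Ib (lazyn_bmeas j bg1)|exact: Ib (lazyn_bmeas j be1)].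
      apply: Rint_ext => x; rewrite -mulrDl; congr (_ * _).
      have := lazynD j bg1 be1 => /(congr1 (fun F : V -> R => F x)) /= <-.
      by congr (lazyn j _ x); apply/funext => y; rewrite addrC subrK.
    rewrite -Rint_sum; last by move=> j _; exact: Ib (lazyn_bmeas j bd1).
    by apply: Rint_ext => x; rewrite mulr_suml.
  have bm := lazyn_bmeas m b1.
  have IS : Intg leb (fun x => (\sum_(j < m) lazyn j (dop nu Phi1) x) * g2 x).
    under eq_fun do rewrite mulr_suml; apply: Intg_sum => j _; exact: Ib (lazyn_bmeas j bd1).
  rewrite -RintZ// -RintB; [|exact: Ib bm|exact: IntgZ].
  apply: Rint_ext => x; have := lazyn_tele m x b1; set s := \sum_(j < m) _ => h.
  rewrite mulrA -mulrBl -h; congr (_ * _); ring.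
have avgE : \int[leb]_x (Phi1 x * g2 x) + energy g1 g2 =
    \int[leb]_x (Phi1 x * (k%:R^-1 * \sum_(m < k) lazyn m g2 x)) - (2 * c * k%:R)^-1 * \sum_(m < k) \sum_(j < m) E j.
  have -> : \int[leb]_x (Phi1 x * (k%:R^-1 * \sum_(m < k) lazyn m g2 x)) = k%:R^-1 * \sum_(m < k) \int[leb]_x (Phi1 x * lazyn m g2 x).
    have Im (m : 'I_k) : Intg leb (fun x => Phi1 x * lazyn m g2 x) by apply: bmeas_IntgM b1 _; have [] := lazyn_Intg m bg2 I2.
    rewrite -Rint_sum// -RintZ; last exact: Intg_sum.
    by apply: Rint_ext => x; rewrite mulrCA mulr_sumr.
  have h : k%:R * \int[leb]_x (Phi1 x * g2 x) = \sum_(m < k) \int[leb]_x (Phi1 x * lazyn m g2 x) -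
      (2 * c)^-1 * (\sum_(m < k) \sum_(j < m) \int[leb]_x (lazyn j g1 x * g2 x) + \sum_(m < k) \sum_(j < m) E j).
    rewrite -big_split mulr_sumr -sumrB /= mulr_natl -[in LHS](card_ord k) -sumr_const.
    apply: eq_bigr => m _; rewrite {1}(step m); congr (_ - _ * _); exact: big_split.
  rewrite -[LHS](mulKf kn) mulrDr h /energy; field.
  by rewrite kn gt_eqF.
rewrite avgE; apply: le_trans (ler_normB _ _) _; apply: lerD.
  pose q x := k%:R^-1 * \sum_(m < k) lazyn m g2 x.
  have Iq : Intg leb q /\ \int[leb]_x `|q x| <= G.
    have Im (m : 'I_k) : Intg leb (lazyn m g2) by have [] := lazyn_Intg m bg2 I2.
    have Iq : Intg leb q by apply: IntgZ; apply: Intg_sum => m _; exact: Im.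
    split => //; apply: (@le_trans _ _ (\int[leb]_x (k%:R^-1 * \sum_(m < k) `|lazyn m g2 x|))).
      apply: Rint_le => [||x]; [exact: Intg_abs|by apply: IntgZ; apply: Intg_sum => m _; exact: Intg_abs (Im m)|].
      by rewrite /q normrM gtr0_norm ?invr_gt0// ler_wpM2l ?invr_ge0 ?(ltW kR)// ler_norm_sum.
    rewrite RintZ; last by apply: Intg_sum => m _; exact: Intg_abs (Im m).
    rewrite Rint_sum; last by move=> m _; exact: Intg_abs (Im m).
    rewrite ler_pdivrMl//; apply: (@le_trans _ _ (\sum_(m < k) G)).
      by apply: ler_sum => m _; apply: le_trans G2; have [] := lazyn_Intg m bg2 I2.
    by rewrite sumr_const card_ord mulr_natl.
  have qb x : `|q x| <= 4 * c * B / k%:R + err.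
    have -> : q x = k%:R^-1 * (2 * c * (lazyn k Phi2 x - Phi2 x)) -
        k%:R^-1 * \sum_(m < k) lazyn m (fun x => dop nu Phi2 x - g2 x) x.
      rewrite (lazyn_tele k x b2) (mulrA (2 * c)) mulfV ?mul1r ?gt_eqF ?mulr_gt0// -mulrBr -sumrB.
      congr (_ * _); apply: eq_bigr => m _.
      have be2' := bmeasZ (-1) be2.
      have := lazynD m bd2 be2' => /(congr1 (fun F : V -> R => F x)) /=.
      rewrite (lazynZ m (-1) be2) mulN1r => <-; congr (lazyn m _ x); apply/funext => y; ring.
    apply: le_trans (ler_normB _ _) _; rewrite !normrM (gtr0_norm (_ : 0 < k%:R^-1)) ?invr_gt0//.
    apply: lerD.
      rewrite mulrC ler_wpM2r ?invr_ge0 ?(ltW kR)// gtr0_norm ?mulr_gt0//.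
      rewrite (_ : 4 * c * B = 2 * c * (B + B)); last by ring.
      rewrite (gtr0_norm c0) ler_wpM2l ?mulr_ge0 ?(ltW c0)//.
      by apply: le_trans (ler_normB _ _) _; apply: lerD; [exact: (lazyn_bmeas k b2).2|exact: b2.2].
    rewrite ler_pdivrMl//; apply: le_trans (ler_norm_sum _ _ _) _.
    apply: (@le_trans _ _ (\sum_(m < k) err)); last by rewrite sumr_const card_ord mulr_natl.
    by apply: ler_sum => m _; exact: (lazyn_bmeas m be2).2.
  have [Iq1 Iq2] := Iq.
  set eta := 4 * c * B / k%:R + err in qb *; have eta0 : 0 <= eta by apply: le_trans (qb 0).
  have mA : measurable [set x | xi < `|Phi1 x|] by apply: measurable_gt_abs; exact: b1.1.
  have IA := indic_Intg mA mxi.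
  apply: (@le_trans _ _ (\int[leb]_x (B * eta * \1_[set x | xi < `|Phi1 x|] x + xi * `|q x|))).
    apply: (Rint_dom (bmeas_IntgM b1 Iq1)) => [|x]; first by apply: IntgD; apply: IntgZ => //; exact: Intg_abs.
    rewrite normrM; have [px|px] := ltP xi `|Phi1 x|.
      rewrite indic_in// mulr1; apply: (@le_trans _ _ (B * eta)); last by rewrite lerDl mulr_ge0.
      by apply: ler_pM => //; exact: b1.2.
    apply: (@le_trans _ _ (xi * `|q x|)); first by rewrite ler_wpM2r.
    by rewrite lerDr mulr_ge0 ?mulr_ge0// indicE.
  rewrite RintD; [|exact: IntgZ|by apply: IntgZ; exact: Intg_abs].
  rewrite RintZ// RintZ; last exact: Intg_abs.
  by rewrite Rint_indic// lerD2l ler_wpM2l.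
rewrite normrM gtr0_norm ?invr_gt0 ?mulr_gt0// ler_pdivrMl ?mulr_gt0//.
have -> : 2 * c * k%:R * (k%:R / (2 * c) * (err * G)) = k%:R * (k%:R * (err * G)) by field; rewrite gt_eqF.
apply: le_trans (ler_norm_sum _ _ _) _.
apply: (@le_trans _ _ (\sum_(m < k) k%:R * (err * G))); last by rewrite sumr_const card_ord [leRHS]mulr_natl.
apply: ler_sum => m _; apply: le_trans (ler_norm_sum _ _ _) _.
apply: (@le_trans _ _ (\sum_(j < m) err * G)); first by apply: ler_sum => j _; exact: hE.
by rewrite sumr_const card_ord -[leLHS]mulr_natl ler_wpM2r ?mulr_ge0// ler_nat ltnW.
Qed.

End core.

End markov.

(** * Symmetry and negativity of the limit operator *)

Section limit_symmetry.
Variables (nu : nat -> fmeas) (err : nat -> R).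
Hypothesis snu : forall n, sym (nu n).
Hypothesis err0 : err @ \oo --> (0 : R).

(** Phi belongs to the domain of the limit operator and g is its image: the approximation is uniform
    and g integrable, whereas Phi is only bounded with level sets of finite measure. *)
Definition in_domain (B : R) (Phi g : V -> R) := [/\ bmeas B Phi, exists C, bmeas C g, Intg leb g,
  forall n x, `|dop (nu n) Phi x - g x| <= err n &
  forall xi, 0 < xi -> (leb [set x | (xi < `|Phi x|)%R] < +oo)%E].

Lemma energy_lim B Phi1 g1 Phi2 g2 e : 0 < e -> in_domain B Phi1 g1 -> in_domain B Phi2 g2 -> exists n k,
  `|\int[leb]_x (Phi1 x * g2 x) + energy (nu n) k g1 g2| <= e /\
  `|\int[leb]_x (Phi2 x * g1 x) + energy (nu n) k g2 g1| <= e.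
Proof.
move=> e0 [b1 [C1 bg1] I1 h1 f1] [b2 [C2 bg2] I2 h2 f2].
have B0 : 0 <= B by apply: le_trans (b1.2 0).
pose G := \int[leb]_x `|g1 x| + \int[leb]_x `|g2 x|.
have G1 : \int[leb]_x `|g1 x| <= G by rewrite lerDl; exact: Rint_ge0.
have G2 : \int[leb]_x `|g2 x| <= G by rewrite lerDr; exact: Rint_ge0.
have G0 : 0 <= G by apply: le_trans G1; exact: Rint_ge0.
pose xi := e / 3 / (G + 1); have xi0 : 0 < xi by rewrite !divr_gt0// ltr_wpDl.
have xiG : xi * G <= e / 3 by rewrite /xi -mulrA ler_piMr ?divr_ge0 ?(ltW e0)// mulrC ler_pdivrMr ?ltr_wpDl// mul1r lerDl.
pose m1 := fine (leb [set x | (xi < `|Phi1 x|)%R]); pose m2 := fine (leb [set x | (xi < `|Phi2 x|)%R]).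
have m10 : 0 <= m1 by rewrite fine_ge0. have m20 : 0 <= m2 by rewrite fine_ge0.
pose m := m1 + m2; have m0 : 0 <= m by rewrite addr_ge0.
(* K is fixed before n and makes 4 B^2 m / K at most e / 3. The number k of powers will lie between
   c K and c (K + 1), which controls both c / k and k / c whatever the mass of [nu n]; only then is
   n taken large enough for the terms in [err n]. *)
pose K := 12 * B * B * m / e + 1.
have K0 : 0 < K by rewrite ltr_wpDl// divr_ge0 ?(ltW e0)// !mulr_ge0.
have KE : 4 * B * B * m <= e / 3 * K.
  rewrite /K (mulrDr (e / 3)) (_ : e / 3 * (12 * B * B * m / e) = 4 * B * B * m); last by field; rewrite gt_eqF.
  by rewrite lerDl mulr1 divr_ge0// ltW.
pose A := B * m + (K + 1) * G; have A0 : 0 <= A.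
  by apply: addr_ge0; apply: mulr_ge0 => //; apply: addr_ge0 => //; exact: ltW.
have [n hn] : exists n, err n * A <= e / 3.
  have d0 : 0 < e / 3 / (A + 1) by rewrite !divr_gt0// ltr_wpDl.
  have [n _ hn] : \forall n \near \oo, `|err n| < e / 3 / (A + 1) by move/cvgr0Pnorm_lt : err0; exact.
  exists n; have := hn n (leqnn _); rewrite ltr_pdivlMr ?ltr_wpDl// => /ltW; apply: le_trans.
  by apply: ler_pM; rewrite ?ler_norm ?lerDl//; apply: le_trans (h1 n 0).
pose c := mass (nu n) + 1; have c1 : 1 <= c by rewrite lerDr mass_ge0.
have c0 : 0 < c by apply: lt_le_trans c1.
pose k := (Num.truncn (c * K)).+1.
have kK : c * K <= k%:R by rewrite ltW// truncnS_gt.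
have kK' : k%:R <= c * (K + 1).
  rewrite /k -natr1 (mulrDr c K 1) mulr1; apply: lerD => //; rewrite truncn_le.
  by rewrite mulr_ge0// ltW.
have en : 0 <= err n by apply: le_trans (h1 n 0).
have kp : 0 < k%:R :> R by rewrite ltr0n.
have fb q : 0 <= q -> q <= m ->
    B * (4 * c * B / k%:R + err n) * q + xi * G + k%:R / (2 * c) * (err n * G) <= e.
  move=> q0 qm; have a1 : B * (4 * c * B / k%:R) * q <= e / 3.
    apply: (@le_trans _ _ (B * (4 * B / K) * m)).
      apply: ler_pM => //; first by rewrite mulr_ge0// divr_ge0 ?(ltW kp)// !mulr_ge0// ltW.
      rewrite ler_wpM2l// ler_pdivrMr// -mulrA mulrAC ler_pdivlMr//.
      by rewrite (_ : 4 * (c * B) * K = 4 * B * (c * K)); [rewrite ler_wpM2l ?mulr_ge0|ring].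
    by rewrite (_ : _ * m = 4 * B * B * m / K) ?ler_pdivrMr//; field; rewrite gt_eqF.
  have a2 : B * err n * q <= B * err n * m by rewrite ler_wpM2l ?mulr_ge0.
  have a3 : k%:R / (2 * c) * (err n * G) <= (K + 1) * (err n * G).
    rewrite ler_wpM2r ?mulr_ge0// ler_pdivrMr ?mulr_gt0//; apply: le_trans kK' _.
    by move: (mulr_ge0 (ltW c0) (ltW K0)) (c0); move: (c) (K) => c' K'; lra.
  have : err n * A = B * err n * m + (K + 1) * (err n * G) by rewrite /A; ring.
  by move=> hA; rewrite hA in hn; rewrite mulrDr mulrDl; lra.
exists n, k; split.
  apply: le_trans (energy_core (snu n) b1 b2 bg1 bg2 I2 G2 (h1 n) (h2 n) (ltW xi0) (f1 _ xi0) _) _ => //.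
  by apply: fb => //; rewrite lerDl.
apply: le_trans (energy_core (snu n) b2 b1 bg2 bg1 I1 G1 (h2 n) (h1 n) (ltW xi0) (f2 _ xi0) _) _ => //.
by apply: fb => //; rewrite lerDr.
Qed.

(** Both pairings are approximated with the same n and k by energies that coincide, the powers of
    [lazy] being symmetric. *)
Lemma limit_sym B Phi1 g1 Phi2 g2 : in_domain B Phi1 g1 -> in_domain B Phi2 g2 ->
  \int[leb]_x (Phi1 x * g2 x) = \int[leb]_x (Phi2 x * g1 x).
Proof.
move=> d1 d2; apply/eqP; rewrite -subr_eq0 -normr_le0; apply/ler_addgt0Pr => e e0; rewrite add0r.
have [n [k [a1 a2]]] := energy_lim (divr_gt0 e0 (ltr0Sn R 1)) d1 d2.
have es : energy (nu n) k g1 g2 = energy (nu n) k g2 g1.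
  have [_ [C1 bg1] I1 _ _] := d1; have [_ [C2 bg2] I2 _ _] := d2.
  congr (_ * _); apply: eq_bigr => i _; apply: eq_bigr => j _.
  by rewrite (lazyn_sym (snu n) j bg2 I2 bg1); apply: Rint_ext => x; rewrite mulrC.
rewrite es in a1; rewrite (_ : _ - _ = (\int[leb]_x (Phi1 x * g2 x) + energy (nu n) k g2 g1) -
  (\int[leb]_x (Phi2 x * g1 x) + energy (nu n) k g2 g1)); last by ring.
by apply: le_trans (ler_normB _ _) _; lra.
Qed.

Lemma limit_neg B Phi g : in_domain B Phi g -> \int[leb]_x (Phi x * g x) <= 0.
Proof.
move=> d; apply/ler_addgt0Pr => e e0; rewrite add0r.
have [n [k [a1 _]]] := energy_lim e0 d d.
have [_ [C bg] Ig _ _] := d.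
have : 0 <= energy (nu n) k g g.
  rewrite mulr_ge0 ?invr_ge0 ?mulr_ge0 ?addr_ge0 ?mass_ge0//.
  by apply: sumr_ge0 => i _; apply: sumr_ge0 => j _; exact: (lazyn_pos (snu n) _ bg Ig).
by move: a1; rewrite ler_norml => /andP[_]; lra.
Qed.

End limit_symmetry.

(** * Differences of two solutions *)

Lemma derive_trans (f : V -> R) (v y : V) : 'D_v (fun x => f (x - y)) = (fun x => 'D_v f (x - y)).
Proof. by apply/funext => x; rewrite /derive; under eq_fun do rewrite /= -addrA. Qed.

Lemma levy_op_trans P (sigma : 'M[R]_(N, P)) mu (eta : V -> R) (y x : V) :
  levy_op sigma mu (fun x => eta (x - y)) x = levy_op sigma mu eta (x - y).
Proof.
have g1 i : partial i (fun x => eta (x - y)) = (fun x => partial i eta (x - y)) by exact: derive_trans.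
have hE : hessian (fun x => eta (x - y)) x = hessian eta (x - y).
  apply/matrixP => i j; rewrite [LHS]mxE [RHS]mxE g1.
  by have := derive_trans (partial j eta) (unit_rV i) y => /(congr1 (fun F : V -> R => F x)).
have gE : grad (fun x => eta (x - y)) x = grad eta (x - y) by apply/rowP => i; rewrite [LHS]mxE [RHS]mxE g1.
rewrite /levy_op hE gE; congr (_ + _); apply: eq_Rintegral => z _.
by have -> : x + z - y = x - y + z by exact: addrAC.
Qed.

(* [d_pair]: the pairing of w(., t) with a fixed test function agrees, for a.e.
   t, with a function of t which is continuous on ]0, T[. *)
Record difference (T M : R) (L : (V -> R) -> V -> R) (w z : VT -> R) : Prop := Difference {
  d_T : 0 < T;
  d_w : bmeas M w;
  d_wI : Intg lebT w;
  d_slice : forall t, Intg leb (fun x => w (x, t));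
  d_z : bmeas M z;
  d_sign : forall p, 0 <= z p * w p;
  d_w0 : forall p, w p = 0 -> z p = 0;
  d_mod : forall xi, 0 < xi -> exists2 C, 0 <= C & forall p, `|z p| <= xi + C * `|w p|;
  d_out : forall x t, ~~ (0 < t < T) -> w (x, t) = 0;
  d_id : forall psi, test_function T psi ->
    Intg lebT (fun p : VT => w p * dt psi p + z p * L (fun x => psi (x, p.2)) p.1) /\
    \int[lebT]_p (w p * dt psi p + z p * L (fun x => psi (x, p.2)) p.1) = 0;
  d_pair : exists A : (V -> R) -> R -> R, (forall eta t, Cc_smooth eta -> 0 < t < T -> {for t, continuous (A eta)}) /\
    {ae lam, forall t : RT, 0 < t < T -> forall eta, Cc_smooth eta ->
      \int[leb]_x (w (x, t) * eta x) = A eta t} }.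

(** The times whose slice fails to be integrable form a null set. Setting the function to 0 there
    makes every slice integrable, so mollification is legitimate at each time. *)
Lemma good_slices K (q : VT -> R) : bmeas K q -> Intg lebT q ->
  exists q', [/\ bmeas K q', Intg lebT q', forall p, q' p = q p \/ q' p = 0,
    {ae lebT, forall p, q' p = q p} & forall t, Intg leb (fun x => q' (x, t))].
Proof.
move=> bq Iq.
have mqE : measurable_fun setT (EFin \o q) by apply/measurable_EFinP; exact: bq.1.
pose J (t : RT) := (\int[leb]_x `|(q (x, t))%:E|)%E.
have mJ : measurable_fun setT J.
  apply: (@measurable_fun_fubini_tonelli_G _ _ _ _ _ leb (fun z => `|(EFin \o q) z|%E)) => //.
  exact: measurableT_comp.
pose E := [set t | (J t < +oo)%E].
have mE : measurable E.
  have := emeasurable_fun_infty_o measurableT mJ +oo%E; rewrite setTI; congr measurable.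
pose q' (p : VT) := (\1_E p.2 : R) * q p.
have b1 : bmeas 1 (fun p : VT => \1_E p.2 : R).
  have [m1E b1E] := @bmeas_indic _ _ R _ mE.
  by split=> [|p]; [exact: meas_snd m1E|exact: b1E].
have bq' : bmeas K q' by have := bmeasM b1 bq; rewrite mul1r.
exists q'; split => //.
- exact: bmeas_IntgM b1 Iq.
- by move=> p; rewrite /q' indicE; case: (_ \in _); [left; rewrite mul1r|right; rewrite mul0r].
- have : {ae lam, forall t, E t}.
    by apply: filterS (Fubini_ae2 Iq) => t It; have /integrableP[_] := It.
  move=> [A [mA A0 sub]]; exists (setT `*` A); split; first exact: measurableX.
    by rewrite (product_measure1E _ _ measurableT mA) [X in (_ * X)%E]A0 mule0.
  move=> [x t] /= h; split => //; apply: sub => /= Et; apply: h.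
  by rewrite /q' indicE mem_set// mul1r.
move=> t; have mqt : measurable_fun setT (fun x => q (x, t)) by exact: (measurableT_comp bq.1 (measurable_pair2 t)).
have [Et|nE] := pselect (E t); last first.
  have -> : (fun x => q' (x, t)) = (fun=> 0) by apply/funext => x; rewrite /q' indicE memNset// mul0r.
  exact: Intg0.
have -> : (fun x => q' (x, t)) = (fun x => q (x, t)) by apply/funext => x; rewrite /q' indicE mem_set// mul1r.
by apply/integrableP; split; [exact/measurable_EFinP|exact: Et].
Qed.

Lemma pair_Intg (K : set V) C (eta f : V -> R) : compact K -> bmeas C eta -> (forall x, ~ K x -> eta x = 0) ->
  leb.-integrable K (EFin \o f) -> Intg leb (fun x => f x * eta x).
Proof.
move=> cK be ek If; have mK := compact_measurable_rV cK.
have I : Intg leb (f \_ K) by rewrite /Intg -restrict_EFin; exact/(integrable_mkcond _ mK).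
have := bmeas_IntgM be I; congr (Intg _ _); apply/funext => x; rewrite mulrC patchE.
by case: ifPn => //; rewrite notin_setE => /ek ->; rewrite !mulr0.
Qed.

Lemma pair_dist (K : set V) C (eta f g : V -> R) : compact K -> bmeas C eta -> (forall x, ~ K x -> eta x = 0) ->
  leb.-integrable K (EFin \o f) -> leb.-integrable K (EFin \o g) ->
  (`|\int[leb]_x (f x * eta x) - \int[leb]_x (g x * eta x)|%:E <= C%:E * L1_dist K f g)%E.
Proof.
move=> cK be ek If Ig; have mK := compact_measurable_rV cK.
have Ifg : leb.-integrable K (EFin \o (fun x => f x - g x)).
  by have := integrableB mK If Ig; apply: eq_integrable => // x _; rewrite /= EFinB.
have I : Intg leb ((fun x => f x - g x) \_ K) by rewrite /Intg -restrict_EFin; exact/(integrable_mkcond _ mK).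
rewrite -RintB; [|exact: pair_Intg cK be ek If|exact: pair_Intg cK be ek Ig].
rewrite (Rint_ext _ (g := fun x => eta x * ((fun x => f x - g x) \_ K) x)); last first.
  by move=> x; rewrite -mulrBl mulrC patchE; case: ifPn => //; rewrite notin_setE => /ek ->; rewrite !mul0r.
have -> : L1_dist K f g = (\int[leb]_x `|((fun x => f x - g x) \_ K) x|)%:E.
  rewrite Rint_EFin; last exact: Intg_abs.
  rewrite /L1_dist [LHS]integral_mkcond; apply: eq_integral => x _.
  by rewrite !patchE; case: ifP => // _; rewrite normr0.
by rewrite -EFinM lee_fin; exact: Rint_bmeasM_le be I.
Qed.

Definition bounded_solution T P (sigma : 'M[R]_(N, P)) mu phi f u0 (u : V * R -> R) :=
  [/\ L1_Loo (lebesgue_QT (N := N)) (u \_ (QT T)), C_L1loc T u & distributional_solution T sigma mu phi f u0 u].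

Section difference_data.
Variables (T : R) (P : nat) (sigma : 'M[R]_(N, P)) (mu : {measure set V -> \bar R}).
Variables (phi : R -> R) (f : V * R -> R) (u0 : V -> R).

Lemma near_L1 (u : V * R -> R) (K : set V) t e : C_L1loc T u -> compact K -> 0 <= t <= T -> 0 < e ->
  \forall s \near t, 0 <= s <= T -> (L1_dist K (fun x => u (x, s)) (fun x => u (x, t)) < e%:E)%E.
Proof.
move=> Cu cK t0 e0; have [_ /(_ t t0) /fine_cvgP[fin]] := Cu K cK.
move=> /cvgr0Pnorm_lt /(_ e e0); rewrite !near_withinE => h.
move: fin; rewrite near_withinE; move: h; apply: filterS2 => s h1 h2 sT.
have sI : `[0, T]%classic s by rewrite /= in_itv.
by rewrite -(fineK (h2 sI)) lte_fin; apply: le_lt_trans (ler_norm _) (h1 sI).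
Qed.

Lemma pair_cont (u : V * R -> R) (eta : V -> R) t : C_L1loc T u -> Cc_smooth eta -> 0 < t < T ->
  {for t, continuous (fun s => \int[leb]_x (u (x, s) * eta x))}.
Proof.
move=> Cu ce /andP[t0 tT]; have [C C0 be] := Cc_meas ce; have cK := ce.2.
have ek x : ~ supp eta x -> eta x = 0 by exact: supp_vanish.
apply/cvgrPdist_lt => e e0; have d0 : 0 < e / (C + 1) by rewrite divr_gt0// ltr_wpDl.
have tI : 0 <= t <= T by rewrite !ltW.
have op : \forall s \near t, `]0, T[%classic s by apply: open_nbhs_nbhs; split; [exact: interval_open|rewrite /= in_itv/= t0].
move: op; apply: filterS2 (near_L1 Cu cK tI d0) => s hs; rewrite /= in_itv/= => /andP[s0 sT].
have sI : 0 <= s <= T by rewrite !ltW.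
have [I _] := Cu _ cK; rewrite distrC -lte_fin; apply: le_lt_trans (pair_dist cK be ek (I s sI) (I t tI)) _.
have h := hs sI; apply: (@le_lt_trans _ _ (C%:E * (e / (C + 1))%:E)%E); first by rewrite lee_wpmul2l// ltW.
by rewrite -EFinM lte_fin mulrCA gtr_pMr// ltr_pdivrMr ?mul1r ?ltrDl// ltr_wpDl.
Qed.

(** Both solutions are clipped, set to 0 outside [QT] and freed of bad slices, so that the pointwise
    relations between w and z hold everywhere. Initial data and source cancel in the difference,
    which is why its weak identity has neither. *)
Lemma difference_data u v : 0 < T -> levy_measure mu -> nondecreasing_continuous phi ->
  bounded_solution T sigma mu phi f u0 u -> bounded_solution T sigma mu phi f u0 v ->
  exists M w z, [/\ difference T M (levy_op sigma mu) w z, forall p, exists a b, z p = phi a - phi b &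
    {ae lebT, forall p : VT, QT T p -> w p = u p - v p}].
Proof.
move=> T0 lmu nphi [/L1_LooP[Iu [Cu Cu0 hu]] cu su] [/L1_LooP[Iv [Cv Cv0 hv]] cv sv].
have [phim phic] := nphi.
pose K := Cu + Cv; have K0 : 0 <= K by rewrite addr_ge0.
have cl (q : VT -> R) : Intg lebT q -> exists q', [/\ bmeas K q', Intg lebT q',
    forall p, q p = 0 -> q' p = 0, {ae lebT, forall p, q' p = clip K (q p)} &
    forall t, Intg leb (fun x => q' (x, t))].
  move=> Iq; have bc := clip_bmeas K0 (Intg_meas Iq).
  have Ic : Intg lebT (fun p : VT => clip K (q p)).
    by apply: (Intg_le bc.1 (Intg_abs Iq)) => p; exact: clip_le.
  have [q' [h1 h2 h3 h4 h5]] := good_slices bc Ic; exists q'; split => // p q0.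
  by have [->|//] := h3 p; rewrite q0 clip_id// normr0.
have [U [bU IU U0 Ue Us]] := cl _ Iu; have [Vv [bV IV V0 Ve Vs]] := cl _ Iv.
pose w p := U p - Vv p; pose z p := phi (U p) - phi (Vv p).
pose B := `|phi K| + `|phi (- K)|.
have mphi (q : VT -> R) : bmeas K q -> bmeas B (fun p => phi (q p)).
  move=> [mq qK]; split; first exact: (measurableT_comp (continuous_measurable_fun phic) mq).
  by move=> p; exact: mono_bnd.
pose M := K + K + (B + B).
have B0 : 0 <= B by rewrite addr_ge0.
have bw : bmeas M (w : VT -> R) by apply: bmeas_le (bmeasB bU bV); rewrite lerDl addr_ge0.
have bz : bmeas M (z : VT -> R).
  by apply: bmeas_le (bmeasB (mphi _ bU) (mphi _ bV)); rewrite lerDr addr_ge0.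
have Iw : Intg lebT (w : VT -> R) by exact: IntgB.
have ew : {ae lebT, forall p : VT, QT T p -> U p = u p /\ Vv p = v p}.
  have r C (q : V * R -> R) (Q : VT -> R) : C <= K -> {ae lebT, forall p : VT, `|(q \_ (QT T)) p| <= C} ->
      {ae lebT, forall p : VT, Q p = clip K ((q \_ (QT T)) p)} ->
      {ae lebT, forall p : VT, QT T p -> Q p = q p}.
    move=> CK; apply: filterS2 => p h -> pT; rewrite clip_id; first by rewrite patchE mem_set.
    exact: le_trans h CK.
  have c1 : Cu <= K by rewrite lerDl.
  have c2 : Cv <= K by rewrite lerDr.
  have := r _ _ _ c1 hu Ue; have := r _ _ _ c2 hv Ve.
  by apply: filterS2 => p h1 h2 pT; rewrite h2// h1.
exists M, w, z; split; [|by move=> p; exists (U p), (Vv p)|by apply: filterS ew => p h /h [h1 h2]; rewrite /w h1 h2].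
have out p : ~ QT T p -> U p = 0 /\ Vv p = 0.
  by move=> h; split; [apply: U0|apply: V0]; rewrite patchE memNset.
split => //.
- by move=> t; exact: IntgB (Us t) (Vs t).
- move=> p; rewrite /z /w; have [h|h] := leP (Vv p) (U p).
    by rewrite mulr_ge0// subr_ge0//; exact: phim.
  by rewrite -mulrNN mulr_ge0// oppr_ge0 subr_le0; [apply: phim|]; exact: ltW.
- by move=> p /subr0_eq h; rewrite /z h subrr.
(* Either |w| < d and uniform continuity bounds |z| by xi, or |z| is bounded by its maximum B + B,
   which is then at most (B + B) / d times |w|. *)
- move=> xi xi0; have [d d0 hd] := unif_cont_on K phic xi0.
  have BB : 0 <= B + B by exact: addr_ge0.
  have Bd := divr_ge0 BB (ltW d0); exists ((B + B) / d) => // p.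
  have [h|h] := ltP `|w p| d.
    have := hd (Vv p) (U p) (bV.2 p) h => /ltW h'; apply: le_trans h' _.
    by rewrite lerDl mulr_ge0.
  apply: (@le_trans _ _ (B + B)); first exact: (bmeasB (mphi _ bU) (mphi _ bV)).2.
  by rewrite -[leLHS]add0r lerD ?(ltW xi0)// mulrAC ler_pdivlMr// ler_wpM2l.
- move=> x t h; have [h1 h2] : U (x, t) = 0 /\ Vv (x, t) = 0.
    by apply: out => -[_] /=; rewrite in_itv/= (negbTE h).
  by rewrite /w h1 h2 subrr.
- move=> psi tpsi; have [_ /(_ psi tpsi)[_ J1 J2]] := su; have [_ /(_ psi tpsi)[_ J3 J4]] := sv.
  set F := fun p : VT => w p * dt psi p + _.
  have mQ := @measurable_QT T.
  have [cc _] := tpsi; have [C tf] := testfam_Cc cc.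
  have [ml _] := @lo_slice psi (LimitOp sigma mu phi) _ _ lmu tf.
  have [C' [_ _ bd _]] := test_bdd tpsi.
  have mF : measurable_fun [set: VT] F.
    by apply: measurable_funD; apply: measurable_funM => //; [exact: bw.1|exact: bd.1|exact: bz.1].
  pose G (u : V * R -> R) p := u p * dt psi p + phi (u p) * levy_op_x sigma mu psi p + f p * psi p.
  have IG : Intg lebT ((fun p => G u p - G v p) \_ (QT T)).
    rewrite /Intg -restrict_EFin; apply/(integrable_mkcond _ mQ).
    by have := integrableB mQ J1 J3; apply: eq_integrable => // p _; rewrite /= EFinB.
  have e : {ae lebT, forall p : VT, ((fun p => G u p - G v p) \_ (QT T)) p = F p}.
    apply: filterS ew => -[x t] h; rewrite patchE; case: ifPn; rewrite ?inE ?notin_setE => pT.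
      have [h1 h2] := h pT; rewrite /F /G /w /z /levy_op_x h1 h2; ring.
    by have [h1 h2] := out _ pT; rewrite /F /w /z h1 h2 !subrr !mul0r addr0.
  split; first exact: Intg_ae mF e IG.
  rewrite -(Rint_ae (Intg_meas IG) mF e) -Rintegral_mkcond.
  rewrite (RintegralB mQ J1 J3) -[RHS](subrr (\int[leb]_x (u0 x * psi (x, 0)))).
  by move: J2 J4 => /eqP; rewrite addr_eq0 => /eqP -> /eqP; rewrite addr_eq0 => /eqP ->; rewrite opprK addrC.
have int eta t : Cc_smooth eta -> 0 < t < T ->
    Intg leb (fun x => u (x, t) * eta x) /\ Intg leb (fun x => v (x, t) * eta x).
  move=> ce /andP[t0 tT]; have tI : 0 <= t <= T by rewrite !ltW.
  have [C C0 be] := Cc_meas ce; have [Iu' _] := cu _ ce.2; have [Iv' _] := cv _ ce.2.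
  by split; apply: (pair_Intg ce.2 be (@supp_vanish _ _ eta)); [exact: Iu'|exact: Iv'].
exists (fun eta t => \int[leb]_x (u (x, t) * eta x) - \int[leb]_x (v (x, t) * eta x)); split.
  by move=> eta t ce t0; apply: cvgB; exact: pair_cont.
apply: filterS (ae_prod2 ew) => t ht t0 eta ce; have [I1 I2] := int eta t ce t0.
have [C C0 be] := Cc_meas ce.
have mw : measurable_fun setT (fun x : V => w (x, t)) by exact: (measurableT_comp bw.1 (measurable_pair2 t)).
rewrite -RintB//; apply: Rint_ae; [by apply: measurable_funM => //; exact: be.1|exact: Intg_meas (IntgB I1 I2)|].
apply: filterS ht => x hx; rewrite -mulrBl; have [|h1 h2] := hx; first by split => //=; rewrite in_itv.
by rewrite /w h1 h2.
Qed.

End difference_data.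

(** The factor 3 is crude: 2 for the distance of f to its translates, 1 for f itself. *)
Lemma mconv_L1 (f : V -> R) d : Intg leb f -> 0 < d ->
  Intg leb (mconv f d) /\ \int[leb]_y `|mconv f d y| <= 3 * \int[leb]_y `|f y|.
Proof.
move=> If d0; have [|I h] := @mconv_dist f d (2 * \int[leb]_y `|f y|) If d0.
  move=> z _; have Is := Intg_shift z If.
  apply: (@le_trans _ _ (\int[leb]_x (`|f (x + z)| + `|f x|))).
    apply: Rint_le => [||x]; [exact: Intg_abs (IntgB Is If)|exact: IntgD (Intg_abs Is) (Intg_abs If)|exact: ler_normB].
  rewrite RintD; [|exact: Intg_abs..].
  by rewrite (Rint_shift z (Intg_meas (Intg_abs If))) mulrDl mul1r.
split => //; apply: (@le_trans _ _ (\int[leb]_y (`|mconv f d y - f y| + `|f y|))).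
  apply: Rint_le => [||y]; [exact: Intg_abs|exact: IntgD (Intg_abs (IntgB I If)) (Intg_abs If)|].
  by rewrite -{1}(subrK (f y) (mconv f d y)) ler_normD.
rewrite RintD; [|exact: Intg_abs (IntgB I If)|exact: Intg_abs].
by rewrite (_ : 3 * _ = 2 * \int[leb]_y `|f y| + \int[leb]_y `|f y|) ?lerD2r//; ring.
Qed.

(** * Generators approximated by jump operators *)

Lemma combined_measure (m1 m2 : fmeas) (c1 c2 : R) : 0 <= c1 -> 0 <= c2 ->
  sym m1 -> sym m2 -> exists nu : fmeas, sym nu /\
  forall C g x, bmeas C g -> dop nu g x = c1 * dop m1 g x + c2 * dop m2 g x.
Proof.
move=> c10 c20 s1 s2; pose k1 := mscale (NngNum c10) m1; pose k2 := mscale (NngNum c20) m2.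
pose m := measure_add k1 k2.
have mE A : m A = (c1%:E * m1 A + c2%:E * m2 A)%E by rewrite /m measure_addE.
have fin : (m setT < +oo)%E.
  by rewrite mE lte_add_pinfty//; apply: lte_mul_pinfty; rewrite ?lee_fin// -ge0_fin_numE// fin_num_measure.
have [nu en] := exists_finite_measure fin.
(* Additivity in the measure is obtained for nonnegative integrands; a bounded g is reached through
   g + C, as jump operators ignore constants. *)
have pos C g x : bmeas C g -> (forall y, 0 <= g y) -> avg nu g x = c1 * avg m1 g x + c2 * avg m2 g x.
  move=> bg g0; apply: EFin_inj; rewrite EFinD !EFinM.
  rewrite (Rint_EFin (Intg_avg0 nu x bg)) (Rint_EFin (Intg_avg0 m1 x bg)) (Rint_EFin (Intg_avg0 m2 x bg)).
  have mg : measurable_fun setT (fun z => (g (x + z))%:E) by apply/measurable_EFinP; exact: shiftl_meas bg.1.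
  have p0 z : setT z -> (0 <= (g (x + z))%:E)%E by rewrite lee_fin.
  rewrite (eq_measure_integral m) => [|A mA _]; last exact: (congr1 (fun k : set V -> \bar R => k A) en).
  rewrite (ge0_integral_measure_add k1 k2 measurableT p0 mg).
  rewrite (ge0_integral_mscale m1 measurableT (NngNum c10) mg p0).
  by rewrite (ge0_integral_mscale m2 measurableT (NngNum c20) mg p0).
have mass_E : mass nu = c1 * mass m1 + c2 * mass m2.
  have b1 : bmeas 1 (fun _ : V => (1 : R)) by split => // y; rewrite normr1.
  have := pos _ _ 0 b1 (fun _ => ler01); by rewrite !avg_cst !mul1r.
exists nu; split.
  move=> A mA; have e B : nu B = m B by rewrite en.
  by rewrite !e !mE s1// s2.
move=> C g x bg; have C0 : 0 <= C by apply: le_trans (bg.2 0).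
have bC := bmeas_cst V C.
have bp := bmeasD bg bC.
have p0 y : 0 <= g y + C by have := bg.2 y; rewrite ler_norml => /andP[h _]; lra.
have := pos _ _ x bp p0; rewrite !(avgD _ _ bg bC) !avg_cst /dop mass_E; lra.
Qed.

(** The sets {K > 0} cut by boxes are admissible and force the positive part to vanish; the same is
    applied to -K. *)
Lemma ae0_sets (K : V -> R) : Intg leb K ->
  (forall A, measurable A -> (leb A < +oo)%E -> \int[leb]_x (\1_A x * K x) = 0) -> {ae leb, forall x, K x = 0}.
Proof.
suff half (K' : V -> R) : Intg leb K' ->
    (forall A, measurable A -> (leb A < +oo)%E -> \int[leb]_x (\1_A x * K' x) = 0) -> {ae leb, forall x, K' x <= 0}.
  move=> IK hK; have h1 := half _ IK hK; have h2 := half _ (IntgZ (-1) IK).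
  have {}h2 : {ae leb, forall x, -1 * K x <= 0}.
    apply: h2 => A mA fA; rewrite (Rint_ext _ (g := fun x => -1 * (\1_A x * K x))) => [|x]; last by ring.
    by rewrite RintZ ?hK ?mulr0//; exact: bmeas_IntgM (bmeas_indic mA) IK.
  by apply: filterS2 h1 h2 => x a b; apply/le_anti; rewrite a; lra.
move=> IK hK; pose A n := [set x | 0 < K' x] `&` Qbox n%:R.
have mP : measurable [set x | 0 < K' x].
  rewrite (_ : mkset _ = setT `&` K' @^-1` `]0, +oo[%classic).
    have mK := Intg_meas IK; exact: (mK measurableT _ (measurable_itv _)).
  by apply/seteqP; split => x /=; rewrite in_itv/= andbT// => -[].
have mA n : measurable (A n) by apply: measurableI => //; exact: measurable_Qbox.
have fA n : (leb (A n) < +oo)%E.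
  apply: le_lt_trans (Qbox_fin n%:R); apply: le_measure; rewrite ?inE//; first exact: measurable_Qbox.
  by move=> x [].
have : {ae leb, forall x, forall n, \1_(A n) x * K' x = 0}.
  apply: ae_foralln => i; have IA : Intg leb (fun x => \1_(A i) x * K' x) := bmeas_IntgM (bmeas_indic (mA i)) IK.
  apply: (Rint_eq0_ae IA _ (hK _ (mA i) (fA i))) => x.
  have [[h _]|h] := pselect (A i x); last by rewrite indic_out// mul0r.
  by rewrite mulr_ge0// ?indicE// ltW.
apply: filterS => x hx; rewrite leNgt; apply/negP => p.
have [n _ Qx] : (\bigcup_n @Qbox n%:R) x by rewrite Qbox_bigcup.
by have := hx n; rewrite indic_in ?mul1r// => e; rewrite e ltxx in p.
Qed.

(** The uniqueness argument forgets the Levy triplet and keeps these four properties. [L] is any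
    functional on test functions; even its homogeneity is recovered, almost everywhere, from the
    approximation. *)
Record generator (L : (V -> R) -> V -> R) (nu : nat -> fmeas) : Prop := Generator {
  g_sym : forall n, sym (nu n);
  g_Intg : forall eta, Cc_smooth eta -> Intg leb (L eta);
  g_cvg : forall eta, Cc_smooth eta -> \int[leb]_x `|dop (nu n) eta x - L eta x| @[n --> \oo] --> (0 : R);
  g_trans : forall eta y x, L (fun x => eta (x - y)) x = L eta (x - y) }.

(** * Time cutoffs and the equation integrated in time *)

Section oleinik.
Variables (T M : R) (L : (V -> R) -> V -> R) (nu : nat -> fmeas).
Hypothesis gen : generator L nu.

Lemma g_scale c eta : Cc_smooth eta -> {ae leb, forall x, L (fun x => c * eta x) x = c * L eta x}.
Proof.
move=> ce; have cc := CcZ c ce; have [C C0 be] := Cc_meas ce; have Ie := Cc_Intg ce.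
have I1 := g_Intg gen ce; have I2 := g_Intg gen cc.
have Id n : Intg leb (dop (nu n) eta) := dop_Intg (nu n) be Ie.
have dE n x : dop (nu n) (fun x => c * eta x) x = c * dop (nu n) eta x.
  by rewrite /dop (avgZ _ _ _ be); ring.
have Idc n : Intg leb (dop (nu n) (fun x => c * eta x)).
  by apply: dop_Intg (bmeasZ c be) _; exact: Cc_Intg.
have I := IntgB I2 (IntgZ c I1).
have h n : \int[leb]_x `|L (fun x => c * eta x) x - c * L eta x| <=
    \int[leb]_x `|dop (nu n) (fun x => c * eta x) x - L (fun x => c * eta x) x| +
    `|c| * \int[leb]_x `|dop (nu n) eta x - L eta x|.
  have J1 := Intg_abs (IntgB (Idc n) I2); have J2 := Intg_abs (IntgB (Id n) I1).
  rewrite -RintZ// -RintD//; last exact: IntgZ.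
  apply: Rint_le => [||x]; [exact: Intg_abs|by apply: IntgD => //; exact: IntgZ|].
  rewrite dE -normrM; set a := L _ x.
  rewrite (_ : a - _ = - (c * dop (nu n) eta x - a) + c * (dop (nu n) eta x - L eta x)); last by ring.
  by apply: le_trans (ler_normD _ _) _; rewrite normrN.
have cv : (\int[leb]_x `|dop (nu n) (fun x => c * eta x) x - L (fun x => c * eta x) x| +
    `|c| * \int[leb]_x `|dop (nu n) eta x - L eta x|) @[n --> \oo] --> (0 : R).
  rewrite -[X in _ --> X](addr0 0); apply: cvgD; first exact: g_cvg gen _ cc.
  rewrite -(mulr0 `|c|); exact: (@cvgMr R _ _ _ _ `|c| _ (g_cvg gen ce)).
have q0 : \int[leb]_x `|L (fun x => c * eta x) x - c * L eta x| <= 0.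
  by apply: (cvgr_to_ge cv); exact: nearW.
have := Rint_eq0_ae (Intg_abs I) (fun x => normr_ge0 _).
move=> /(_ (le_anti _)) h'; have : {ae leb, forall x, `|L (fun x => c * eta x) x - c * L eta x| = 0}.
  by apply: h'; rewrite q0 Rint_ge0.
by apply: filterS => x /normr0_eq0/subr0_eq.
Qed.

(** A plateau in time. The first factor is constant for t >= -1 and makes the support compact on the
    negative side; the second falls to 0 across [t0 - e, t0 + e], so that for t > 0 the derivative
    is -[bump1_int 1] / e times a bump centred at t0. *)
Definition theta (t0 e t : R) : R := bump1_int (t + 2) * bump1_int (e^-1 * (t0 - t)).

Lemma theta_test eta t0 e : Cc_smooth eta -> 0 < e -> t0 + e < T ->
  test_function T (fun p : V * R => theta t0 e p.2 * eta p.1).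
Proof.
move=> ce e0 et; pose psi := fun p : V * R => theta t0 e p.2 * eta p.1.
have cl (a b : R) : continuous (fun p : V * R => a * p.2 + b : R).
  move=> p; apply: cvgD; last exact: cvg_cst.
  have h : (fun p : V * R => p.2) @ p --> p.2 by exact: cvg_snd.
  exact: (@cvgMr R _ _ _ (fun p : V * R => p.2) a _ h).
have sl (a b : R) : smooth (fun p : V * R => bump1_int (a * p.2 + b)).
  apply: (@smooth_comp_aff R (V * R)%type R^o (bump1_int : R^o -> R) (fun p : V * R => a * p.2 + b : R^o) (fun v => a * v.2)).
  - exact: smooth_bump1_int.
  - exact: cl.
  - by move=> x v s; transitivity (s * (a * v.2) + (a * x.2 + b)) => //; transitivity (a * (s * v.2 + x.2) + b) => //; ring.
have sp : smooth psi.
  apply: (@smoothM R (V * R)%type (fun p : V * R => theta t0 e p.2) (fun p => eta p.1)).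
    apply: (@smoothM R (V * R)%type (fun p : V * R => bump1_int (p.2 + 2)) (fun p => bump1_int (e^-1 * (t0 - p.2)))).
      by have := sl 1 2; congr smooth; apply/funext => p; rewrite mul1r.
    by have := sl (- e^-1) (e^-1 * t0); congr smooth; apply/funext => p; congr bump1_int; ring.
  apply: (@smooth_comp_aff R (V * R)%type V eta fst fst) => //; first by case: ce.
  by move=> x; exact: cvg_fst.
have sub : supp psi `<=` supp eta `*` `[-3, t0 + e]%classic.
  have clo : closed (supp eta `*` `[-3, t0 + e]%classic).
    apply: compact_closed; first exact: norm_hausdorff.
    by apply: compact_setX; [case: ce|exact: segment_compact].
  rewrite /supp [X in _ `<=` X](closure_id _).1//; apply: closureS => -[x t] /= px.
  split => /=; first by apply: subset_closure => /=; apply: contraNN px => /eqP h; rewrite /psi/= h mulr0.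
  rewrite in_itv/=; apply/andP; split; rewrite leNgt; apply: contraNN px => h; rewrite /psi/= /theta.
    by rewrite bump1_int_lo ?mul0r//; lra.
  by rewrite (@bump1_int_lo R (e^-1 * (t0 - t))) ?mulr0 ?mul0r// mulrC ler_pdivrMr//; lra.
split; last by move=> p /sub [_] /=; rewrite in_itv/= => /andP[_ h]; exact: le_lt_trans h et.
split => //; apply: (subclosed_compact _ _ sub); first exact: closed_closure.
by apply: compact_setX; [case: ce|exact: segment_compact].
Qed.

Let k1 : R := bump1_int 1.

Lemma theta_pos t0 e t : 0 <= t -> theta t0 e t = k1 * bump1_int (e^-1 * (t0 - t)).
Proof. by move=> t0'; rewrite /theta bump1_int_hi//; lra. Qed.

Lemma theta_dt eta t0 e x t : Cc_smooth eta -> 0 < e -> t0 + e < T -> 0 < t ->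
  dt (fun p : V * R => theta t0 e p.2 * eta p.1) (x, t) = - k1 / e * bump1 (e^-1 * (t - t0)) * eta x.
Proof.
move=> ce e0 et tp; have [[sp _] _] := theta_test ce e0 et.
have [_ <-] := slice_dt x sp t; rewrite /=.
have -> : 'D_1 (fun s : R => theta t0 e s * eta x) t = 'D_1 (fun s : R => k1 * bump1_int (e^-1 * (t0 - s)) * eta x) t.
  apply: near_eq_derive; near=> s; rewrite theta_pos// ltW//; near: s; exact: lt_nbhsr.
have d1 : is_derive t (1 : R) (fun s : R => e^-1 * (t0 - s)) (- e^-1).
  have := is_deriveZ e^-1 (is_deriveB (is_derive_cst t0 t (1 : R)) (is_derive_id t (1 : R))).
  by rewrite sub0r => h; apply: is_derive_eq h _; rewrite [LHS]mulrN1.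
have d2 := @is_derive1_comp R bump1_int (fun s : R => e^-1 * (t0 - s)) t _ _ (is_derive_bump1_int _) d1.
have -> : bump1 (e^-1 * (t - t0)) = bump1 (e^-1 * (t0 - t)) by rewrite -[in RHS]bump1N; congr bump1; ring.
have d3 := is_deriveZ (eta x) (is_deriveZ k1 d2).
have -> : (fun s : R => k1 * bump1_int (e^-1 * (t0 - s)) * eta x) = eta x \*: (k1 \*: (bump1_int \o (fun s : R => e^-1 * (t0 - s)))).
  by apply/funext => s /=; rewrite mulrC.
have [_ ->] := d3; rewrite /GRing.scale/=; ring.
Unshelve. all: by end_near. Qed.

Lemma bump1_bdd : exists2 D : R, 0 <= D & forall t : R, `|bump1 t| <= D.
Proof.
have bm : compact `[-1, 1 : R] by exact: segment_compact.
apply: (@compact_bdd R R^o (bump1 : R^o -> R) _ (@bump1_continuous R) bm) => x hx; apply: bump1_out.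
rewrite leNgt; apply/negP; rewrite ltr_norml => /andP[a b].
by apply: hx; rewrite /= in_itv/= !ltW.
Qed.

Lemma bump1_int_bdd t : `|bump1_int t| <= \int[lam]_s (bump1 s : R).
Proof.
have Ib := @bump1_Intg R; rewrite /bump1_int Rintegral_mkcond.
have le (s : RT) : `|(bump1 \_ `]-oo, t]%classic) s| <= bump1 s.
  by rewrite patchE; case: ifP => _; rewrite ?normr0 ?ger0_norm ?bump1_ge0.
have I : Intg lam (bump1 \_ `]-oo, t]%classic : RT -> R).
  apply: (Intg_le _ Ib le); apply/(measurable_restrictT _ (measurable_itv _)).
  exact: measurable_funTS (Intg_meas Ib).
exact: Rint_dom.
Qed.

Lemma bump1_scaled t0 e : 0 < e -> Intg lam (fun t : RT => bump1 (e^-1 * (t - t0))) /\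
  \int[lam]_t bump1 (e^-1 * (t - t0)) = e * k1.
Proof.
move=> e0; pose h t : R := e * bump1_int (e^-1 * (t - t0)).
have ch : continuous (fun t : R => bump1 (e^-1 * (t - t0))).
  move=> t; apply: (@continuous_comp _ _ _ (fun t : R => e^-1 * (t - t0)) bump1); last exact: bump1_continuous.
  by apply: (@cvgMr R _ _ _ (fun t : R => t - t0) e^-1); apply: cvgB; [exact: cvg_id|exact: cvg_cst].
have dh (t : R) : is_derive t 1 h (bump1 (e^-1 * (t - t0))).
  have d1 : is_derive t (1 : R) (fun s : R => e^-1 * (s - t0)) e^-1.
    have := is_deriveZ e^-1 (is_deriveB (is_derive_id t (1 : R)) (is_derive_cst t0 t (1 : R))).
    by rewrite subr0 => d; apply: is_derive_eq d _; rewrite [LHS]mulr1.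
  have d2 := is_deriveZ e (@is_derive1_comp R bump1_int (fun s : R => e^-1 * (s - t0)) t _ _ (is_derive_bump1_int _) d1).
  by apply: is_derive_eq d2 _; rewrite [LHS]mulrCA mulrA mulfK// gt_eqF.
have supp0 t : itv_ind (t0 - e) (t0 + e) t * bump1 (e^-1 * (t - t0)) = bump1 (e^-1 * (t - t0)).
  rewrite itv_indE; case: (boolP (_ < t <= _)) => ht; first by rewrite mul1r.
  rewrite bump1_out ?mulr0// normrM gtr0_norm ?invr_gt0// ler_pdivlMl// mulr1 ler_normr.
  by move: ht; rewrite negb_and -leNgt -ltNge => /orP[] ht; apply/orP; [right|left]; lra.
have mb : measurable_fun [set: RT] (fun t : RT => bump1 (e^-1 * (t - t0)) : R).
  exact: continuous_measurable_fun ch.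
have [D D0 bD] := bump1_bdd.
split.
  have bq : bmeas D (fun t : RT => bump1 (e^-1 * (t - t0)) : R) by split.
  by have := Intg_itv_bdd (t0 - e) (t0 + e) bq; congr (Intg _ _); apply/funext => t; exact: supp0.
rewrite (Rint_ext _ (g := fun t => itv_ind (t0 - e) (t0 + e) t * bump1 (e^-1 * (t - t0)))) => [|t]; last by rewrite supp0.
rewrite (FTC_line dh ch); last by lra.
have ei : e^-1 * e = 1 by rewrite mulVf// gt_eqF.
rewrite /h (_ : t0 + e - t0 = e); last by ring.
rewrite (_ : t0 - e - t0 = - e); last by ring.
by rewrite mulrN ei (@bump1_int_lo R (-1))// mulr0 subr0.
Qed.

Variables (w z : VT -> R).
Hypothesis D : difference T M L w z.

Lemma z_out x t : ~~ (0 < t < T) -> z (x, t) = 0.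
Proof. by move=> h; apply: (d_w0 D); exact: (d_out D). Qed.

Lemma itv_z a b x t : a <= 0 -> T <= b -> itv_ind a b t * z (x, t) = z (x, t).
Proof.
move=> a0 Tb; rewrite itv_indE; case: (boolP (0 < t < T)) => [/andP[t0 tT]|h]; last by rewrite z_out ?mulr0.
by rewrite (le_lt_trans a0 t0) (le_trans (ltW tT) Tb) mul1r.
Qed.

Lemma z_slice t : bmeas M (fun x => z (x, t)).
Proof. exact: (bmeas_pair2 (t : RT) (d_z D)). Qed.

Definition zpair (h : V -> R) (t : R) : R := \int[leb]_x (z (x, t) * h x).

Lemma z_IntgM h : Intg leb h -> Intg lebT (fun p : VT => z p * h p.1).
Proof.
move=> Ih; have mq : measurable_fun [set: VT] (fun p : VT => z p * h p.1).
  by apply: measurable_funM; [exact: (d_z D).1|exact: meas_fst (Intg_meas Ih)].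
have := Intg_strip 0 T mq (IntgZ M (Intg_abs Ih)).
have -> : (fun p : VT => itv_ind 0 T p.2 * (z p * h p.1)) = (fun p : VT => z p * h p.1).
  by apply/funext => -[x t] /=; rewrite mulrA itv_z.
by apply => x t; rewrite normrM ler_wpM2r// (d_z D).2.
Qed.

Lemma zpair_Intg h : Intg leb h -> Intg lam (zpair h : RT -> R).
Proof. by move=> Ih; exact: (Fubini_intg2 (z_IntgM Ih)). Qed.

Lemma theta_bmeas (t0 e : R) :
  (forall B, (forall t : R, `|bump1 t| <= B) -> bmeas B (fun t : RT => bump1 (e^-1 * (t - t0)) : R)) /\
  bmeas (\int[lam]_s (bump1 s : R)) (fun t : RT => bump1_int (e^-1 * (t0 - t)) : R).
Proof.
have c2 (g l : R -> R) : continuous g -> continuous l ->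
    measurable_fun setT (fun t : RT => g (e^-1 * l t) : R).
  move=> cg cl; apply: continuous_measurable_fun => t.
  apply: (@continuous_comp _ _ _ (fun t : R => e^-1 * l t) g); last exact: cg.
  exact: (@cvgMr R _ _ _ l e^-1 _ (cl t)).
split; last first.
  split => [|t]; last exact: bump1_int_bdd.
  apply: (c2 _ (fun t => t0 - t)); first exact: smooth_continuous (@smooth_bump1_int R).
  by move=> t; apply: cvgB; [exact: cvg_cst|exact: cvg_id].
move=> B hB; split => [|t]; last exact: hB.
apply: (c2 _ (fun t => t - t0)); first exact: bump1_continuous.
by move=> t; apply: cvgB; [exact: cvg_id|exact: cvg_cst].
Qed.

Lemma weak_theta eta t0 e : Cc_smooth eta -> 0 < e -> t0 + e < T ->
  \int[lam]_t (bump1 (e^-1 * (t - t0)) * \int[leb]_x (w (x, t) * eta x)) =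
  e * \int[lam]_t (bump1_int (e^-1 * (t0 - t)) * zpair (L eta) t).
Proof.
move=> ce e0 et; have [C C0 be] := Cc_meas ce; have IL := g_Intg gen ce.
have [IF F0] := d_id D (theta_test ce e0 et); set F := (fun p : VT => _) in IF F0.
pose a (t : RT) := \int[leb]_x (w (x, t) * eta x).
have Iwe : Intg lebT (fun p : VT => w p * eta p.1).
  have b1 : bmeas C (fun p : VT => eta p.1).
    by split => [|p]; [exact: meas_fst be.1|exact: be.2].
  by have := bmeas_IntgM b1 (d_wI D); congr (Intg _ _); apply/funext => p; exact: mulrC.
have Ia : Intg lam a := Fubini_intg2 Iwe.
have Ib := zpair_Intg IL.
have [Ibu _] := bump1_scaled t0 e0.
have [B B0 hB] := bump1_bdd; have [bB bG] := theta_bmeas t0 e.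
have I1 := bmeas_IntgM (bB B hB) Ia; have I2 := bmeas_IntgM bG Ib.
have k0 : k1 != 0 by rewrite gt_eqF// bump1_int1.
have slice : {ae lam, forall t : RT, \int[leb]_x F (x, t) =
    k1 * (bump1_int (e^-1 * (t0 - t)) * zpair (L eta) t - e^-1 * (bump1 (e^-1 * (t - t0)) * a t))}.
  have := Fubini_ae2 IF; have := Fubini_ae2 Iwe; apply: filterS2 => t J1 J2.
  have [tp|tn] := boolP (0 < t < T); last first.
    rewrite /a /zpair (Rint_ext _ (g := fun=> 0)) => [|x]; last by rewrite /F (d_out D _ tn) z_out// !mul0r addr0.
    rewrite (Rint_ext _ (f := fun x => z (x, t) * _) (g := fun=> 0)) => [|x]; last by rewrite z_out// mul0r.
    rewrite (Rint_ext _ (f := fun x => w (x, t) * _) (g := fun=> 0)) => [|x]; last by rewrite (d_out D)// mul0r.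
    by rewrite Rint_zero !mulr0 subrr mulr0.
  have /andP[t00 tT] := tp.
  have J3 := bmeas_IntgM (z_slice t) IL.
  rewrite (Rint_ae _ (g := fun x => (- k1 / e * bump1 (e^-1 * (t - t0))) * (w (x, t) * eta x) +
      theta t0 e t * (z (x, t) * L eta x))).
  - rewrite RintD ?RintZ//; try exact: IntgZ.
    rewrite -/(a t) -/(zpair (L eta) t) theta_pos ?ltW//; ring.
  - exact: Intg_meas J2.
  - exact: Intg_meas (IntgD (IntgZ _ J1) (IntgZ _ J3)).
  apply: filterS (g_scale (theta t0 e t) ce) => x hx.
  rewrite /F (theta_dt _ ce e0 et t00) /= hx; ring.
have := Fubini_Rint2 IF; rewrite F0 (Rint_ae _ _ slice); last 2 first.
- exact: Intg_meas (Fubini_intg2 IF).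
- exact: Intg_meas (IntgZ k1 (IntgB I2 (IntgZ e^-1 I1))).
rewrite RintZ; last by apply: IntgB => //; exact: IntgZ.
rewrite RintB ?RintZ//; last exact: IntgZ.
move=> /eqP; rewrite mulf_eq0 (negbTE k0) subr_eq0/= => /eqP ->.
by rewrite mulrA mulfV ?mul1r// gt_eqF.
Qed.

(** As the width of the cutoff tends to 0, one side of [weak_theta] becomes a value at t0 and the
    other an integral up to t0. The first limit rests on the continuous representative of the
    pairing: Lebesgue points would leave a null set of times depending on eta, while mollification
    uses all the functions [rho y] at the same time. *)
Lemma pairing : {ae lam, forall t : RT, 0 < t < T -> forall eta, Cc_smooth eta ->
  \int[leb]_x (w (x, t) * eta x) = \int[lam]_s (itv_ind 0 t s * zpair (L eta) s)}.
Proof.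
have [A [cA aA]] := d_pair D.
suff main eta (t0 : R) : Cc_smooth eta -> 0 < t0 < T ->
    A eta t0 = \int[lam]_s (itv_ind 0 t0 s * zpair (L eta) s).
  by apply: filterS aA => t0 h tp eta ce; rewrite h//; exact: main.
move=> ce /andP[t0p tT]; have k1p : 0 < k1 by exact: bump1_int1.
have Ib := zpair_Intg (g_Intg gen ce).
have [C C0 be] := Cc_meas ce; have [D0 D0p hD] := bump1_bdd.
pose a (t : RT) := \int[leb]_x (w (x, t) * eta x).
have Ia : Intg lam a.
  have b1 : bmeas C (fun p : VT => eta p.1).
    by split => [|p]; [exact: meas_fst be.1|exact: be.2].
  have : Intg lebT (fun p : VT => w p * eta p.1).
    by have := bmeas_IntgM b1 (d_wI D); congr (Intg _ _); apply/funext => p; exact: mulrC.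
  exact: Fubini_intg2.
pose e (n : nat) : R := n.+1%:R^-1.
have e0 n : 0 < e n by rewrite invr_gt0.
have en d : 0 < d -> \forall n \near \oo, e n < d by move=> d0; exact: (near_infty_natSinv_lt (PosNum d0)).
pose r n := \int[lam]_t (bump1_int ((e n)^-1 * (t0 - t)) * zpair (L eta) t).
have c1 : r n @[n --> \oo] --> k1 * \int[lam]_s (itv_ind 0 t0 s * zpair (L eta) s).
  rewrite -RintZ; last exact: Intg_itv.
  have [|||||_ _] := @DCT _ _ _ lam (fun n t => bump1_int ((e n)^-1 * (t0 - t)) * zpair (L eta) t)
      (fun t => k1 * (itv_ind 0 t0 t * zpair (L eta) t)) (fun t => (\int[lam]_s (bump1 s : R)) * `|zpair (L eta) t|).
  - by move=> n; apply: measurable_funM; [have [] := (theta_bmeas t0 (e n)).2|exact: Intg_meas Ib].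
  - exact: Intg_meas (IntgZ k1 (Intg_itv 0 t0 Ib)).
  - apply: filterS (ae_neq t0) => t; rewrite neq_lt => /orP[tt|tt].
    + have zE : itv_ind 0 t0 t * zpair (L eta) t = zpair (L eta) t.
        rewrite itv_indE (ltW tt) andbT; case: ltP => tp; first by rewrite mul1r.
        rewrite mul0r /zpair (Rint_eq0 _)// => x.
        by rewrite z_out ?mul0r// negb_and -leNgt tp.
      rewrite zE; apply: cvg_near_cst; have dt0 : 0 < t0 - t by rewrite subr_gt0.
      apply: filterS (en _ dt0) => n hn; rewrite bump1_int_hi// ler_pdivlMl// mulr1 ltW//.
    + rewrite itv_indE [t <= t0]leNgt tt andbF mul0r mulr0; apply: cvg_near_cst.
      have dt0 : 0 < t - t0 by rewrite subr_gt0.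
      apply: filterS (en _ dt0) => n hn; rewrite bump1_int_lo ?mul0r// ler_pdivrMl// mulrN1; lra.
  - by apply: IntgZ; exact: Intg_abs.
  - by move=> n; apply: aeW => t; rewrite normrM ler_wpM2r// bump1_int_bdd.
  - exact.
have c2 : r n @[n --> \oo] --> k1 * A eta t0.
  apply/cvgrPdist_le => eps eps0; have d1 : 0 < eps / k1 by rewrite divr_gt0.
  have /cvgrPdist_lt/(_ _ d1)/nbhs_normP[d /= d0 hd] := cA eta t0 ce (introT andP (conj t0p tT)).
  have t1 : 0 < T - t0 by rewrite subr_gt0.
  apply: filterS3 (en _ t1) (en _ t0p) (en _ d0) => n h1 h2 h3.
  have [Ibu bE] := bump1_scaled t0 (e0 n).
  have Iba := bmeas_IntgM ((theta_bmeas t0 (e n)).1 _ hD) Ia.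
  have -> : r n = (e n)^-1 * \int[lam]_t (bump1 ((e n)^-1 * (t - t0)) * a t).
    by rewrite (weak_theta ce (e0 n)) ?mulKf ?gt_eqF//; lra.
  have -> : k1 * A eta t0 = (e n)^-1 * \int[lam]_t (A eta t0 * bump1 ((e n)^-1 * (t - t0))).
    by rewrite RintZ// bE mulrCA mulKf ?gt_eqF// mulrC.
  rewrite -mulrBr -RintB//; last exact: IntgZ.
  rewrite normrM gtr0_norm ?invr_gt0// ler_pdivrMl//.
  have I := IntgB (IntgZ (A eta t0) Ibu) Iba; apply: le_trans (Rint_norm I) _.
  rewrite (_ : e n * eps = eps / k1 * (e n * k1)); last by rewrite mulrCA divfK ?gt_eqF.
  rewrite -bE -RintZ//; apply: Rint_le_ae; [exact: Intg_abs|exact: IntgZ|].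
  apply: filterS aA => t ht; rewrite (mulrC (A _ _)) -mulrBr normrM ger0_norm ?bump1_ge0// mulrC.
  have [tt|tt] := leP (e n) `|t - t0|.
    by rewrite bump1_out ?mulr0// normrM gtr0_norm ?invr_gt0// ler_pdivlMl// mulr1.
  apply: ler_wpM2r; first exact: bump1_ge0.
  have := tt; rewrite ltr_norml => /andP[tt1 tt2].
  rewrite /a ht//; last by lra.
  by apply/ltW/hd; rewrite /= distrC; exact: lt_trans tt h3.
apply: (mulfI (lt0r_neq0 k1p)); exact: (cvg_unique _ c2 c1).
Qed.

(** * The mollified energy inequality *)

Section mollified.
Variable d : R.
Hypothesis d0 : 0 < d.

Definition rho (y x : V) : R := moll d (y - x).

Lemma Cc_rho y : Cc_smooth (rho y). Proof. exact: Cc_refl (Cc_moll d0). Qed.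

Lemma rhoE y x : rho y x = moll d (x - y). Proof. by rewrite /rho -mollN opprB. Qed.

Lemma L_rho y x : L (rho y) x = L (moll d) (x - y).
Proof. by rewrite -(g_trans gen); congr (L _ _); apply/funext => ?; exact: rhoE. Qed.

Lemma dop_rho m y x : dop m (rho y) x = dop m (moll d) (x - y).
Proof.
rewrite /dop rhoE /avg (Rint_ext _ (g := fun u => moll d (x - y + u))) // => u.
rewrite rhoE; congr (moll d _); exact: addrAC.
Qed.

Lemma dop_mconv m C (h : V -> R) y : sym m -> bmeas C h ->
  dop m (mconv h d) y = \int[leb]_x (h x * dop m (rho y) x).
Proof.
move=> sm bh; have [Cr _ br] := Cc_meas (Cc_rho y); have Ir := Cc_Intg (Cc_rho y).
have Ia := avg_Intg m br Ir.
have S := Intg_shiftM m br Ir bh.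
have -> : \int[leb]_x (h x * dop m (rho y) x) =
    \int[leb]_x (h x * avg m (rho y) x) - mass m * \int[leb]_x (h x * rho y x).
  have J1 := bmeas_IntgM bh Ir; have J2 := bmeas_IntgM bh Ia.
  rewrite -RintZ// -RintB//; last exact: IntgZ.
  by apply: Rint_ext => x; rewrite /dop; ring.
congr (_ - _); transitivity (\int[m]_u \int[leb]_x (rho y (x + u) * h x)).
  rewrite -(Rint_sym sm (F := fun u => \int[leb]_x (rho y (x + u) * h x))).
    apply: Rint_ext => u; apply: Rint_ext => x; rewrite mulrC /rho; congr (moll d _ * _).
    by rewrite opprD opprK addrAC addrA.
  exact: Intg_meas (Fubini_intg1 S).
rewrite (Fubini_swap S) /=; apply: Rint_ext => x; rewrite /avg -RintZ; last exact: Intg_avg0 br.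
by apply: Rint_ext => u; exact: mulrC.
Qed.

Definition zint (b : RT -> R) (x : V) : R := \int[lam]_s (b s * z (x, s)).

(** Formally L applied to the mollified [zint b]; carrying L over to the mollifier gives it a
    meaning although [zint b] is only bounded. *)
Definition zsrc (b : RT -> R) (y : V) : R := \int[leb]_x (zint b x * L (rho y) x).

Lemma zline (b : RT -> R) x : bmeas 1 b -> Intg lam (fun s => b s * z (x, s)) /\
  forall s, `|b s * z (x, s)| <= M * itv_ind 0 T s.
Proof.
move=> bb; have le s : `|b s * z (x, s)| <= M * itv_ind 0 T s.
  rewrite -(itv_z x s (lexx 0) (lexx T)) normrM normrM mulrA (ger0_norm (itv_ind_ge0 _ _ _)).
  rewrite mulrAC; apply: ler_pM; rewrite ?mulr_ge0 ?itv_ind_ge0//.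
    by rewrite -[leRHS]mul1r; apply: ler_pM => //; [exact: bb.2|exact: (d_z D).2].
split => //; apply: (Intg_le _ (IntgZ M (Intg_itv_ind 0 T))) => //.
apply: measurable_funM; first exact: bb.1.
exact: (measurableT_comp (d_z D).1 (measurable_pair1 x)).
Qed.

Lemma zint_bmeas b : bmeas 1 b -> bmeas (T * M) (zint b).
Proof.
move=> bb; split => [|x].
  apply: (@measurable_Rint_param _ V _ _ R lam (fun p => b p.2 * z p)).
  by apply: measurable_funM; [exact: meas_snd bb.1|exact: (d_z D).1].
have [I h] := zline x bb.
apply: (@le_trans _ _ (\int[lam]_s (M * itv_ind 0 T s))); first exact: Rint_dom I (IntgZ M (Intg_itv_ind 0 T)) h.
by rewrite RintZ ?Rint_itv_ind ?subr0 1?mulrC//; [exact: ltW (d_T D)|exact: Intg_itv_ind].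
Qed.

Lemma zsrc_bmeas b : bmeas 1 b -> exists C, bmeas C (zsrc b).
Proof.
move=> bb; have bW := zint_bmeas bb; have IL := g_Intg gen (Cc_moll d0).
exists (T * M * \int[leb]_x `|L (moll d) x|); split => [|y].
  apply: (@measurable_Rint_param _ V _ V R leb (fun p => zint b p.2 * L (rho p.1) p.2)).
  apply: measurable_funM; first exact: meas_snd bW.1.
  under eq_fun do rewrite L_rho; apply: (measurableT_comp (Intg_meas IL)).
  exact: (@measurable_subrV_swap R N).
have Iy : Intg leb (L (rho y)) by apply: g_Intg gen _ (Cc_rho y).
apply: le_trans (Rint_bmeasM_le bW Iy) _; rewrite -(Rint_shift (- y) (Intg_meas (Intg_abs IL))).
by under eq_Rintegral do rewrite L_rho.
Qed.

(** The bound T M of [zint b] times an L^1 error on the fixed mollifier: this is how consistency in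
    L^1 becomes uniform in space. *)
Definition zerr n := T * M * \int[leb]_x `|dop (nu n) (moll d) x - L (moll d) x|.

Lemma zerr0 : zerr @ \oo --> (0 : R).
Proof.
rewrite /zerr -(mulr0 (T * M)); exact: (@cvgMr R _ _ _ _ (T * M) _ (g_cvg gen (Cc_moll d0))).
Qed.

(** [d_mod] at level xi / (2 T), integrated over [0, T], bounds |zint b| by xi / 2 plus a multiple
    of an integrable function. Mollifying preserves such a bound, and Chebyshev concludes. *)
Lemma zint_level b xi : bmeas 1 b -> 0 < xi -> (leb [set y | (xi < `|mconv (zint b) d y|)%R] < +oo)%E.
Proof.
move=> bb xi0; have T0 := d_T D; have x1 : 0 < xi / (2 * T) by rewrite divr_gt0// mulr_gt0.
have [C C0 hC] := d_mod D x1; have Iw := d_wI D.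
pose om x := \int[lam]_s `|w (x, s)|.
have Iom : Intg leb om := Fubini_intg1 (Intg_abs Iw).
have [Im _] := mconv_L1 Iom d0.
have bW := zint_bmeas bb.
have le : {ae leb, forall x, `|zint b x| <= xi / 2 + C * om x}.
  apply: filterS (Fubini_ae1 Iw) => x Ix; have [I h] := zline x bb.
  have I2 := IntgD (IntgZ (xi / (2 * T)) (Intg_itv_ind 0 T)) (IntgZ C (Intg_abs Ix)).
  apply: (@le_trans _ _ (\int[lam]_s (xi / (2 * T) * itv_ind 0 T s + C * `|w (x, s)|))).
    apply: (Rint_dom I) => // s.
    rewrite -(itv_z x s (lexx 0) (lexx T)) normrM normrM (ger0_norm (itv_ind_ge0 _ _ _)).
    apply: (@le_trans _ _ (itv_ind 0 T s * (xi / (2 * T) + C * `|w (x, s)|))).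
      rewrite -[leRHS]mul1r; apply: ler_pM => //; rewrite ?mulr_ge0 ?itv_ind_ge0//; first exact: bb.2.
      by rewrite ler_wpM2l ?itv_ind_ge0//; exact: hC.
    rewrite mulrDr mulrC lerD2l itv_indE; case: (_ && _); rewrite ?mul1r ?mul0r// mulr_ge0//.
  have J1 := Intg_itv_ind 0 T; have J2 := Intg_abs Ix.
  rewrite (RintD (IntgZ (xi / (2 * T)) J1) (IntgZ C J2)) (RintZ _ J1) (RintZ _ J2).
  rewrite Rint_itv_ind ?(ltW T0)// subr0 lerD2r le_eqVlt; apply/orP; left; apply/eqP; field.
  by rewrite gt_eqF.
have le2 y : `|mconv (zint b) d y| <= xi / 2 + `|C * mconv om d y|.
  have Ir := Cc_Intg (Cc_rho y); have I1 := bmeas_IntgM bW Ir.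
  have [Cr _ br] := Cc_meas (Cc_rho y).
  have I2 : Intg leb (fun x => om x * rho y x) by under eq_fun do rewrite mulrC; exact: bmeas_IntgM br Iom.
  apply: (@le_trans _ _ (xi / 2 + C * mconv om d y)); last by rewrite lerD2l ler_norm.
  apply: le_trans (Rint_norm I1) _.
  apply: (@le_trans _ _ (\int[leb]_x (xi / 2 * rho y x + C * (om x * rho y x)))).
    apply: Rint_le_ae; [exact: Intg_abs|exact: IntgD (IntgZ _ Ir) (IntgZ _ I2)|].
    apply: filterS le => x hx; rewrite normrM (ger0_norm (moll_ge0 _ _)).
    have -> : xi / 2 * rho y x + C * (om x * rho y x) = (xi / 2 + C * om x) * rho y x by ring.
    by apply: ler_wpM2r hx; exact: moll_ge0.
  rewrite (RintD (IntgZ _ Ir) (IntgZ _ I2)) (RintZ _ Ir) (RintZ _ I2).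
  rewrite (_ : \int[leb]_x rho y x = 1) ?mulr1// -[RHS](@moll_int d d0).
  exact: Rint_refl (Intg_meas (Cc_Intg (Cc_moll d0))).
have x2 : 0 < xi / 2 by rewrite divr_gt0.
apply: le_lt_trans (markov_fin (IntgZ C Im) x2); apply: le_measure; rewrite ?inE.
- apply: measurable_gt_abs; apply: (@measurable_Rint_param _ V _ V R leb (fun p => zint b p.2 * rho p.1 p.2)).
  apply: measurable_funM; first exact: meas_snd bW.1.
  have [Cm _ bm] := Cc_meas (Cc_moll d0).
  exact: (measurableT_comp bm.1 (@measurable_subrV R N)).
- by apply: measurable_gt_abs; exact: Intg_meas (IntgZ C Im).
by move=> y /= h; have := le2 y; lra.
Qed.

Lemma zint_domain b : bmeas 1 b -> Intg leb (zsrc b) -> in_domain nu zerr (T * M) (mconv (zint b) d) (zsrc b).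
Proof.
move=> bb Is; have bW := zint_bmeas bb; have IL := g_Intg gen (Cc_moll d0).
have [Cm _ bm] := Cc_meas (Cc_moll d0); have Im := Cc_Intg (Cc_moll d0).
split => //.
- split => [|y]; last exact: mconv_le bW d0.
  apply: (@measurable_Rint_param _ V _ V R leb (fun p => zint b p.2 * rho p.1 p.2)).
  apply: measurable_funM; first exact: meas_snd bW.1.
  exact: (measurableT_comp bm.1 (@measurable_subrV R N)).
- exact: zsrc_bmeas.
- move=> n y; rewrite (dop_mconv y (g_sym gen n) bW).
  have Idn := dop_Intg (nu n) bm Im; have J := Intg_abs (IntgB Idn IL).
  have I1 : Intg leb (dop (nu n) (rho y)) by have := Intg_shift (- y) Idn; congr (Intg _ _); apply/funext => x; rewrite dop_rho.
  have I2 : Intg leb (L (rho y)) by exact: g_Intg gen _ (Cc_rho y).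
  have I3 := IntgB (bmeas_IntgM bW I1) (bmeas_IntgM bW I2).
  rewrite /zsrc -RintB; [|exact: bmeas_IntgM bW I1|exact: bmeas_IntgM bW I2].
  apply: le_trans (Rint_norm I3) _; rewrite /zerr -(Rint_shift (- y) (Intg_meas J)) -RintZ; last exact: Intg_shift J.
  apply: Rint_le => [||x]; [exact: Intg_abs|by apply: IntgZ; exact: Intg_shift J|].
  by rewrite -mulrBr normrM dop_rho L_rho ler_wpM2r// bW.2.
- by move=> xi; exact: zint_level.
Qed.

Lemma zint_pair b h : bmeas 1 b -> Intg leb h -> \int[leb]_x (zint b x * h x) = \int[lam]_s (b s * zpair h s).
Proof.
move=> bb Ih; have I : Intg lebT (fun p : VT => b p.2 * (z p * h p.1)).
  apply: bmeas_IntgM (z_IntgM Ih); split => [|p]; last exact: bb.2.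
  exact: meas_snd bb.1.
transitivity (\int[leb]_x \int[lam]_s (b s * (z (x, s) * h x))).
  apply: Rint_ext => x; have [Ix _] := zline x bb.
  by rewrite mulrC -RintZ//; apply: Rint_ext => s; ring.
rewrite (Fubini_swap I); apply: Rint_ext => s /=; rewrite RintZ//; exact: bmeas_IntgM (z_slice s) Ih.
Qed.

Lemma measurable_zint : measurable_fun [set: VT] (fun p : VT => zint (itv_ind 0 p.2) p.1).
Proof.
apply: (@measurable_Rint_param _ VT _ RT R lam (fun q => itv_ind 0 q.1.2 q.2 * z (q.1.1, q.2))).
apply: measurable_funM; last first.
  apply: (measurableT_comp (d_z D).1); apply: measurable_fun_pair; last exact: measurable_snd.
  exact: (measurableT_comp measurable_fst measurable_fst).
pose A := [set r : RT * RT | 0 < r.2 <= r.1].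
have mA : measurable A.
  have e : A = (setT `*` `]0, +oo[%classic) `&` (fun r : RT * RT => r.1 - r.2) @^-1` `[0, +oo[%classic.
    apply/seteqP; split => -[a b]; rewrite /A /= !in_itv/= !andbT subr_ge0; first by move=> /andP[-> ->].
    by move=> [[_ ->] ->].
  rewrite e; apply: measurableI; first by apply: measurableX => //; exact: measurable_itv.
  have m : measurable_fun setT (fun r : RT * RT => r.1 - r.2 : R).
    by apply: measurable_funB; [exact: measurable_fst|exact: measurable_snd].
  by rewrite -[X in measurable X]setTI; apply: m => //; exact: measurable_itv.
have -> : (fun q : VT * RT => itv_ind 0 q.1.2 q.2) = (\1_A : _ -> R) \o (fun q : VT * RT => (q.1.2, q.2)).
  by apply/funext => q; rewrite itv_indE /= indicE /A mem_setE.
apply: measurableT_comp; first exact: measurable_indic.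
apply: measurable_fun_pair; last exact: measurable_snd.
exact: (measurableT_comp measurable_snd measurable_fst).
Qed.

(** By the symmetry of the cross terms, twice the pairing of Ft - Fs with Gt equals the increment of
    the energy plus the pairing of Ft - Fs with Gt - Gs, which is nonpositive. *)
Lemma quad_expand (Ft Fs Gt Gs : V -> R) : Intg leb (fun y => Ft y * Gt y) -> Intg leb (fun y => Ft y * Gs y) ->
  Intg leb (fun y => Fs y * Gt y) -> Intg leb (fun y => Fs y * Gs y) ->
  \int[leb]_y ((Ft y - Fs y) * (Gt y - Gs y)) <= 0 -> \int[leb]_y (Ft y * Gs y) = \int[leb]_y (Fs y * Gt y) ->
  2 * \int[leb]_y ((Ft y - Fs y) * Gt y) <= \int[leb]_y (Ft y * Gt y) - \int[leb]_y (Fs y * Gs y).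
Proof.
move=> I11 I12 I21 I22; have -> : \int[leb]_y ((Ft y - Fs y) * (Gt y - Gs y)) =
    (\int[leb]_y (Ft y * Gt y) - \int[leb]_y (Ft y * Gs y)) - (\int[leb]_y (Fs y * Gt y) - \int[leb]_y (Fs y * Gs y)).
  rewrite -(RintB I11 I12) -(RintB I21 I22) -(RintB (IntgB I11 I12) (IntgB I21 I22)).
  by apply: Rint_ext => y; ring.
have -> : \int[leb]_y ((Ft y - Fs y) * Gt y) = \int[leb]_y (Ft y * Gt y) - \int[leb]_y (Fs y * Gt y).
  by rewrite -(RintB I11 I21); apply: Rint_ext => y; ring.
move=> h1 h2; rewrite h2 in h1; lra.
Qed.

Let F (p : VT) := mconv (zint (itv_ind 0 p.2)) d p.1.
Let G (p : VT) := mconv (fun x => w (x, p.2)) d p.1.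

Let mmoll : measurable_fun [set: VT * V] (fun q : VT * V => moll d (q.1.1 - q.2)).
Proof.
have [C _ bm] := Cc_meas (Cc_moll d0); apply: (measurableT_comp bm.1).
have m : measurable_fun [set: VT * V] (fun q : VT * V => (q.1.1, q.2)).
  by apply: measurable_fun_pair; [exact: (measurableT_comp measurable_fst measurable_fst)|exact: measurable_snd].
exact: (measurableT_comp (@measurable_subrV R N) m).
Qed.

Let mswap : measurable_fun [set: VT * V] (fun q : VT * V => ((q.2, q.1.2) : VT)).
Proof.
by apply: measurable_fun_pair; [exact: measurable_snd|exact: (measurableT_comp measurable_snd measurable_fst)].
Qed.

Lemma F_bmeas : bmeas (T * M) F.
Proof.
split => [|p]; last exact: mconv_le (zint_bmeas (bmeas_itv_ind 0 p.2)) d0.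
apply: (@measurable_Rint_param _ VT _ V R leb (fun q => zint (itv_ind 0 q.1.2) q.2 * moll d (q.1.1 - q.2))).
apply: measurable_funM; [exact: (measurableT_comp measurable_zint mswap)|exact: mmoll].
Qed.

Lemma G_Intg : Intg lebT G.
Proof.
apply: (@Intg_prod2 _ _ _ _ _ leb lam _ (fun t => 3 * \int[leb]_x `|w (x, t)|)).
- apply: (@measurable_Rint_param _ VT _ V R leb (fun q => w (q.2, q.1.2) * moll d (q.1.1 - q.2))).
  apply: measurable_funM; [exact: (measurableT_comp (d_w D).1 mswap)|exact: mmoll].
- by apply: IntgZ; exact: (Fubini_intg2 (Intg_abs (d_wI D))).
- by move=> t; have [] := mconv_L1 (d_slice D t) d0.
- by move=> t; have [] := mconv_L1 (d_slice D t) d0.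
Qed.

Lemma G_out y t : ~~ (0 < t < T) -> G (y, t) = 0.
Proof.
move=> h; rewrite /G /mconv (Rint_eq0 _)// => x /=.
by rewrite (d_out D)// mul0r.
Qed.

(** At such times the mollified w is exactly the generator applied to the mollified primitive of
    z. *)
Let good (t : R) := forall y, zsrc (itv_ind 0 t) y = G (y, t).

Lemma ae_good : {ae lam, forall t : RT, t < T -> good t}.
Proof.
apply: filterS (pairing) => t h tT y; have [t0|t0] := ltP 0 t.
  rewrite /zsrc (zint_pair (bmeas_itv_ind 0 t)); last exact: g_Intg gen _ (Cc_rho y).
  by rewrite -h ?t0//; exact: Cc_rho.
rewrite G_out; last by rewrite negb_and -leNgt t0.
rewrite /zsrc (Rint_eq0 _)// => x.
rewrite /zint (Rint_eq0 _) ?mul0r// => s.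
by rewrite itv_indE; case: ltP => //= s0; rewrite ?mul0r// leNgt (le_lt_trans t0 s0) mul0r.
Qed.

Let dom t : good t -> in_domain nu (zerr) (T * M) (fun y => F (y, t)) (fun y => G (y, t)).
Proof.
move=> gt; have -> : (fun y => G (y, t)) = zsrc (itv_ind 0 t) by apply/funext => y; rewrite gt.
apply: (zint_domain (bmeas_itv_ind 0 t)).
have -> : zsrc (itv_ind 0 t) = (fun y => G (y, t)) by apply/funext => y; rewrite gt.
by have [] := mconv_L1 (d_slice D t) d0.
Qed.

Let alpha t := \int[leb]_y (F (y, t) * G (y, t)).

Lemma alpha_le0 t : good t -> alpha t <= 0.
Proof. by move=> gt; exact: (limit_neg (g_sym gen) (zerr0) (dom gt)). Qed.

Lemma alpha_step s t : good s -> good t ->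
  2 * \int[leb]_y ((F (y, t) - F (y, s)) * G (y, t)) <= alpha t - alpha s.
Proof.
move=> gs gt; have ds := dom gs; have dt := dom gt.
have [bFs [Cs bGs] IGs _ _] := ds; have [bFt [Ct bGt] IGt _ _] := dt.
have e := limit_sym (g_sym gen) (zerr0) dt ds.
(* The increment of F between s and t is again a mollified [zint], with a difference of two
   indicators as weight, so the negativity of L applies to it. *)
have bb : bmeas 1 (fun r => itv_ind 0 t r - itv_ind 0 s r).
  split; first by apply: measurable_funB; exact: measurable_itv_ind.
  by move=> r; rewrite !itv_indE; case: (_ && _); case: (_ && _); rewrite ?subrr ?subr0 ?sub0r ?normrN ?normr1 ?normr0.
have zB x : zint (fun r => itv_ind 0 t r - itv_ind 0 s r) x = zint (itv_ind 0 t) x - zint (itv_ind 0 s) x.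
  have [It _] := zline x (bmeas_itv_ind 0 t); have [Is _] := zline x (bmeas_itv_ind 0 s).
  by rewrite /zint -RintB//; apply: Rint_ext => r; rewrite mulrBl.
have bW r := zint_bmeas (bmeas_itv_ind 0 r).
have zI y h : Intg leb h -> \int[leb]_x (zint (fun r => itv_ind 0 t r - itv_ind 0 s r) x * h x) =
    \int[leb]_x (zint (itv_ind 0 t) x * h x) - \int[leb]_x (zint (itv_ind 0 s) x * h x) + y * 0.
  move=> Ih; rewrite mulr0 addr0 -RintB; [|exact: bmeas_IntgM (bW t) Ih|exact: bmeas_IntgM (bW s) Ih].
  by apply: Rint_ext => x; rewrite zB mulrBl.
have eF : mconv (zint (fun r => itv_ind 0 t r - itv_ind 0 s r)) d = (fun y => F (y, t) - F (y, s)).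
  by apply/funext => y; rewrite /mconv (zI 0) ?mulr0 ?addr0//; exact: Cc_Intg (Cc_rho y).
have eG : zsrc (fun r => itv_ind 0 t r - itv_ind 0 s r) = (fun y => G (y, t) - G (y, s)).
  apply/funext => y; rewrite /zsrc (zI 0) ?mulr0 ?addr0; last exact: g_Intg gen _ (Cc_rho y).
  by rewrite -(gs y) -(gt y).
have IG : Intg leb (fun y => G (y, t) - G (y, s)) by exact: IntgB.
have := zint_domain bb; rewrite eF eG => /(_ IG) /(limit_neg (g_sym gen) (zerr0)).
have I11 := bmeas_IntgM bFt IGt; have I12 := bmeas_IntgM bFt IGs.
have I21 := bmeas_IntgM bFs IGt; have I22 := bmeas_IntgM bFs IGs.
by move=> neg; exact: quad_expand I11 I12 I21 I22 neg e.
Qed.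

Let Zm (p : VT) := mconv (fun x => z (x, p.2)) d p.1.

Lemma Zm_bmeas : bmeas M Zm.
Proof.
split => [|p]; last exact: mconv_le (z_slice p.2) d0.
apply: (@measurable_Rint_param _ VT _ V R leb (fun q => z (q.2, q.1.2) * moll d (q.1.1 - q.2))).
apply: measurable_funM; [exact: (measurableT_comp (d_z D).1 mswap)|exact: mmoll].
Qed.

Lemma F_prim y t : F (y, t) = \int[lam]_s (itv_ind 0 t s * Zm (y, s)).
Proof. exact: (zint_pair (bmeas_itv_ind 0 t) (Cc_Intg (Cc_rho y))). Qed.

Lemma Zm_line y : Intg lam (fun s => Zm (y, s)).
Proof. exact: (zpair_Intg (Cc_Intg (Cc_rho y))). Qed.

Lemma F_shift c : bmeas (T * M) (fun p : VT => F (p.1, p.2 + c)).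
Proof.
split => [|p]; last exact: F_bmeas.2.
apply: (measurableT_comp F_bmeas.1); apply: measurable_fun_pair; first exact: measurable_fst.
exact: (measurableT_comp (measurable_tshift c) measurable_snd).
Qed.

Lemma F_incr y t tau : 0 < tau -> `|F (y, t) - F (y, t - tau)| <= tau * M.
Proof.
move=> tau0; have I := Zm_line y; rewrite !F_prim -(RintB (Intg_itv 0 t I) (Intg_itv 0 (t - tau) I)).
have Ii := Intg_itv_ind (t - tau) t.
apply: (@le_trans _ _ (\int[lam]_s (M * itv_ind (t - tau) t s))); last first.
  by rewrite (RintZ _ Ii) Rint_itv_ind; [rewrite (_ : t - (t - tau) = tau) 1?mulrC//; ring|lra].
apply: (Rint_dom (IntgB (Intg_itv 0 t I) (Intg_itv 0 (t - tau) I)) (IntgZ M Ii)) => s.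
rewrite -mulrBl normrM mulrC; apply: ler_pM => //; first exact: Zm_bmeas.2.
rewrite !itv_indE; case: (ltP 0 s) => h1; case: (leP s t) => h2; case: (leP s (t - tau)) => h3; case: (ltP (t - tau) s) => h4 //=;
  by rewrite ?subrr ?subr0 ?sub0r ?normrN ?normr0 ?normr1 ?ler01//; lra.
Qed.

Lemma shifted_energy tau : 0 < tau -> \int[lebT]_p ((F p - F (p.1, p.2 - tau)) * G p) <= 0.
Proof.
move=> tau0; have bF := bmeasB F_bmeas (F_shift (- tau)).
have Iq := bmeas_IntgM bF G_Intg; rewrite -(Fubini_Rint2 Iq) /=.
have Ia : Intg lam (alpha : RT -> R) := Fubini_intg2 (bmeas_IntgM F_bmeas G_Intg).
apply: (@telescoping_le0 R alpha _ tau Ia (Fubini_intg2 Iq)).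
apply: filterS2 ae_good (ae_tshift (- tau) ae_good) => t h1 h2.
have [tT|tT] := ltP t T.
  have sT : t - tau < T by apply: lt_trans tT; rewrite gtrBl.
  exact: (alpha_step (h2 sT) (h1 tT)).
(* From T on the energy is 0, so its increment across T is minus an earlier energy, which is
   nonnegative because L is nonpositive. *)
have Gt y : G (y, t) = 0 by apply: G_out; rewrite negb_and -leNgt -leNgt tT orbT.
rewrite (Rint_eq0 _) ?mulr0 => [|y]; last by rewrite Gt mulr0.
rewrite {1}/alpha (Rint_eq0 _) ?sub0r => [|y]; last by rewrite Gt mulr0.
rewrite oppr_ge0; have [sT|sT] := ltP (t - tau) T; first by apply: alpha_le0; exact: h2.
rewrite /alpha (Rint_eq0 _)// => y.
by rewrite G_out ?mulr0// negb_and -leNgt -leNgt sT orbT.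
Qed.

(** The inequality over shifts of length 1/(n+1) is multiplied by n+1. The quotients of F are
    bounded by M and, for each y, tend at almost every time to the mollified z; the integrable G
    dominates. *)
Lemma mollified_energy : \int[lebT]_p (Zm p * G p) <= 0.
Proof.
pose e n : R := n.+1%:R^-1; have e0 n : 0 < e n by rewrite invr_gt0.
pose Q n (p : VT) := n.+1%:R * (F p - F (p.1, p.2 - e n)).
have bQ n : bmeas M (Q n).
  split => [|p]; first by apply: measurable_funM => //; exact: (bmeasB F_bmeas (F_shift (- e n))).1.
  rewrite /Q normrM gtr0_norm// -ler_pdivlMl//; exact: F_incr.
have IQ n := bmeas_IntgM (bQ n) G_Intg; have IZ := bmeas_IntgM Zm_bmeas G_Intg.
have le n : \int[lebT]_p (Q n p * G p) <= 0.
  have J := bmeas_IntgM (bmeasB F_bmeas (F_shift (- e n))) G_Intg.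
  rewrite (Rint_ext _ (g := fun p => n.+1%:R * ((F p - F (p.1, p.2 - e n)) * G p))) => [|p]; last by rewrite /Q mulrA.
  by rewrite (RintZ _ J) pmulr_rle0//; exact: shifted_energy.
have cv : (\int[leb]_y \int[lam]_t (Q n (y, t) * G (y, t))) @[n --> \oo] --> \int[leb]_y \int[lam]_t (Zm (y, t) * G (y, t)).
  have IG := Fubini_intg1 (Intg_abs G_Intg).
  have [|||||_ _] := @DCT _ _ _ leb (fun n y => \int[lam]_t (Q n (y, t) * G (y, t)))
      (fun y => \int[lam]_t (Zm (y, t) * G (y, t))) (fun y => M * \int[lam]_t `|G (y, t)|).
  - by move=> n; exact: Intg_meas (Fubini_intg1 (IQ n)).
  - exact: Intg_meas (Fubini_intg1 IZ).
  - apply: filterS (Fubini_ae1 G_Intg) => y Iy.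
    have [|||||_ _] := @DCT _ _ _ lam (fun n t => Q n (y, t) * G (y, t)) (fun t => Zm (y, t) * G (y, t))
        (fun t => M * `|G (y, t)|).
    + move=> n; apply: measurable_funM; last exact: Intg_meas Iy.
      exact: (measurableT_comp (bQ n).1 (measurable_pair1 y)).
    + by apply: measurable_funM; [exact: Intg_meas (Zm_line y)|exact: Intg_meas Iy].
    + have z0 (s : R) : s <= 0 -> Zm (y, s) = 0.
        move=> s0; rewrite /Zm /mconv (Rint_eq0 _)// => x /=.
        by rewrite (z_out) ?mul0r// negb_and -leNgt s0.
      apply: filterS (left_quotients (Zm_line y) z0) => t ht.
      apply: cvgM; last exact: cvg_cst.
      by move: ht; under eq_fun do rewrite -!F_prim.
    + by apply: IntgZ; exact: Intg_abs.
    + by move=> n; apply: aeW => t; rewrite normrM ler_wpM2r// (bQ n).2.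
    + exact.
  - exact: IntgZ.
  - move=> n; apply: filterS (Fubini_ae1 G_Intg) => y Iy.
    exact: Rint_bmeasM_le (bmeas_pair1 y (bQ n)) Iy.
  - exact.
rewrite -(Fubini_Rint1 IZ); apply: (cvgr_to_le cv); apply: nearW => n.
by rewrite (Fubini_Rint1 (IQ n)).
Qed.

End mollified.

(** * Removal of the mollification *)

Let e (n : nat) : R := n.+1%:R^-1.
Let e0 n : 0 < e n. Proof. by rewrite invr_gt0. Qed.

(** Mollifications of z need not approach z in L^1, so only w is approximated: in z w, w is replaced
    by its mollification, which is moved to z by adjointness, and then the remaining w is replaced.
    Each replacement costs M times the L^1 distance of w to its mollification. *)
Lemma energy_le0 : \int[lebT]_p (z p * w p) <= 0.
Proof.
have M0 : 0 <= M by apply: le_trans ((d_w D).2 (0, 0)).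
have Iw := d_wI D; have Izw := bmeas_IntgM (d_z D) Iw.
pose r n t := \int[leb]_y `|mconv (fun x => w (x, t)) (e n) y - w (y, t)|.
have IG n := G_Intg (e0 n); have bZ n := Zm_bmeas (e0 n).
have IZG n := bmeas_IntgM (bZ n) (IG n).
have Ir n : Intg lam (r n : RT -> R) := Fubini_intg2 (Intg_abs (IntgB (IG n) Iw)).
have cv : \int[lam]_t r n t @[n --> \oo] --> (0 : R).
  have Iwt := Fubini_intg2 (Intg_abs Iw).
  have [|||||_ _] := @DCT _ _ _ lam (fun n t => r n t) (fun=> 0) (fun t => 4 * \int[leb]_x `|w (x, t)|).
  - by move=> n; exact: Intg_meas (Ir n).
  - by [].
  - by apply: aeW => t; exact: mconv_cvg (d_slice D t).
  - exact: IntgZ.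
  - move=> n; apply: aeW => t; rewrite ger0_norm; last by apply: Rint_ge0.
    have If := d_slice D t; have [Im le] := mconv_L1 If (e0 n).
    apply: (@le_trans _ _ (\int[leb]_y (`|mconv (fun x => w (x, t)) (e n) y| + `|w (y, t)|))).
      apply: Rint_le => [||y]; [exact: Intg_abs (IntgB Im If)|exact: IntgD (Intg_abs Im) (Intg_abs If)|exact: ler_normB].
    by rewrite (RintD (Intg_abs Im) (Intg_abs If)); lra.
  - by rewrite Rint_zero.
have le n : \int[lebT]_p (z p * w p) <= 2 * M * \int[lam]_t r n t.
  apply: (@le_trans _ _ (\int[lam]_t (2 * M * r n t) + \int[lebT]_p (mconv (fun x => z (x, p.2)) (e n) p.1 * mconv (fun x => w (x, p.2)) (e n) p.1))); last first.
    by rewrite (RintZ _ (Ir n)) gerDl; exact: (mollified_energy (e0 n)).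
  rewrite -(Fubini_Rint2 Izw) -(Fubini_Rint2 (IZG n)) -(RintD (IntgZ _ (Ir n)) (Fubini_intg2 (IZG n))).
  apply: Rint_le => [||t]; [exact: (Fubini_intg2 Izw)|exact: IntgD (IntgZ _ (Ir n)) (Fubini_intg2 (IZG n))|].
  have If := d_slice D t; have [Im _] := mconv_L1 If (e0 n); have bz := z_slice t.
  have bm : bmeas M (mconv (fun x => z (x, t)) (e n)).
    by split => [|y]; [exact: (measurableT_comp (bZ n).1 (measurable_pair2 t))|exact: mconv_le bz (e0 n)].
  have Id := IntgB Im If; have Ia := Intg_abs Id.
  have bnd g : bmeas M g -> `|\int[leb]_y (g y * (mconv (fun x => w (x, t)) (e n) y - w (y, t)))| <= M * r n t.
    by move=> bg; exact: Rint_bmeasM_le bg Id.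
  have := bnd _ bz; have := bnd _ bm.
  have spl g : bmeas M g -> \int[leb]_y (g y * (mconv (fun x => w (x, t)) (e n) y - w (y, t))) =
      \int[leb]_y (g y * mconv (fun x => w (x, t)) (e n) y) - \int[leb]_y (g y * w (y, t)).
    move=> bg; rewrite -(RintB (bmeas_IntgM bg Im) (bmeas_IntgM bg If)); apply: Rint_ext => y; exact: mulrBr.
  rewrite (spl _ bz) (spl _ bm) -(mconv_adj bz If (e0 n)) !ler_norml /=.
  by move=> /andP[h1 h2] /andP[h3 h4]; lra.
have cv2 : (2 * M * \int[lam]_t r n t) @[n --> \oo] --> (0 : R).
  by rewrite -(mulr0 (2 * M)); exact: (@cvgMr R _ _ _ _ (2 * M) _ cv).
by apply: (cvgr_to_ge cv2); exact: nearW.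
Qed.

Lemma difference_z0 : {ae lebT, forall p : VT, z p = 0}.
Proof.
have I := bmeas_IntgM (d_z D) (d_wI D).
have h : \int[lebT]_p (z p * w p) = 0.
  by apply/le_anti; rewrite energy_le0 Rint_ge0//; exact: d_sign D.
have := Rint_eq0_ae I (d_sign D) h; apply: filterS => p /eqP.
by rewrite mulf_eq0 => /orP[/eqP//|/eqP h']; exact: (d_w0 D h').
Qed.

(** Once z vanishes, [pairing] says that w at almost every time is orthogonal to all test functions,
    in particular to the mollifiers, so its mollifications vanish and so does their limit. *)
Lemma difference_w0 : {ae lebT, forall p : VT, w p = 0}.
Proof.
have Iw := Intg_abs (d_wI D).
suff h : {ae lam, forall t : RT, \int[leb]_x `|w (x, t)| = 0}.
  have e1 : \int[lebT]_p `|w p| = 0.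
    rewrite -(Fubini_Rint2 Iw) -[RHS](@Rint_zero _ _ R lam); apply: Rint_ae => //.
    exact: Intg_meas (Fubini_intg2 Iw).
  by have := Rint_eq0_ae Iw (fun p => normr_ge0 _) e1; apply: filterS => p /normr0_eq0.
have zp eta : Intg leb eta -> {ae lam, forall s : RT, zpair eta s = 0}.
  move=> Ie; apply: filterS (ae_prod2 difference_z0) => s hs.
  rewrite /zpair -[RHS](@Rint_zero _ _ R leb); apply: Rint_ae => //.
    exact: Intg_meas (bmeas_IntgM (z_slice s) Ie).
  by apply: filterS hs => x ->; rewrite mul0r.
apply: filterS (pairing) => t ht; have [tT|tT] := boolP (0 < t < T); last first.
  by rewrite -[RHS](@Rint_zero _ _ R leb); apply: Rint_ext => x; rewrite (d_out D)// normr0.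
have If := d_slice D t.
have m0 n y : mconv (fun x => w (x, t)) (e n) y = 0.
  have IL := g_Intg gen (Cc_rho (e0 n) y).
  rewrite /mconv (ht tT _ (Cc_rho (e0 n) y)) -[RHS](@Rint_zero _ _ R lam); apply: Rint_ae => //.
    exact: Intg_meas (Intg_itv 0 t (zpair_Intg IL)).
  by apply: filterS (zp _ IL) => s ->; rewrite mulr0.
apply/le_anti; rewrite Rint_ge0 ?andbT//; apply: (cvgr_to_ge (mconv_cvg If)); apply: nearW => n.
by rewrite le_eqVlt; apply/orP; left; apply/eqP; apply: Rint_ext => x; rewrite m0 sub0r normrN.
Qed.

End oleinik.

(** * From almost every time to every time *)

Lemma ae_dense (T : R) (P : RT -> Prop) t d : 0 < T -> {ae lam, forall s, 0 < s < T -> P s} ->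
  0 <= t <= T -> 0 < d -> exists s : R, [/\ 0 < s < T, `|s - t| < d & P s].
Proof.
move=> T0 [Z [mZ Z0 hZ]] /andP[t0 tT] d0; apply: contrapT => H.
pose a := Num.max 0 (t - d); pose b := Num.min T (t + d).
have ab : a < b by rewrite /a /b lt_min !gt_max; apply/andP; split; apply/andP; split; lra.
have sub : [set` `]a, b[] `<=` Z.
  move=> s; rewrite /= in_itv/= /a /b lt_min gt_max => /andP[/andP[s0 s1] /andP[s2 s3]].
  apply: hZ => /= h; apply: H; exists s; split; [by rewrite s0|by rewrite ltr_distl; apply/andP; split|].
  by apply: h; rewrite s0.
have : (lam [set` `]a, b[] <= 0)%E by rewrite -Z0; apply: le_measure; rewrite ?inE.
by rewrite lebesgue_measure_itv/= lte_fin ab lee_fin subr_le0 leNgt ab.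
Qed.

Lemma L1_dist_triangle (K : set V) (f1 f2 f3 : V -> R) : measurable K ->
  leb.-integrable K (EFin \o f1) -> leb.-integrable K (EFin \o f2) -> leb.-integrable K (EFin \o f3) ->
  (L1_dist K f1 f3 <= L1_dist K f1 f2 + L1_dist K f2 f3)%E.
Proof.
move=> mK I1 I2 I3; have m (f h : V -> R) : leb.-integrable K (EFin \o f) -> leb.-integrable K (EFin \o h) ->
    measurable_fun K (fun x => `|(f x - h x)%:E|%E).
  move=> If Ih; have := integrableB mK If Ih => /integrableP[mB _].
  exact: measurableT_comp mB.
rewrite /L1_dist -ge0_integralD//; [|exact: m..].
apply: ge0_le_integral => //; [exact: m|by apply: emeasurable_funD; exact: m|].
by move=> x _; rewrite /= -EFinD lee_fin ler_distD.
Qed.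

Lemma L1_dist_eq0 (K : set V) (f h : V -> R) : measurable K ->
  leb.-integrable K (EFin \o f) -> leb.-integrable K (EFin \o h) -> L1_dist K f h = 0%E ->
  {ae leb, forall x, K x -> f x = h x}.
Proof.
move=> mK If Ih e; have /integrableP[mB _] := integrableB mK If Ih.
have /(ae_eq_integral_abs leb mK mB) : (\int[leb]_(x in K) `|((EFin \o f) \- (EFin \o h)) x| = 0)%E by exact: e.
by apply: filterS => x H Kx; have := H Kx => -[] /subr0_eq.
Qed.

(** Good times come arbitrarily close to any t in [0, T], the endpoints included. On each closed
    cube both paths are continuous in L^1, so t is compared with a nearby good time along either
    path. *)
Lemma C_L1loc_ae_eq (T : R) (u v : V * R -> R) : 0 < T -> C_L1loc T u -> C_L1loc T v ->
  {ae lam, forall s : RT, 0 < s < T -> {ae leb, forall x, u (x, s) = v (x, s)}} ->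
  forall t, 0 <= t <= T -> {ae leb, forall x, v (x, t) = u (x, t)}.
Proof.
move=> T0 cu cv h t tT; pose K (n : nat) := [set x : V | `|x| <= n%:R].
have cK n : compact (K n) by exact: closed_ball_rV_compact.
have mK n : measurable (K n) by exact: compact_measurable_rV.
suff H n : {ae leb, forall x, K n x -> v (x, t) = u (x, t)}.
  apply: filterS (ae_foralln H) => x hx; apply: (hx (Num.bound `|x|)).
  by rewrite /K /= ltW// archi_boundP.
have [Iu _] := cu _ (cK n); have [Iv _] := cv _ (cK n).
apply: (@L1_dist_eq0 _ (fun x => v (x, t)) (fun x => u (x, t)) (mK n)); [exact: Iv|exact: Iu|].
apply/eqP; rewrite eq_le; apply/andP; split; last by apply: integral_ge0.
apply/lee_addgt0Pr => e e0; rewrite add0e.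
have e2 : 0 < e / 2 by rewrite divr_gt0.
have /nbhs_normP[d1 /= d10 h1] := near_L1 cu (cK n) tT e2.
have /nbhs_normP[d2 /= d20 h2] := near_L1 cv (cK n) tT e2.
have d0 : 0 < Num.min d1 d2 by rewrite lt_min d10.
have [s [sT]] := ae_dense T0 h tT d0; rewrite lt_min distrC => /andP[s1 s2] hs.
have sI : 0 <= s <= T by case/andP: sT => *; rewrite !ltW.
have a1 := h1 s s1 sI; have a2 := h2 s s2 sI.
have sw (f k : V -> R) : L1_dist (K n) f k = L1_dist (K n) k f.
  by apply: eq_integral => x _; rewrite /= distrC.
apply: le_trans (L1_dist_triangle (mK n) (Iv t tT) (Iv s sI) (Iu t tT)) _.
rewrite (splitr e) EFinD; apply: leeD; first by rewrite sw ltW.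
apply: ltW; apply: le_lt_trans a1; rewrite le_eqVlt; apply/orP; left; apply/eqP; apply: ae_eq_integral => //.
- by have /integrableP[mB _] := integrableB (mK n) (Iv s sI) (Iu t tT); exact: measurableT_comp mB.
- by have /integrableP[mB _] := integrableB (mK n) (Iu s sI) (Iu t tT); exact: measurableT_comp mB.
- by apply: filterS hs => x -> _.
Qed.

(** * Uniform estimates along the family *)

Lemma near_pos : \forall h \near (0 : R)^'+, 0 < h.
Proof. exact: nbhs_right_gt. Qed.

Lemma near_dop (nu : R -> {measure set V -> \bar R}) (m : R -> fmeas) (L : limit_op) psi K C e :
  levy_measure (lo_mu L) -> consistent_op nu (lo_sigma L) (lo_mu L) ->
  (forall h, 0 < h -> forall g, discrete_op (nu h) g = discrete_op (m h) g) -> testfam psi K C -> 0 < e ->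
  \forall h \near 0^'+, forall t, \int[leb]_x `|dop (m h) (fun x => psi (x, t)) x - lo_op L psi (x, t)| < e.
Proof.
move=> lm co op tf e0; have [om [om0 H]] := consistent_rate lm co tf.
have /cvgr0Pnorm_lt/(_ e e0) oe := om0; near=> h => t.
have h0 : 0 < h by near: h; exact: near_pos.
apply: le_lt_trans (H h h0 (m h) (op h h0) t) _.
apply: le_lt_trans (ler_norm _) _; move: (t); near: h; move: oe; exact: filterS.
Unshelve. all: by end_near. Qed.

Lemma near_dop_bnd (nu : R -> {measure set V -> \bar R}) (m : R -> fmeas) (L : limit_op) psi K C :
  levy_measure (lo_mu L) -> consistent_op nu (lo_sigma L) (lo_mu L) ->
  (forall h, 0 < h -> forall g, discrete_op (nu h) g = discrete_op (m h) g) -> testfam psi K C ->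
  exists2 B, 0 <= B & \forall h \near 0^'+, forall t, \int[leb]_x `|dop (m h) (fun x => psi (x, t)) x| <= B.
Proof.
move=> lm co op tf; have [ml [H IH hH]] := levy_dom (lo_sigma L) lm (tf_C2 tf).
have H0 x : 0 <= H x by apply: le_trans (hH x 0).
exists (\int[leb]_x H x + 1); first by rewrite addr_ge0//; exact: Rint_ge0.
apply: filterS (near_dop lm co op tf ltr01) => h h1 t.
have [C' _ be] := Cc_meas (tf_Cc tf t); have Id := dop_Intg (m h) be (Cc_Intg (tf_Cc tf t)).
have il : Intg leb (fun x => lo_op L psi (x, t)).
  apply: Intg_le IH _; last by move=> x; exact: hH.
  exact: (measurableT_comp ml (measurable_pair2 (t : RT))).
have iB := Intg_abs (IntgB Id il); apply: (@le_trans _ _ (\int[leb]_x (H x + `|dop (m h) (fun x => psi (x, t)) x - lo_op L psi (x, t)|))).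
  apply: Rint_le => [||x]; [exact: Intg_abs|exact: IntgD|].
  have := ler_normD (dop (m h) (fun x => psi (x, t)) x - lo_op L psi (x, t)) (lo_op L psi (x, t)).
  by rewrite subrK => /le_trans; apply; rewrite addrC lerD2r; exact: hH.
by rewrite RintD// lerD2l ltW.
Unshelve. all: by end_near. Qed.

Variables (T M : R) (u0 : V -> R) (g : VT -> R) (ninf : R -> R) (S : R -> scheme R N).
Variables (m1 m2 : R -> fmeas) (W : R -> nat -> V -> R) (L1 L2 : @limit_op).
Hypothesis fam : scheme_family T M u0 g ninf S m1 m2 W L1 L2.

Lemma fam_dop1 psi K C e : testfam psi K C -> 0 < e ->
  \forall h \near 0^'+, forall t, \int[leb]_x `|dop (m1 h) (fun x => psi (x, t)) x - lo_op L1 psi (x, t)| < e.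
Proof. exact: near_dop (fam_mu1 fam) (fam_op1 fam) (fun h h0 => gs_op1 (fam_good fam h0)). Qed.

Lemma fam_dop2 psi K C e : testfam psi K C -> 0 < e ->
  \forall h \near 0^'+, forall t, \int[leb]_x `|dop (m2 h) (fun x => psi (x, t)) x - lo_op L2 psi (x, t)| < e.
Proof. exact: near_dop (fam_mu2 fam) (fam_op2 fam) (fun h h0 => gs_op2 (fam_good fam h0)). Qed.

Lemma fam_dop_bnd psi K C : testfam psi K C -> exists2 B, 0 <= B & \forall h \near 0^'+, forall t,
  \int[leb]_x `|dop (m1 h) (fun x => psi (x, t)) x| <= B /\ \int[leb]_x `|dop (m2 h) (fun x => psi (x, t)) x| <= B.
Proof.
move=> tf; have [B1 B10 h1] := near_dop_bnd (fam_mu1 fam) (fam_op1 fam) (fun h h0 => gs_op1 (fam_good fam h0)) tf.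
have [B2 B20 h2] := near_dop_bnd (fam_mu2 fam) (fam_op2 fam) (fun h h0 => gs_op2 (fam_good fam h0)) tf.
exists (B1 + B2); first exact: addr_ge0.
by apply: filterS2 h1 h2 => h h1 h2 t; split; [apply: le_trans (h1 t) _; rewrite lerDl|apply: le_trans (h2 t) _; rewrite lerDr].
Qed.

(** The extra 1 absorbs the distance of the approximate nonlinearities to their limits, eventually
    below 1 on [-M, M]. *)
Definition phi_bnd := `|lo_f L1 M| + `|lo_f L1 (- M)| + (`|lo_f L2 M| + `|lo_f L2 (- M)|) + 1.

Lemma phi_bnd_near : \forall h \near 0^'+, forall r, `|r| <= M ->
  `|phi1 (S h) r| <= phi_bnd /\ `|phi2 (S h) r| <= phi_bnd.
Proof.
near=> h => r rM.
have h1 : `|phi1 (S h) r - lo_f L1 r| < 1.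
  by move: r rM; near: h; exact: (compact_cvg_near _ (fam_phi1 fam)).
have h2 : `|phi2 (S h) r - lo_f L2 r| < 1.
  by move: r rM {h1}; near: h; exact: (compact_cvg_near _ (fam_phi2 fam)).
have [f1 _] := fam_f1 fam; have [f2 _] := fam_f2 fam.
have a1 := mono_bnd f1 rM; have a2 := mono_bnd f2 rM.
have n1 := normr_ge0 (lo_f L1 M); have n2 := normr_ge0 (lo_f L1 (- M)).
have n3 := normr_ge0 (lo_f L2 M); have n4 := normr_ge0 (lo_f L2 (- M)).
rewrite /phi_bnd; split.
  rewrite -(subrK (lo_f L1 r) (phi1 (S h) r)); apply: le_trans (ler_normD _ _) _; lra.
rewrite -(subrK (lo_f L2 r) (phi2 (S h) r)); apply: le_trans (ler_normD _ _) _; lra.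
Unshelve. all: by end_near. Qed.

(** The L^1 norms of the discrete operators on eta are eventually bounded by consistency, so each
    step is dominated by the increment of C (t + [prim ninf] t), one function of time for all
    schemes. *)
Lemma near_step_bnd eta : Cc_smooth eta -> exists2 C, 0 <= C & \forall h \near 0^'+,
  forall j, (1 <= j <= steps (S h))%N ->
  `|\int[leb]_x (W h j x * eta x) - \int[leb]_x (W h j.-1 x * eta x)| <=
    C * (node (S h) j + prim ninf (node (S h) j)) -
    C * (node (S h) j.-1 + prim ninf (node (S h) j.-1)).
Proof.
move=> ce; have [K tf] := testfam_cst ce.
have [Ce Ce0 be] := Cc_meas ce; have ie := Cc_Intg ce.
have A0 : 0 <= phi_bnd by rewrite /phi_bnd !addr_ge0.
have [B B0 hB] := fam_dop_bnd tf; pose E := \int[leb]_x `|eta x|.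
have E0 : 0 <= E by exact: Rint_ge0.
exists (phi_bnd * B + phi_bnd * B + E); first by rewrite !addr_ge0// mulr_ge0.
near=> h => j hj.
have h0 : 0 < h by near: h; exact: near_pos.
have gs := fam_good fam h0.
have pb : forall r, `|r| <= M -> `|phi1 (S h) r| <= phi_bnd /\ `|phi2 (S h) r| <= phi_bnd.
  by near: h; exact: phi_bnd_near.
have [d1 d2] : \int[leb]_x `|dop (m1 h) eta x| <= B /\ \int[leb]_x `|dop (m2 h) eta x| <= B.
  by move: (0 : R); near: h.
have jS : (j <= steps (S h))%N by case/andP: hj.
have iW k : (k <= steps (S h))%N -> Intg leb (fun x => W h k x * eta x).
  by move=> kS; exact: bmeas_IntgM (gs_bnd gs kS) ie.
rewrite -RintB; [|exact: iW|by apply: iW; exact: node_prev_le].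
rewrite (Rint_ext _ (g := fun x => (W h j x - W h j.-1 x) * eta x)); last by move=> x; rewrite mulrBl.
apply: le_trans (weak_step_bnd gs (fam_src fam) hj be ie A0 (fun r h => (pb r h).1) (fun r h => (pb r h).2) d1 d2) _.
have pr : 0 <= prim ninf (node (S h) j) - prim ninf (node (S h) j.-1).
  rewrite subr_ge0; apply: prim_nd; [exact: src_bnd_Intg (fam_src fam)|exact: src_bnd_ge0 (fam_src fam)| |].
    exact: (grid_ge0 (gs_grid gs) (node_prev_le hj)).
  by apply: (grid_mono (gs_grid gs)) => //; exact: leq_pred.
have st := step_gt0 (gs_grid gs) hj.
rewrite -mulrBr opprD addrACA [X in _ <= X]mulrDr -/(step (S h) j); apply: lerD.
  by rewrite mulrC ler_wpM2r ?(ltW st)// lerDl.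
rewrite mulrC -/E; apply: ler_wpM2r => //; by rewrite lerDr addr_ge0// mulr_ge0.
Unshelve. all: by end_near. Qed.

Definition vh (h t : R) (x : V) : R := interp (S h) (fun j => W h j x) t.

Definition data_L1 : R := \int[leb]_x `|u0 x| + \int[lam]_t \int[leb]_x `|g (x, t)|.

Definition data_trans (y : V) : R := \int[leb]_x `|u0 (x + y) - u0 x| +
    \int[lam]_t \int[leb]_x `|g (x + y, t) - g (x, t)|.

Lemma vh_piece h t : 0 < h -> 0 <= t <= T -> exists k th, [/\ (1 <= k <= steps (S h))%N, 0 <= th <= 1 &
  forall v, interp (S h) v t = (1 - th) * v k.-1 + th * v k].
Proof.
move=> h0 tT; have [k [th [k1 th1 _ e]]] := interp_conv (fam_T fam) (gs_grid (fam_good fam h0)) tT.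
by exists k, th.
Qed.

Lemma vh_bmeas h t : 0 < h -> 0 <= t <= T -> bmeas M (vh h t).
Proof.
move=> h0 tT; have [k [th [k1 th1 e]]] := vh_piece h0 tT; have gs := fam_good fam h0.
have b1 := gs_bnd gs (node_prev_le k1); have b2 : bmeas M (W h k) by apply: (gs_bnd gs); case/andP: k1.
split.
  rewrite /vh; under eq_fun do rewrite e; apply: measurable_funD; apply: measurable_funM => //; [exact: b1.1|exact: b2.1].
move=> x; apply: (interp_le (fam_T fam) (gs_grid gs) tT) => j js.
exact: (gs_bnd gs js).2.
Qed.

Lemma vh_Intg h t : 0 < h -> 0 <= t <= T -> Intg leb (vh h t).
Proof.
move=> h0 tT; have [k [th [k1 th1 e]]] := vh_piece h0 tT; have gs := fam_good fam h0.
rewrite /vh; under eq_fun do rewrite e; apply: IntgD; apply: IntgZ; apply: (gs_Intg gs).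
  exact: node_prev_le.
by case/andP: k1.
Qed.

(** At each time the interpolant is a convex combination of two consecutive nodal values, so the L^1
    norm after a linear map is bounded as soon as it is bounded at the nodes. The maps used are the
    identity and the difference with a translate. *)
Lemma vh_combo (A : (V -> R) -> V -> R) h t C : 0 < h -> 0 <= t <= T ->
  (forall v, Intg leb v -> Intg leb (A v)) ->
  (forall a b v w, A (fun x => a * v x + b * w x) = (fun x => a * A v x + b * A w x)) ->
  (forall j, (j <= steps (S h))%N -> \int[leb]_x `|A (W h j) x| <= C) -> \int[leb]_x `|A (vh h t) x| <= C.
Proof.
move=> h0 tT IA lA H; have [k [th [k1 /andP[th0 th1] e]]] := vh_piece h0 tT; have gs := fam_good fam h0.
have kS : (k <= steps (S h))%N by case/andP: k1.
have i1 := Intg_abs (IA _ (gs_Intg gs (node_prev_le k1))); have i2 := Intg_abs (IA _ (gs_Intg gs kS)).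
have th1' : 0 <= 1 - th by rewrite subr_ge0.
have -> : vh h t = (fun x => (1 - th) * W h k.-1 x + th * W h k x) by apply/funext => x; exact: e.
rewrite lA; apply: (@le_trans _ _ (\int[leb]_x ((1 - th) * `|A (W h k.-1) x| + th * `|A (W h k) x|))).
  apply: Rint_le => [||x]; [|by apply: IntgD; exact: IntgZ|].
    by apply: Intg_abs; apply: IntgD; apply: IntgZ; apply: IA; apply: (gs_Intg gs) => //; exact: node_prev_le.
  by apply: le_trans (ler_normD _ _) _; rewrite !normrM (ger0_norm th0) (ger0_norm th1').
rewrite RintD ?RintZ//; try exact: IntgZ.
have := ler_wpM2l th1' (H _ (node_prev_le k1)); have := ler_wpM2l th0 (H _ kS); lra.
Qed.

Lemma vh_L1 h t : 0 < h -> 0 <= t <= T -> \int[leb]_x `|vh h t x| <= data_L1.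
Proof.
move=> h0 tT; apply: (vh_combo (A := id)) => // j js.
exact: (good_L1 (fam_M fam) (fam_u0 fam) (src_Intg (fam_src fam)) (fam_good fam h0) js).
Qed.

Lemma vh_trans h t y : 0 < h -> 0 <= t <= T -> \int[leb]_x `|vh h t (x + y) - vh h t x| <= data_trans y.
Proof.
move=> h0 tT; apply: (vh_combo (A := fun v x => v (x + y) - v x)) => //.
- by move=> v Iv; apply: IntgB => //; exact: Intg_shift.
- by move=> a b v w; apply/funext => x; ring.
by move=> j js; exact: (good_trans y (fam_u0 fam) (src_Intg (fam_src fam)) (fam_good fam h0) js).
Qed.

Lemma vh_weak h t C eta : 0 < h -> 0 <= t <= T -> bmeas C eta -> Intg leb eta ->
  \int[leb]_x (vh h t x * eta x) = interp (S h) (fun j => \int[leb]_x (W h j x * eta x)) t.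
Proof.
move=> h0 tT be ie; have [k [th [k1 /andP[th0 th1] e]]] := vh_piece h0 tT; have gs := fam_good fam h0.
have iW j : (j <= steps (S h))%N -> Intg leb (fun x => W h j x * eta x).
  by move=> js; exact: bmeas_IntgM (gs_bnd gs js) ie.
have i1 := iW _ (node_prev_le k1); have i2 : Intg leb (fun x => W h k x * eta x) by apply: iW; case/andP: k1.
rewrite e -!RintZ// -RintD; try exact: IntgZ.
by apply: Rint_ext => x; rewrite /vh e mulrDl !mulrA.
Qed.

(** The source contributes an integral in time of L^1 moduli of translation; these tend to 0 at
    almost every time and are dominated by twice the L^1 norm of the slice. *)
Lemma trans_small e : 0 < e -> exists2 d : R, 0 < d & forall y, `|y| < d -> data_trans y < e.
Proof.
move=> e0; have e2 : 0 < e / 2 by rewrite divr_gt0.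
have [d1 d10 h1] := trans_cts_ball (fam_u0 fam) e2.
have Ig := src_Intg (fam_src fam).
suff [d2 d20 h2] : exists2 d : R, 0 < d & forall y : V, `|y| < d ->
    \int[lam]_t \int[leb]_x `|g (x + y, t) - g (x, t)| < e / 2.
  exists (Num.min d1 d2); first by rewrite lt_min d10.
  move=> y; rewrite lt_min => /andP[y1 y2]; rewrite /data_trans.
  rewrite (splitr e); exact: ltrD (h1 y y1) (h2 y y2).
apply: near0_seq => y_ y0.
pose F n (t : RT) : R := \int[leb]_x `|g (x + y_ n, t) - g (x, t)|.
have IF n : Intg lam (F n).
  by apply: (Intg_prod_abs (h := fun p => g (p.1 + y_ n, p.2) - g p)); apply: IntgB => //; exact: Intg_transT.
have aet := Fubini_ae2 Ig.
have [] := @DCT _ _ _ lam F (fun=> 0) (fun t => 2 * \int[leb]_x `|g (x, t)|).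
- by move=> n; exact: Intg_meas (IF n).
- exact: measurable_cst.
- move: aet; apply: filterS => t It; have [_ ct] := Intg_trans_cts It; exact: ct y0.
- by apply: IntgZ; exact: Intg_prod_abs.
- move=> n; move: aet; apply: filterS => t It.
  rewrite ger0_norm ?Rint_ge0// mulr2n mulrDl mul1r.
  have Is := Intg_shift (y_ n) It; have Isa := Intg_abs Is; have Ia := Intg_abs It.
  rewrite -{1}(Rint_shift (y_ n) (Intg_meas Ia)) -RintD//.
  apply: Rint_le => [||x]; [by apply: Intg_abs; exact: IntgB|exact: IntgD|exact: ler_normB].
move=> _ _; rewrite Rint_zero => /cvgrPdist_lt/(_ _ e2)[n _ /(_ n (leqnn n))].
rewrite sub0r normrN ger0_norm ?Rint_ge0//; last by move=> t; exact: Rint_ge0.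
by exists n.
Qed.

(** Three errors below r / 4: the interpolated bound differs little from the continuous function [b]
    at each of the two times, once the steps are shorter than d, and [b] itself varies little
    between them. *)
Lemma vh_time eta t0 r : Cc_smooth eta -> 0 <= t0 <= T -> 0 < r -> exists2 d : R, 0 < d &
  \forall h \near 0^'+, forall t, 0 <= t <= T -> `|t - t0| < d ->
    `|\int[leb]_x (vh h t x * eta x) - \int[leb]_x (vh h t0 x * eta x)| < r.
Proof.
move=> ce t0T r0; have [Ce Ce0 be] := Cc_meas ce; have ie := Cc_Intg ce.
have [C C0 hC] := near_step_bnd ce.
pose b (t : R) := C * (t + prim ninf t).
have In := src_bnd_Intg (fam_src fam); have n0 := src_bnd_ge0 (fam_src fam).
have bm (s t : R) : 0 <= s -> s <= t -> b s <= b t.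
  by move=> s0 st; rewrite ler_wpM2l// lerD//; exact: prim_nd.
have r4 : 0 < r / 4 by rewrite divr_gt0.
have C1 : 0 < C + 1 by rewrite ltr_wpDl.
have rC : 0 < r / 4 / (2 * (C + 1)) by rewrite !divr_gt0// mulr_gt0.
have [d d0 hd] : exists2 d : R, 0 < d & forall x y, 0 <= x -> x <= y -> y - x < d -> b y - b x < r / 4.
  have [d1 d10 h1] := abs_cont In n0 rC.
  exists (Num.min d1 (r / 4 / (2 * (C + 1)))); first by rewrite lt_min d10.
  move=> x y x0 xy; rewrite lt_min => /andP[a1 a2].
  have := h1 x y xy a1; rewrite -primB// => a3.
  rewrite /b -mulrBr (_ : y + _ - _ = (y - x) + (prim ninf y - prim ninf x)); last by ring.
  have p0 : 0 <= (y - x) + (prim ninf y - prim ninf x) by rewrite addr_ge0 ?subr_ge0//; exact: prim_nd.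
  apply: (@le_lt_trans _ _ ((C + 1) * ((y - x) + (prim ninf y - prim ninf x)))).
    by rewrite ler_wpM2r// lerDl.
  rewrite mulrC -ltr_pdivlMr//; apply: lt_le_trans (ltrD a2 a3) _.
  rewrite le_eqVlt; apply/orP; left; apply/eqP; field.
  by rewrite gt_eqF.
exists d => //; near=> h => t tT td.
have h0 : 0 < h by near: h; exact: near_pos.
have tg := gs_grid (fam_good fam h0).
have ms : max_step (S h) < d.
  near: h; have /cvgr0Pnorm_lt/(_ d d0) := fam_step fam; apply: filterS => h; apply: le_lt_trans; exact: ler_norm.
have nb s : 0 <= s <= T -> `|interp (S h) (fun j => b (node (S h) j)) s - b s| < r / 4.
  move=> sT; apply: (interp_near (fam_T fam) tg sT ms).
    by move=> x y; rewrite !in_itv/= => /andP[x0 _] _; exact: bm.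
  by move=> x y x0 xy _; exact: hd.
have wlogle s s' : 0 <= s <= T -> 0 <= s' <= T -> s <= s' -> s' - s < d ->
    `|\int[leb]_x (vh h s' x * eta x) - \int[leb]_x (vh h s x * eta x)| < r.
  move=> sT sT' ss sd; rewrite !(vh_weak h0 _ be ie)//.
  apply: le_lt_trans (interp_mono_diff tg (b := fun j => b (node (S h) j)) ss _) _.
    by move=> j hj; move: j hj; near: h.
  have := nb s sT; have := nb s' sT'; rewrite !ltr_norml => /andP[_ a1] /andP[a2 _].
  have s00 : 0 <= s by case/andP: sT.
  by have := hd s s' s00 ss sd; lra.
have [tt|tt] := leP t t0.
  by rewrite distrC; apply: wlogle => //; apply: le_lt_trans td; rewrite -opprB -normrN ler_norm.
by apply: wlogle => //; [exact: ltW|rewrite -(gtr0_norm (_ : 0 < t - t0)) ?subr_gt0].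
Unshelve. all: by end_near. Qed.

(** * Compactness of the interpolants *)

Lemma cauchy_ultra (G : set_system R) k e : UltraFilter G -> 0^'+ `<=` G -> 0 < e ->
  exists2 A, G A & forall h h', A h -> A h' -> [/\ 0 < h, 0 < h' &
    forall t, 0 <= t <= T -> Qdist k (vh h t) (vh h' t) <= e].
Proof.
move=> uG G0 e0; have pG := @ultra_proper _ _ uG.
have e4 : 0 < e / 4 by rewrite divr_gt0.
have M0 := fam_M fam; have M1 : 0 < M + 1 by rewrite ltr_wpDl.
have [d0 d00 hd] := trans_small e4.
(* Mollification at this scale moves every interpolant by at most e / 4 in L^1, uniformly in h and
   t, and makes them equicontinuous on a closed cube times [0, T]. Uniform closeness obtained there
   is then integrated over the box, of volume [LQ]. *)
pose d := d0 / 2; have dp : 0 < d by rewrite divr_gt0.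
have cd h t : 0 < h -> 0 <= t <= T ->
    Intg leb (mconv (vh h t) d) /\ \int[leb]_y `|mconv (vh h t) d y - vh h t y| <= e / 4.
  move=> h0 tT; apply: mconv_dist => //; first exact: vh_Intg.
  move=> z zd; apply: le_trans (vh_trans z h0 tT) _; apply/ltW/hd.
  by apply: le_lt_trans zd _; rewrite /d; lra.
pose LQ := \int[leb]_x (\1_(Qbox k%:R) x : R).
have LQ0 : 0 <= LQ by apply: Rint_ge0 => x; rewrite indicE.
have LQ1 : 0 < LQ + 1 by rewrite ltr_wpDl.
have e' : 0 < e / 4 / (LQ + 1) by rewrite divr_gt0.
pose K : set (V * R) := [set x : V | `|x| <= k%:R] `*` `[0, T]%classic.
have cK : compact K by apply: compact_setX; [exact: closed_ball_rV_compact|exact: segment_compact].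
have [] := @equicontinuous_cauchy R _ R G K (fun h p => mconv (vh h p.2) d p.1) M _ uG cK _ _ e'.
- move=> [y t] [_ /=]; rewrite in_itv/= => tT; apply: G0; near=> h.
  apply: mconv_le => //; apply: vh_bmeas => //; near: h; exact: near_pos.
- move=> [y0 t0] [_ /=]; rewrite in_itv/= => tT r r0.
  have r2 : 0 < r / 2 by rewrite divr_gt0.
  have im := Cc_Intg (Cc_moll dp).
  have rM : 0 < r / 2 / (M + 1) by rewrite divr_gt0.
  have [d1 d10 h1] := trans_cts_ball im rM.
  have [d2 d20 h2] := vh_time (Cc_refl y0 (Cc_moll dp)) tT r2.
  exists ([set y | `|y - y0| < d1] `*` [set t | `|t - t0| < d2]).
    exists ([set y | `|y - y0| < d1], [set t | `|t - t0| < d2]) => //; split => /=.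
      exact: nbhs_rV_dist.
    by apply/nbhs_normP; exists d2 => // t /=; rewrite distrC.
  apply: G0; near=> h => -[y t] [/= y1 t1] [_ /=]; rewrite in_itv/= => tT1.
  have h0 : 0 < h by near: h; exact: near_pos.
  rewrite -(subrK (mconv (vh h t) d y0) (mconv (vh h t) d y)) -addrA.
  apply: le_lt_trans (ler_normD _ _) _; rewrite (splitr r); apply: ler_ltD.
    apply: le_trans (mconv_lip y y0 (vh_bmeas h0 tT1) dp) _.
    apply: (@le_trans _ _ ((M + 1) * \int[leb]_x `|moll d (x + (y - y0)) - moll d x|)).
      by rewrite ler_wpM2r ?Rint_ge0// lerDl.
    by rewrite mulrC -ler_pdivlMr//; apply/ltW/h1.
  by move: t tT1 t1; near: h; exact: h2.
move=> A GA hA.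
have G00 : G [set h | 0 < h] by apply: G0; exact: near_pos.
exists (A `&` [set h | 0 < h]); first exact: filterI.
move=> h h' [Ah /= h0] [Ah' /= h0']; split => // t tT.
have [I1 c1] := cd h t h0 tT; have [I2 c2] := cd h' t h0' tT.
have i1 := vh_Intg h0 tT; have i2 := vh_Intg h0' tT.
have j1 := Intg_abs (IntgB I1 i1); have j2 := Intg_abs (IntgB I2 i2).
have jq := IntgZ (e / 4 / (LQ + 1)) (Intg_Qbox k).
apply: (@le_trans _ _ (\int[leb]_y (`|mconv (vh h t) d y - vh h t y| + `|mconv (vh h' t) d y - vh h' t y| +
    e / 4 / (LQ + 1) * \1_(Qbox k%:R) y))).
  apply: Rint_le => [||y].
  - exact: Intg_Qdist (vh_bmeas h0 tT) (vh_bmeas h0' tT).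
  - by apply: IntgD => //; exact: IntgD.
  have [Qy|Qy] := pselect (Qbox k%:R y); last first.
    by rewrite indic_out// mul0r mulr0 !addr_ge0.
  rewrite indic_in// mul1r mulr1.
  have Ky : K (y, t).
    split => /=; last by rewrite in_itv.
    by apply: rV_norm_le => // i; have := Qy i; rewrite /= in_itv/= -ltr_norml; exact: ltW.
  have := hA h h' Ah Ah' (y, t) Ky; rewrite /= => /ltW h3.
  rewrite (_ : vh h t y - vh h' t y = - (mconv (vh h t) d y - vh h t y) +
     (mconv (vh h' t) d y - vh h' t y) + (mconv (vh h t) d y - mconv (vh h' t) d y)); last by ring.
  apply: le_trans (ler_normD _ _) _; apply: lerD => //.
  by apply: le_trans (ler_normD _ _) _; rewrite normrN.
rewrite RintD//; last exact: IntgD.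
rewrite RintD// RintZ; last exact: Intg_Qbox.
have : e / 4 / (LQ + 1) * LQ <= e / 4.
  rewrite mulrAC ler_pdivrMr// ler_wpM2l ?(ltW e4)//; lra.
rewrite -/LQ; lra.
Unshelve. all: by end_near. Qed.

(** [B] is a parameter so that the extraction can also be run among the values of h at which
    convergence would fail. The ultrafilter refines the trace of [B] at 0+; choosing [hs n] in the
    sets of indices 0 to n at once makes the sequence Cauchy at a fixed rate on every box of size k
    <= n. *)
Lemma extract (B : set R) : (forall e, 0 < e -> exists h, B h /\ 0 < h < e) ->
  exists hs : nat -> R, (forall n, B (hs n) /\ 0 < hs n < n.+1%:R^-1) /\
    forall k n m t, (k <= n)%N -> (n <= m)%N -> 0 <= t <= T ->
      Qdist k (vh (hs n) t) (vh (hs m) t) <= rate n.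
Proof.
move=> hB.
pose F : set_system R := [set A | exists2 e, 0 < e & forall h, B h -> 0 < h -> h < e -> A h].
have pF : ProperFilter F.
  apply: Build_ProperFilter_ex.
    by move=> A [e e0 he]; have [h [Bh /andP[h0 h1]]] := hB e e0; exists h; exact: he.
  split; first by exists 1.
    move=> A1 A2 [e e0 he] [e' e'0 he']; exists (Num.min e e'); first by rewrite lt_min e0.
    by move=> h Bh h0; rewrite lt_min => /andP[h1 h2]; split; [exact: he|exact: he'].
  by move=> A1 A2 sub [e e0 he]; exists e => // h Bh h0 h1; apply/sub/he.
have [G [uG FG]] := ultraFilterLemma pF; have pG := @ultra_proper _ _ uG.
have G0 : 0^'+ `<=` G.
  move=> A /nbhs_normP[e /= e0 he]; apply: FG; exists e => // h Bh h0 h1; apply: he => //=.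
  by rewrite sub0r normrN gtr0_norm.
have GB : G B by apply: FG; exists 1.
have := fun n : nat => cauchy_ultra n uG G0 (rate_gt0 n).
move=> H; have : forall n : nat, exists A : set R, G A /\ forall h h', A h -> A h' -> [/\ 0 < h, 0 < h' &
    forall t, 0 <= t <= T -> Qdist n (vh h t) (vh h' t) <= rate n].
  by move=> n; have [A GA hA] := H n; exists A.
move=> /choice[A hA].
have : forall n : nat, exists h, (forall i : 'I_n.+1, A i h) /\ B h /\ 0 < h < n.+1%:R^-1.
  move=> n.
  suff : G [set h | (forall i : 'I_n.+1, A i h) /\ B h /\ 0 < h < n.+1%:R^-1] by move=> /filter_ex[h hh]; exists h.
  apply: filterI; first by apply: filter_forall => i; exact: (hA i).1.
  apply: filterI => //; apply: FG; exists n.+1%:R^-1 => // h Bh h0 h1; by rewrite h0.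
move=> /choice[hs hhs]; exists hs; split; first by move=> n; exact: (hhs n).2.
move=> k n m t kn nm tT.
have a1 : A n (hs n) by exact: ((hhs n).1 (Ordinal (ltnSn n))).
have a2 : A n (hs m) by exact: ((hhs m).1 (Ordinal (_ : (n < m.+1)%N))).
have [h1 h2 /(_ t tT)] := (hA n).2 _ _ a1 a2; apply: le_trans.
have [b1 b2] := (vh_bmeas h1 tT, vh_bmeas h2 tT).
apply: Rint_le; [exact: Intg_Qdist b1 b2|exact: Intg_Qdist b1 b2|move=> x].
rewrite ler_wpM2r//; have [Qx|Qx] := pselect (Qbox k%:R x); last by rewrite (indic_out Qx) indicE.
rewrite !indic_in// => i; have := Qx i; rewrite /= !in_itv/= => /andP[c1 c2].
have kn' : k%:R <= n%:R :> R by rewrite ler_nat.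
by apply/andP; split; lra.
Qed.

Definition vh0 (h : R) (p : VT) : R := if (0 <= p.2 <= T) then vh h p.2 p.1 else 0.

Lemma vh0_bmeas h : 0 < h -> bmeas M (vh0 h).
Proof.
move=> h0; split; last first.
  move=> [x t]; rewrite /vh0 /=; case: ifPn => tT; last by rewrite normr0; exact: fam_M fam.
  exact: (vh_bmeas h0 tT).2.
have mt : measurable_fun [set: VT] (fun p : VT => p.2) by exact: measurable_snd.
apply: measurable_fun_ifT.
- have m1' := measurable_fun_ler (measurable_cst (0 : R)) mt.
  have m2' := measurable_fun_ler mt (measurable_cst T).
  exact: measurable_and m1' m2'.
- rewrite /vh /interp; apply: measurable_funD.
    exact: meas_fst (gs_bnd (fam_good fam h0) (leq0n _)).1.
  rewrite (_ : (fun p : VT => _) = (fun p : VT => \sum_(i < steps (S h))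
     ramp (node (S h) i) (node (S h) i.+1) p.2 * (W h i.+1 p.1 - W h i p.1))); last first.
    by apply/funext => p; rewrite big_add1 big_mkord.
  apply: measurable_sum => i; apply: measurable_funM.
    apply: measurable_maxr => //; apply: measurable_minr => //.
    by apply: measurable_funM => //; exact: measurable_funB.
  have js : (i < steps (S h))%N by exact: ltn_ord.
  apply: measurable_funB.
    exact: meas_fst (gs_bnd (fam_good fam h0) js).1.
  exact: meas_fst (gs_bnd (fam_good fam h0) (ltnW js)).1.
- exact: measurable_cst.
Qed.

Lemma compactness (B : set R) : (forall e, 0 < e -> exists h, B h /\ 0 < h < e) ->
  exists (hs : nat -> R) (u : VT -> R), [/\ forall n, B (hs n) /\ 0 < hs n < n.+1%:R^-1,
    bmeas M u & forall k n t, (k <= n)%N -> 0 <= t <= T ->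
      Qdist k (vh (hs n) t) (fun x => u (x, t)) <= rate n].
Proof.
move=> /extract[hs [h1 h2]].
have hp n : 0 < hs n by have [_ /andP[]] := h1 n.
pose w n := vh0 (hs n).
have bw n : bmeas M (w n) by exact: vh0_bmeas.
have [|u bu hu] := seq_limit (fam_M fam) bw.
  move=> t k n m kn nm; rewrite /Qdist /w /vh0 /=; case: (boolP (0 <= t <= T)) => tT; first exact: h2.
  rewrite (Rint_ext _ (g := fun=> 0)); last by move=> x; rewrite subrr normr0 mulr0.
  by rewrite Rint_zero; exact/ltW/rate_gt0.
exists hs, u; split => // k n t kn tT.
by have := hu t k n kn; rewrite /w /vh0 /= tT.
Qed.

(** * Regularity of a limit *)

Section limit.
Variables (hs : nat -> R) (u : VT -> R).
Hypothesis hs0 : forall n, 0 < hs n < n.+1%:R^-1.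
Hypothesis bu : bmeas M u.
Hypothesis hu : forall k n t, (k <= n)%N -> 0 <= t <= T ->
  Qdist k (vh (hs n) t) (fun x => u (x, t)) <= rate n.

Let hs_gt0 n : 0 < hs n. Proof. by have /andP[] := hs0 n. Qed.
Let gs_n n := fam_good fam (hs_gt0 n).
Let T0 := fam_T fam.
Let M0 := fam_M fam.
Local Notation Sh n := (S (hs n)).

Lemma bu_slice t : bmeas M (fun x : V => u (x, t) : R).
Proof.
exact: (bmeas_pair2 (t : RT) bu).
Qed.

Lemma hs_near (P : R -> Prop) : (\forall h \near 0^'+, P h) -> \forall n \near \oo, P (hs n).
Proof.
move=> /nbhs_normP[e /= e0 he]; near=> n; apply: he => //=.
rewrite sub0r normrN gtr0_norm//; have /andP[_] := hs0 n; move/lt_trans; apply.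
near: n; exact: near_infty_natSinv_lt (PosNum e0).
Unshelve. all: by end_near. Qed.

Lemma rate_cvg : (rate n : R) @[n --> \oo] --> (0 : R).
Proof.
apply/cvgr0Pnorm_lt => e e0; near=> n; rewrite gtr0_norm ?rate_gt0//.
apply: (@le_lt_trans _ _ n.+1%:R^-1); last by near: n; exact: near_infty_natSinv_lt (PosNum e0).
rewrite /rate mul1r lef_pV2 ?posrE ?ltr0n ?expn_gt0// ler_nat.
by apply: leq_trans (ltnW (ltn_expl n.+1 (ltnSn 1))) _.
Unshelve. all: by end_near. Qed.

Lemma u_Intg t : 0 <= t <= T -> Intg leb (fun x => u (x, t)) /\ \int[leb]_x `|u (x, t)| <= data_L1.
Proof.
move=> tT; apply: (@Intg_exhaust _ _ M (bu_slice t)) => k.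
have bk := bu_slice t.
have H n : (k <= n)%N -> \int[leb]_x (\1_(Qbox k%:R) x * `|u (x, t)|) <= data_L1 + rate n.
  move=> kn; have bv := vh_bmeas (hs_gt0 n) tT; have iv := vh_Intg (hs_gt0 n) tT.
  apply: le_trans (lerD (vh_L1 (hs_gt0 n) tT) (hu kn tT)).
  rewrite -RintD; [|exact: Intg_abs|exact: Intg_Qdist bv bk].
  apply: Rint_le => [||x].
  - by under eq_fun do rewrite mulrC; exact: bmeas_IntgM (bmeas_abs bk) (Intg_Qbox k).
  - by apply: IntgD; [exact: Intg_abs|exact: Intg_Qdist bv bk].
  have [Qx|Qx] := pselect (Qbox k%:R x); last by rewrite indic_out// !mul0r addr0.
  rewrite indic_in// !mul1r; rewrite -{1}(subKr (vh (hs n) t x) (u (x, t))).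
  by apply: le_trans (ler_normB _ _) _.
rewrite -[leRHS]addr0; have c : data_L1 + rate n @[n --> \oo] --> data_L1 + 0.
  by apply: cvgD; [exact: cvg_cst|exact: rate_cvg].
rewrite -(cvg_lim _ c)//; apply: limr_ge; first by apply/cvg_ex; eexists; exact: c.
by exists k => // n /= kn; exact: H.
Qed.

(** The constant depends on h, which suffices: closeness to u is uniform in t, so one index is fixed
    before t varies. *)
Lemma vh_cont h s : 0 < h -> 0 <= s <= T -> exists2 L, 0 <= L & forall t k, 0 <= t <= T ->
  Qdist k (vh h t) (vh h s) <= L * `|t - s|.
Proof.
move=> h0 sT; have gs := fam_good fam h0; have tg := gs_grid gs.
pose D i x := W h i.+1 x - W h i x.
have ID (i : 'I_(steps (S h))) : Intg leb (D i).
  by apply: IntgB; apply: (gs_Intg gs); [exact: ltn_ord|exact/ltnW/ltn_ord].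
pose d (i : 'I_(steps (S h))) := node (S h) i.+1 - node (S h) i.
have d0 i : 0 < d i.
  have hi : (1 <= i.+1 <= steps (S h))%N by rewrite /= ltn_ord.
  exact: (step_gt0 tg hi).
exists (\sum_(i < steps (S h)) (d i)^-1 * \int[leb]_x `|D i x|).
  by apply: sumr_ge0 => i _; rewrite mulr_ge0 ?invr_ge0 ?(ltW (d0 i))//; exact: Rint_ge0.
move=> t k tT; rewrite mulr_suml.
have bt := vh_bmeas h0 tT; have bs := vh_bmeas h0 sT.
apply: (@le_trans _ _ (\int[leb]_x \sum_(i < steps (S h)) ((d i)^-1 * `|t - s|) * `|D i x|)).
  apply: Rint_le => [||x]; first exact: Intg_Qdist bt bs.
    by apply: Intg_sum => i _; apply: IntgZ; exact: Intg_abs.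
  apply: (@le_trans _ _ (`|vh h t x - vh h s x|)).
    by rewrite -[leRHS]mul1r ler_wpM2r// indicE; case: (_ \in _).
  rewrite /vh /interp !big_add1 !big_mkord opprD addrACA subrr add0r -sumrB.
  apply: le_trans (ler_norm_sum _ _ _) _; apply: ler_sum => i _.
  rewrite -mulrBl normrM ler_wpM2r// mulrC; apply: ramp_lip; by rewrite -subr_gt0; exact: d0.
rewrite Rint_sum; last by move=> i _; apply: IntgZ; exact: Intg_abs.
apply: ler_sum => i _; rewrite RintZ; last exact: Intg_abs.
by rewrite mulrAC.
Qed.

Lemma u_time k s e : 0 <= s <= T -> 0 < e -> exists2 d, 0 < d &
  forall t, 0 <= t <= T -> `|t - s| < d -> Qdist k (fun x => u (x, t)) (fun x => u (x, s)) < e.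
Proof.
move=> sT e0; have e4 : 0 < e / 4 by rewrite divr_gt0.
have [n [kn rn]] : exists n, (k <= n)%N /\ rate n < e / 4.
  have /cvgr0Pnorm_lt/(_ _ e4)[n1 _ h1] := rate_cvg.
  exists (maxn k n1); split; first exact: leq_maxl.
  by apply: le_lt_trans (ler_norm _) (h1 _ _); exact: leq_maxr.
have [L L0 hL] := vh_cont (hs_gt0 n) sT.
have L10 : 0 < L + 1 by rewrite ltr_wpDl.
exists (e / 4 / (L + 1)); first by rewrite divr_gt0.
move=> t tT ts; have bt := vh_bmeas (hs_gt0 n) tT; have bs := vh_bmeas (hs_gt0 n) sT.
apply: le_lt_trans (Qdist_triangle k (bu_slice t) bt (bu_slice s)) _.
apply: le_lt_trans (lerD (lexx _) (Qdist_triangle k bt bs (bu_slice s))) _.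
rewrite (Qdist_sym _ (fun x => u (x, t))).
have := hu kn tT; have := hu kn sT; have := hL t k tT.
have : L * `|t - s| <= e / 4.
  apply: (@le_trans _ _ ((L + 1) * `|t - s|)); first by rewrite ler_wpM2r// lerDl.
  by rewrite mulrC -ler_pdivlMr// ltW.
lra.
Qed.

Lemma node_vh h j : 0 < h -> (j <= steps (S h))%N -> vh h (node (S h) j) = W h j.
Proof.
move=> h0 js; have gs := fam_good fam h0; have tg := gs_grid gs; apply/funext => x; rewrite /vh.
have [t0 tT _] := tg.
case: j js => [|j] js; first by rewrite t0 (interp0 T0 tg).
have hj : (1 <= j.+1 <= steps (S h))%N by [].
have nj := node_step gs hj; rewrite /= in nj.
rewrite (interp_piece tg (fun j => W h j x) hj) /= ?lexx ?(ltW nj)//.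
by rewrite divff ?mul1r ?subrKC// subr_eq0 gt_eqF.
Qed.

(** The nonlinear terms contain nodal values rather than the interpolant. A nodal value is the
    interpolant at a node within one step of t, and u is continuous in time. *)
Lemma node_cvg (j_ : nat -> nat) t : 0 <= t <= T ->
  (forall n, (j_ n <= steps (Sh n))%N) ->
  (forall n, `|node (Sh n) (j_ n) - t| <= max_step (Sh n)) ->
  forall k, Qdist k (W (hs n) (j_ n)) (fun x => u (x, t)) @[n --> \oo] --> (0 : R).
Proof.
move=> tT js jt k; apply/cvgr0Pnorm_lt => e e0; have e2 : 0 < e / 2 by rewrite divr_gt0.
have [d d0 hd] := u_time k tT e2.
have nd : \forall n \near \oo, max_step (Sh n) < d.
  apply: (hs_near (P := fun h => max_step (S h) < d)).
  by have /cvgr0Pnorm_lt/(_ _ d0) := fam_step fam; apply: filterS => h; apply: le_lt_trans; exact: ler_norm.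
near=> n; have gs := gs_n n.
rewrite ger0_norm ?Qdist_ge0//.
have nT : 0 <= node (Sh n) (j_ n) <= T.
  by rewrite (grid_ge0 (gs_grid gs) (js n)) (grid_leT (gs_grid gs) (js n)).
have bw := gs_bnd gs (js n).
apply: le_lt_trans (Qdist_triangle k bw (bu_slice (node (Sh n) (j_ n))) (bu_slice t)) _.
rewrite (splitr e); apply: ltrD.
  rewrite -(node_vh (hs_gt0 n) (js n)); apply: le_lt_trans (hu _ nT) _.
    by near: n; exists k.
  apply: le_lt_trans (ler_norm _) _; near: n; by move/cvgr0Pnorm_lt : rate_cvg; exact.
apply: hd => //; apply: le_lt_trans (jt n) _; near: n; exact: nd.
Unshelve. all: by end_near. Qed.

Lemma src_test_Intg C psi : bmeas C psi -> Intg lebT (fun p => itv_ind 0 T p.2 * (g p * psi p)).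
Proof.
move=> bp; have b2 : bmeas (1 * C) (fun p : VT => itv_ind 0 T p.2 * psi p).
  apply: bmeasM bp; split; first exact: measurable_itv_snd.
  by move=> p; have [_] := bmeas_itv_ind (0 : R) T; exact.
have := bmeas_IntgM b2 (src_Intg (fam_src fam)); congr (Intg _ _); apply/funext => p; rewrite /=; ring.
Qed.

(** * Passage to the limit in the weak form *)

Section test.
Variable psi : V * R -> R.
Hypothesis tpsi : test_function T psi.

Definition flux_sum n (t : R) : R := \sum_(i < steps (Sh n))
  cell (Sh n) i t *
  flux (Sh n) (m1 (hs n)) (m2 (hs n)) (W (hs n)) psi i.+1 t.

Definition flux_lim (t : R) : R := \int[leb]_x (lo_f L1 (u (x, t)) * lo_op L1 psi (x, t)) +
  \int[leb]_x (lo_f L2 (u (x, t)) * lo_op L2 psi (x, t)).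

Lemma flux_sumE n t : exists2 F : nat -> R, F = (fun j => flux (Sh n) (m1 (hs n)) (m2 (hs n)) (W (hs n)) psi j t) &
  flux_sum n t = pw (Sh n) F t.
Proof. by eexists; first reflexivity; rewrite /pw big_add1 big_mkord. Qed.

Lemma flux_sum_out n t : ~~ (0 < t <= T) -> flux_sum n t = 0.
Proof.
move=> tT; rewrite /flux_sum big1// => i _; rewrite itv_indE.
have tg := gs_grid (gs_n n).
case: (boolP (_ && _)) => [/andP[a b]|]; last by rewrite mul0r.
case/negP: tT; rewrite (le_lt_trans _ a) ?(le_trans b)//.
  by apply: (grid_leT tg); exact: ltn_ord.
by apply: (grid_ge0 tg); exact/ltnW/ltn_ord.
Qed.

Lemma flux_piece n t : 0 < t <= T -> exists j, [/\ (1 <= j <= steps (Sh n))%N,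
  flux_sum n t = flux (Sh n) (m1 (hs n)) (m2 (hs n)) (W (hs n)) psi j t,
  `|node (Sh n) j - t| <= max_step (Sh n) & `|node (Sh n) j.-1 - t| <= max_step (Sh n)].
Proof.
move=> tT; have gs := gs_n n; have tg := gs_grid gs.
have [k [hk kt]] := find_piece tg tT; exists k.
have [F -> ->] := flux_sumE n t.
have st := step_le_max hk; rewrite /step in st; have /andP[k1 k2] := kt.
split => //; first by rewrite (pwE tg _ hk kt).
  by rewrite ger0_norm ?subr_ge0//; lra.
by rewrite ler0_norm ?subr_le0 ?(ltW k1)// opprB; lra.
Qed.

Lemma psi_bmeas : exists2 C, 0 <= C & forall t, bmeas C (fun x => psi (x, t)) /\ Intg leb (fun x => psi (x, t)).
Proof.
have [C [C0 bp _ _]] := test_bdd tpsi; have [cc _] := tpsi; exists C => // t; split.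
  exact: (bmeas_pair2 (t : RT) bp).
exact: Cc_Intg (Cc_slice t cc).
Qed.

(** On the cell of t the implicit term is taken at the right node and the explicit one at the left
    node; both nodes tend to t, so both terms see u at time t in the limit. *)
Lemma flux_cvg t : 0 < t <= T -> flux_sum n t @[n --> \oo] --> flux_lim t.
Proof.
move=> tT; have tT' : 0 <= t <= T by case/andP: tT => /ltW -> ->.
have [cc _] := tpsi; have [C tf] := testfam_Cc cc.
have /choice[j_ hj] := fun n => flux_piece n tT.
have -> : (fun n => flux_sum n t) = (fun n => flux (Sh n) (m1 (hs n)) (m2 (hs n)) (W (hs n)) psi (j_ n) t).
  by apply/funext => n; have [] := hj n.
have jS n : (j_ n <= steps (Sh n))%N by have [/andP[]] := hj n.
have jS' n : ((j_ n).-1 <= steps (Sh n))%N by have [/node_prev_le] := hj n.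
have gs n := gs_n n.
have [Cp _ hp] := psi_bmeas; have [bp ip] := hp t.
have b n := gs_bnd (gs n) (jS n); have b' n := gs_bnd (gs n) (jS' n).
have mono1 n : {homo phi1 (Sh n) : x y / x <= y} by case: (gs_phi1 (gs n)).
have [f1m f1c] := fam_f1 fam; have [f2m f2c] := fam_f2 fam.
have [_ [H1 _ [_ I1]]] := lo_slice (fam_mu1 fam) tf; have [_ [H2 _ [_ I2]]] := lo_slice (fam_mu2 fam) tf.
apply: cvgD.
  apply: (@comp_cvg M (`|lo_f L1 M| + `|lo_f L1 (- M)|) (fun n => phi1 (Sh n)) (lo_f L1)
    (fun n => W (hs n) (j_ n)) (fun x => u (x, t)) (fun n => dop (m1 (hs n)) (fun y => psi (y, t)))
    (fun x => lo_op L1 psi (x, t)) (fun n => `|phi1 (Sh n) M| + `|phi1 (Sh n) (- M)|)) => //.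
  - move=> e e0; apply: (hs_near (P := fun h => forall r, `|r| <= M -> `|phi1 (S h) r - lo_f L1 r| < e)).
    exact: (compact_cvg_near _ (fam_phi1 fam)).
  - by move=> n; exact: mono_bmeas.
  - exact: mono_bmeas (bu_slice t).
  - by move=> r; exact: mono_bnd.
  - exact: bu_slice.
  - by apply: node_cvg => // n; have [] := hj n.
  - by move=> n; exact: dop_Intg bp ip.
  - apply/cvgr0Pnorm_lt => e e0; near=> n; rewrite ger0_norm ?Rint_ge0//; move: (t); near: n.
    exact: (hs_near (fam_dop1 tf e0)).
apply: (@comp_cvg M (`|lo_f L2 M| + `|lo_f L2 (- M)|) (fun n => phi2 (Sh n)) (lo_f L2)
    (fun n => W (hs n) (j_ n).-1) (fun x => u (x, t)) (fun n => dop (m2 (hs n)) (fun y => psi (y, t)))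
    (fun x => lo_op L2 psi (x, t)) (fun n => `|phi2 (Sh n) M| + `|phi2 (Sh n) (- M)|)) => //.
- move=> e e0; apply: (hs_near (P := fun h => forall r, `|r| <= M -> `|phi2 (S h) r - lo_f L2 r| < e)).
  exact: (compact_cvg_near _ (fam_phi2 fam)).
- by move=> n; apply: mono_bmeas => //; exact: gs_phi2 (gs n).
- exact: mono_bmeas (bu_slice t).
- by move=> r; exact: mono_bnd.
- exact: bu_slice.
- by apply: (@node_cvg (fun n => (j_ n).-1)) => // n; have [] := hj n.
- by move=> n; exact: dop_Intg bp ip.
- apply/cvgr0Pnorm_lt => e e0; near=> n; rewrite ger0_norm ?Rint_ge0//; move: (t); near: n.
  exact: (hs_near (fam_dop2 tf e0)).
Unshelve. all: by end_near. Qed.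

Lemma flux_sum_bnd : exists2 B, 0 <= B & \forall n \near \oo, forall t, `|flux_sum n t| <= B * itv_ind 0 T t.
Proof.
have [cc _] := tpsi; have [C tf] := testfam_Cc cc.
pose A := phi_bnd; have A0 : 0 <= A by rewrite /A /phi_bnd !addr_ge0.
have [B B0 hB] := fam_dop_bnd tf; have [Cp _ hp] := psi_bmeas.
exists (A * B + A * B); first by rewrite addr_ge0// mulr_ge0.
near=> n => t; have [tT|tT] := boolP (0 < t <= T); last by rewrite flux_sum_out// normr0 itv_indE (negbTE tT) mulr0.
have gs := gs_n n.
have [j [hj -> _ _]] := flux_piece n tT; rewrite itv_indE tT mulr1.
have jS : (j <= steps (Sh n))%N by case/andP: hj.
have b := gs_bnd gs jS; have b' := gs_bnd gs (node_prev_le hj).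
have pb : forall r, `|r| <= M -> `|phi1 (Sh n) r| <= A /\ `|phi2 (Sh n) r| <= A.
  near: n; exact: (hs_near (phi_bnd_near)).
have [d1 d2] : \int[leb]_x `|dop (m1 (hs n)) (fun x => psi (x, t)) x| <= B /\
    \int[leb]_x `|dop (m2 (hs n)) (fun x => psi (x, t)) x| <= B.
  by move: (t); near: n; exact: (hs_near hB).
have [bp ip] := hp t; have [mp1 _] := gs_phi1 gs.
apply: le_trans (ler_normD _ _) _; apply: lerD.
  apply: le_trans (ler_wpM2l A0 d1); apply: (Rint_bmeasM_le (f := phi1 (Sh n) \o _) _ (dop_Intg _ bp ip)).
  by split => [|x]; [exact: (mono_bmeas mp1 b).1|have [] := pb _ (b.2 x)].
apply: le_trans (ler_wpM2l A0 d2); apply: (Rint_bmeasM_le (f := phi2 (Sh n) \o _) _ (dop_Intg _ bp ip)).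
by split => [|x]; [exact: (mono_bmeas (gs_phi2 gs) b').1|have [] := pb _ (b'.2 x)].
Unshelve. all: by end_near. Qed.

Lemma flux_lim_Intg : Intg lam (fun t => itv_ind 0 T t * flux_lim t).
Proof.
have [cc _] := tpsi; have [C tf] := testfam_Cc cc.
have key (L : limit_op) : nondecreasing_continuous (lo_f L) -> levy_measure (lo_mu L) ->
    Intg lam (fun t => itv_ind 0 T t * \int[leb]_x (lo_f L (u (x, t)) * lo_op L psi (x, t))).
  move=> [fm fc] lm; have [ml [H IH [hH I]]] := lo_slice lm tf.
  pose A := `|lo_f L M| + `|lo_f L (- M)|.
  have mu' : measurable_fun [set: VT] (fun p => lo_f L (u p)).
    exact: (measurableT_comp (continuous_measurable_fun fc) bu.1).
  have Ip := @Intg_strip (fun p => lo_f L (u p) * lo_op L psi p) (fun x => A * H x) 0 T (measurable_funM mu' ml) (IntgZ A IH) _.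
  have := Fubini_intg2 (Ip _); rewrite /=.
  have e t : \int[leb]_x (itv_ind 0 T t * (lo_f L (u (x, t)) * lo_op L psi (x, t))) =
      itv_ind 0 T t * \int[leb]_x (lo_f L (u (x, t)) * lo_op L psi (x, t)).
    rewrite RintZ//; exact: bmeas_IntgM (mono_bmeas fm (bu_slice t)) (I t).
  under [X in _ -> Intg _ X]eq_fun do rewrite -e; apply => x t.
  by rewrite normrM; apply: ler_pM => //; apply: mono_bnd => //; exact: bu.2.
under eq_fun do rewrite /flux_lim mulrDr; apply: IntgD; apply: key.
- exact: fam_f1 fam. - exact: fam_mu1 fam. - exact: fam_f2 fam. - exact: fam_mu2 fam.
Qed.

Lemma flux_int_cvg : \sum_(i < steps (Sh n)) \int[lam]_t (cell (Sh n) i t *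
    flux (Sh n) (m1 (hs n)) (m2 (hs n)) (W (hs n)) psi i.+1 t) @[n --> \oo] -->
  \int[lam]_t (itv_ind 0 T t * flux_lim t).
Proof.
have wc n i := weak_cell (gs_n n) (fam_src fam) tpsi (i := i).
have If n : Intg lam (flux_sum n) by apply: Intg_sum => i _; have [] := wc n i (ltn_ord i).
have [B B0 [n0 _ hB]] := flux_sum_bnd.
(* The majorant is valid only from n0 on. *)
rewrite -(cvg_shiftn n0).
have [|||||_ _ cv] := @DCT _ _ _ lam (fun n t => flux_sum (n + n0)%N t) (fun t => itv_ind 0 T t * flux_lim t) (fun t => B * itv_ind 0 T t).
- by move=> n; exact: Intg_meas (If _).
- exact: Intg_meas flux_lim_Intg.
- apply: aeW => t; rewrite itv_indE; case: (boolP (0 < t <= T)) => tT.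
    by rewrite mul1r; have := flux_cvg tT; rewrite -(cvg_shiftn n0).
  by rewrite mul0r; under eq_fun do rewrite flux_sum_out//; exact: cvg_cst.
- by apply: IntgZ; exact: Intg_itv_ind.
- by move=> n; apply: aeW => t; apply: hB => /=; exact: leq_addl.
move: cv; apply: cvg_trans; apply: near_eq_cvg; apply: nearW => n /=.
by rewrite /flux_sum Rint_sum// => i _; have [] := wc (n + n0)%N i (ltn_ord i).
Qed.

Lemma vh_int_cvg :
  \int[leb]_x \int[lam]_t (itv_ind 0 T t * (interp (Sh n) (fun j => W (hs n) j x) t * dt psi (x, t))) @[n --> \oo] -->
  \int[leb]_x \int[lam]_t (itv_ind 0 T t * (u (x, t) * dt psi (x, t))).
Proof.
have [C [C0 bp bd van]] := test_bdd tpsi; have [cc _] := tpsi.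
have [H [IH bH H0 hH]] := test_cutoff tpsi.
have [k hk] := compact_Qbox (Cc_slice_compact cc).
pose X n (p : VT) := itv_ind 0 T p.2 * (vh0 (hs n) p * dt psi p).
pose Y (p : VT) := itv_ind 0 T p.2 * (u p * dt psi p).
have b0 n := vh0_bmeas (hs_gt0 n).
have key (v : VT -> R) : bmeas M v -> Intg lebT (fun p => itv_ind 0 T p.2 * (v p * dt psi p)).
  move=> bv; apply: (@Intg_strip (fun p => v p * dt psi p) (fun x => M * C * H x)).
  - by apply: measurable_funM; [exact: bv.1|exact: bd.1].
  - exact: IntgZ.
  - move=> x t; rewrite (hH x t).2 mulrA normrM (ger0_norm (H0 x)) ler_wpM2r// normrM.
    by apply: ler_pM => //; [exact: bv.2|exact: bd.2].
have IX n : Intg lebT (X n) := key _ (b0 n).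
have IY : Intg lebT Y := key _ bu.
have eX n x t : itv_ind 0 T t * (interp (Sh n) (fun j => W (hs n) j x) t * dt psi (x, t)) = X n (x, t).
  rewrite /X /vh0 /= itv_indE; case: (boolP (0 < t <= T)) => [/andP[t0 tT]|]; last by rewrite !mul0r.
  by rewrite (ltW t0) tT.
apply/cvgrPdist_le => e e0.
have TC : 0 < T * C + 1 by rewrite ltr_wpDl// mulr_ge0// ltW.
near=> n.
have -> : \int[leb]_x \int[lam]_t (itv_ind 0 T t * (interp (Sh n) (fun j => W (hs n) j x) t * dt psi (x, t))) =
    \int[leb]_x \int[lam]_t X n (x, t) by apply: Rint_ext => x; apply: Rint_ext => t; exact: eX.
rewrite -/(Y _) (Fubini_swap (IX n)) (Fubini_swap IY) -RintB; [|exact: Fubini_intg2 IY|exact: Fubini_intg2 (IX n)].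
have kn : (k <= n)%N by near: n; exists k.
have rn : rate n < e / (T * C + 1).
  by apply: le_lt_trans (ler_norm _) _; near: n; move/cvgr0Pnorm_lt : rate_cvg; apply; rewrite divr_gt0.
apply: (@le_trans _ _ (\int[lam]_t (C * rate n * itv_ind 0 T t))).
  apply: (Rint_dom (IntgB (Fubini_intg2 IY) (Fubini_intg2 (IX n))) (IntgZ _ (Intg_itv_ind 0 T))) => t.
  rewrite /X /Y /= itv_indE; case: (boolP (0 < t <= T)) => [/andP[t0 tT]|]; last first.
    have z (F : V -> R) : \int[leb]_x (0 * F x) = 0.
      by rewrite (Rint_eq0 _)// => x; exact: mul0r.
    by rewrite mulr0 (z (fun x => u (x, t) * _)) (z (fun x => vh0 (hs n) (x, t) * _)) subrr normr0.
  have tT' : 0 <= t <= T by rewrite (ltW t0) tT.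
  have bv := vh_bmeas (hs_gt0 n) tT'.
  have mdt : measurable_fun setT (fun x : V => dt psi (x, t)).
    exact: (measurableT_comp bd.1 (measurable_pair2 (t : RT))).
  have Idt : Intg leb (fun x => dt psi (x, t)).
    apply: (Intg_le mdt (IntgZ C IH)) => x.
    by rewrite (hH x t).2 normrM (ger0_norm (H0 x)) ler_wpM2r// bd.2.
  have i1 : Intg leb (fun x => u (x, t) * dt psi (x, t)) by exact: bmeas_IntgM (bu_slice t) Idt.
  have i2 : Intg leb (fun x => vh (hs n) t x * dt psi (x, t)) by exact: bmeas_IntgM bv Idt.
  rewrite mulr1 (Rint_ext _ (g := fun x => u (x, t) * dt psi (x, t))); last by move=> x; rewrite mul1r.
  rewrite [X in _ - X](Rint_ext _ (g := fun x => vh (hs n) t x * dt psi (x, t))); last first.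
    by move=> x; rewrite mul1r /vh0 /= tT'.
  rewrite -RintB//; apply: (le_trans _ (ler_wpM2l C0 (hu kn tT'))); rewrite -RintZ; last exact: Intg_Qdist bv (bu_slice t).
  apply: (Rint_dom (IntgB i1 i2) (IntgZ C (Intg_Qdist k bv (bu_slice t)))) => x.
  rewrite -mulrBl normrM distrC mulrC.
  have [Kx|Kx] := pselect ((fst @` supp psi) x); last by rewrite (van x t Kx).2 normr0 mul0r mulr_ge0// mulr_ge0// indicE.
  by rewrite (indic_in (hk _ Kx)) mul1r ler_wpM2r// bd.2.
rewrite RintZ; last exact: Intg_itv_ind.
rewrite (Rint_itv_ind (ltW T0)) subr0.
apply: (@le_trans _ _ ((T * C + 1) * rate n)); last by rewrite mulrC -ler_pdivlMr// ltW.
by rewrite mulrC mulrA ler_wpM2r ?lerDl// ltW// rate_gt0.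
Unshelve. all: by end_near. Qed.

Lemma psi_time x C : bmeas C (dt psi : VT -> R) -> forall s t, `|psi (x, t) - psi (x, s)| <= C * `|t - s|.
Proof.
move=> bd; have [[sp _] _] := tpsi.
have cx := slice_dt_continuous (x:=x) sp.
have bx : bmeas C (fun t : RT => dt psi (x, t)).
  exact: (bmeas_pair1 x bd).
have H s t : s <= t -> `|psi (x, t) - psi (x, s)| <= C * `|t - s|.
  move=> st; rewrite -(FTC_line (slice_dt x sp) cx st).
  rewrite [`|t - s|]ger0_norm ?subr_ge0// -(Rint_itv_ind st) -RintZ; last exact: Intg_itv_ind.
  apply: (Rint_dom (Intg_itv_bdd s t bx) (IntgZ C (Intg_itv_ind s t))) => r.
  by rewrite normrM (ger0_norm (itv_ind_ge0 _ _ _)) mulrC ler_wpM2r ?itv_ind_ge0// bx.2.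
move=> s t; have [st|ts] := leP s t; first exact: H.
by rewrite distrC [`|t - s|]distrC; apply: H; exact: ltW.
Qed.

Lemma itv_sum n t : \sum_(i < steps (Sh n)) cell (Sh n) i t = itv_ind 0 T t.
Proof.
have tg := gs_grid (gs_n n).
rewrite [RHS]itv_indE; case: (boolP (0 < t <= T)) => tT.
  have [k [hk kt]] := find_piece tg tT; have := pwE tg (fun=> 1) hk kt.
  rewrite /pw big_add1 big_mkord => <-; apply: eq_bigr => i _; by rewrite mulr1.
rewrite big1// => i _; rewrite itv_indE.
case: (boolP (_ && _)) => [/andP[a b]|//].
case/negP: tT; rewrite (le_lt_trans _ a) ?(le_trans b)//.
  by apply: (grid_leT tg); exact: ltn_ord.
by apply: (grid_ge0 tg); exact/ltnW/ltn_ord.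
Qed.

(** Inside a cell psi differs from its cell mean by at most the bound of [dt psi] times the step.
    The averages of the source are exact, so this is the only error. *)
Lemma source_x n x C : bmeas C (psi : VT -> R) -> bmeas C (dt psi : VT -> R) -> 0 <= C ->
  Intg lam (fun t => g (x, t)) ->
  `|\sum_(i < steps (Sh n)) fmean (Sh n) g i.+1 x * cell_mean (Sh n) psi i.+1 x -
    \int[lam]_t (itv_ind 0 T t * (g (x, t) * psi (x, t)))| <= C * max_step (Sh n) * \int[lam]_t `|g (x, t)|.
Proof.
move=> bp bd C0 Ig; have gs := gs_n n; set Sn := S (hs n).
have bpx : bmeas C (fun t : RT => psi (x, t)).
  exact: (bmeas_pair1 x bp).
have Igp : Intg lam (fun t => g (x, t) * psi (x, t)).
  by under eq_fun do rewrite mulrC; exact: bmeas_IntgM bpx Ig.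
have ii (q : RT -> R) a b : Intg lam q -> Intg lam (fun t => itv_ind a b t * q t).
  by move=> Iq; exact: Intg_itv.
pose d (i : nat) t := cell Sn i t * (cell_mean Sn psi i.+1 x * g (x, t) - g (x, t) * psi (x, t)).
have Id i : Intg lam (d i) by apply: ii; apply: IntgB => //; exact: IntgZ.
have -> : \sum_(i < steps Sn) fmean Sn g i.+1 x * cell_mean Sn psi i.+1 x -
    \int[lam]_t (itv_ind 0 T t * (g (x, t) * psi (x, t))) = \int[lam]_t \sum_(i < steps Sn) d i t.
  rewrite (Rint_ext _ (f := fun t => itv_ind 0 T t * (g (x, t) * psi (x, t)))
      (g := fun t => \sum_(i < steps Sn) cell Sn i t * (g (x, t) * psi (x, t)))); last first.
    by move=> t; rewrite -mulr_suml itv_sum.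
  rewrite Rint_sum; last by move=> i _; exact: ii.
  rewrite Rint_sum; last by move=> i _; exact: Id.
  rewrite -sumrB; apply: eq_bigr => i _.
  rewrite /fmean mulrC -RintZ; last exact: ii.
  rewrite -RintB; [|by apply: IntgZ; exact: ii|exact: ii].
  by apply: Rint_ext => t; rewrite /d /=; ring.
have Isum : Intg lam (fun t => \sum_(i < steps Sn) d i t) by apply: Intg_sum => i _; exact: Id.
have Ia := Intg_abs Ig.
rewrite -RintZ//; apply: (Rint_dom Isum (IntgZ _ Ia)) => t.
have ms0 : 0 <= max_step Sn.
  have sg := steps_gt0 T0 (gs_grid gs).
  have h1 : (1 <= 1 <= steps Sn)%N by rewrite sg.
  exact: le_trans (ltW (step_gt0 (gs_grid gs) h1)) (step_le_max h1).
apply: (@le_trans _ _ (\sum_(i < steps Sn) cell Sn i t * (C * max_step Sn * `|g (x, t)|))).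
  apply: le_trans (ler_norm_sum _ _ _) _; apply: ler_sum => i _.
  rewrite /d normrM (ger0_norm (itv_ind_ge0 _ _ _)).
  rewrite itv_indE; case: (boolP (_ < t <= _)) => [/andP[a b]|]; last by rewrite !mul0r.
  rewrite !mul1r [g (x, t) * _]mulrC -mulrBl normrM ler_wpM2r//.
  have hj : (1 <= i.+1 <= steps Sn)%N by rewrite /= ltn_ord.
  have nj := node_step gs hj; rewrite /= in nj.
  have s0 := step_gt0 (gs_grid gs) hj; have sn : step Sn i.+1 != 0 by rewrite gt_eqF.
  have sE : step Sn i.+1 = node Sn i.+1 - node Sn i by [].
  have -> : psi (x, t) = (step Sn i.+1)^-1 * \int[lam]_s (psi (x, t) * cell Sn i s).
    rewrite RintZ; last exact: Intg_itv_ind.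
    by rewrite (Rint_itv_ind (ltW nj)) -sE mulrCA mulVf// mulr1.
  rewrite /cell_mean /= -mulrBr -RintB; [|exact: Intg_itv_bdd bpx|by apply: IntgZ; exact: Intg_itv_ind].
  have Idd : Intg lam (fun s => cell Sn i s * psi (x, s) - psi (x, t) * cell Sn i s).
    by apply: IntgB; [exact: Intg_itv_bdd bpx|by apply: IntgZ; exact: Intg_itv_ind].
  rewrite normrM (gtr0_norm (_ : 0 < (step Sn i.+1)^-1)) ?invr_gt0// ler_pdivrMl//.
  apply: (@le_trans _ _ (\int[lam]_s (C * max_step Sn * cell Sn i s))).
    apply: (Rint_dom Idd (IntgZ _ (Intg_itv_ind _ _))) => s.
    rewrite itv_indE; case: (boolP (_ < s <= _)) => [/andP[a' b']|]; last by rewrite mul0r !mulr0 subrr normr0.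
    rewrite mul1r !mulr1; apply: le_trans (psi_time x bd t s) _; rewrite ler_wpM2l//.
    apply: le_trans (step_le_max hj); rewrite sE ler_norml; apply/andP; split; lra.
  rewrite RintZ; last exact: Intg_itv_ind.
  by rewrite (Rint_itv_ind (ltW nj)) -sE mulrC.
rewrite -mulr_suml itv_sum -[leRHS]mul1r ler_wpM2r ?mulr_ge0//.
by rewrite itv_indE; case: (_ && _).
Qed.

Lemma source_cvg : \sum_(i < steps (Sh n)) \int[leb]_x (fmean (Sh n) g i.+1 x * cell_mean (Sh n) psi i.+1 x)
  @[n --> \oo] --> \int[leb]_x \int[lam]_t (itv_ind 0 T t * (g (x, t) * psi (x, t))).
Proof.
have [C [C0 bp bd van]] := test_bdd tpsi.
have Ig := src_Intg (fam_src fam).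
have wc n i := weak_cell (gs_n n) (fam_src fam) tpsi (i := i).
pose G := \int[leb]_x \int[lam]_t `|g (x, t)|.
have IG : Intg leb (fun x => \int[lam]_t `|g (x, t)|) by exact: Fubini_intg1 (Intg_abs Ig).
have G0 : 0 <= G by apply: Rint_ge0 => x; exact: Rint_ge0.
have Igp := src_test_Intg bp.
have I2 := Fubini_intg1 Igp.
apply/cvgrPdist_le => e e0.
have CG : 0 < C * G + 1 by rewrite ltr_wpDl// mulr_ge0.
near=> n.
have ms : max_step (Sh n) < e / (C * G + 1).
  apply: le_lt_trans (ler_norm _) _; near: n.
  apply: (hs_near (P := fun h => `|max_step (S h)| < e / (C * G + 1))).
  by move/cvgr0Pnorm_lt : (fam_step fam); apply; rewrite divr_gt0.
have I1 : Intg leb (fun x => \sum_(i < steps (Sh n)) fmean (Sh n) g i.+1 x * cell_mean (Sh n) psi i.+1 x).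
  by apply: Intg_sum => i _; have [] := wc n i (ltn_ord i).
rewrite -Rint_sum; last by move=> i _; have [] := wc n i (ltn_ord i).
rewrite distrC -RintB//; apply: le_trans (Rint_norm (IntgB I1 I2)) _.
apply: (@le_trans _ _ (C * max_step (Sh n) * G)).
  rewrite /G -RintZ//; apply: Rint_le_ae; [by apply: Intg_abs; exact: IntgB|exact: IntgZ|].
  by have := Fubini_ae1 Ig; apply: filterS => x Igx; exact: source_x.
rewrite mulrAC; apply: (@le_trans _ _ ((C * G + 1) * (e / (C * G + 1)))).
  apply: ler_pM; [exact: mulr_ge0| |by rewrite lerDl|exact: ltW].
  have sg := steps_gt0 T0 (gs_grid (gs_n n)).
  have h1 : (1 <= 1 <= steps (Sh n))%N by rewrite sg.
  exact: le_trans (ltW (step_gt0 (gs_grid (gs_n n)) h1)) (step_le_max h1).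
by rewrite mulrCA mulfV ?mulr1// gt_eqF.
Unshelve. all: by end_near. Qed.

Lemma limit_identity : \int[leb]_x \int[lam]_t (itv_ind 0 T t * (u (x, t) * dt psi (x, t))) =
  - (\int[leb]_x (u0 x * psi (x, 0))) - (\int[lam]_t (itv_ind 0 T t * flux_lim t)) -
  (\int[leb]_x \int[lam]_t (itv_ind 0 T t * (g (x, t) * psi (x, t)))).
Proof.
have c1 := vh_int_cvg.
have e n := weak_form (gs_n n) (fam_src fam) T0 (fam_u0 fam) tpsi.
have := c1; under eq_fun do rewrite e; move=> c2.
apply: (cvg_unique _ c2) => //; apply: cvgB; last exact: source_cvg.
apply: cvgB; [exact: cvg_cst|exact: flux_int_cvg].
Qed.

End test.

(** * A limit is a bounded solution *)

Let uI t (tT : 0 <= t <= T) := (u_Intg tT).1.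
Let uL t (tT : 0 <= t <= T) := (u_Intg tT).2.

Lemma limit_QT_Intg : Intg lebT (u \_ (QT T)).
Proof.
have mr : measurable_fun [set: VT] (u \_ (QT T)).
  by apply/(measurable_restrictT _ (measurable_QT T)); apply: measurable_funTS; exact: bu.1.
have D0 : 0 <= data_L1 by apply: addr_ge0; apply: Rint_ge0 => // t; exact: Rint_ge0.
apply: (@Intg_prod2 _ _ _ _ _ leb lam _ (fun t => data_L1 * itv_ind 0 T t)) => //.
- by apply: IntgZ; exact: Intg_itv_ind.
- move=> t; under eq_fun do rewrite QT_restrictE; case: (boolP (0 < t < T)) => [/andP[t0 tT]|_]; last exact: (Intg0 _).
  by apply: uI; rewrite !ltW.
- move=> t; rewrite (Rint_ext _ (g := fun x => `|if 0 < t < T then u (x, t) else 0|)); last first.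
    by move=> x; rewrite QT_restrictE.
  rewrite itv_indE; case: (boolP (0 < t < T)) => [/andP[t0 tT]|_].
    by rewrite t0 (ltW tT) mulr1; apply: uL; rewrite !ltW.
  by rewrite (Rint_eq0 _) ?mulr_ge0// => x; rewrite normr0.
Qed.

Lemma limit_L1_Loo : L1_Loo (lebesgue_QT (N := N)) (u \_ (QT T)).
Proof.
apply/L1_LooP; split; first exact: limit_QT_Intg.
exists M; first exact: fam_M fam.
apply: aeW => p; rewrite patchE; case: ifP => _; first exact: bu.2.
by rewrite normr0; exact: fam_M fam.
Qed.

Lemma L1_distE (K : set V) k (v w : V -> R) : compact K -> K `<=` Qbox k%:R -> bmeas M v -> bmeas M w ->
  L1_dist K v w = (\int[leb]_x (\1_K x * `|v x - w x|))%:E /\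
  \int[leb]_x (\1_K x * `|v x - w x|) <= Qdist k v w.
Proof.
move=> cK KQ bv bw; have mK : measurable K by exact: compact_measurable_rV.
have iK : Intg leb (\1_K : V -> R) by apply: indic_Intg => //; exact: compact_leb_fin.
have I : Intg leb (fun x => \1_K x * `|v x - w x|).
  by under eq_fun do rewrite mulrC; exact: bmeas_IntgM (bmeas_abs (bmeasB bv bw)) iK.
split.
  rewrite Rint_EFin// /L1_dist [LHS]integral_mkcond; apply: eq_integral => x _.
  by rewrite patchE indicE; case: (x \in K); rewrite ?mul1r ?mul0r.
apply: Rint_le => // [|x]; first exact: Intg_Qdist bv bw.
rewrite ler_wpM2r//; have [Kx|Kx] := pselect (K x); last by rewrite indic_out// indicE.
by rewrite !indic_in//; exact: KQ.
Qed.

Lemma limit_C_L1loc : C_L1loc T u.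
Proof.
move=> K cK; have mK : measurable K by exact: compact_measurable_rV.
split; first by move=> t tT; apply: (integrableS measurableT mK (@subsetT _ _)); exact: uI.
move=> s sT; have [k KQ] := compact_Qbox cK.
have e t := L1_distE cK KQ (bu_slice t) (bu_slice s).
under eq_fun do rewrite (e _).1.
apply: cvg_EFin; first exact: nearW.
apply/cvgr0Pnorm_lt => r r0; have [d d0 hd] := u_time k sT r0.
have nd : \forall t \near s, `|t - s| < d by apply/nbhs_normP; exists d => // t /=; rewrite distrC.
rewrite near_withinE; move: nd; apply: filterS => t td; rewrite /= in_itv/= => tT.
rewrite ger0_norm; last by apply: Rint_ge0 => x; rewrite mulr_ge0// indicE.
exact: le_lt_trans (e t).2 (hd t tT td).
Qed.

Lemma limit_solution P (sigma : 'M[R]_(N, P)) (mu : {measure set V -> \bar R}) (phi : R -> R) (f : V * R -> R) :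
  levy_measure mu -> nondecreasing_continuous phi -> g = f \_ (QT T) ->
  (forall v psi : V -> R, L1_Loo leb v -> Cc_smooth psi ->
        \int[leb]_x (lo_f L1 (v x) * levy_op (lo_sigma L1) (lo_mu L1) psi x +
          lo_f L2 (v x) * levy_op (lo_sigma L2) (lo_mu L2) psi x -
          phi (v x) * levy_op sigma mu psi x) = 0) ->
  distributional_solution T sigma mu phi f u0 u.
Proof.
move=> lmu nphi gf cons; split.
  split; first by apply: measurable_funTS; exact: bu.1.
  move=> K cK KQ; apply: (integrableS (measurable_QT T) _ KQ); first exact: compact_measurable_prod.
  apply/(integrable_mkcond _ (measurable_QT T)); rewrite restrict_EFin; exact: limit_QT_Intg.
move=> psi tpsi; have [cc _] := tpsi; have [C tf] := testfam_Cc cc.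
have [C' [C0 bp bd van]] := test_bdd tpsi.
have [H [IH bH H0 hH]] := test_cutoff tpsi.
have lid := limit_identity tpsi.
have [phim phic] := nphi.
pose L := LimitOp sigma mu phi.
have [ml [HL IHL [hHL IL]]] := @lo_slice psi L _ _ lmu tf.
pose A := `|phi M| + `|phi (- M)|.
have mu' : measurable_fun [set: VT] (fun p => phi (u p)).
  exact: (measurableT_comp (continuous_measurable_fun phic) bu.1).
have mul := measurable_funM mu' ml.
have bul x t : `|phi (u (x, t)) * lo_op L psi (x, t)| <= A * HL x.
  by rewrite normrM; apply: ler_pM => //; apply: mono_bnd => //; exact: bu.2.
have I2 := @Intg_strip (fun p => phi (u p) * lo_op L psi p) (fun x => A * HL x) 0 T mul (IntgZ A IHL) bul.
have mud : measurable_fun [set: VT] (fun p => u p * dt psi p) by apply: measurable_funM; [exact: bu.1|exact: bd.1].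
have I1 : Intg lebT (fun p => itv_ind 0 T p.2 * (u p * dt psi p)).
  apply: (@Intg_strip (fun p => u p * dt psi p) (fun x => M * C' * H x)) => //.
    exact: IntgZ.
  move=> x t; rewrite (hH x t).2 mulrA normrM (ger0_norm (H0 x)) ler_wpM2r// normrM.
  by apply: ler_pM => //; [exact: bu.2|exact: bd.2].
have mgp : measurable_fun [set: VT] (fun p => g p * psi p) by apply: measurable_funM; [exact: src_meas (fam_src fam)|exact: bp.1].
have I3 := src_test_Intg bp.
pose G' p := u p * dt psi p + phi (u p) * lo_op L psi p + g p * psi p.
have IG : Intg lebT (fun p : VT => itv_ind 0 T p.2 * G' p).
  have := IntgD (IntgD I1 I2) I3; congr (Intg _ _); apply/funext => p; by rewrite /= /G' !mulrDr.
have mG : measurable_fun [set: VT] G' by apply: measurable_funD => //; exact: measurable_funD.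
have [J1 _] := QT_integral (q := fun p => phi (u p) * levy_op_x sigma mu psi p) (fun p _ => erefl) mul I2.
have [|J2 J3] := QT_integral (q := fun p => u p * dt psi p + phi (u p) * levy_op_x sigma mu psi p + f p * psi p)
   (q' := G') _ mG IG.
  move=> p hp; rewrite /G' gf patchE mem_set//.
split => //; rewrite J3.
rewrite (Rint_ext _ (g := fun p : VT => itv_ind 0 T p.2 * (u p * dt psi p) + itv_ind 0 T p.2 * (phi (u p) * lo_op L psi p) +
   itv_ind 0 T p.2 * (g p * psi p))); last by move=> p; rewrite /G' !mulrDr.
rewrite RintD//; last exact: IntgD.
rewrite RintD// -(Fubini_Rint1 I1) -(Fubini_Rint1 I3) -(Fubini_Rint2 I2) /= lid.
(* The consistency identity is applied slice by slice: at each time in ]0, T] u is in L^1 and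
   bounded, and psi restricts to a test function of x. *)
have -> : \int[lam]_t \int[leb]_x (itv_ind 0 T t * (phi (u (x, t)) * lo_op L psi (x, t))) =
    \int[lam]_t (itv_ind 0 T t * flux_lim psi t).
  apply: Rint_ext => t; rewrite itv_indE; case: (boolP (0 < t <= T)) => [/andP[t0 tT]|_]; last first.
    by rewrite mul0r (Rint_eq0 _)// => x; rewrite mul0r.
  rewrite mul1r (Rint_ext _ (g := fun x => phi (u (x, t)) * lo_op L psi (x, t))); last by move=> x; rewrite mul1r.
  have tT' : 0 <= t <= T by rewrite (ltW t0) tT.
  have bs := bu_slice t.
  have [f1m f1c] := fam_f1 fam; have [f2m f2c] := fam_f2 fam.
  have [_ [H1 _ [_ K1]]] := lo_slice (fam_mu1 fam) tf; have [_ [H2 _ [_ K2]]] := lo_slice (fam_mu2 fam) tf.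
  have q1 : Intg leb (fun x => lo_f L1 (u (x, t)) * lo_op L1 psi (x, t)) := bmeas_IntgM (mono_bmeas f1m bs) (K1 t).
  have q2 : Intg leb (fun x => lo_f L2 (u (x, t)) * lo_op L2 psi (x, t)) := bmeas_IntgM (mono_bmeas f2m bs) (K2 t).
  have q3 : Intg leb (fun x => phi (u (x, t)) * lo_op L psi (x, t)) := bmeas_IntgM (mono_bmeas phim bs) (IL t).
  have vL : L1_Loo leb (fun x => u (x, t)).
    apply/L1_LooP; split; first exact: uI.
    by exists M; [exact: fam_M fam|apply: aeW => x; exact: bs.2].
  have := cons _ _ vL (Cc_slice t cc).
  rewrite RintB//; last exact: IntgD.
  by rewrite RintD// => /eqP; rewrite subr_eq0 => /eqP <-.
ring.
Qed.

End limit.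

(** * Uniqueness for the limit problem *)

Variables (P : nat) (sigma : 'M[R]_(N, P)) (mu : {measure set V -> \bar R}) (phi : R -> R).
Hypothesis lmu : levy_measure mu.
Hypothesis nphi : nondecreasing_continuous phi.
Hypothesis cons : forall v psi : V -> R, L1_Loo leb v -> Cc_smooth psi ->
  \int[leb]_x (lo_f L1 (v x) * levy_op (lo_sigma L1) (lo_mu L1) psi x +
    lo_f L2 (v x) * levy_op (lo_sigma L2) (lo_mu L2) psi x - phi (v x) * levy_op sigma mu psi x) = 0.

Let op (L : @limit_op) := levy_op (lo_sigma L) (lo_mu L).

Lemma op_Intg L eta : levy_measure (lo_mu L) -> Cc_smooth eta -> Intg leb (op L eta).
Proof.
move=> lm ce; have [C tf] := testfam_cst ce; have [_ [H _ [_ I]]] := lo_slice lm tf; exact: (I 0).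
Qed.

(** The consistency identity is tested with a 1_A and with 0. As phi(a 1_A) = phi(0) + (phi(a) -
    phi(0)) 1_A, and likewise for the two limit nonlinearities, subtraction shows that K has
    integral 0 over every set A of finite measure. *)
Lemma limit_operators_relation a eta : Cc_smooth eta -> {ae leb, forall x,
  (lo_f L1 a - lo_f L1 0) * op L1 eta x + (lo_f L2 a - lo_f L2 0) * op L2 eta x = (phi a - phi 0) * levy_op sigma mu eta x}.
Proof.
move=> ce; have I1 := op_Intg (fam_mu1 fam) ce; have I2 := op_Intg (fam_mu2 fam) ce.
have I : Intg leb (levy_op sigma mu eta) by exact: (@op_Intg (LimitOp sigma mu phi)).
pose K x := (lo_f L1 a - lo_f L1 0) * op L1 eta x + (lo_f L2 a - lo_f L2 0) * op L2 eta x - (phi a - phi 0) * levy_op sigma mu eta x.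
pose K0 x := lo_f L1 0 * op L1 eta x + lo_f L2 0 * op L2 eta x - phi 0 * levy_op sigma mu eta x.
have IK : Intg leb K by apply: IntgB; [apply: IntgD; exact: IntgZ|exact: IntgZ].
have IK0 : Intg leb K0 by apply: IntgB; [apply: IntgD; exact: IntgZ|exact: IntgZ].
suff h : {ae leb, forall x, K x = 0} by apply: filterS h => x /subr0_eq.
have main A : measurable A -> (leb A < +oo)%E -> \int[leb]_x K0 x + \int[leb]_x (\1_A x * K x) = 0.
  move=> mA fA; have IA := indic_Intg mA fA.
  have va : L1_Loo leb (fun x => a * \1_A x).
    apply/L1_LooP; split; [exact: IntgZ|exists `|a| => //].
    by apply: aeW => x; rewrite normrM -[leRHS]mulr1 ler_wpM2l//; exact: (bmeas_indic mA).2.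
  rewrite -(RintD IK0 (bmeas_IntgM (bmeas_indic mA) IK)) -[RHS](cons va ce); apply: Rint_ext => x.
  have [Ax|Ax] := pselect (A x); first by rewrite indic_in// mul1r mulr1 /K /K0 /op; ring.
  by rewrite indic_out// mul0r mulr0 addr0.
apply: ae0_sets => // A mA fA; have e1 := main A mA fA.
have := main set0 measurable0; rewrite measure0 => /(_ (ltry 0)).
rewrite (Rint_ext _ (f := fun x => \1_set0 x * K x) (g := fun=> 0)) => [|x]; last by rewrite indic0 mul0r.
by rewrite Rint_zero addr0 => e0; rewrite e0 add0r in e1.
Qed.

(** If [phi] is constant then z = 0 and the zero operator serves. Otherwise some a with phi(a)
    different from phi(0) expresses the Levy operator as c1 L1 + c2 L2 almost everywhere on test
    functions, with c1, c2 >= 0 by monotonicity; the same combination of the jump measures of the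
    schemes is symmetric, finite and approximates it. *)
Lemma exists_generator : exists L nu, generator L nu /\
  forall M' w z, difference T M' (levy_op sigma mu) w z -> (forall p, exists a b, z p = phi a - phi b) -> difference T M' L w z.
Proof.
have [[a na]|cst] := pselect (exists a, phi a != phi 0); last first.
  have z0 : forall a, phi a = phi 0 by move=> a; apply: contrapT => h; apply: cst; exists a; exact/eqP.
  pose nul : {measure set V -> \bar R} := mzero.
  have [nu en] : exists m : fmeas, m = nul :> (set V -> \bar R).
    by apply: exists_finite_measure; rewrite /nul /= /mzero.
  have mz A : nu A = 0%E by rewrite en.
  have d0 eta x : Cc_smooth eta -> dop nu eta x = 0.
    move=> ce; have [C _ be] := Cc_meas ce; have := avg_bdd nu x be.
    by rewrite /dop /mass mz /= mulr0 normr_le0 => /eqP ->; rewrite mul0r subrr.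
  exists (fun _ _ => 0), (fun=> nu); split.
    split => //.
    - by move=> n A mA; rewrite !mz.
    - by move=> eta ce; exact: Intg0.
    - move=> eta ce; rewrite (_ : (fun=> _) = fun=> 0); first exact: cvg_cst.
      apply/funext => n; rewrite (Rint_eq0 _)// => x.
      by rewrite d0// subrr normr0.
  move=> M' w z D hz; have zz p : z p = 0 by have [b [b' ->]] := hz p; rewrite (z0 b) (z0 b') subrr.
  case: D => dT dw dwI ds dz dsg dw0 dm dou did dp; split => // psi tp.
  have -> : (fun p : VT => w p * dt psi p + z p * 0) =
      (fun p : VT => w p * dt psi p + z p * levy_op sigma mu (fun x => psi (x, p.2)) p.1).
    by apply/funext => p; rewrite zz !mul0r.
  exact: did.
have c0 (f : R -> R) : {homo f : x y / x <= y} -> 0 <= (f a - f 0) / (phi a - phi 0).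
  move=> hf; have [hp _] := nphi; have [a0|a0] := leP 0 a; first by rewrite divr_ge0// subr_ge0; [exact: hf|exact: hp].
  by rewrite -mulrNN -invrN !opprB divr_ge0// subr_ge0; [apply: hf|apply: hp]; exact: ltW.
have c10 := c0 _ (fam_f1 fam).1; have c20 := c0 _ (fam_f2 fam).1.
set c1 := (_ - _) / _ in c10; set c2 := (_ - _) / _ in c20.
(* Any positive sequence tending to 0 would do; n + 2 yields the strict bound by 1/(n+1) that
   [hs_near] expects. *)
pose hs n : R := n.+2%:R^-1.
have hs0 n : 0 < hs n < n.+1%:R^-1.
  by rewrite /hs invr_gt0 ltr0n /= ltf_pV2 ?posrE ?ltr0n// ltr_nat.
have hp n : 0 < hs n by have /andP[] := hs0 n.
have /choice[nu hnu] : forall n, exists nu : fmeas, sym nu /\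
    forall C g x, bmeas C g -> dop nu g x = c1 * dop (m1 (hs n)) g x + c2 * dop (m2 (hs n)) g x.
  move=> n; apply: combined_measure => //; first exact: gs_sym1 (fam_good fam (hp n)).
  exact: gs_sym2 (fam_good fam (hp n)).
pose L eta x := c1 * op L1 eta x + c2 * op L2 eta x.
exists L, nu; split.
  split.
  - by move=> n; have [] := hnu n.
  - by move=> eta ce; apply: IntgD; apply: IntgZ; apply: op_Intg => //; [exact: fam_mu1 fam|exact: fam_mu2 fam].
  - move=> eta ce; have [C tf] := testfam_cst ce; apply/cvgr0Pnorm_lt => e e0.
    have e1 : 0 < e / (c1 + c2 + 1) by rewrite divr_gt0// ltr_wpDl// addr_ge0.
    have := hs_near hs0 (fam_dop1 tf e1); have := hs_near hs0 (fam_dop2 tf e1).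
    apply: filterS2 => n /(_ 0) d2 /(_ 0) d1; rewrite ger0_norm ?Rint_ge0//.
    have [B B0 be] := Cc_meas ce; have ie := Cc_Intg ce.
    have I1 := op_Intg (fam_mu1 fam) ce; have I2 := op_Intg (fam_mu2 fam) ce.
    have J1 := Intg_abs (IntgB (dop_Intg (m1 (hs n)) be ie) I1).
    have J2 := Intg_abs (IntgB (dop_Intg (m2 (hs n)) be ie) I2).
    apply: (@le_lt_trans _ _ (c1 * (e / (c1 + c2 + 1)) + c2 * (e / (c1 + c2 + 1)))).
      apply: le_trans (lerD (ler_wpM2l c10 (ltW d1)) (ler_wpM2l c20 (ltW d2))).
      rewrite -(RintZ _ J1) -(RintZ _ J2) -RintD; [|exact: IntgZ|exact: IntgZ].
      apply: Rint_le => [||x].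
      + by apply: Intg_abs; apply: IntgB; [exact: dop_Intg be ie|apply: IntgD; exact: IntgZ].
      + by apply: IntgD; exact: IntgZ.
      rewrite ((hnu n).2 _ _ _ be) /L opprD addrACA -!mulrBr.
      by apply: le_trans (ler_normD _ _) _; rewrite (normrM c1) (normrM c2) (ger0_norm c10) (ger0_norm c20).
    rewrite -mulrDl mulrA ltr_pdivrMr; last by rewrite ltr_wpDl// addr_ge0.
    by rewrite mulrC ltr_pM2l// ltrDl.
  - by move=> eta y x; rewrite /L /op !levy_op_trans.
move=> M' w z D _; case: D => dT dw dwI ds dz dsg dw0 dm dou did dp; split => // psi tp.
have [I e] := did psi tp; have [cc _] := tp; have [C tf] := testfam_Cc cc.
have [ml _] := @lo_slice psi (LimitOp sigma mu phi) _ _ lmu tf.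
have [mL1 _] := lo_slice (fam_mu1 fam) tf; have [mL2 _] := lo_slice (fam_mu2 fam) tf.
have [C' [_ _ bd _]] := test_bdd tp.
pose q p := lo_op (LimitOp sigma mu phi) psi p - (c1 * lo_op L1 psi p + c2 * lo_op L2 psi p).
have mL : measurable_fun [set: VT] (fun p => c1 * lo_op L1 psi p + c2 * lo_op L2 psi p).
  by apply: measurable_funD; apply: measurable_funM.
have mq : measurable_fun [set: VT] q by exact: measurable_funB.
(* The two operators agree at each time up to a null set depending on that time; slicing along time
   makes the exceptional set null in space-time. *)
have q0 : {ae lebT, forall p : VT, q p = 0}.
  exists [set p | 0 < `|q p|]; split; first exact: measurable_gt_abs.
    apply: ae_prod_swap; first exact: measurable_gt_abs.
    apply: aeW => t; have [Z [mZ Z0 hZ]] := limit_operators_relation a (tf_Cc tf t).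
    apply/eqP; rewrite -measure_le0 -Z0; apply: le_measure; rewrite ?inE//.
      by apply: measurable_ysection; exact: measurable_gt_abs.
    move=> x; rewrite /ysection /= inE /= => h; apply: hZ => /= h1.
    move: h; rewrite (_ : q (x, t) = 0) ?normr0 ?ltxx//.
    have na' : phi a - phi 0 != 0 by rewrite subr_eq0.
    apply/eqP; rewrite /q subr_eq0; apply/eqP; apply: (mulfI na').
    rewrite -[LHS]h1 /c1 /c2 /lo_op /levy_op_x /op /=; field; exact: na'.
  by move=> p /= h; rewrite normr_gt0; apply/eqP.
have mF : measurable_fun [set: VT] (fun p : VT => w p * dt psi p + z p * L (fun x => psi (x, p.2)) p.1).
  by apply: measurable_funD; apply: measurable_funM => //; [exact: dw.1|exact: bd.1|exact: dz.1].
have eF : {ae lebT, forall p : VT, w p * dt psi p + z p * levy_op sigma mu (fun x => psi (x, p.2)) p.1 =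
    w p * dt psi p + z p * L (fun x => psi (x, p.2)) p.1}.
  by apply: filterS q0 => p /subr0_eq h; congr (_ + _ * _).
by split; [exact: Intg_ae mF eF I|rewrite -(Rint_ae (Intg_meas I) mF eF)].
Qed.

Lemma unique_solution f u v :
  bounded_solution T sigma mu phi f u0 u -> bounded_solution T sigma mu phi f u0 v ->
  forall t, 0 <= t <= T -> {ae leb, forall x, v (x, t) = u (x, t)}.
Proof.
move=> su sv; have T0 := fam_T fam; have [_ u2 _] := su; have [_ v2 _] := sv.
apply: (C_L1loc_ae_eq T0 u2 v2).
have [M' [w [z [D hz ew]]]] := difference_data T0 lmu nphi su sv.
have [L [nu [gen tr]]] := exists_generator.
have w0 := difference_w0 gen (tr _ _ _ D hz).
have : {ae lebT, forall p : VT, QT T p -> u p = v p}.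
  by apply: filterS2 ew w0 => p h1 h2 pT; apply/subr0_eq; rewrite -h1.
move=> /ae_prod2; apply: filterS => s hs sT; apply: filterS hs => x; apply.
by split => //=; rewrite in_itv.
Qed.

End euclidean.

Theorem theorem2p11 (R : realType) (N : nat) (T : R)
    (P : nat) (sigma : 'M[R]_(N, P)) (mu : {measure set 'rV[R]_N -> \bar R})
    (phi : R -> R) (u0 : 'rV[R]_N -> R) (f : 'rV[R]_N * R -> R)
    (S : R -> scheme R N) (U : R -> nat -> 'rV[R]_N -> R) :
  (0 < N)%N -> 0 < T ->
  levy_measure mu -> nondecreasing_continuous phi ->
  L1_Loo (@lebesgue_rV R N) u0 ->
  measurable_fun (QT T) f ->
  (\int[@lebesgue_measure R]_(t in `]0%R, T[)
    ('N[@lebesgue_rV R N]_1[EFin \o (fun x => f (x, t))] +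
     'N[@lebesgue_rV R N]_+oo[EFin \o (fun x => f (x, t))]) < +oo)%E ->
  (forall h, 0 < h -> time_grid T (S h)) ->
  max_step (S h) @[h --> 0^'+] --> 0 ->
  consistent S sigma mu phi ->
  (forall h, 0 < h -> admissible T (S h) u0 f) ->
  uniform_levy S ->
  (forall h, 0 < h -> scheme_solution (S h) u0 f (U h)) ->
  let solution (u : 'rV[R]_N * R -> R) :=
    [/\ L1_Loo (lebesgue_QT (N := N)) (u \_ (QT T)), C_L1loc T u &
        distributional_solution T sigma mu phi f u0 u] in
  exists u : 'rV[R]_N * R -> R,
    [/\ solution u,
        forall v, solution v -> forall t : R, 0 <= t <= T ->
          {ae @lebesgue_rV R N, forall x, v (x, t) = u (x, t)} &
        forall K : set 'rV[R]_N, compact K ->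
          CL1loc_dist T K (interpolant (S h) (U h)) u @[h --> 0^'+] --> 0%E].
Proof.
move=> N0 T0 lmu nphi Lu0 mf fin tg st0 [f1 [f2 [P1 [P2 [s1 [s2 [mu1 [mu2 [[nf1 nf2] [lm1 lm2] cons [co1 co2] [cf1 cf2]]]]]]]]]] adm _ sol solution.
pose V := 'rV[R]_N.
have [ninf [k0 [sd k00 u0k dB]]] := exists_source mf Lu0 fin.
set M := k0 + _ in dB.
have /choice[q hq] : forall h, exists q : {finite_measure set V -> \bar R} * {finite_measure set V -> \bar R} * (nat -> V -> R),
    0 < h -> good_scheme T (S h) M u0 (f \_ (QT T)) q.1.1 q.1.2 q.2 /\
    forall j, (j <= steps (S h))%N -> {ae @lebesgue_rV R N, forall x, q.2 j x = U h j x}.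
  move=> h; have [h0|h0] := ltP 0 h; last first.
    (* Choice ranges over all reals, so parameters h <= 0 receive a dummy value. *)
    by pose d : {finite_measure set V -> \bar R} := \d_(0 : V); exists (d, d, fun _ _ => 0).
  have [m1 [m2 [W [gs e]]]] := exists_good_scheme (tg h h0) (adm h h0) (sol h h0) sd k00 u0k dB.
  by exists (m1, m2, W).
pose m1 h := (q h).1.1; pose m2 h := (q h).1.2; pose W h := (q h).2.
have M0 : 0 <= M by rewrite addr_ge0//; apply: Rint_ge0; exact: src_bnd_ge0 sd.
have /L1_LooP[Iu0 _] := Lu0.
have fam : scheme_family T M u0 (f \_ (QT T)) ninf S m1 m2 W (LimitOp s1 mu1 f1) (LimitOp s2 mu2 f2).
  by split => // h h0; have [] := hq h h0.
have limsol (hs : nat -> R) (u : V * R -> R) : (forall n, 0 < hs n < n.+1%:R^-1) -> bmeas M u ->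
    (forall k n t, (k <= n)%N -> 0 <= t <= T -> Qdist k (vh S W (hs n) t) (fun x => u (x, t)) <= rate n) -> solution u.
  move=> h1 h2 h3; split; [exact: (limit_L1_Loo fam h1 h2 h3)|exact: (limit_C_L1loc fam h1 h2 h3)|].
  exact: (limit_solution fam h1 h2 h3).
have uniq u v : solution u -> solution v -> forall t : R, 0 <= t <= T -> {ae @lebesgue_rV R N, forall x, v (x, t) = u (x, t)}.
  exact: (unique_solution fam lmu nphi cons).
(* Transfer from the representatives [W] back to the given [U]: the null sets of all nodes are
   united, and the interpolant at a fixed time involves nothing but nodal values. *)
have dist (K : set V) k h t (u v : V * R -> R) r : compact K -> K `<=` Qbox k%:R -> 0 < h -> 0 <= t <= T ->
    bmeas M v -> {ae @lebesgue_rV R N, forall x, v (x, t) = u (x, t)} -> C_L1loc T u ->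
    Qdist k (vh S W h t) (fun x => v (x, t)) <= r ->
    (L1_dist K (fun x => interpolant (S h) (U h) (x, t)) (fun x => u (x, t)) <= r%:E)%E.
  move=> cK KQ h0 tT bv e Cu hr; have mK : measurable K by exact: compact_measurable_rV.
  have bvt := bu_slice bv t; have [gs eW] := hq h h0; have [LU _ _] := sol h h0.
  have [E1 E2] := L1_distE cK KQ (vh_bmeas fam h0 tT) bvt.
  apply: (@le_trans _ _ (L1_dist K (vh S W h t) (fun x => v (x, t)))); last by rewrite E1 lee_fin (le_trans E2).
  have mU j : (j <= steps (S h))%N -> measurable_fun setT (U h j).
    by move=> jS; have /L1_LooP[/Intg_meas] := LU j jS.
  have allW : {ae @lebesgue_rV R N, forall x, forall j, (j <= steps (S h))%N -> W h j x = U h j x}.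
    apply: ae_foralln => j; have [jS|jS] := leqP j (steps (S h)); last exact: aeW.
    by apply: filterS (eW j jS) => x hx _.
  have int_ext x : (forall j, (j <= steps (S h))%N -> W h j x = U h j x) ->
      interpolant (S h) (U h) (x, t) = vh S W h t x.
    move=> hx; rewrite (interpolantE T0 (tg h h0) _ _ tT) /vh /interp hx//; congr (_ + _).
    apply: eq_big_nat => j /andP[j1]; rewrite ltnS => jS.
    by rewrite !hx// (leq_trans (leq_pred _)).
  have [Iu _] := Cu K cK; have /integrableP[/measurable_EFinP mut _] := Iu t tT.
  rewrite /L1_dist le_eqVlt; apply/orP; left; apply/eqP; apply: ae_eq_integral => //.
  - apply: measurableT_comp => //; apply/measurable_EFinP; apply: measurable_funB mut; apply: measurable_funTS.
    rewrite (_ : (fun x => _) = fun x => interp (S h) (fun j => U h j x) t); last first.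
      by apply/funext => x; rewrite (interpolantE T0 (tg h h0) _ _ tT).
    apply: measurable_funD; first exact: mU.
    pose F j x := if (1 <= j <= steps (S h))%N then ramp (node (S h) j.-1) (node (S h) j) t * (U h j x - U h j.-1 x) else 0.
    apply: (eq_measurable_fun (fun x => \sum_(1 <= j < (steps (S h)).+1) F j x)).
      by move=> x _; apply: eq_big_nat => j; rewrite /F ltnS => ->.
    apply: measurable_sum => j; rewrite /F; case: (boolP (1 <= j <= _)%N) => // /andP[j1 jS].
    by apply: measurable_funM => //; apply: measurable_funB; apply: mU => //; exact: leq_trans (leq_pred _) jS.
  - apply: measurableT_comp => //; apply/measurable_EFinP; apply: measurable_funTS.
    by apply: measurable_funB; [exact: (vh_bmeas fam h0 tT).1|exact: bvt.1].
  - by apply: filterS2 allW e => x hx -> _; rewrite int_ext.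
(* Extraction among all positive parameters yields existence. *)
have [] := @compactness _ _ T M u0 _ ninf S m1 m2 W _ _ fam setT.
  by move=> e e0; exists (e / 2); split => //; rewrite divr_gt0//= ltr_pdivrMr// ltr_pMr// ltr1n.
move=> hs [u [h1 bu hu]]; have hs0 n : 0 < hs n < n.+1%:R^-1 by have [] := h1 n.
have su := limsol hs u hs0 bu hu; exists u; split => //; first by move=> v sv; exact: uniq.
move=> K cK; have [k KQ] := compact_Qbox cK.
have Cu : C_L1loc T u by have [] := su.
suff H e : 0 < e -> \forall h \near 0^'+, (CL1loc_dist T K (interpolant (S h) (U h)) u <= e%:E)%E.
  have d0 h : (0 <= CL1loc_dist T K (interpolant (S h) (U h)) u)%E.
    apply: le_trans (ereal_sup_ubound _); last first.
      by exists 0 => //=; rewrite in_itv/= lexx ltW.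
    exact: integral_ge0.
  apply/fine_cvgP; split.
    apply: filterS (H 1 ltr01) => h hh; rewrite ge0_fin_numE//; exact: le_lt_trans hh (ltry 1).
  apply/cvgr0Pnorm_le => e e0; apply: filterS (H e e0) => h hh.
  have fn : CL1loc_dist T K (interpolant (S h) (U h)) u \is a fin_num.
    by rewrite ge0_fin_numE//; exact: le_lt_trans hh (ltry e).
  by rewrite /= ger0_norm ?fine_ge0// -lee_fin fineK.
(* If the distance were not eventually at most e, the bad parameters would accumulate at 0.
   Extraction inside them produces another solution, equal to u at every time, and contradicts
   badness at a large index. *)
move=> e0; pose B := [set h : R | ~ (CL1loc_dist T K (interpolant (S h) (U h)) u <= e%:E)%E].
apply: contrapT => nH.
have Bd d : 0 < d -> exists h, B h /\ 0 < h < d.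
  move=> d0; apply: contrapT => nB; apply: nH; near=> h.
  apply: contrapT => Bh; apply: nB; exists h; split => //; apply/andP; split; first by near: h; exact: near_pos.
  by near: h; exact: nbhs_right_lt.
have [hs' [u' [h1' bu' hu']]] := compactness fam Bd.
have hs0' n : 0 < hs' n < n.+1%:R^-1 by have [] := h1' n.
have eu := uniq u u' su (limsol hs' u' hs0' bu' hu').
have [n kn rn] : exists2 n, (k <= n)%N & rate n <= e.
  (* The rate 1/2^(n+1) is below 1/(n+1), which reduces the choice of n to the archimedean
     property. *)
  have [m _ hm] := near_infty_natSinv_lt (PosNum e0); exists (maxn k m); first exact: leq_maxl.
  apply: le_trans (ltW (hm (maxn k m) (leq_maxr _ _))); rewrite /rate div1r.
  by rewrite lef_pV2 ?posrE ?ltr0n ?expn_gt0// ler_nat; exact/ltnW/ltn_expl.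
have [Bn /andP[hp _]] := h1' n; apply: Bn; apply: ge_ereal_sup => _ [t + <-].
rewrite /= in_itv/= => tT; apply: le_trans (_ : ((rate n)%:E <= _)%E); last by rewrite lee_fin.
exact: (dist K k (hs' n) t u u' _ cK KQ hp tT bu' (eu t tT) Cu (hu' k n t kn tT)).
Unshelve. all: by end_near. Qed.
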